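(* Let $T>0$, let $Z$ be a Lévy process with characteristic triplet $(a,0,\pi)$, $\pi$ symmetric, let $g(t,s)$ be a deterministic measurable kernel and $Y_t=\int_0^tg(t,s)\,dZ_s$, $t\in[0,T]$. Assume that one of the following holds: 1. $p\ge1$, $a=0$, $\int_{\mathbb R}|x|^p\pi(dx)<\infty$, and conditions (B1) and (B2) below hold with this $p$ and with some $\alpha\in\mathbb R$, $\beta>-\frac1p$, $\gamma>-\frac1p$, $\delta>\frac1p$ such that $\alpha+\beta+\gamma>-\frac1p$ and $\kappa>0$; 2. $p\ge2$, $\int_{\mathbb R}|x|^p\pi(dx)<\infty$, and (B1) and (B2) hold with this $p$ and with some $\alpha\in\mathbb R$, $\beta>-\frac1p$, $\gamma>-\frac1p$, $\delta>\frac1p$ such that $\alpha+\beta+\gamma>-\frac1p$ and $\kappa>0$; 3. $Z$ is a Brownian motion, and (B1) and (B2) hold with $p=2$, $\alpha\in\mathbb R$, $\beta>-\frac12$, $\gamma>-\frac12$, $\delta>0$ such that $\alpha+\beta+\gamma>-\frac12$ and $\kappa>-\frac12$. Here $\kappa=\alpha+\beta+\gamma$ if $\alpha+\beta<0$ and $\kappa=\gamma$ if $\alpha+\beta\ge0$. Then $Y$ has (up to modification) a.s. continuous, hence locally bounded, sample paths. Consequently, if $u\colon\mathbb R\to\mathbb R$ is measurable, of linear growth (there is $C>0$ with $|u(x)|\le C(1+|x|)$ for all $x\in\mathbb R$) and locally Lipschitz (for any $R>0$ there is $C_R>0$ with $|u(x)-u(y)|\le C_R|x-y|$ for all $|x|,|y|<R$),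 then the equation $$dX_t=u(X_t)\,dt+dY_t,\qquad X|_{t=0}=X_0\in\mathbb R,$$ i.e. $X_t=X_0+\int_0^tu(X_s)\,ds+Y_t$, has a unique solution on $[0,T]$.
   Context: $Z$ satisfies $\mathbf E e^{i\mu Z_t}=e^{t\Psi(\mu)}$ with $\Psi(\mu)=-\frac{a\mu^2}2+\int_{\mathbb R}(e^{i\mu x}-1-i\mu\tau(x))\pi(dx)$, where $\tau(x)=x$ for $|x|\le1$, $\tau(x)=x/|x|$ for $|x|>1$, $a\ge0$, and $\pi$ is a symmetric Lévy measure ($\pi(\{0\})=0$, $\int(x^2\wedge1)\pi(dx)<\infty$); the drift is zero. The integral $\int_0^tg(t,s)\,dZ_s$ is understood (Rajput–Rosiński) as the limit in probability of integrals of elementary functions. (B1) (with parameter $p$ and constants $\alpha,\beta,\gamma$): there is $C>0$ such that $|g(t,u)|\le Ct^\alpha u^\beta(t-u)^\gamma$ for all $0<u<t\le T$. (B2) (with parameter $p$ and constant $\delta>0$): there is a function $h(t,s,u)$ such that $|g(t,u)-g(s,u)|\le|t-s|^\delta h(t,s,u)$ for all $0<u<s<t\le T$ and $\sup_{0<s<t\le T}\int_0^s|h(t,s,u)|^p\,du<\infty$. The equation is understood pathwise (a.s.); continuity of paths is understood for a suitable modification. *)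

(* Defs.v *)
From HB Require Import structures.
Set Warnings "-notation-overridden,-ambiguous-paths,-notation-incompatible-prefix".
From mathcomp Require Import all_boot all_order all_algebra.
From mathcomp Require Import complex.
From mathcomp Require Import all_classical all_reals all_analysis.

Set Implicit Arguments.
Unset Strict Implicit.
Unset Printing Implicit Defensive.

Import Order.TTheory GRing.Theory Num.Theory.
Import numFieldNormedType.Exports.
Import HBSimple.

Local Open Scope classical_set_scope.
Local Open Scope ring_scope.

Section characteristic_exponent.
Context {R : realType}.
Local Open Scope complex_scope.

Definition cexp (z : R[i]) : R[i] :=
  (expR (complex.Re z) * cos (complex.Im z)) +i*
  (expR (complex.Re z) * sin (complex.Im z)).

Definition Cintegral d (S : measurableType d) (m : {measure set S -> \bar R})
    (f : S -> R[i]) : R[i] :=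
  (\int[m]_x complex.Re (f x)) +i* (\int[m]_x complex.Im (f x)).

Definition tau (x : R) : R := if `|x| <= 1 then x else x / `|x|.

Definition levy_measure (pi : {measure set R -> \bar R}) : Prop :=
  pi [set 0] = 0%E /\
  (\int[pi]_x (Num.min (x ^+ 2) 1)%:E < +oo)%E.

Definition symmetric_measure (pi : {measure set R -> \bar R}) : Prop :=
  forall A : set R, measurable A -> pi (-%R @^-1` A) = pi A.

(* Levy-Khintchine exponent of the triplet (a, 0, pi): the drift is zero. *)
Definition Psi (a : R) (pi : {measure set R -> \bar R}) (mu : R) : R[i] :=
  - (a * mu ^+ 2 / 2)%:C +
  Cintegral pi (fun x => cexp (Complex 0 (mu * x)) - 1 - Complex 0 (mu * tau x)).

End characteristic_exponent.

Section levy_processes.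
Context d {Omega : measurableType d} {R : realType} (P : probability Omega R).

(* Each [B i] may be the whole line, so this is mutual independence. *)
Definition mutually_independent (n : nat) (X : 'I_n -> Omega -> R) : Prop :=
  forall B : 'I_n -> set R, (forall i, measurable (B i)) ->
    P (\bigcap_(i in [set: 'I_n]) (X i @^-1` B i)) =
    (\prod_(i < n) P (X i @^-1` B i))%E.

Definition cvg_in_probability (X : nat -> Omega -> R) (Y : Omega -> R) : Prop :=
  forall e : R, 0 < e -> P [set w | e <= `|X n w - Y w|] @[n --> \oo] --> 0%E.

Definition independent_increments (Z : R -> Omega -> R) : Prop :=
  forall (n : nat) (s : nat -> R),
    0 <= s 0%N -> (forall i, s i <= s i.+1) ->
    mutually_independent (fun i : 'I_n => Z (s i.+1) \- Z (s i)).

(* Only the values [Z t] with [0 <= t] are relevant. *)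
Record is_levy_process (Z : R -> {RV P >-> R}) : Prop := {
  levy_zero : {ae P, forall w, Z 0 w = 0} ;
  levy_independent : independent_increments Z ;
  levy_stationary : forall s t (B : set R), 0 <= s -> s <= t -> measurable B ->
    P ((Z t \- Z s) @^-1` B) = P (Z (t - s) @^-1` B) ;
  levy_stoch_continuous : forall t e : R, 0 <= t -> 0 < e ->
    P [set w | e <= `|Z s w - Z t w|] @[s --> within `[0, +oo[ (nbhs t)] --> 0%E ;
  levy_cadlag : {ae P, forall w, forall t, 0 <= t ->
    Z s w @[s --> t^'+] --> Z t w /\
    (0 < t -> cvg (Z s w @[s --> t^'-]))} }.

Definition has_triplet (Z : R -> {RV P >-> R}) (a : R)
    (pi : {measure set R -> \bar R}) : Prop :=
  forall t mu : R, 0 <= t ->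
    Cintegral P (fun w => cexp (Complex 0 (mu * Z t w))) =
    cexp (Complex t 0 * Psi a pi mu).

(* The variance parameter [sigma ^+ 2] is arbitrary, [sigma = 1] being the
   standard case. *)
Definition is_brownian_motion (Z : R -> {RV P >-> R}) : Prop :=
  exists sigma : R, 0 < sigma /\
  [/\ {ae P, forall w, Z 0 w = 0},
      independent_increments Z,
      forall s t (B : set R), 0 <= s -> s < t -> measurable B ->
        P ((Z t \- Z s) @^-1` B) = normal_prob 0 (sigma * Num.sqrt (t - s)) B
    & {ae P, forall w, {within `[0, +oo[, continuous (fun t => Z t w)}}].

(* [L] is the independently scattered random measure induced by [Z] on the
   delta-ring of bounded Borel subsets of ]0, +oo[; its values elsewhere are
   irrelevant. *)
Record is_random_measure_of (Z : R -> {RV P >-> R})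
    (L : set R -> {RV P >-> R}) : Prop := {
  rmeas_increment : forall s t, 0 <= s -> s <= t ->
    {ae P, forall w, L `]s, t]%classic w = Z t w - Z s w} ;
  rmeas_independent : forall (A : nat -> set R) (b : R),
    (forall i, measurable (A i)) -> (forall i, A i `<=` `]0, b]%classic) ->
    trivIset setT A ->
    forall n, mutually_independent (fun i : 'I_n => L (A i)) ;
  rmeas_additive : forall (A : nat -> set R) (b : R),
    (forall i, measurable (A i)) -> (forall i, A i `<=` `]0, b]%classic) ->
    trivIset setT A ->
    {ae P, forall w, series (fun i => L (A i) w) @ \oo --> L (\bigcup_i A i) w} }.

Definition elementary_integral (L : set R -> {RV P >-> R}) (A : set R)
    (f : {sfun R >-> R}) (w : Omega) : R :=
  \sum_(y \in range f) y * L (A `&` f @^-1` [set y]) w.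

(* [I] is (a version of) the integral of [f] over ]0, t] with respect to [Z],
   in the sense of Rajput and Rosinski; that [f] is integrable is
   [exists I, is_levy_integral Z t f I].  The convergence is required on every
   Borel subset [A], not only on the whole domain, as in their definition. *)
Definition is_levy_integral (Z : R -> {RV P >-> R}) (t : R) (f : R -> R)
    (I : {RV P >-> R}) : Prop :=
  exists (L : set R -> {RV P >-> R}) (fn : nat -> {sfun R >-> R}),
  [/\ is_random_measure_of Z L,
      {ae lebesgue_measure, forall s : R, `]0, t]%classic s ->
        fn n s @[n --> \oo] --> f s},
      forall A : set R, measurable A -> A `<=` `]0, t]%classic ->
        exists J : {RV P >-> R},
          cvg_in_probability (fun n => elementary_integral L A (fn n)) J
    & cvg_in_probability (fun n => elementary_integral L `]0, t]%classic (fn n)) I].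

Definition is_modification (T : R) (Y' Y : R -> {RV P >-> R}) : Prop :=
  forall t, 0 <= t <= T -> {ae P, forall w, Y' t w = Y t w}.

Definition as_continuous (T : R) (Y : R -> {RV P >-> R}) : Prop :=
  {ae P, forall w, {within `[0, T], continuous (fun t => Y t w)}}.

Definition as_bounded (T : R) (Y : R -> {RV P >-> R}) : Prop :=
  {ae P, forall w, exists M : R, forall t, 0 <= t <= T -> `|Y t w| <= M}.

End levy_processes.

Section kernel_conditions.
Context {R : realType}.

Definition jointly_measurable_kernel (T : R) (g : R -> R -> R) : Prop :=
  measurable_fun [set z : R * R | 0 <= z.2 /\ z.2 <= z.1 <= T]
    (fun z => g z.1 z.2).

Definition condB1 (T : R) (g : R -> R -> R) (alpha beta gamma : R) : Prop :=
  exists C : R, 0 < C /\ forall t u : R, 0 < u -> u < t -> t <= T ->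
    `|g t u| <= C * t `^ alpha * u `^ beta * (t - u) `^ gamma.

Definition condB2 (T : R) (g : R -> R -> R) (p delta : R) : Prop :=
  0 < delta /\ exists h : R -> R -> R -> R,
  [/\ forall t s : R, 0 < s -> s < t -> t <= T ->
        measurable_fun `]0, s[ (h t s),
      forall t s u : R, 0 < u -> u < s -> s < t -> t <= T ->
        `|g t u - g s u| <= `|t - s| `^ delta * h t s u
    & (ereal_sup [set r | exists s t : R, [/\ (0 < s)%R, (s < t)%R, (t <= T)%R &
          r = \int[lebesgue_measure]_(u in `]0%R, s[) (`|h t s u| `^ p)%:E]]
        < +oo)%E].

Definition kappa (alpha beta gamma : R) : R :=
  if alpha + beta < 0 then alpha + beta + gamma else gamma.

Definition finite_moment (p : R) (pi : {measure set R -> \bar R}) : Prop :=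
  (\int[pi]_x (`|x| `^ p)%:E < +oo)%E.

Definition linear_growth (u : R -> R) : Prop :=
  exists C : R, 0 < C /\ forall x, `|u x| <= C * (1 + `|x|).

Definition locally_lipschitz (u : R -> R) : Prop :=
  forall r : R, 0 < r -> exists C : R, 0 < C /\
    forall x y, `|x| < r -> `|y| < r -> `|u x - u y| <= C * `|x - y|.

(* Integrability of [u \o x] is the minimal requirement for the equation to make
   sense, so uniqueness is among all such functions, not only continuous ones. *)
Definition is_solution (T : R) (u : R -> R) (x0 : R) (y x : R -> R) : Prop :=
  lebesgue_measure.-integrable `[0, T] (EFin \o (u \o x)) /\
  forall t, 0 <= t <= T ->
    x t = x0 + \int[lebesgue_measure]_(s in `[0, t]) u (x s) + y t.

End kernel_conditions.

(* Main.v *)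
(* The driver enters only through the characteristic function of its increments: for
   disjoint sets A_i the variable sum_i c_i L(A_i) has characteristic function
   exp (- sum_i |A_i| psi(mu c_i)), and the moments of any variable of this form satisfy
   E|X|^q <= K (sum_i |A_i| |c_i|^p)^(q/p) with a constant that only depends on a bound
   for sum_i |A_i|.  Here |x|^q is comparable to sum_j 2^(jq) sin^(2k)(2^-j x / 2), and
   each E sin^(2k)(mu X / 2) is controlled by a Gronwall inequality along the convolution
   semigroup with characteristic functions exp (- r Psi), 0 <= r <= 1.  The same bound
   shows that Z extends to an independently scattered random measure and that every f
   in L^p is integrable with E|int f dZ|^q <= K (int |f|^p)^(q/p).

   The conditions (B1) and (B2) then give
   E|Y_t - Y_s|^q <= C |t - s|^(rho q/p) with rho = min (delta p, 1 + kappa p), and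
   rho q / p > 1 (for a Brownian motion q is free), so that Kolmogorov's criterion
   applies.  The equation is solved path by path with the Euler scheme, which converges
   by a discrete Gronwall inequality and is measurable in the random parameter; every
   solution is the limit of the same scheme, whence uniqueness. *)
Require Import Defs.
From HB Require Import structures.
Set Warnings "-notation-overridden,-ambiguous-paths,-notation-incompatible-prefix".
From mathcomp Require Import all_boot all_order all_algebra.
From mathcomp Require Import all_classical all_reals all_analysis.
From mathcomp Require Import measurable_realfun zify ring lra.
From mathcomp Require Import complex.

Import Order.TTheory GRing.Theory Num.Theory.
Import numFieldNormedType.Exports.
Import HBSimple HBNNSimple.

Set Implicit Arguments.
Unset Strict Implicit.
Unset Printing Implicit Defensive.

Local Open Scope classical_set_scope.
Local Open Scope ring_scope.

(** The integral is defined with an unspecified random measure and with simple functions that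
    converge only almost everywhere, without control in L^p. So limits must be identified before a
    moment bound applies to them: random measures of the same [Z] agree almost surely on each
    bounded Borel set, and integrals of simple functions tending to 0 almost everywhere have 0 as
    only possible limit in probability. The latter compares characteristic functions by Fatou's
    lemma for [psi]. Powers of the haversine are the test functions because they are trigonometric
    polynomials, so that their expectations are finite combinations of values of the characteristic
    function, and because their second differences are again bounded by powers of haversines. No
    splitting of the driver into small and large jumps is involved. For a Brownian motion the
    scaling of the normal law gives psi mu = mu^2 psi 1, so the bound applies with zero Levy
    measure. Countable additivity of the random measure is required almost surely, while
    approximation gives it only in probability; independence closes this gap through a maximal
    inequality. *)

Section integrable_EFin.
Context d {S : measurableType d} {R : realType}.
Variables (m : {measure set S -> \bar R}) (D : set S).
Hypothesis mD : measurable D.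
Implicit Types f g : S -> R.

Lemma integrable_EFinD f g : m.-integrable D (EFin \o f) ->
  m.-integrable D (EFin \o g) -> m.-integrable D (EFin \o (f \+ g)).
Proof. by move=> mf mg; apply: (eq_integrable mD _ _ _ (integrableD mD mf mg)). Qed.

Lemma integrable_EFinB f g : m.-integrable D (EFin \o f) ->
  m.-integrable D (EFin \o g) -> m.-integrable D (EFin \o (f \- g)).
Proof. by move=> mf mg; apply: (eq_integrable mD _ _ _ (integrableB mD mf mg)). Qed.

Lemma integrable_EFinZl c f : m.-integrable D (EFin \o f) ->
  m.-integrable D (EFin \o (fun x => c * f x)).
Proof. by move=> mf; apply: (eq_integrable mD _ _ _ (integrableZl mD c mf)). Qed.

Lemma integrable_EFin_sum (I : Type) (s : seq I) (f : I -> S -> R) :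
  (forall i, m.-integrable D (EFin \o f i)) ->
  m.-integrable D (EFin \o (fun x => \sum_(i <- s) f i x)).
Proof.
move=> mf; elim: s => [|i s ih].
  apply: (eq_integrable mD (cst 0%E)); last exact: integrable0.
  by move=> x _ /=; rewrite big_nil.
apply: (eq_integrable mD _ _ _ (integrable_EFinD (mf i) ih)).
by move=> x _ /=; rewrite big_cons.
Qed.

Lemma Rintegral_sum (I : Type) (s : seq I) (f : I -> S -> R) :
  (forall i, m.-integrable D (EFin \o f i)) ->
  \int[m]_(x in D) (\sum_(i <- s) f i x) = \sum_(i <- s) \int[m]_(x in D) f i x.
Proof.
move=> mf; elim: s => [|i s ih].
  rewrite big_nil (@eq_Rintegral _ _ _ _ _ (cst 0)); last first.
    by move=> x _; rewrite big_nil.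
  by rewrite Rintegral_cst// mul0r.
rewrite big_cons -ih -RintegralD//; last exact: integrable_EFin_sum.
by apply: eq_Rintegral => x _; rewrite big_cons.
Qed.

End integrable_EFin.

(** The power is exp (q ln x) only away from 0, so the limit 0 is treated apart, by inverting the
    power. *)
Lemma cvg_norm_powR {R : realType} (u : nat -> R) (l q : R) : 0 < q ->
  u n @[n --> \oo] --> l -> `|u n| `^ q @[n --> \oo] --> `|l| `^ q.
Proof.
move=> q0 /cvg_norm ul; have [l0|l0] := eqVneq l 0.
  rewrite l0 normr0 in ul *; rewrite powR0 ?gt_eqF//.
  apply/cvgrPdist_le => e e0.
  have e1 : 0 < e `^ q^-1 by rewrite powR_gt0.
  move/cvgrPdist_le : ul => /(_ _ e1); apply: filterS => n.
  rewrite !sub0r !normrN normr_id => h; rewrite ger0_norm ?powR_ge0//.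
  have -> : e = (e `^ q^-1) `^ q by rewrite -powRrM mulVf ?gt_eqF// powRr1// ltW.
  by rewrite ge0_ler_powR// ?nnegrE// ?ltW.
have l1 : 0 < `|l| by rewrite normr_gt0.
have -> : `|l| `^ q = expR (q * ln `|l|) by rewrite /powR gt_eqF.
have : expR (q * ln `|u n|) @[n --> \oo] --> expR (q * ln `|l|).
  apply: continuous_cvg; first exact: continuous_expR.
  apply: cvgM; first exact: cvg_cst.
  by apply: continuous_cvg => //; exact: continuous_ln.
apply: cvg_trans; apply: near_eq_cvg.
have /cvgr_gt/(_ 0 l1) := ul.
by apply: filterS => n un0; rewrite /powR gt_eqF.
Qed.

(** * Convergence in probability as a metric, and almost sure limits *)

Section probability_toolkit.
Context d {Omega : measurableType d} {R : realType} (P : probability Omega R).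
Implicit Types X Y : Omega -> R.

Lemma bounded_measurable_integrable (f : Omega -> R) (M : R) :
  measurable_fun setT f -> (forall w, `|f w| <= M) ->
  P.-integrable setT (EFin \o f).
Proof.
move=> mf fM; apply: measurable_bounded_integrable => //.
- by rewrite (le_lt_trans (probability_le1 P measurableT)) ?ltry.
- exists M; split; first exact: num_real.
  by move=> x Mx y _ /=; rewrite (le_trans (fM y)) // ltW.
Qed.

Lemma Rintegral_probability_cst (c : R) : \int[P]_w c = c.
Proof. by rewrite Rintegral_cst//= probability_setT mulr1. Qed.

Lemma ae_eq_Rintegral (f g : Omega -> R) :
  measurable_fun setT f -> measurable_fun setT g ->
  {ae P, forall w, f w = g w} -> \int[P]_w f w = \int[P]_w g w.
Proof.
move=> mf mg fg; rewrite /Rintegral; congr fine; apply: ae_eq_integral => //.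
- exact/measurable_EFinP.
- exact/measurable_EFinP.
- by apply: filterS fg => w ->.
Qed.

Lemma bounded_convergence (f : nat -> Omega -> R) (g : Omega -> R) (M : R) :
  (forall n, measurable_fun setT (f n)) -> measurable_fun setT g ->
  (forall n w, `|f n w| <= M) ->
  {ae P, forall w, f n w @[n --> \oo] --> g w} ->
  \int[P]_w f n w @[n --> \oo] --> \int[P]_w g w.
Proof.
move=> mf mg fM fg.
have := @dominated_convergence _ _ _ P setT measurableT
  (fun n => EFin \o f n) (EFin \o g) (cst M%:E) _ _ _ _ _.
case.
- by move=> n; exact/measurable_EFinP.
- exact/measurable_EFinP.
- by apply: filterS fg => w fg _; apply/cvg_EFin => //; exact: nearW.
- apply: (bounded_measurable_integrable (M := `|M|)) => //.
- by apply: aeW => w n _ /=; rewrite lee_fin.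
- move=> ig _ cvi; apply: fine_cvg.
  rewrite fineK; last exact: integrable_fin_num.
  exact: cvi.
Qed.

(** Up to almost sure equality this is a metric for convergence in probability; the truncation at 1
    makes it finite for all random variables. *)
Definition pd X Y : R := \int[P]_w Num.min `|X w - Y w| 1.

Lemma measurable_pd X Y : measurable_fun setT X -> measurable_fun setT Y ->
  measurable_fun setT (fun w => Num.min `|X w - Y w| 1).
Proof.
move=> mX mY; apply: measurable_minr => //.
by apply: measurableT_comp => //; exact: measurable_funB.
Qed.

Lemma min1_le1 (x : R) : `|Num.min `|x| 1| <= 1.
Proof. by rewrite ger0_norm ?ge_min ?lexx ?orbT// le_min normr_ge0 ler01. Qed.

Lemma integrable_pd X Y : measurable_fun setT X -> measurable_fun setT Y ->
  P.-integrable setT (EFin \o (fun w => Num.min `|X w - Y w| 1)).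
Proof.
move=> mX mY; apply: (bounded_measurable_integrable (M := 1)).
  exact: measurable_pd.
by move=> w; exact: min1_le1.
Qed.

Lemma pd_ge0 X Y : 0 <= pd X Y.
Proof. by apply: Rintegral_ge0 => w _; rewrite le_min normr_ge0 ler01. Qed.

Lemma pdC X Y : pd X Y = pd Y X.
Proof. by apply: eq_Rintegral => w _; rewrite distrC. Qed.

Lemma pdxx X : pd X X = 0.
Proof.
rewrite /pd (@eq_Rintegral _ _ _ _ _ (cst 0)) ?Rintegral_probability_cst//.
by move=> w _; rewrite subrr normr0 min_l.
Qed.

Lemma min1_triangle (x y : R) :
  Num.min `|x + y| 1 <= Num.min `|x| 1 + Num.min `|y| 1.
Proof.
rewrite /Num.min; do !case: ifPn => //; rewrite -?leNgt => *;
  have := ler_normD x y; have := normr_ge0 x; have := normr_ge0 y; lra.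
Qed.

Lemma pdD X X' Y Y' : measurable_fun setT X -> measurable_fun setT Y ->
  measurable_fun setT X' -> measurable_fun setT Y' ->
  pd (X \+ X') (Y \+ Y') <= pd X Y + pd X' Y'.
Proof.
move=> mX mY mX' mY'; rewrite /pd -RintegralD//; try exact: integrable_pd.
apply: le_Rintegral => //.
- by apply: integrable_pd; exact: measurable_funD.
- by apply: integrable_EFinD => //; exact: integrable_pd.
- by move=> w _ /=; rewrite opprD addrACA; exact: min1_triangle.
Qed.

Lemma pdN X Y : pd (\- X) (\- Y) = pd X Y.
Proof. by apply: eq_Rintegral => w _; rewrite -opprD normrN. Qed.

Lemma pdB X X' Y Y' : measurable_fun setT X -> measurable_fun setT Y ->
  measurable_fun setT X' -> measurable_fun setT Y' ->
  pd (X \- X') (Y \- Y') <= pd X Y + pd X' Y'.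
Proof.
move=> mX mY mX' mY'; rewrite -(pdN X' Y').
by apply: pdD => //; exact: measurableT_comp.
Qed.

Lemma pd_triangle X Y Z : measurable_fun setT X -> measurable_fun setT Y ->
  measurable_fun setT Z -> pd X Z <= pd X Y + pd Y Z.
Proof.
move=> mX mY mZ; have := @pdD X Y Y Z mX mY mY mZ; apply: le_trans.
rewrite le_eqVlt; apply/orP; left; apply/eqP.
by apply: eq_Rintegral => w _ /=; congr (Num.min `| _ | _); ring.
Qed.

Lemma pd_ae X X' Y Y' : measurable_fun setT X -> measurable_fun setT Y ->
  measurable_fun setT X' -> measurable_fun setT Y' ->
  {ae P, forall w, X w = X' w} -> {ae P, forall w, Y w = Y' w} ->
  pd X Y = pd X' Y'.
Proof.
move=> mX mY mX' mY' XX YY; apply: ae_eq_Rintegral; try exact: measurable_pd.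
by apply: filterS2 XX YY => w -> ->.
Qed.

Lemma pd_eq0 X Y : measurable_fun setT X -> measurable_fun setT Y ->
  pd X Y = 0 -> {ae P, forall w, X w = Y w}.
Proof.
move=> mX mY XY.
have ifin := integrable_fin_num measurableT (integrable_pd mX mY).
have /ae_eq_integral_abs : measurable_fun setT
  (EFin \o (fun w => Num.min `|X w - Y w| 1)).
  by apply/measurable_EFinP; exact: measurable_pd.
move=> /(_ P measurableT) [+ _].
have -> : (\int[P]_w `|(EFin \o (fun w => Num.min `|X w - Y w| 1)%R) w| = 0)%E.
  rewrite (eq_integral (EFin \o (fun w => Num.min `|X w - Y w| 1)%R)).
    by rewrite -(fineK ifin) -[fine _]/(pd X Y) XY.
  by move=> w _ /=; rewrite ger0_norm// le_min normr_ge0 ler01.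
move=> /(_ erefl); apply: filterS => w /(_ I) [].
rewrite /Num.min; case: ifPn => _; last by move/eqP; rewrite oner_eq0.
by move/eqP; rewrite normr_eq0 subr_eq0 => /eqP.
Qed.

Lemma measurable_dist_ge X Y (e : R) :
  measurable_fun setT X -> measurable_fun setT Y ->
  measurable [set w | e <= `|X w - Y w|].
Proof.
move=> mX mY; rewrite (_ : [set w | _] =
  setT `&` (fun w => `|X w - Y w|) @^-1` `[e, +oo[).
  have mf : measurable_fun setT (fun w => `|X w - Y w|).
    by apply: measurableT_comp => //; exact: measurable_funB.
  exact: mf.
by apply/seteqP; split => w /=; rewrite in_itv/= andbT// => -[].
Qed.

Lemma Rintegral_indic_probability (A : set Omega) : measurable A ->
  \int[P]_w \1_A w = fine (P A).
Proof. by move=> mA; rewrite /Rintegral integral_indic// setIT. Qed.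

Lemma integrable_indic_probability (A : set Omega) : measurable A ->
  P.-integrable setT (EFin \o (\1_A : Omega -> R)).
Proof.
move=> mA; apply: (bounded_measurable_integrable (M := 1)) => //.
by move=> w; rewrite indicE; case: (_ \in _); rewrite ?normr1 ?normr0.
Qed.

Lemma pd_markov X Y (e : R) : measurable_fun setT X -> measurable_fun setT Y ->
  0 < e -> e <= 1 -> e * fine (P [set w | e <= `|X w - Y w|]) <= pd X Y.
Proof.
move=> mX mY e0 e1; have mS := measurable_dist_ge e mX mY.
rewrite -Rintegral_indic_probability// -RintegralZl//; last first.
  exact: integrable_indic_probability.
apply: le_Rintegral => //.
- apply: (bounded_measurable_integrable (M := e)) => //.
    by apply: measurable_funM => //; exact: measurable_indic.
  move=> w; rewrite indicE; case: (_ \in _) => /=; rewrite ?mulr1 ?mulr0 ?normr0 ?(ltW e0)//.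
  by rewrite gtr0_norm.
- exact: integrable_pd.
- move=> w _; rewrite indicE; case: (boolP (_ \in _)) => [/set_mem/= h|_] /=.
    by rewrite mulr1 le_min h e1.
  by rewrite mulr0 le_min normr_ge0 ler01.
Qed.

Lemma pd_le_prob X Y (e : R) : measurable_fun setT X -> measurable_fun setT Y ->
  0 < e -> pd X Y <= e + fine (P [set w | e <= `|X w - Y w|]).
Proof.
move=> mX mY e0; have mS := measurable_dist_ge e mX mY.
rewrite -Rintegral_indic_probability// -{1}(Rintegral_probability_cst e).
have ie : P.-integrable setT (EFin \o (fun _ : Omega => e)).
  by apply: (bounded_measurable_integrable (M := `|e|)).
rewrite -RintegralD//; last exact: integrable_indic_probability.
apply: le_Rintegral => //; first exact: integrable_pd.
  by apply: integrable_EFinD => //; exact: integrable_indic_probability.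
move=> w _; rewrite indicE; case: (boolP (_ \in _)) => [_|] /=.
  by rewrite ge_min; apply/orP; right; lra.
move/negP => h; rewrite addr0 ge_min; apply/orP; left.
by rewrite leNgt; apply/negP => /ltW h'; apply: h; apply/mem_set.
Qed.

Lemma cvg_in_probability_pd (X : nat -> Omega -> R) Y :
  (forall n, measurable_fun setT (X n)) -> measurable_fun setT Y ->
  cvg_in_probability P X Y <-> pd (X n) Y @[n --> \oo] --> 0.
Proof.
move=> mX mY; split=> h.
- apply/cvgrPdist_le => e e0.
  have e2 : 0 < e / 2 by rewrite divr_gt0.
  have /fine_cvgP[_ /cvgrPdist_le/(_ _ e2)] := h _ e2.
  apply: filterS => n; rewrite !sub0r !normrN => hn.
  rewrite ger0_norm ?pd_ge0//; apply: le_trans (pd_le_prob (mX n) mY e2) _.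
  by have := le_trans (ler_norm _) hn => /=; lra.
- move=> e e0; pose e' := Num.min e 1.
  have e'0 : 0 < e' by rewrite lt_min e0 ltr01.
  apply/fine_cvgP; split.
    by apply: nearW => n; rewrite fin_num_measure//; exact: measurable_dist_ge.
  apply/cvgrPdist_le => r r0.
  move/cvgrPdist_le: h => /(_ (e' * r)); rewrite mulr_gt0// => /(_ isT).
  apply: filterS => n; rewrite !sub0r !normrN => hn /=.
  rewrite ger0_norm ?fine_ge0//.
  have e'1 : e' <= 1 by rewrite ge_min lexx orbT.
  have := le_trans (pd_markov (mX n) mY e'0 e'1) (le_trans (ler_norm _) hn).
  rewrite ler_pM2l//; apply: le_trans; apply: fine_le.
  - by rewrite fin_num_measure//; exact: measurable_dist_ge.
  - by rewrite fin_num_measure//; exact: measurable_dist_ge.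
  - apply: le_measure; rewrite ?inE; try exact: measurable_dist_ge.
    by move=> w /=; apply: le_trans; rewrite ge_min lexx.
Qed.

Lemma ae_cvg_pd (X : nat -> Omega -> R) Y :
  (forall n, measurable_fun setT (X n)) -> measurable_fun setT Y ->
  {ae P, forall w, X n w @[n --> \oo] --> Y w} -> pd (X n) Y @[n --> \oo] --> 0.
Proof.
move=> mX mY XY; rewrite -[X in _ --> X](Rintegral_probability_cst 0).
apply: (bounded_convergence (M := 1)) => //.
- by move=> n; exact: measurable_pd.
- by move=> n w; exact: min1_le1.
- apply: filterS XY => w /cvgrPdist_le h; apply/cvgrPdist_le => e e0.
  apply: filterS (h _ e0) => n hn; rewrite sub0r normrN ger0_norm.
    by rewrite ge_min distrC hn.
  by rewrite le_min normr_ge0 ler01.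
Qed.

(** The upper limit exists at every point and is measurable, so it is a random variable whatever
    happens on the exceptional null set. *)
Definition limit_rv (X : nat -> Omega -> R) (w : Omega) : R :=
  fine (limn_esup (fun n => (X n w)%:E)).

Lemma measurable_limit_rv (X : nat -> Omega -> R) :
  (forall n, measurable_fun setT (X n)) -> measurable_fun setT (limit_rv X).
Proof.
move=> mX; apply: (@measurableT_comp _ _ _ _ _ _ fine).
  exact: (fine_measurable measurableT).
by apply: measurable_fun_limn_esup => n; exact/measurable_EFinP.
Qed.

Lemma limit_rvE (X : nat -> Omega -> R) w (l : R) :
  X n w @[n --> \oo] --> l -> limit_rv X w = l.
Proof.
move=> h; rewrite /limit_rv.
have h' : (X n w)%:E @[n --> \oo] --> l%:E by apply: cvg_EFin => //; exact: nearW.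
by rewrite is_cvg_limn_esupE; [rewrite (cvg_lim _ h') | apply/cvg_ex; exists l%:E].
Qed.

Lemma limit_rv_cvg (X : nat -> Omega -> R) w :
  cvg (X n w @[n --> \oo]) -> X n w @[n --> \oo] --> limit_rv X w.
Proof. by move=> h; rewrite (limit_rvE h). Qed.

(** By monotone convergence the full series has finite expectation, hence is finite almost
    surely. *)
Lemma ae_bounded_sums (f : nat -> Omega -> R) (B : R) :
  (forall n, measurable_fun setT (f n)) -> (forall n w, 0 <= f n w) ->
  (forall N, (\sum_(0 <= n < N) \int[P]_w (f n w)%:E <= B%:E)%E) ->
  {ae P, forall w, exists M, forall N, \sum_(0 <= n < N) f n w <= M}.
Proof.
move=> mf f0 fB.
have mF : measurable_fun setT (fun w => \sum_(0 <= n <oo) (f n w)%:E)%E.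
  apply: ge0_emeasurable_sum => //; first by move=> *; rewrite lee_fin.
  by move=> k _; exact/measurable_EFinP.
have iF : (\int[P]_w (\sum_(0 <= n <oo) (f n w)%:E) <= B%:E)%E.
  rewrite integral_nneseries//; last by move=> *; rewrite lee_fin.
    apply: lime_le; last by apply: nearW => N; exact: fB.
    apply: is_cvg_nneseries => n _ _; apply: integral_ge0 => w _.
    by rewrite lee_fin.
  by move=> n; exact/measurable_EFinP.
have F0 w : (0 <= \sum_(0 <= n <oo) (f n w)%:E)%E.
  by apply: nneseries_ge0 => n _ _; rewrite lee_fin.
have : P.-integrable setT (fun w => \sum_(0 <= n <oo) (f n w)%:E)%E.
  apply/integrableP; split => //.
  rewrite (eq_integral (fun w => \sum_(0 <= n <oo) (f n w)%:E)%E).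
    exact: le_lt_trans iF (ltry _).
  by move=> w _; rewrite gee0_abs.
move/(integrable_ae measurableT); apply: filterS => w /(_ I) wfin.
exists (fine (\sum_(0 <= n <oo) (f n w)%:E)%E) => N.
rewrite -lee_fin fineK// -sumEFin.
by apply: nneseries_lim_ge => n _ _; rewrite lee_fin.
Qed.

Lemma bounded_sums_cvg (u : nat -> R) (M : R) : (forall n, 0 <= u n) ->
  (forall N, \sum_(0 <= n < N) u n <= M) -> cvgn (series u).
Proof.
move=> u0 uM; apply: nondecreasing_is_cvgn.
  by apply: nondecreasing_series => n _ _.
by exists M => _ [n _ <-]; exact: uM.
Qed.

(** Summable truncated steps are eventually below 1, where the truncation is void; from there on the
    telescoping series converges absolutely. *)
Lemma summable_steps_cvg (x : nat -> R) (M : R) :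
  (forall N, \sum_(0 <= n < N) Num.min `|x n - x n.+1| 1 <= M) -> cvgn x.
Proof.
move=> xM; set D := fun n => Num.min `|x n - x n.+1| 1.
have D0 n : 0 <= D n by rewrite le_min normr_ge0 ler01.
have cD := bounded_sums_cvg D0 xM.
have /cvgrPdist_lt/(_ _ ltr01) [N _ hN] := cvg_series_cvg_0 cD.
have xD n : (N <= n)%N -> `|telescope x n| = D n.
  move=> /hN; rewrite /= sub0r normrN ger0_norm// /D /telescope distrC.
  by rewrite /Num.min; case: ifPn => // _; rewrite ltxx.
have : cvgn [normed series (telescope x)].
  rewrite -(@is_cvg_series_restrict N) in cD.
  rewrite -(@is_cvg_series_restrict N).
  rewrite (_ : [sequence _]_n = [sequence \sum_(N <= k < n) D k]_n)//.
  apply/funext => n /=; apply: eq_big_nat => i /andP[Ni _].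
  exact: xD.
move/normed_cvg; rewrite telescopeK => /cvg_ex[l hl].
apply/cvg_ex; exists (l + x 0%N).
rewrite [X in X @ _](_ : x = (fun n => (x n - x 0%N) + x 0%N)).
  exact: cvgD hl (cvg_cst _).
by apply/funext => n; rewrite subrK.
Qed.

(** The expected truncated steps sum to at most 2, the value of the geometric series, so almost
    surely the truncated steps themselves are summable. *)
Lemma fast_pd_ae_cvg (X : nat -> Omega -> R) :
  (forall n, measurable_fun setT (X n)) ->
  (forall n, pd (X n) (X n.+1) <= 2^-1 ^+ n) ->
  {ae P, forall w, cvg (X n w @[n --> \oo])}.
Proof.
move=> mX h.
have := @ae_bounded_sums (fun n w => Num.min `|X n w - X n.+1 w| 1) 2.
have mD n : measurable_fun setT (fun w => Num.min `|X n w - X n.+1 w| 1).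
  exact: measurable_pd.
move=> /(_ mD) H; apply: filterS (H _ _) => [w [M hM]|n w|N].
- exact: summable_steps_cvg hM.
- by rewrite le_min normr_ge0 ler01.
- apply: (@le_trans _ _ (\sum_(0 <= n < N) (2^-1 ^+ n : R)%:E)%E).
    apply: lee_sum => n _.
    rewrite -[leLHS]fineK; first by rewrite lee_fin; exact: h.
    exact: (integrable_fin_num measurableT (integrable_pd (mX n) (mX n.+1))).
  rewrite sumEFin lee_fin.
  rewrite (_ : \sum_(0 <= i < N) _ = series (geometric 1 (2^-1 : R)) N); last first.
    by rewrite /series/=; apply: eq_bigr => i _; rewrite mul1r.
  rewrite geometric_seriesE ?mul1r; last by apply/eqP; lra.
  have : 0 <= (2^-1 : R) ^+ N by apply: exprn_ge0; lra.
  rewrite /= (_ : 1 - 2^-1 = (2:R)^-1); [rewrite /= invrK; lra | lra].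
Qed.

(** Completeness of convergence in probability: a subsequence with geometrically small steps
    converges almost surely, and the Cauchy property carries its limit over to the whole
    sequence. *)
Lemma pd_cauchy_cvg (X : nat -> Omega -> R) :
  (forall n, measurable_fun setT (X n)) ->
  (forall e, 0 < e -> exists N, forall n m, (N <= n)%N -> (N <= m)%N ->
     pd (X n) (X m) <= e) ->
  exists2 Y, measurable_fun setT Y &
    pd (X n) Y @[n --> \oo] --> 0 /\
    exists f : nat -> nat, (forall n, (n <= f n)%N) /\
      {ae P, forall w, X (f n) w @[n --> \oo] --> Y w}.
Proof.
move=> mX hX.
have H n : exists N, forall k l, (N <= k)%N -> (N <= l)%N ->
    pd (X k) (X l) <= 2^-1 ^+ n.
  by apply: hX; rewrite exprn_gt0.
have [g hg] := choice H.
(* Summing the earlier thresholds puts both [f n] and [f n.+1] beyond [g n]; the summand [n] makes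
   [f] tend to infinity. *)
pose f n := (\sum_(i < n.+1) g i + n)%N.
have gf n : (g n <= f n)%N by rewrite /f big_ord_recr/= -addnA; lia.
have fS n : (g n <= f n.+1)%N.
  apply: leq_trans (gf n) _; rewrite /f [X in (_ <= X + _)%N]big_ord_recr/=.
  by rewrite -addnA leq_add2l; lia.
have nf n : (n <= f n)%N by rewrite /f leq_addl.
have cv : {ae P, forall w, X (f n) w @[n --> \oo] --> limit_rv (X \o f) w}.
  have := @fast_pd_ae_cvg (X \o f) (fun n => mX _).
  move=> /(_ (fun n => hg n _ _ (gf n) (fS n))).
  by apply: filterS => w /limit_rv_cvg.
have mY : measurable_fun setT (limit_rv (X \o f)).
  by apply: measurable_limit_rv => n; exact: mX.
exists (limit_rv (X \o f)) => //; split; last by exists f; split.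
have c0 := @ae_cvg_pd (X \o f) _ (fun n => mX _) mY cv.
apply/cvgrPdist_le => e e0.
have e2 : 0 < e / 2 by rewrite divr_gt0.
have [N hN] := hX _ e2.
near=> n.
rewrite sub0r normrN ger0_norm ?pd_ge0//.
have [m [mN hm]] : exists m, (N <= f m)%N /\ pd (X (f m)) (limit_rv (X \o f)) <= e / 2.
  have /cvgrPdist_le/(_ _ e2)[M _ hM] := c0.
  exists (maxn M N); split; first by apply: leq_trans (nf _); rewrite leq_maxr.
  have := hM (maxn M N) (leq_maxl _ _).
  by rewrite /= sub0r normrN ger0_norm ?pd_ge0.
apply: le_trans (pd_triangle (mX n) (mX (f m)) mY) _.
have : pd (X n) (X (f m)) <= e / 2 by apply: hN => //; near: n; exists N.
by lra.
Unshelve. all: by end_near. Qed.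

Lemma pd_cvg_unique (X : nat -> Omega -> R) Y Y' :
  (forall n, measurable_fun setT (X n)) -> measurable_fun setT Y ->
  measurable_fun setT Y' ->
  pd (X n) Y @[n --> \oo] --> 0 -> pd (X n) Y' @[n --> \oo] --> 0 ->
  {ae P, forall w, Y w = Y' w}.
Proof.
move=> mX mY mY' c c'; apply: pd_eq0 => //; apply/eqP.
rewrite eq_le pd_ge0 andbT; apply/ler_addgt0Pl => e e0; rewrite addr0.
have e2 : 0 < e / 2 by rewrite divr_gt0.
have /cvgrPdist_le/(_ _ e2)[M _ hM] := c.
have /cvgrPdist_le/(_ _ e2)[M' _ hM'] := c'.
have := hM (maxn M M') (leq_maxl _ _); have := hM' (maxn M M') (leq_maxr _ _).
rewrite /= !sub0r !normrN !ger0_norm ?pd_ge0// => h h'.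
apply: le_trans (pd_triangle mY (mX (maxn M M')) mY') _.
by rewrite pdC; lra.
Qed.

Lemma pd_cvg_subseq (X : nat -> Omega -> R) Y :
  (forall n, measurable_fun setT (X n)) -> measurable_fun setT Y ->
  pd (X n) Y @[n --> \oo] --> 0 ->
  exists f : nat -> nat, (forall n, (n <= f n)%N) /\
    {ae P, forall w, X (f n) w @[n --> \oo] --> Y w}.
Proof.
move=> mX mY c.
have [e e0|Y' mY' [c' [f [nf cf]]]] := @pd_cauchy_cvg X mX.
  have e2 : 0 < e / 2 by rewrite divr_gt0.
  have /cvgrPdist_le/(_ _ e2)[M _ hM] := c.
  exists M => n m /hM + /hM; rewrite /= !sub0r !normrN !ger0_norm ?pd_ge0// => h h'.
  apply: le_trans (pd_triangle (mX n) mY (mX m)) _.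
  by rewrite (pdC Y); lra.
exists f; split => //.
by apply: filterS2 cf (pd_cvg_unique mX mY mY' c c') => w + ->.
Qed.

(** Pointwise min (x, 1) <= e + e^(-q) x^q, as is seen by separating x <= e from x > e. *)
Lemma pd_le_moment X Y (q e : R) : measurable_fun setT X ->
  measurable_fun setT Y -> 0 < q -> 0 < e ->
  ((pd X Y)%:E <= e%:E + (e `^ (- q))%:E * \int[P]_w (`|X w - Y w| `^ q)%:E)%E.
Proof.
move=> mX mY q0 e0.
have mXY : measurable_fun setT (fun w => `|X w - Y w| `^ q).
  apply: (@measurableT_comp _ _ _ _ _ _ (fun x : R => x `^ q)).
    exact: measurable_powR.
  by apply: measurableT_comp => //; exact: measurable_funB.
rewrite -ge0_integralZl//; last by rewrite lee_fin powR_ge0.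
- rewrite -[e%:E]mule1 -(probability_setT P) -integral_cst//.
  rewrite -ge0_integralD//; last 3 first.
  + by move=> w _; rewrite lee_fin ltW.
  + by move=> w _; rewrite lee_fin mulr_ge0// powR_ge0.
  + apply/measurable_EFinP; exact: measurable_funM.
  rewrite /pd /Rintegral fineK; last first.
    exact: (integrable_fin_num measurableT (integrable_pd mX mY)).
  apply: ge0_le_integral => //.
  + by apply/measurable_EFinP; exact: measurable_pd.
  + apply: emeasurable_funD => //; apply/measurable_EFinP; exact: measurable_funM.
  + move=> w _ /=; rewrite -EFinM -EFinD lee_fin.
    have [h|h] := leP `|X w - Y w| e.
      by rewrite ge_min; apply/orP; left; rewrite (le_trans h)// lerDl mulr_ge0// powR_ge0.
    rewrite ge_min; apply/orP; right.
    rewrite powRN -[leLHS]add0r lerD//; first exact: ltW.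
    rewrite ler_pdivlMl ?powR_gt0// mulr1.
    by rewrite ge0_ler_powR// ?nnegrE ltW.
- exact/measurable_EFinP.
Qed.

(** Fatou's lemma along a subsequence that converges almost surely. The bound is asked for only
    eventually and up to any slack. *)
Lemma fatou_pd_moment (X : nat -> Omega -> R) Y (q : R) (B : \bar R) :
  (forall n, measurable_fun setT (X n)) -> measurable_fun setT Y -> 0 < q ->
  pd (X n) Y @[n --> \oo] --> 0 ->
  (forall e : R, 0 < e -> \forall n \near \oo,
     (\int[P]_w (`|X n w| `^ q)%:E <= B + e%:E)%E) ->
  (\int[P]_w (`|Y w| `^ q)%:E <= B)%E.
Proof.
move=> mX mY q0 c hB.
have [f [nf cf]] := pd_cvg_subseq mX mY c.
have mp (Z : Omega -> R) : measurable_fun setT Z ->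
    measurable_fun setT (fun w => (`|Z w| `^ q)%:E).
  move=> mZ; apply/measurable_EFinP.
  apply: (@measurableT_comp _ _ _ _ _ _ (fun x : R => x `^ q)).
    exact: measurable_powR.
  exact: measurableT_comp.
have -> : (\int[P]_w (`|Y w| `^ q)%:E = \int[P]_w limn_einf (fun n => (`|X (f n) w| `^ q)%:E))%E.
  apply: ae_eq_integral => //; first exact: mp.
    under eq_fun do rewrite -[limn_einf _]oppeK -limn_esupN.
    apply: measurableT_comp => //.
    apply: measurable_fun_limn_esup => n.
    by apply: measurableT_comp => //; exact: mp.
  apply: filterS cf => w hw _.
  have hw' : (`|X (f n) w| `^ q)%:E @[n --> \oo] --> (`|Y w| `^ q)%:E.
    apply: cvg_EFin; first exact: nearW.
    have : `|X (f n) w| @[n --> \oo] --> `|Y w| by exact: cvg_norm.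
    by move=> _; exact: cvg_norm_powR.
  by rewrite is_cvg_limn_einfE; [rewrite (cvg_lim _ hw') | apply/cvg_ex; exists (`|Y w| `^ q)%:E].
apply: le_trans (fatou P measurableT _ _) _.
- by move=> n; exact: mp.
- by move=> n w _; rewrite lee_fin powR_ge0.
apply/lee_addgt0Pr => e e0.
have [N _ hN] := hB e e0.
rewrite limn_einf_lim; apply: lime_le; first exact: is_cvg_einfs.
apply: nearW => n; rewrite /einfs.
apply: (@le_trans _ _ (\int[P]_w (`|X (f (maxn n N)) w| `^ q)%:E)%E).
  by apply: ereal_inf_lbound; exists (maxn n N) => //=; rewrite leq_maxl.
by apply: hN => /=; apply: leq_trans (nf _); rewrite leq_maxr.
Qed.

(** Where the distance exceeds 1 the oscillation of [phi], at most 2, takes over; this is the origin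
    of 2 <= K. *)
Lemma pd_lipschitz (phi : R -> R) (K : R) X Y : measurable_fun setT X ->
  measurable_fun setT Y -> measurable_fun setT phi ->
  (forall x, `|phi x| <= 1) -> 2 <= K ->
  (forall x y, `|phi x - phi y| <= K * `|x - y|) ->
  `|\int[P]_w phi (X w) - \int[P]_w phi (Y w)| <= K * pd X Y.
Proof.
move=> mX mY mphi phi1 K2 phiK.
have K0 : 0 <= K by lra.
have mpX : measurable_fun setT (fun w => phi (X w)) by exact: measurableT_comp.
have mpY : measurable_fun setT (fun w => phi (Y w)) by exact: measurableT_comp.
have ipX : P.-integrable setT (EFin \o (fun w => phi (X w))).
  exact: (bounded_measurable_integrable (M := 1)).
have ipY : P.-integrable setT (EFin \o (fun w => phi (Y w))).
  exact: (bounded_measurable_integrable (M := 1)).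
have ib : P.-integrable setT (EFin \o (fun w => phi (X w) - phi (Y w))).
  exact: integrable_EFinB.
rewrite -RintegralB//; apply: le_trans (le_normr_Rintegral _ _) _ => //.
rewrite -RintegralZl//; last exact: integrable_pd.
apply: le_Rintegral => //.
- exact: (integrable_norm ib).
- by apply: integrable_EFinZl => //; exact: integrable_pd.
- move=> w _; rewrite /Num.min; case: ifPn => // _; rewrite mulr1.
  apply: le_trans K2; apply: le_trans (ler_normB _ _) _.
  by have := phi1 (X w); have := phi1 (Y w); lra.
Qed.

Lemma pd_cvg_lipschitz (phi : R -> R) (K : R) (X : nat -> Omega -> R) Y :
  (forall n, measurable_fun setT (X n)) ->
  measurable_fun setT Y -> measurable_fun setT phi ->
  (forall x, `|phi x| <= 1) -> 
  (forall x y, `|phi x - phi y| <= K * `|x - y|) ->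
  pd (X n) Y @[n --> \oo] --> 0 ->
  \int[P]_w phi (X n w) @[n --> \oo] --> \int[P]_w phi (Y w).
Proof.
move=> mX mY mphi phi1 phiK c.
pose L := `|K| + 2.
have L2 : 2 <= L by rewrite lerDr.
have phiL x y : `|phi x - phi y| <= L * `|x - y|.
  apply: le_trans (phiK x y) _; rewrite ler_wpM2r// (le_trans (ler_norm _))//.
  by rewrite lerDl.
apply/cvgrPdist_le => e e0.
have e2 : 0 < e / L by rewrite divr_gt0//; lra.
move/cvgrPdist_le : c => /(_ _ e2); apply: filterS => n.
rewrite sub0r normrN ger0_norm ?pd_ge0// => h.
rewrite distrC; apply: le_trans (pd_lipschitz (mX n) mY mphi phi1 L2 phiL) _.
rewrite mulrC -ler_pdivlMr//; lra.
Qed.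

End probability_toolkit.

Lemma measurable_norm_ge d (S : measurableType d) (R : realType) (f : S -> R) (r : R) :
  measurable_fun setT f -> measurable [set w | r <= `|f w|].
Proof.
move=> mf; have := measurable_dist_ge r mf (@measurable_cst _ _ S R setT 0).
by under eq_set do rewrite subr0.
Qed.

Lemma measurable_sum_nat d (S : measurableType d) (R : realType)
    (f : nat -> S -> R) (a b : nat) :
  (forall i, (a <= i < b)%N -> measurable_fun setT (f i)) ->
  measurable_fun setT (fun w => \sum_(a <= i < b) f i w).
Proof.
move=> mf; rewrite [X in measurable_fun _ X](_ : _ =
    (fun w => \sum_(a <= i < b) (if (a <= i < b)%N then f i w else 0))).
  apply: measurable_sum => i; case E : (a <= i < b)%N; [exact: mf|exact: measurable_cst].
by apply/funext => w; apply: eq_big_nat => i ->.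
Qed.

(** * Independence: generation, grouping, limits in probability and series *)

Section independence.
Context d {Omega : measurableType d} {R : realType} (P : probability Omega R).

Definition pr (A : set Omega) : R := fine (P A).

Lemma EFin_pr A : measurable A -> (pr A)%:E = P A.
Proof. by move=> mA; rewrite /pr fineK// fin_num_measure. Qed.

Lemma pr_ge0 A : 0 <= pr A. Proof. exact: fine_ge0. Qed.

Lemma pr_setT : pr setT = 1. Proof. by rewrite /pr probability_setT. Qed.

Lemma pr_set0 : pr set0 = 0. Proof. by rewrite /pr measure0. Qed.

Lemma le_pr A B : measurable A -> measurable B -> A `<=` B -> pr A <= pr B.
Proof.
move=> mA mB AB; rewrite -lee_fin !EFin_pr//.
by apply: le_measure => //; rewrite inE.
Qed.

Lemma pr_le1 A : measurable A -> pr A <= 1.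
Proof. by move=> mA; rewrite -pr_setT; apply: le_pr. Qed.

Lemma prU A B : measurable A -> measurable B -> A `&` B = set0 ->
  pr (A `|` B) = pr A + pr B.
Proof.
move=> mA mB AB; apply/EFin_inj; rewrite EFinD !EFin_pr//.
  exact: measureU.
exact: measurableU.
Qed.

Lemma prU_le A B : measurable A -> measurable B -> pr (A `|` B) <= pr A + pr B.
Proof.
move=> mA mB; rewrite -lee_fin EFinD !EFin_pr//; last exact: measurableU.
exact: measureU2.
Qed.

Lemma pr_bigsetU_le (N : nat) (A : nat -> set Omega) :
  (forall i, measurable (A i)) ->
  pr (\big[setU/set0]_(i < N) A i) <= \sum_(i < N) pr (A i).
Proof.
move=> mA; elim: N => [|N ih]; first by rewrite !big_ord0 pr_set0.
rewrite !big_ord_recr/=; apply: le_trans (prU_le _ _) _ => //.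
  exact: bigsetU_measurable.
by rewrite lerD2r.
Qed.

Lemma prC A : measurable A -> pr (~` A) = 1 - pr A.
Proof.
move=> mA; have := prU mA (measurableC mA) (setICr _).
by rewrite setUCr pr_setT => ->; rewrite addrC addKr.
Qed.

Lemma prD A B : measurable A -> measurable B -> B `<=` A ->
  pr (A `\` B) = pr A - pr B.
Proof.
move=> mA mB BA; rewrite -{2}(setDUK BA) prU ?setIDAC//.
- by rewrite addrAC subrr add0r.
- exact: measurableD.
- by rewrite setICA setICr setI0.
Qed.

Lemma cvg_pr_bigcup (F : nat -> set Omega) : (forall n, measurable (F n)) ->
  (forall n m, (n <= m)%N -> F n `<=` F m) ->
  pr (F n) @[n --> \oo] --> pr (\bigcup_n F n).
Proof.
move=> mF ndF; have mU : measurable (\bigcup_n F n) by exact: bigcupT_measurable.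
apply: fine_cvg; rewrite -/(pr _) EFin_pr//.
by apply: nondecreasing_cvg_mu => // n m nm; apply/subsetPset; exact: ndF.
Qed.

Lemma cvg_pr_sum (F : nat -> set Omega) : (forall n, measurable (F n)) ->
  trivIset setT F ->
  \sum_(0 <= i < n) pr (F i) @[n --> \oo] --> pr (\bigcup_n F n).
Proof.
move=> mF tF; have mU : measurable (\bigcup_n F n) by exact: bigcupT_measurable.
have h : (\sum_(0 <= i < n) P (F i))%E @[n --> \oo] --> P (\bigcup_n F n).
  exact: (@measure_semi_sigma_additive _ _ _ P F mF tF mU).
rewrite -EFin_pr// in h.
rewrite [X in X @ _](_ : _ = fine \o (fun n => \sum_(0 <= i < n) P (F i))%E).
  exact: fine_cvg h.
apply/funext => n /=; rewrite -[LHS]/(fine _%:E); congr fine; rewrite -sumEFin.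
by apply: eq_bigr => i _; rewrite EFin_pr.
Qed.

(** The events independent of a fixed [B] form a Dynkin system. *)
Lemma indep_sigma (G : set (set Omega)) (B : set Omega) : setI_closed G ->
  (forall A, G A -> measurable A) -> measurable B ->
  (forall A, G A -> pr (A `&` B) = pr A * pr B) ->
  forall A, <<s G>> A -> measurable A /\ pr (A `&` B) = pr A * pr B.
Proof.
move=> GI mG mB GB.
pose H := [set A | measurable A /\ pr (A `&` B) = pr A * pr B].
apply: (@lambda_system_subset _ G GI setT H) => //; last first.
  by move=> A GA; split; [exact: mG|exact: GB].
apply/dynkin_lambda_system; split.
- by split => //; rewrite setTI pr_setT mul1r.
- move=> A [mA AB]; split; first exact: measurableC.
  rewrite prC// mulrBl mul1r -AB.
  have -> : ~` A `&` B = B `\` (A `&` B).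
    by rewrite setDE setCI setIUr setICr setU0 setIC.
  by rewrite prD//; exact: measurableI.
- move=> F tF HF; split; first by apply: bigcupT_measurable => k; case: (HF k).
  have mF k : measurable (F k) by case: (HF k).
  have c1 := cvg_pr_sum mF tF.
  have := @cvg_pr_sum (fun k => F k `&` B).
  case/(_ _)/Wrap => [k|]; first exact: measurableI.
  case/(_ _)/Wrap => [|c2].
    apply/trivIsetP => a b _ _ ab.
    by move/trivIsetP : tF => /(_ a b I I ab); rewrite setIACA => ->; rewrite set0I.
  rewrite -setI_bigcupl in c2.
  apply: (cvg_unique _ c2) => //.
  rewrite /= [X in X @ _](_ : _ = fun n => (\sum_(0 <= i < n) pr (F i)) * pr B).
    by apply: cvgM => //; exact: cvg_cst.
  by apply/funext => n; rewrite mulr_suml; apply: eq_bigr => i _; rewrite (HF i).2.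
Qed.

(** Induction on the number [k] of factors already enlarged to the generated sigma-algebra.
    Enlarging one more factor is [indep_sigma], with the intersection of all other factors as the
    fixed event. *)
Lemma pi_indep (N : nat) (G : nat -> set (set Omega)) :
  (forall i, setI_closed (G i)) -> (forall i, G i setT) ->
  (forall i A, G i A -> measurable A) ->
  (forall A : nat -> set Omega, (forall i, G i (A i)) ->
     pr (\bigcap_(i in `I_N) A i) = \prod_(i < N) pr (A i)) ->
  forall A : nat -> set Omega, (forall i, <<s G i>> (A i)) ->
     pr (\bigcap_(i in `I_N) A i) = \prod_(i < N) pr (A i).
Proof.
move=> GI GT mG GP.
suff H k : forall A : nat -> set Omega,
    (forall i, (i < k)%N -> <<s G i>> (A i)) ->
    (forall i, (k <= i)%N -> G i (A i)) ->
    pr (\bigcap_(i in `I_N) A i) = \prod_(i < N) pr (A i).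
  move=> A hA.
  rewrite (@eq_bigcapr _ _ _ _ (fun i => if (i < N)%N then A i else setT)).
    rewrite (@H N) => [|i iN|i iN].
    + by apply: eq_bigr => i _; rewrite ltn_ord.
    + by rewrite iN.
    + by rewrite ltnNge iN.
  by move=> i /= ->.
elim: k => [|k ih] A hA hA'; first by apply: GP => i; exact: hA'.
have smG i A' : <<s G i>> A' -> measurable A'.
  by apply: smallest_sub => [|B]; [exact: sigma_algebra_measurable|exact: mG].
have mA i : measurable (A i).
  by have [/hA/smG//|/hA'/mG] := ltnP i k.+1.
pose upd C i := if i == k then C else A i.
have updP C : G k C -> pr (\bigcap_(i in `I_N) upd C i) = \prod_(i < N) pr (upd C i).
  move=> GC; apply: ih => i ik; rewrite /upd; case: eqVneq => [e|ne].
  - by rewrite e ltnn in ik.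
  - by apply: hA; rewrite ltnS ltnW.
  - by rewrite e.
  - by apply: hA'; rewrite ltn_neqAle eq_sym ne.
have [kN|Nk] := ltnP k N; last first.
  rewrite (_ : \bigcap_(i in `I_N) A i = \bigcap_(i in `I_N) upd setT i).
    rewrite updP//; apply: eq_bigr => i _; rewrite /upd ifN//.
    by rewrite neq_ltn (leq_trans (ltn_ord i)).
  apply: eq_bigcapr => i /= iN; rewrite /upd ifN//.
  by rewrite neq_ltn (leq_trans iN).
pose B := \bigcap_(i in `I_N) upd setT i.
have mB : measurable B.
  apply: bigcap_measurableType => i _; rewrite /upd; case: ifP => // _.
have capE C : \bigcap_(i in `I_N) upd C i = C `&` B.
  apply/seteqP; split=> w.
    move=> h; split; first by have := h k kN; rewrite /upd eqxx.
    by move=> i iN; have := h i iN; rewrite /upd; case: ifP.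
  move=> [Cw h] i iN; have := h i iN; rewrite /upd; case: ifP => //.
have prodE C : \prod_(i < N) pr (upd C i) = pr C * pr B.
  rewrite /B updP//.
  rewrite (bigD1 (Ordinal kN))//= [in RHS](bigD1 (Ordinal kN))//=.
  rewrite /upd !eqxx pr_setT mul1r; congr *%R; apply: eq_bigr => i ik.
  by rewrite !ifN//; apply: contraNN ik => /eqP ik; apply/eqP/val_inj.
have -> : \bigcap_(i in `I_N) A i = A k `&` B.
  rewrite -capE; apply: eq_bigcapr => i _; rewrite /upd; case: eqVneq => //.
  by move=> ->.
have -> : \prod_(i < N) pr (A i) = pr (A k) * pr B.
  rewrite -prodE; apply: eq_bigr => i _; rewrite /upd; case: eqVneq => //.
  by move=> ->.
apply: (@indep_sigma (G k) B _ _ _ _ (A k) _).2 => //.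
- exact: mG.
- by move=> C GC; rewrite -capE updP// prodE.
- exact: hA.
Qed.

(** Families are indexed by all naturals with only the first [N] members constrained, so that
    truncation and regrouping need no change of index type. *)
Definition indepN (X : nat -> Omega -> R) (N : nat) : Prop :=
  forall B : nat -> set R, (forall i, measurable (B i)) ->
    pr (\bigcap_(i in `I_N) (X i @^-1` B i)) = \prod_(i < N) pr (X i @^-1` B i).

Lemma measurable_preimageT (X : Omega -> R) (B : set R) :
  measurable_fun setT X -> measurable B -> measurable (X @^-1` B).
Proof. by move=> mX mB; rewrite -[X in measurable X]setTI; exact: mX. Qed.

Lemma indepNP (X : nat -> Omega -> R) (N : nat) :
  (forall i, measurable_fun setT (X i)) ->
  indepN X N <-> mutually_independent P (fun i : 'I_N => X i).
Proof.
move=> mX; split => [h B mB|h B mB].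
- pose B' i := if insub i is Some j then B j else setT.
  have B'E (i : 'I_N) : B' i = B i by rewrite /B' valK.
  have mB' i : measurable (B' i) by rewrite /B'; case: insub.
  have mXB i : measurable (X i @^-1` B' i) by exact: measurable_preimageT.
  transitivity (P (\bigcap_(i in `I_N) (X i @^-1` B' i))).
    congr (P _); apply/seteqP; split=> w.
      by move=> hw i /= iN; have := hw (Ordinal iN) I; rewrite -B'E.
    by move=> hw i _; rewrite -B'E; exact: hw (ltn_ord i).
  rewrite -EFin_pr; last exact: bigcap_measurableType.
  rewrite h// -prodEFin; apply: eq_bigr => i _.
  by rewrite EFin_pr// B'E.
- have mXB i : measurable (X i @^-1` B i) by exact: measurable_preimageT.
  apply: EFin_inj; rewrite -prodEFin.
  transitivity (P (\bigcap_(i in [set: 'I_N]) (X i @^-1` B i))).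
    rewrite EFin_pr; last exact: bigcap_measurableType.
    congr (P _); apply/seteqP; split=> w.
      by move=> hw i _; exact: hw (ltn_ord i).
    by move=> hw i /= iN; exact: hw (Ordinal iN) I.
  by rewrite (h (fun i => B i))//; apply: eq_bigr => i _; rewrite EFin_pr.
Qed.

Lemma indepN_le (X : nat -> Omega -> R) (N M : nat) :
  (forall i, measurable_fun setT (X i)) -> (M <= N)%N ->
  indepN X N -> indepN X M.
Proof.
move=> mX MN h B mB; pose B' i := if (i < M)%N then B i else setT.
have mB' i : measurable (B' i) by rewrite /B'; case: ifP.
have := h B' mB'; rewrite -(subnKC MN) big_split_ord/= [X in _ * X]big1 ?mulr1.
  rewrite (_ : \bigcap_(i in `I_(M + (N - M))) _ = \bigcap_(i in `I_M) (X i @^-1` B i)).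
    by move=> ->; apply: eq_bigr => i _; rewrite /B' ltn_ord.
  apply/seteqP; split=> w hw i /= iM.
    by have := hw i; rewrite /B' iM /=; apply; rewrite ltn_addr.
  by rewrite /B'; case: ifP => // ?; exact: hw.
by move=> i _; rewrite /B' ifN ?preimage_setT ?pr_setT// -leqNgt leq_addr.
Qed.

(** A pi-system generating the sigma-algebra of the variables [X j] with j < N and j in [J]. *)
Definition cylinders (X : nat -> Omega -> R) (N : nat) (J : pred nat) :
    set (set Omega) :=
  [set A | exists B : nat -> set R, [/\ forall j, measurable (B j),
     forall j, ~~ J j -> B j = setT & A = \bigcap_(j in `I_N) (X j @^-1` B j)]].

Lemma cylinders_setI X N J : setI_closed (cylinders X N J).
Proof.
move=> _ _ [B [mB BJ ->]] [C [mC CJ ->]]; exists (fun j => B j `&` C j); split.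
- by move=> j; exact: measurableI.
- by move=> j Jj; rewrite BJ// CJ// setIT.
- by rewrite -bigcapI.
Qed.

Lemma cylinders_setT X N J : cylinders X N J setT.
Proof. by exists (fun=> setT); split=> //; apply/seteqP; split. Qed.

Lemma cylinders_preimage X N (J : pred nat) j B : measurable B -> (j < N)%N -> J j ->
  cylinders X N J (X j @^-1` B).
Proof.
move=> mB jN Jj; exists (fun i => if i == j then B else setT); split.
- by move=> i; case: ifP.
- by move=> i; case: eqVneq => // -> /negP.
- apply/seteqP; split=> w; last by move/(_ j jN); rewrite eqxx.
  by move=> hw i _; case: eqVneq => // ->.
Qed.

Lemma measurable_cylinders X N (J : pred nat) j : (j < N)%N -> J j ->
  measurable_fun [set: g_sigma_algebraType (cylinders X N J)]
    (X j : g_sigma_algebraType (cylinders X N J) -> R).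
Proof.
move=> jN Jj _ B mB; rewrite setTI; apply: sub_sigma_algebra.
exact: cylinders_preimage.
Qed.

(** On generators both sides are double products over blocks and coordinates. Coordinate [j]
    contributes a factor other than 1 only in its own block [kap j], so exchanging the products
    gives the formula. *)
Lemma block_indep (X : nat -> Omega -> R) (N : nat) (kap : nat -> nat) (m : nat)
    (A : nat -> set Omega) :
  (forall i, measurable_fun setT (X i)) -> indepN X N ->
  (forall j, (j < N)%N -> (kap j < m)%N) ->
  (forall i, <<s cylinders X N (fun j => kap j == i)>> (A i)) ->
  pr (\bigcap_(i in `I_m) A i) = \prod_(i < m) pr (A i).
Proof.
move=> mX iX kapm hA.
apply: (@pi_indep m (fun i => cylinders X N (fun j => kap j == i))) => //.
- by move=> i; exact: cylinders_setI.
- by move=> i; exact: cylinders_setT.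
- move=> i _ [B [mB _ ->]]; apply: bigcap_measurableType => j _.
  exact: measurable_preimageT.
move=> {hA}A hA; have [B hB] := choice hA.
rewrite (_ : \bigcap_(i in _) _ = \bigcap_(j in `I_N) (X j @^-1` B (kap j) j)).
  rewrite iX; last by move=> j; have [] := hB (kap j).
  transitivity (\prod_(i < m) \prod_(j < N) pr (X j @^-1` B i j)); last first.
    by apply: eq_bigr => i _; have [mB _ ->] := hB i; rewrite iX.
  rewrite exchange_big/=; apply: eq_bigr => j _.
  have kj := kapm j (ltn_ord j).
  rewrite (bigD1 (Ordinal kj))//= big1 ?mulr1// => i ik.
  have [_ -> //] := hB i; first by rewrite preimage_setT pr_setT.
  by apply: contra ik => /eqP ik; apply/eqP/val_inj.
apply/seteqP; split=> w hw.
  move=> j /= jN; have := hw (kap j) (kapm _ jN); have [_ _ ->] := hB (kap j).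
  exact.
move=> i /= im; have [_ BT ->] := hB i => j /= jN.
have [<-|ne] := eqVneq (kap j) i; first exact: hw.
by rewrite BT.
Qed.

Lemma block_indepN (X Y : nat -> Omega -> R) (N : nat) (kap : nat -> nat) (m : nat) :
  (forall i, measurable_fun setT (X i)) -> indepN X N ->
  (forall j, (j < N)%N -> (kap j < m)%N) ->
  (forall i, measurable_fun
    [set: g_sigma_algebraType (cylinders X N (fun j => kap j == i))]
    (Y i : g_sigma_algebraType (cylinders X N (fun j => kap j == i)) -> R)) ->
  indepN Y m.
Proof.
move=> mX iX kapm mY B mB.
apply: (@block_indep X N kap m (fun i => Y i @^-1` B i)) => // i.
rewrite -[X in <<s _ >> X]setTI.
exact: mY (B i) (mB i).
Qed.

Lemma indepN_block_sum (X : nat -> Omega -> R) (N : nat) (kap : nat -> nat) (m : nat) :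
  (forall i, measurable_fun setT (X i)) -> indepN X N ->
  (forall j, (j < N)%N -> (kap j < m)%N) ->
  indepN (fun i w => \sum_(j < N) (if kap j == i then X j w else 0)) m.
Proof.
move=> mX iX kapm; apply: (block_indepN mX iX kapm) => i.
apply: measurable_sum => j; case E : (kap j == i); last exact: measurable_cst.
exact: (@measurable_cylinders X N (fun j => kap j == i)).
Qed.

Lemma cvg_prod_ord (N : nat) (f : nat -> nat -> R) (l : nat -> R) :
  (forall i, (i < N)%N -> f n i @[n --> \oo] --> l i) ->
  \prod_(i < N) f n i @[n --> \oo] --> \prod_(i < N) l i.
Proof.
elim: N => [|N ih] h.
  by under eq_cvg do rewrite big_ord0; rewrite big_ord0; exact: cvg_cst.
under eq_cvg do rewrite big_ord_recr/=; rewrite big_ord_recr/=.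
by apply: cvgM; [apply: ih => i iN; apply: h; exact: ltnW|exact: h].
Qed.

Lemma cvg_sum_ord (N : nat) (f : nat -> nat -> R) (l : nat -> R) :
  (forall i, (i < N)%N -> f n i @[n --> \oo] --> l i) ->
  \sum_(i < N) f n i @[n --> \oo] --> \sum_(i < N) l i.
Proof.
elim: N => [|N ih] h.
  by under eq_cvg do rewrite big_ord0; rewrite big_ord0; exact: cvg_cst.
under eq_cvg do rewrite big_ord_recr/=; rewrite big_ord_recr/=.
by apply: cvgD; [apply: ih => i iN; apply: h; exact: ltnW|exact: h].
Qed.

Lemma cvg_pr_bigcap (N : nat) (F : nat -> nat -> set Omega) :
  (forall n i, measurable (F n i)) ->
  (forall n m i, (n <= m)%N -> F n i `<=` F m i) ->
  pr (\bigcap_(i in `I_N) F n i) @[n --> \oo] -->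
    pr (\bigcap_(i in `I_N) \bigcup_n F n i).
Proof.
move=> mF ndF.
rewrite (_ : \bigcap_(i in _) _ = \bigcup_n \bigcap_(i in `I_N) F n i).
  apply: cvg_pr_bigcup => [n|n m nm w hw i iN].
    exact: bigcap_measurableType.
  exact: ndF nm _ (hw i iN).
apply/seteqP; split=> w; last first.
  by move=> [n _ hw] i iN; exists n => //; exact: hw.
elim: N => [_|N ih hw]; first by exists 0%N.
have [n _ hn] := ih (fun i iN => hw i (ltnW iN)).
have [m _ hm] := hw N (ltnSn N).
exists (maxn n m) => // i; rewrite /= ltnS leq_eqVlt => /orP[/eqP->|iN].
  by apply: ndF hm; exact: leq_maxr.
by apply: ndF (hn i iN); exact: leq_maxl.
Qed.

Lemma measurable_ray (X : Omega -> R) (x : R) :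
  measurable_fun setT X -> measurable (X @^-1` `]-oo, x[).
Proof. by move=> mX; exact: measurable_preimageT. Qed.

(** Open rays together with the whole line form a pi-system. The whole line is an increasing union
    of rays, so the product formula reaches it by continuity from below. *)
Lemma indepN_rays (X : nat -> Omega -> R) (N : nat) :
  (forall i, measurable_fun setT (X i)) ->
  (forall x : nat -> R, pr (\bigcap_(i in `I_N) (X i @^-1` `]-oo, x i[)) =
     \prod_(i < N) pr (X i @^-1` `]-oo, x i[)) ->
  indepN X N.
Proof.
move=> mX h.
pose G i := [set A | A = setT \/ exists x : R, A = X i @^-1` `]-oo, x[].
have mG i A : G i A -> measurable A.
  by move=> [->//|[x ->]]; exact: measurable_ray.
have GI i : setI_closed (G i).
  move=> A B [->|[x ->]]; first by rewrite setTI.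
  move=> [->|[y ->]]; first by rewrite setIT; right; exists x.
  right; exists (Num.min x y); apply/seteqP; split=> w /=; rewrite !in_itv/=.
    by case=> ? ?; rewrite lt_min; apply/andP.
  by rewrite lt_min => /andP[].
have GP A : (forall i, G i (A i)) ->
    pr (\bigcap_(i in `I_N) A i) = \prod_(i < N) pr (A i).
  move=> GA.
  have ey i : exists z : nat -> R, (forall n m, (n <= m)%N -> z n <= z m) /\
      A i = \bigcup_n (X i @^-1` `]-oo, z n[).
    case: (GA i) => [->|[x ->]].
      exists (fun n => n%:R); split; first by move=> n m nm; rewrite ler_nat.
      apply/seteqP; split=> w // _; exists (Num.bound `|X i w|) => //=.
      by rewrite in_itv/= (le_lt_trans (ler_norm _))// archi_boundP.
    exists (fun=> x); split => //; apply/seteqP; split=> w.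
      by move=> hw; exists 0%N.
    by case.
  have [y hy] := choice ey.
  have sub i n m : (n <= m)%N -> X i @^-1` `]-oo, y i n[ `<=` X i @^-1` `]-oo, y i m[.
    move=> nm w /=; rewrite !in_itv/= => /lt_le_trans; apply.
    exact: (hy i).1.
  have c1 := @cvg_pr_bigcap N (fun n i => X i @^-1` `]-oo, y i n[)
    (fun n i => measurable_ray _ (mX i)) (fun n m i => @sub i n m).
  have c2 : \prod_(i < N) pr (X i @^-1` `]-oo, y i n[) @[n --> \oo] -->
      \prod_(i < N) pr (A i).
    apply: (@cvg_prod_ord N (fun n i => pr (X i @^-1` `]-oo, y i n[))
      (fun i => pr (A i))) => i _; rewrite (hy i).2.
    apply: cvg_pr_bigcup => [n|]; first exact: measurable_ray.
    exact: sub.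
  rewrite (@eq_bigcapr _ _ _ _ (fun i => \bigcup_n (X i @^-1` `]-oo, y i n[))).
    apply: (cvg_unique _ c1) => //.
    by rewrite /=; under eq_fun do rewrite h.
  by move=> i _; rewrite (hy i).2.
move=> B mB; apply: (@pi_indep N G GI _ mG GP (fun i => X i @^-1` B i)).
  by left.
move=> i.
have mXi : measurable_fun [set: g_sigma_algebraType (G i)]
    (X i : g_sigma_algebraType (G i) -> R).
  apply: (@measurability _ _ (g_sigma_algebraType (G i)) R setT (X i)
    (@RGenInftyO.G R)).
    exact: RGenInftyO.measurableE.
  move=> _ [_ [x ->] <-]; rewrite setTI; apply: sub_sigma_algebra.
  by right; exists x.
rewrite -[X in <<s _ >> X]setTI.
exact: mXi (B i) (mB i).
Qed.

Lemma ray_bigcup (X : Omega -> R) (x : R) :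
  X @^-1` `]-oo, x[ = \bigcup_n (X @^-1` `]-oo, x - n.+1%:R^-1[).
Proof.
apply/seteqP; split=> w /=; last first.
  move=> [n _] /=; rewrite !in_itv/= => /lt_trans; apply.
  by rewrite ltrBlDr ltrDl invr_gt0 ltr0n.
rewrite in_itv/= => h; have e0 : 0 < x - X w by rewrite subr_gt0.
have [n _ /(_ n (leqnn n))] := near_infty_natSinv_lt (PosNum e0).
move=> /= hn; exists n => //=; rewrite in_itv/=.
by rewrite ltrBrDr -ltrBrDl.
Qed.

(** Joint distribution functions are compared at shifted levels: outside the event of a deviation by
    at least [e], lying below s - e for one family implies lying below s for the other. First [n]
    tends to infinity with [e] fixed, then [e] tends to 0, where open rays provide left
    continuity. *)
Lemma indepN_pd_limit (Xn : nat -> nat -> Omega -> R) (X : nat -> Omega -> R)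
    (N : nat) :
  (forall n i, measurable_fun setT (Xn n i)) ->
  (forall i, measurable_fun setT (X i)) ->
  (forall n, indepN (Xn n) N) ->
  (forall i, (i < N)%N -> pd P (Xn n i) (X i) @[n --> \oo] --> 0) ->
  indepN X N.
Proof.
move=> mXn mX iXn cX; apply: indepN_rays => // x.
pose ray (Y : nat -> Omega -> R) (s : R) i := Y i @^-1` `]-oo, x i + s[.
have mray Y s i : measurable_fun setT (Y i) -> measurable (ray Y s i).
  by move=> ?; exact: measurable_ray.
pose H Y s := pr (\bigcap_(i in `I_N) ray Y s i).
pose F Y s := \prod_(i < N) pr (ray Y s i).
pose del n e i := pr [set w | e <= `|Xn n i w - X i w|].
have mdel n e i : measurable [set w | e <= `|Xn n i w - X i w|].
  exact: measurable_dist_ge.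
have mcap Y s : (forall i, measurable_fun setT (Y i)) ->
    measurable (\bigcap_(i in `I_N) ray Y s i).
  by move=> ?; apply: bigcap_measurableType => i _; exact: mray.
have mcup n e : measurable (\big[setU/set0]_(i < N) [set w | e <= `|Xn n i w - X i w|]).
  by apply: bigsetU_measurable.
have cupN n e : pr (\big[setU/set0]_(i < N) [set w | e <= `|Xn n i w - X i w|]) <=
    \sum_(i < N) del n e i.
  exact: (@pr_bigsetU_le N (fun i => [set w | e <= `|Xn n i w - X i w|])).
have cdel e : 0 < e -> \sum_(i < N) del n e i @[n --> \oo] --> (0 : R).
  move=> e0; rewrite -[X in _ --> X](_ : \sum_(i < N) 0 = 0 :> R); last by rewrite big1.
  apply: (@cvg_sum_ord N (fun n => del n e) (fun=> 0)) => i iN.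
  have /cvg_in_probability_pd := cX i iN.
  by move=> /(_ (fun n => mXn n i) (mX i)) /(_ e e0) /fine_cvgP[].
have cdel1 e i : 0 < e -> (i < N)%N -> del n e i @[n --> \oo] --> (0 : R).
  move=> e0 iN; have /cvg_in_probability_pd := cX i iN.
  by move=> /(_ (fun n => mXn n i) (mX i)) /(_ e e0) /fine_cvgP[].
have step (Y Z : nat -> Omega -> R) n s e : 0 < e ->
    (forall i, measurable_fun setT (Y i)) -> (forall i, measurable_fun setT (Z i)) ->
    (forall i w, `|Y i w - Z i w| = `|Xn n i w - X i w|) ->
    H Y (s - e) <= H Z s + \sum_(i < N) del n e i.
  move=> e0 mY mZ YZ; apply: le_trans (_ : pr ((\bigcap_(i in `I_N) ray Z s i) `|`
      \big[setU/set0]_(i < N) [set w | e <= `|Xn n i w - X i w|]) <= _); last first.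
    by apply: le_trans (prU_le (mcap _ _ mZ) (mcup n e)) _; rewrite lerD2l.
  apply: le_pr; [exact: mcap|by apply: measurableU; [exact: mcap|exact: mcup]|].
  move=> w hw.
  case: (pselect (exists i : 'I_N, e <= `|Xn n i w - X i w|)) => [[i hi]|ne].
    by right; rewrite -(bigcup_mkord N (fun i => [set w | e <= `|Xn n i w - X i w|])); exists i => //=.
  left=> i /= iN; have := hw i iN; rewrite /ray /= !in_itv/= => hYi.
  have : ~ e <= `|Xn n i w - X i w| by move=> h; apply: ne; exists (Ordinal iN).
  rewrite -YZ; move/negP; rewrite -ltNge ltr_norml => /andP[h1 h2]; lra.
have step1 (Y Z : nat -> Omega -> R) n s e i : 0 < e ->
    (forall i, measurable_fun setT (Y i)) -> (forall i, measurable_fun setT (Z i)) ->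
    (forall i w, `|Y i w - Z i w| = `|Xn n i w - X i w|) ->
    pr (ray Y (s - e) i) <= pr (ray Z s i) + del n e i.
  move=> e0 mY mZ YZ; apply: le_trans (_ : pr (ray Z s i `|`
      [set w | e <= `|Xn n i w - X i w|]) <= _); last first.
    by apply: prU_le; [exact: mray|exact: mdel].
  apply: le_pr; [exact: mray|by apply: measurableU; [exact: mray|exact: mdel]|].
  move=> w; rewrite /ray /= !in_itv/= => hYi.
  case: (leP e `|Xn n i w - X i w|) => [|]; first by right.
  by rewrite -YZ ltr_norml => /andP[h1 h2]; left; lra.
have HF n s : H (Xn n) s = F (Xn n) s.
  by apply: iXn => i; exact: measurable_itv.
have dXX n i w : `|X i w - Xn n i w| = `|Xn n i w - X i w| by rewrite distrC.
have prodle (a b : nat -> R) : (forall i, 0 <= a i <= b i) ->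
    \prod_(i < N) a i <= \prod_(i < N) b i.
  by move=> ab; apply: ler_prod => i _; exact: ab.
have upper s e : 0 < e -> H X (s - e - e) <= F X s.
  move=> e0.
  have hn n : H X (s - e - e) <=
      \prod_(i < N) (pr (ray X s i) + del n e i) + \sum_(i < N) del n e i.
    apply: le_trans (step X (Xn n) n (s - e) e e0 mX (mXn n) (dXX n)) _.
    rewrite lerD2r HF; apply: (prodle (fun i => pr (ray (Xn n) (s - e) i))
      (fun i => pr (ray X s i) + del n e i)) => i.
    rewrite pr_ge0/=; exact: (step1 (Xn n) X n s e i).
  have c : \prod_(i < N) (pr (ray X s i) + del n e i) + \sum_(i < N) del n e i
      @[n --> \oo] --> F X s + 0.
    apply: cvgD; last exact: cdel.
    apply: (@cvg_prod_ord N (fun n i => pr (ray X s i) + del n e i)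
      (fun i => pr (ray X s i))) => i iN.
    rewrite -[X in _ --> X]addr0; apply: cvgD; first exact: cvg_cst.
    exact: cdel1.
  rewrite addr0 in c.
  by apply: (cvgr_to_ge c); exact: nearW.
have lower s e : 0 < e -> F X (s - e - e) <= H X s.
  move=> e0.
  have hn n : F X (s - e - e) <= \prod_(i < N) (pr (ray (Xn n) (s - e) i) + del n e i).
    apply: (prodle (fun i => pr (ray X (s - e - e) i))
      (fun i => pr (ray (Xn n) (s - e) i) + del n e i)) => i; rewrite pr_ge0/=.
    exact: (step1 X (Xn n)).
  (* All factors are probabilities, so adding [del] to each of them changes the product by at most
     prod (1 + del) - 1. *)
  have diff n : `|\prod_(i < N) (pr (ray (Xn n) (s - e) i) + del n e i) - F (Xn n) (s - e)|
      <= \prod_(i < N) (1 + del n e i) - 1.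
    rewrite /F; elim: (N) => [|M ih]; first by rewrite !big_ord0 subrr normr0.
    rewrite !big_ord_recr/=.
    set C := \prod_(i < M) (1 + _) in ih *.
    set A := \prod_(i < M) (_ + _) in ih *; set B := \prod_(i < M) pr _ in ih *.
    have p0 := pr_ge0 (ray (Xn n) (s - e) M).
    have p1 : pr (ray (Xn n) (s - e) M) <= 1 by apply: pr_le1; exact: mray.
    have d0 : 0 <= del n e M by exact: pr_ge0.
    have A0 : 0 <= A by apply: prodr_ge0 => i _; rewrite addr_ge0// pr_ge0.
    have AC : A <= C.
      apply: ler_prod => i _; rewrite addr_ge0 ?pr_ge0//= lerD2r.
      by apply: pr_le1; exact: mray.
    have -> : A * (pr (ray (Xn n) (s - e) M) + del n e M) -
        B * pr (ray (Xn n) (s - e) M) =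
        (A - B) * pr (ray (Xn n) (s - e) M) + A * del n e M by ring.
    apply: le_trans (ler_normD _ _) _; rewrite !normrM.
    rewrite (ger0_norm p0) (ger0_norm d0) (ger0_norm A0).
    have h1 : `|A - B| * pr (ray (Xn n) (s - e) M) <= C - 1.
      by apply: le_trans ih; rewrite ler_piMr.
    have h2 : A * del n e M <= C * del n e M by rewrite ler_wpM2r.
    lra.
  have hn' n : F X (s - e - e) <=
      H X s + \sum_(i < N) del n e i + (\prod_(i < N) (1 + del n e i) - 1).
    have h1 := step (Xn n) X n s e e0 (mXn n) mX (fun _ _ => erefl).
    rewrite HF in h1; have := hn n; have := diff n; rewrite ler_norml => /andP[_]; lra.
  have c : H X s + \sum_(i < N) del n e i + (\prod_(i < N) (1 + del n e i) - 1)
      @[n --> \oo] --> H X s + 0 + (\prod_(i < N) (1 + 0) - 1).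
    apply: cvgD; first by apply: cvgD; [exact: cvg_cst|exact: cdel].
    apply: cvgB; last exact: cvg_cst.
    apply: (@cvg_prod_ord N (fun n i => 1 + del n e i) (fun=> 1 + 0)) => i iN.
    apply: cvgD; [exact: cvg_cst|exact: cdel1].
  have e1 : \prod_(i < N) (1 + 0 : R) = 1 by rewrite big1// => i _; rewrite addr0.
  rewrite e1 subrr !addr0 in c.
  by apply: (cvgr_to_ge c); exact: nearW.
have cF : F X (- n.+1%:R^-1) @[n --> \oo] --> F X 0.
  apply: (@cvg_prod_ord N (fun n i => pr (ray X (- n.+1%:R^-1) i))
    (fun i => pr (ray X 0 i))) => i iN.
  rewrite /ray addr0 ray_bigcup; apply: cvg_pr_bigcup => [n|n m nm w].
    exact: measurable_ray.
  rewrite /= !in_itv/= => /lt_le_trans; apply; rewrite lerD2l lerN2.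
  by rewrite lef_pV2 ?posrE ?ltr0n// ler_nat ltnS.
have cH : H X (- n.+1%:R^-1) @[n --> \oo] --> H X 0.
  rewrite {2}/H /ray.
  under [X in _ --> pr X]eq_bigcapr do rewrite addr0 ray_bigcup.
  apply: (@cvg_pr_bigcap N (fun n i => ray X (- n.+1%:R^-1) i)) => [n i|n m i nm w].
    exact: measurable_ray.
  rewrite /ray /= !in_itv/= => /lt_le_trans; apply; rewrite lerD2l lerN2.
  by rewrite lef_pV2 ?posrE ?ltr0n// ler_nat ltnS.
(* Passing from the limit to the approximants and back uses one shift each, hence the two halves. *)
have half (n : nat) : (- n.+1%:R^-1 : R) = 0 - (n.+1%:R^-1 / 2) - (n.+1%:R^-1 / 2).
  by move: (n.+1%:R^-1 : R) => t; lra.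
have halfp (n : nat) : 0 < (n.+1%:R^-1 / 2 : R) by rewrite divr_gt0 ?invr_gt0.
suff : H X 0 = F X 0.
  rewrite /H /F /ray; under eq_bigcapr do rewrite addr0.
  by under [in RHS]eq_bigr do rewrite addr0.
apply/eqP; rewrite eq_le; apply/andP; split.
  apply: (cvgr_to_le cH); apply: nearW => n; rewrite half; exact: upper.
apply: (cvgr_to_le cF); apply: nearW => n; rewrite half; exact: lower.
Qed.

Lemma block_indep2 (X : nat -> Omega -> R) (N k : nat) (A B : set Omega) :
  (forall i, measurable_fun setT (X i)) -> indepN X N ->
  <<s cylinders X N (fun j => (j < k)%N)>> A ->
  <<s cylinders X N (fun j => (k <= j)%N)>> B ->
  pr (A `&` B) = pr A * pr B.
Proof.
move=> mX iX sA sB.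
have := @block_indep X N (fun j => (k <= j)%N : nat) 2 (nth setT [:: A; B]) mX iX.
rewrite !big_ord_recr big_ord0/= mul1r => <-.
- congr pr; apply/seteqP; split=> w.
    by move=> [Aw Bw] [|[|]].
  by move=> h; split; [exact: (h 0%N isT)|exact: (h 1%N isT)].
- by move=> j _; case: (k <= j)%N.
- case=> [|[|i]]/=.
  + rewrite (_ : (fun j => _) = (fun j => (j < k)%N))//.
    by apply/funext => j; rewrite ltnNge; case: (k <= j)%N.
  + rewrite (_ : (fun j => _) = (fun j => (k <= j)%N))//.
    by apply/funext => j; case: (k <= j)%N.
  + rewrite nth_nil; apply: sub_sigma_algebra; exact: cylinders_setT.
Qed.

Lemma pr_bigsetU (N : nat) (A : nat -> set Omega) :
  (forall i, measurable (A i)) -> trivIset setT A ->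
  pr (\big[setU/set0]_(i < N) A i) = \sum_(i < N) pr (A i).
Proof.
move=> mA tA; elim: N => [|N ih]; first by rewrite !big_ord0 pr_set0.
rewrite !big_ord_recr/= prU ?ih//; first exact: bigsetU_measurable.
apply/seteqP; split=> w //; rewrite -bigcup_mkord => -[[i /= iN Aiw] ANw].
move/trivIsetP : tA => /(_ i N I I); rewrite (ltn_eqF iN) => /(_ isT) h.
by have : (A i `&` A N) w by []; rewrite h.
Qed.

(** Ottaviani's inequality. Split according to the first index [k] at which the partial sum reaches
    2 e. The remainder from [k] on is independent of this event and smaller than [e] with
    probability at least 1/2, and then the full sum is at least [e]. *)
Lemma ottaviani (X : nat -> Omega -> R) (m n : nat) (e : R) :
  (forall i, measurable_fun setT (X i)) -> indepN X n -> (m <= n)%N -> 0 < e ->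
  (forall k, (m <= k <= n)%N ->
     pr [set w | e <= `|\sum_(k <= i < n) X i w|] <= 2^-1) ->
  pr (\big[setU/set0]_(k < n.+1) (if (m <= k)%N
        then [set w | e + e <= `|\sum_(m <= i < k) X i w|] else set0)) <=
    2 * pr [set w | e <= `|\sum_(m <= i < n) X i w|].
Proof.
move=> mX iX mn e0 half.
pose F k := if (m <= k)%N
  then [set w | e + e <= `|\sum_(m <= i < k) X i w|] else set0.
have mF k : measurable (F k).
  rewrite /F; case: ifP => // _; apply: measurable_norm_ge.
  by apply: measurable_sum_nat => i _.
pose E := seqDU F.
have mE k : measurable (E k) by apply: seqDU_measurable.
have tE : trivIset setT E by exact: trivIset_seqDU.
pose Q k := [set w | e <= `|\sum_(k <= i < n) X i w|].
have mQ k : measurable (Q k).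
  by apply: measurable_norm_ge; apply: measurable_sum_nat.
(* [E k] depends on the terms before [k] only, and [Q k] on the terms from [k] on. *)
have indEQ k : (m <= k <= n)%N -> pr (E k `&` ~` Q k) = pr (E k) * pr (~` Q k).
  move=> /andP[mk kn]; apply: (@block_indep2 X n k) => //.
    pose S := g_sigma_algebraType (cylinders X n (fun j => (j < k)%N)).
    have mFS j : (j <= k)%N -> measurable (F j : set S).
      move=> jk; rewrite /F; case: ifP => // _.
      apply: (@measurable_norm_ge _ S).
      apply: (@measurable_sum_nat _ S) => i /andP[_ ij].
      apply: (@measurable_cylinders X n (fun j => (j < k)%N)).
        by rewrite (leq_trans ij)// (leq_trans jk).
      by rewrite (leq_trans ij).
    rewrite /E /seqDU; apply: (@measurableD _ S); first exact: mFS.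
    apply: (@bigsetU_measurable _ S) => i _; apply: mFS; exact: ltnW.
  pose S := g_sigma_algebraType (cylinders X n (fun j => (k <= j)%N)).
  apply: (@measurableC _ S); apply: (@measurable_norm_ge _ S).
  apply: (@measurable_sum_nat _ S) => i /andP[ki iN].
  exact: (@measurable_cylinders X n (fun j => (k <= j)%N)).
have hk k : (k < n.+1)%N -> pr (E k) <= 2 * pr (E k `&` ~` Q k).
  rewrite ltnS => kn; have [mk|km] := leqP m k; last first.
    have -> : E k = set0 by rewrite /E /seqDU /F leqNgt km set0D.
    by rewrite set0I pr_set0 mulr0.
  rewrite indEQ ?mk// prC//.
  have h := half k; rewrite mk kn in h; have {}h := h isT.
  have := pr_ge0 (E k); rewrite -[pr [set _ | _]]/(pr (Q k)) in h; nra.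
have -> : \big[setU/set0]_(k < n.+1) (if (m <= k)%N
    then [set w | e + e <= `|\sum_(m <= i < k) X i w|] else set0) =
    \big[setU/set0]_(k < n.+1) E k by exact: (bigsetU_seqDU F n.+1).
rewrite pr_bigsetU//.
apply: (@le_trans _ _ (\sum_(k < n.+1) 2 * pr (E k `&` ~` Q k))).
  by apply: ler_sum => k _; exact: hk.
rewrite -mulr_sumr ler_wpM2l//.
rewrite -(@pr_bigsetU n.+1 (fun k => E k `&` ~` Q k)).
- apply: le_pr; first by apply: bigsetU_measurable => i _; apply: measurableI => //; exact: measurableC.
    exact: mQ.
  move=> w; rewrite -(bigcup_mkord n.+1 (fun k => E k `&` ~` Q k)) => -[k /= kn].
  rewrite ltnS in kn.
  move=> [Ek]; have := subset_seqDU Ek; rewrite /F /Q; case: ifPn => //= mk h.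
  move=> /negP; rewrite -ltNge => h'.
  have := @big_cat_nat _ _ _ k m n xpredT (fun i => X i w) mk kn.
  move=> ->; move: h h'; set a := \sum_(_ <= _ < _) _; set b := \sum_(_ <= _ < _) _.
  move=> h h'; have := ler_normB (a + b) b; rewrite addrK; lra.
- by move=> i; apply: measurableI => //; exact: measurableC.
- apply/trivIsetP => a b _ _ ab.
  by move/trivIsetP : tE => /(_ a b I I ab); rewrite setIACA => ->; rewrite set0I.
Qed.

(** Levy's equivalence theorem: independence upgrades convergence in probability to almost sure
    convergence. The almost sure limit is identified with [Y] along a subsequence. *)
Lemma indep_series_ae_cvg (X : nat -> Omega -> R) (Y : Omega -> R) :
  (forall i, measurable_fun setT (X i)) -> (forall N, indepN X N) ->
  measurable_fun setT Y ->
  pd P (fun w => \sum_(0 <= i < n) X i w) Y @[n --> \oo] --> 0 ->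
  {ae P, forall w, \sum_(0 <= i < n) X i w @[n --> \oo] --> Y w}.
Proof.
move=> mX iX mY c.
have mS n : measurable_fun setT (fun w => \sum_(0 <= i < n) X i w).
  by apply: measurable_sum_nat.
have tail (e r : R) : 0 < e -> 0 < r -> exists M, forall m n, (M <= m)%N -> (m <= n)%N ->
    pr [set w | e <= `|\sum_(m <= i < n) X i w|] <= r.
  move=> e0 r0.
  pose e1 := Num.min e 1; have e10 : 0 < e1 by rewrite lt_min e0 ltr01.
  have e11 : e1 <= 1 by rewrite ge_min lexx orbT.
  have er : 0 < e1 * r / 2 by rewrite divr_gt0// mulr_gt0.
  have /cvgrPdist_le/(_ _ er)[M _ hM] := c.
  exists M => m n Mm mn.
  have := hM m Mm; have := hM n (leq_trans Mm mn).
  rewrite /= !sub0r !normrN !ger0_norm ?pd_ge0// => h1 h2.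
  have h3 := pd_triangle P (mS n) mY (mS m).
  have := pd_markov P (mS n) (mS m) e10 e11.
  rewrite (pdC P Y) in h3; rewrite -/(pr _) => h4.
  have h5 : e1 * pr [set w | e1 <= `|\sum_(0 <= i < n) X i w - \sum_(0 <= i < m) X i w|]
      <= e1 * r by lra.
  rewrite ler_pM2l// in h5; apply: le_trans h5; apply: le_pr.
  - by apply: measurable_norm_ge; apply: measurable_sum_nat.
  - exact: measurable_dist_ge.
  - move=> w /= hw; rewrite (@big_cat_nat _ _ _ m 0%N n)//= addrAC subrr add0r.
    by apply: le_trans hw; rewrite ge_min lexx.
(* the maximal inequality makes the partial sums almost surely Cauchy *)
have null (e : R) : 0 < e -> {ae P, forall w, exists m, forall n, (m <= n)%N ->
    `|\sum_(m <= i < n) X i w| < e + e}.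
  move=> e0.
  pose B m n := \big[setU/set0]_(k < n.+1) (if (m <= k)%N
        then [set w | e + e <= `|\sum_(m <= i < k) X i w|] else set0).
  have mB m n : measurable (B m n).
    apply: bigsetU_measurable => k _; case: ifP => // _.
    by apply: measurable_norm_ge; apply: measurable_sum_nat.
  pose U m := \bigcup_n B m n.
  have mU m : measurable (U m) by exact: bigcupT_measurable.
  have BE m n : B m n = \bigcup_(k in `I_n.+1) (if (m <= k)%N
        then [set w | e + e <= `|\sum_(m <= i < k) X i w|] else set0).
    by rewrite bigcup_mkord.
  have Br r : 0 < r -> exists m, pr (U m) <= r.
    move=> r0; pose r1 := Num.min (r / 2) 2^-1.
    have r10 : 0 < r1 by rewrite lt_min divr_gt0//= invr_gt0.
    have [M hM] := tail e r1 e0 r10; exists M.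
    have cU : pr (B M n) @[n --> \oo] --> pr (U M).
      apply: cvg_pr_bigcup => // n n' nn'; rewrite !BE => w [k kn h].
      by exists k => //; exact: leq_trans kn _.
    apply: (cvgr_to_le cU); near=> n.
    have Mn : (M <= n)%N by near: n; exists M.
    apply: le_trans (ottaviani mX (iX n) Mn e0 _) _.
      move=> k /andP[Mk kn]; apply: le_trans (hM k n Mk kn) _.
      by rewrite ge_min lexx orbT.
    have := hM M n (leqnn M) Mn.
    have : r1 <= r / 2 by rewrite ge_min lexx.
    lra.
  exists (\bigcap_m U m); split.
  - exact: bigcapT_measurable.
  - apply/eqP; rewrite -EFin_pr; last exact: bigcapT_measurable.
    rewrite -[0%E]/(0%:E) eqe eq_le pr_ge0 andbT; apply/ler_addgt0Pl => r r0; rewrite addr0.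
    have [m hm] := Br r r0; apply: le_trans hm; apply: le_pr => //.
      exact: bigcapT_measurable.
    exact: bigcap_inf.
  - move=> w /= hw m _; apply: contrapT => hU; apply: hw; exists m => n mn.
    rewrite ltNge; apply/negP => h; apply: hU; exists n => //; rewrite BE.
    by exists n => //=; rewrite mn.
have cau : {ae P, forall w, forall j : nat, exists m, forall n, (m <= n)%N ->
    `|\sum_(m <= i < n) X i w| < j.+1%:R^-1 + j.+1%:R^-1}.
  by apply: ae_foralln => j; apply: null; rewrite invr_gt0 ltr0n.
have [f [nf cf]] := pd_cvg_subseq mS mY c.
apply: filterS2 cau cf => w hw hf.
have cvS : cvg (\sum_(0 <= i < n) X i w @[n --> \oo]).
  apply/cauchy_cvgP/cauchy_exP => e e0.
  have e4 : 0 < e / 4 by rewrite divr_gt0.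
  have [j _ /(_ j (leqnn j)) /= hj] := near_infty_natSinv_lt (PosNum e4).
  have [m hm] := hw j.
  exists (\sum_(0 <= i < m) X i w); exists m => // n /= mn.
  have := hm n mn; rewrite /ball/= (@big_cat_nat _ _ _ m 0%N n)//= opprD addrA subrr sub0r normrN.
  by move: hj => /=; move: (j.+1%:R^-1 : R) => t; lra.
have ff : f @ \oo --> \oo.
  by move=> A [N _ NA]; exists N => // n Nn; apply: NA; exact: leq_trans Nn (nf n).
have -> : Y w = lim (\sum_(0 <= i < n) X i w @[n --> \oo]) => //.
apply: (cvg_unique _ hf) => //.
exact: (cvg_comp f (fun n => \sum_(0 <= i < n) X i w) ff cvS).
Unshelve. all: by end_near. Qed.

Definition indep2 (X Y : Omega -> R) : Prop :=
  forall A B, measurable A -> measurable B ->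
    pr ((X @^-1` A) `&` (Y @^-1` B)) = pr (X @^-1` A) * pr (Y @^-1` B).

(** Independence says that the joint law is the product of the marginal laws; Fubini's theorem then
    separates the integrals. *)
Lemma indep2_expectation (X Y : Omega -> R) (f g : R -> R) (M : R) :
  measurable_fun setT X -> measurable_fun setT Y -> indep2 X Y ->
  measurable_fun setT f -> measurable_fun setT g ->
  (forall x, `|f x| <= M) -> (forall x, `|g x| <= M) ->
  \int[P]_w (f (X w) * g (Y w)) = (\int[P]_w f (X w)) * (\int[P]_w g (Y w)).
Proof.
move=> mX mY iXY mf mg fM gM.
have mXY : measurable_fun setT (fun w => (X w, Y w)) by exact: measurable_fun_pair.
pose X' : {mfun Omega >-> R} := mfun_Sub (mem_set mX).
pose Y' : {mfun Omega >-> R} := mfun_Sub (mem_set mY).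
pose XY' : {mfun Omega >-> (R * R)%type} := mfun_Sub (mem_set mXY).
pose QX : probability R R := distribution P X'.
pose QY : probability R R := distribution P Y'.
have QE Z : measurable Z -> (QX \x QY)%E Z = distribution P XY' Z.
  apply: product_measure_unique => A B mA mB.
  change (P ((X @^-1` A) `&` (Y @^-1` B)) = (P (X @^-1` A) * P (Y @^-1` B))%E).
  have mA' := measurable_preimageT mX mA; have mB' := measurable_preimageT mY mB.
  by rewrite -!EFin_pr ?iXY ?EFinM//; exact: measurableI.
have M0 : 0 <= M by apply: le_trans (fM 0).
pose h := EFin \o (fun z : R * R => f z.1 * g z.2).
have mh : measurable_fun setT h.
  apply/measurable_EFinP; apply: measurable_funM.
    by apply: measurableT_comp => //; exact: measurable_fst.
  by apply: measurableT_comp => //; exact: measurable_snd.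
have ib (Q : probability R R) (k : R -> R) : measurable_fun setT k ->
    (forall x, `|k x| <= M) -> Q.-integrable setT (EFin \o k).
  by move=> mk kM; exact: (bounded_measurable_integrable _ (M := M)).
have ih : P.-integrable setT (h \o XY').
  apply: (bounded_measurable_integrable _ (M := M * M)).
    apply: measurable_funM; exact: measurableT_comp.
  by move=> w; rewrite normrM ler_pM.
have ihp : (QX \x QY)%E.-integrable setT h.
  have : (distribution P XY').-integrable setT h.
    by apply: (@integrable_pushforward _ _ _ _ _ (fun w => (X w, Y w))).
  move/integrableP => [_ hfin]; apply/integrableP; split => //.
  rewrite (eq_measure_integral (distribution P XY'))//.
  by move=> Z mZ _; exact: QE.
have exp (Z : {mfun Omega >-> R}) (k : R -> R) : measurable_fun setT k ->
    (forall x, `|k x| <= M) ->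
    (\int[distribution P Z]_x (k x)%:E = (\int[P]_w k (Z w))%:E)%E.
  move=> mk kM; rewrite integral_distribution//.
  - rewrite /Rintegral fineK//; apply: integrable_fin_num => //.
    apply: (bounded_measurable_integrable _ (M := M)) => //.
    exact: measurableT_comp.
  - exact/measurable_EFinP.
  - apply: (bounded_measurable_integrable _ (M := M)) => //.
    exact: measurableT_comp.
apply: EFin_inj; rewrite EFinM.
transitivity (\int[QX \x QY]_z h z)%E.
  rewrite (eq_measure_integral (distribution P XY'))//; last by move=> Z mZ _; exact: QE.
  rewrite (@integral_distribution _ _ _ _ _ P XY')//.
  by rewrite /Rintegral fineK//; exact: (integrable_fin_num measurableT ih).
rewrite -integral12_prod_meas1//.
rewrite (eq_integral (fun x => (f x)%:E * (\int[P]_w g (Y w))%:E)%E); last first.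
  move=> x _; rewrite -[in RHS](exp Y' g)// -integralZl//; last exact: (ib QY).
rewrite -(exp X' f)// -integralZr//; exact: (ib QX).
Qed.

Lemma measurable_cos_comp (X : Omega -> R) (mu : R) : measurable_fun setT X ->
  measurable_fun setT (fun w => cos (mu * X w)).
Proof.
move=> mX; apply: (@measurableT_comp _ _ _ _ _ _ (@cos R)).
  by apply: continuous_measurable_fun; exact: continuous_cos.
exact: measurable_funM.
Qed.

Lemma measurable_sin_comp (X : Omega -> R) (mu : R) : measurable_fun setT X ->
  measurable_fun setT (fun w => sin (mu * X w)).
Proof.
move=> mX; apply: (@measurableT_comp _ _ _ _ _ _ (@sin R)).
  by apply: continuous_measurable_fun; exact: continuous_sin.
exact: measurable_funM.
Qed.

Lemma integrable_cos_comp (X : Omega -> R) (mu : R) : measurable_fun setT X ->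
  P.-integrable setT (EFin \o (fun w => cos (mu * X w))).
Proof.
move=> mX; apply: (bounded_measurable_integrable _ (M := 1)).
  exact: measurable_cos_comp.
by move=> w; exact: cos_max.
Qed.

Lemma indep2_cos_sin (X Y : Omega -> R) (mu : R) :
  measurable_fun setT X -> measurable_fun setT Y -> indep2 X Y ->
  \int[P]_w cos (mu * (X w + Y w)) =
    (\int[P]_w cos (mu * X w)) * (\int[P]_w cos (mu * Y w)) -
    (\int[P]_w sin (mu * X w)) * (\int[P]_w sin (mu * Y w)) /\
  \int[P]_w sin (mu * (X w + Y w)) =
    (\int[P]_w sin (mu * X w)) * (\int[P]_w cos (mu * Y w)) +
    (\int[P]_w cos (mu * X w)) * (\int[P]_w sin (mu * Y w)).
Proof.
move=> mX mY iXY.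
have mc : measurable_fun setT (fun x : R => cos (mu * x)).
  apply: (@measurableT_comp _ _ _ _ _ _ (@cos R)); last exact: measurable_funM.
  by apply: continuous_measurable_fun; exact: continuous_cos.
have ms : measurable_fun setT (fun x : R => sin (mu * x)).
  apply: (@measurableT_comp _ _ _ _ _ _ (@sin R)); last exact: measurable_funM.
  by apply: continuous_measurable_fun; exact: continuous_sin.
have c1 x : `|cos (mu * x)| <= 1 by exact: cos_max.
have s1 x : `|sin (mu * x)| <= 1 by exact: sin_max.
have E (f g : R -> R) (mf : measurable_fun setT f) (mg : measurable_fun setT g)
    (f1 : forall x, `|f x| <= 1) (g1 : forall x, `|g x| <= 1) :=
  @indep2_expectation X Y f g 1 mX mY iXY mf mg f1 g1.
have I (f g : R -> R) : measurable_fun setT f -> measurable_fun setT g ->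
    (forall x, `|f x| <= 1) -> (forall x, `|g x| <= 1) ->
    P.-integrable setT (EFin \o (fun w => f (X w) * g (Y w))).
  move=> mf mg f1 g1; apply: (bounded_measurable_integrable _ (M := 1)).
    apply: measurable_funM; exact: measurableT_comp.
  by move=> w; rewrite normrM -[leRHS]mulr1 ler_pM.
split.
  rewrite (@eq_Rintegral _ _ _ _ _ (fun w => cos (mu * X w) * cos (mu * Y w) -
      sin (mu * X w) * sin (mu * Y w))).
    rewrite RintegralB//; [|exact: (I (fun x => cos (mu * x)) (fun x => cos (mu * x)))
      |exact: (I (fun x => sin (mu * x)) (fun x => sin (mu * x)))].
    by rewrite (E _ _ mc mc c1 c1) (E _ _ ms ms s1 s1).
  by move=> w _; rewrite mulrDr cosD.
rewrite (@eq_Rintegral _ _ _ _ _ (fun w => sin (mu * X w) * cos (mu * Y w) +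
    cos (mu * X w) * sin (mu * Y w))).
  rewrite RintegralD//; [|exact: (I (fun x => sin (mu * x)) (fun x => cos (mu * x)))
    |exact: (I (fun x => cos (mu * x)) (fun x => sin (mu * x)))].
  by rewrite (E _ _ ms mc s1 c1) (E _ _ mc ms c1 s1).
by move=> w _; rewrite mulrDr sinD.
Qed.

(** With vanishing sine integrals the cross terms of the addition formulas drop out. Thus real
    cosine integrals multiply just as complex characteristic functions do. *)
Lemma indepN_cos_sin_sum (X : nat -> Omega -> R) (N : nat) (mu : R) :
  (forall i, measurable_fun setT (X i)) -> indepN X N ->
  (forall i, (i < N)%N -> \int[P]_w sin (mu * X i w) = 0) ->
  \int[P]_w cos (mu * \sum_(i < N) X i w) = \prod_(i < N) \int[P]_w cos (mu * X i w) /\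
  \int[P]_w sin (mu * \sum_(i < N) X i w) = 0.
Proof.
move=> mX; elim: N => [|N ih] iX sX.
  rewrite big_ord0; split.
    rewrite (@eq_Rintegral _ _ _ _ _ (fun=> 1)) ?Rintegral_probability_cst//.
    by move=> w _; rewrite big_ord0 mulr0 cos0.
  rewrite (@eq_Rintegral _ _ _ _ _ (fun=> 0)) ?Rintegral_probability_cst//.
  by move=> w _; rewrite big_ord0 mulr0 sin0.
have [ihc ihs] := ih (indepN_le mX (leqnSn N) iX) (fun i iN => sX i (ltnW iN)).
have iSX : indep2 (fun w => \sum_(i < N) X i w) (X N).
  move=> A B mA mB; apply: (@block_indep2 X N.+1 N) => //.
    pose S := g_sigma_algebraType (cylinders X N.+1 (fun j => (j < N)%N)).
    rewrite -[X in <<s _ >> X]setTI.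
    have : measurable_fun [set: S] (fun w : S => \sum_(i < N) X i w).
      apply: measurable_sum => i.
      by apply: (@measurable_cylinders X N.+1 (fun j => (j < N)%N)); rewrite // ltnS ltnW.
    by apply.
  rewrite -[X in <<s _ >> X]setTI.
  exact: (@measurable_cylinders X N.+1 (fun j => (N <= j)%N) N).
have mS : measurable_fun setT (fun w => \sum_(i < N) X i w) by exact: measurable_sum.
have := @indep2_cos_sin _ (X N) mu mS (mX N) iSX.
rewrite ihs ihc (sX N (ltnSn N)) !(mul0r,mulr0) subr0 addr0 => -[hc hs]; split.
  by rewrite big_ord_recr/= -hc; apply: eq_Rintegral => w _; rewrite big_ord_recr.
by rewrite -[RHS]hs; apply: eq_Rintegral => w _; rewrite big_ord_recr.
Qed.

End independence.

(** * Elementary bounds for sine and cosine *)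

Section trigonometric_bounds.
Context {R : realType}.
Implicit Types x y : R.

Lemma lipschitz_of_derive (f df : R -> R) x y :
  (forall z : R, is_derive z (1 : R) f (df z)) -> (forall z, `|df z| <= 1) ->
  `|f x - f y| <= `|x - y|.
Proof.
move=> fdf df1; wlog yx : x y / y <= x.
  by move=> H; have [/H//|/ltW/H] := leP y x; rewrite distrC (distrC x).
have [z _ ->] : exists2 z, z \in `[y, x] & f x - f y = df z * (x - y).
  apply: MVT_segment => //; apply: derivable_within_continuous => z _.
  by have [] := fdf z.
by rewrite normrM ler_piMl.
Qed.

Lemma cos_lipschitz x y : `|cos x - cos y| <= `|x - y|.
Proof.
apply: (@lipschitz_of_derive _ (fun z => - sin z)) => z.
by rewrite normrN sin_max.
Qed.

Lemma sin_lipschitz x y : `|sin x - sin y| <= `|x - y|.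
Proof. by apply: (@lipschitz_of_derive _ cos) => z; exact: cos_max. Qed.

Lemma norm_sin_le x : `|sin x| <= `|x|.
Proof. by have := sin_lipschitz x 0; rewrite sin0 !subr0. Qed.

Lemma cos_half x : cos x = 1 - 2 * sin (x / 2) ^+ 2.
Proof.
by rewrite {1}(splitr x) cosD -!expr2 cos2sin2; ring.
Qed.

Lemma cosB1_le x : 1 - cos x <= x ^+ 2 / 2.
Proof.
rewrite cos_half; have := norm_sin_le (x / 2).
rewrite -(@ler_pXn2r _ 2)// ?nnegrE// !real_normK ?num_real//; lra.
Qed.

End trigonometric_bounds.

(** * The characteristic exponent of a symmetric Levy process *)

Section levy_exponent.
Context {R : realType}.
Variables (a : R) (nu : {measure set R -> \bar R}).

(** This is minus the Levy-Khintchine exponent: for symmetric [nu] the compensator and the sine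
    integrate to 0, and the exponent is real. *)
Definition psi (mu : R) : R := a * mu ^+ 2 / 2 + \int[nu]_x (1 - cos (mu * x)).

Hypothesis a0 : 0 <= a.
Hypothesis nu_levy : levy_measure nu.
Hypothesis nu_sym : symmetric_measure nu.

Lemma measurable_cosM (mu : R) : measurable_fun [set: R] (fun x => cos (mu * x)).
Proof.
apply: (@measurableT_comp _ _ _ _ _ _ (@cos R)); last exact: measurable_funM.
by apply: continuous_measurable_fun; exact: continuous_cos.
Qed.

Lemma measurable_sinM (mu : R) : measurable_fun [set: R] (fun x => sin (mu * x)).
Proof.
apply: (@measurableT_comp _ _ _ _ _ _ (@sin R)); last exact: measurable_funM.
by apply: continuous_measurable_fun; exact: continuous_sin.
Qed.

Lemma integrable_1Bcos (mu : R) :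
  nu.-integrable setT (EFin \o (fun x => 1 - cos (mu * x))).
Proof.
have [_ hfin] := nu_levy.
(* The first summand serves x^2 < 1, where 1 - cos is quadratic; the second is the trivial bound
   elsewhere. *)
pose K := mu ^+ 2 / 2 + 2.
have K0 : 0 <= K by rewrite addr_ge0// divr_ge0// sqr_ge0.
have mmin : measurable_fun [set: R] (fun x : R => Num.min (x ^+ 2) 1).
  by apply: measurable_minr => //; exact: measurable_funX.
apply: (le_integrable measurableT (g := (EFin \o (fun x => K * Num.min (x ^+ 2) 1)))) => //.
- by apply/measurable_EFinP; apply: measurable_funB => //; exact: measurable_cosM.
- move=> x _ /=; rewrite lee_fin [leRHS]ger0_norm; last first.
    by rewrite mulr_ge0// le_min sqr_ge0 ler01.
  rewrite ger0_norm ?subr_ge0 ?cos_le1//.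
  have h1 := cosB1_le (mu * x); have h2 := cos_geN1 (mu * x).
  have x2 := sqr_ge0 x; have m2 := sqr_ge0 mu.
  rewrite exprMn in h1; rewrite /K /Num.min; case: ifPn => hx; last by lra.
  by nra.
- apply: integrable_EFinZl => //; apply/integrableP; split.
    exact/measurable_EFinP.
  rewrite (eq_integral (fun x : R => (Num.min (x ^+ 2) 1)%:E))//.
  by move=> x _; rewrite gee0_abs// lee_fin le_min sqr_ge0 ler01.
Qed.

Lemma psi_ge0 mu : 0 <= psi mu.
Proof.
rewrite /psi addr_ge0//; first by rewrite divr_ge0// mulr_ge0// sqr_ge0.
by apply: Rintegral_ge0 => x _; rewrite subr_ge0 cos_le1.
Qed.

Lemma psi0 : psi 0 = 0.
Proof.
rewrite /psi expr0n mulr0 mul0r add0r.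
rewrite (@eq_Rintegral _ _ _ _ _ (fun=> 0)); first by rewrite Rintegral_cst// mul0r.
by move=> x _; rewrite mul0r cos0 subrr.
Qed.

(** Reflection exchanges the positive and the negative part of [f]. If both integrals are infinite,
    the real-valued integral is 0 by convention. *)
Lemma symmetric_odd_Rintegral (f : R -> R) : measurable_fun setT f ->
  (forall x, f (- x) = - f x) -> \int[nu]_x f x = 0.
Proof.
move=> mf fodd; rewrite /Rintegral integralE.
set F := (fun x => (f x)%:E).
have mF : measurable_fun setT F by exact/measurable_EFinP.
have -> : (\int[nu]_x F^\- x = \int[nu]_x F^\+ x)%E.
  transitivity (\int[pushforward nu (-%R : R -> R)]_x F^\+ x)%E; last first.
    by apply: eq_measure_integral => A mA _ /=; exact: nu_sym.
  have mFp : measurable_fun [set: R] F^\+%E by exact: measurable_funepos.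
  rewrite [RHS]ge0_integral_pushforward//=.
  by apply: eq_integral => x _; rewrite funenegE funeposE /F /= fodd EFinN.
have : (0 <= \int[nu]_x F^\+ x)%E by apply: integral_ge0.
by case: (\int[nu]_x F^\+ x)%E => [r| |]//= _; rewrite subrr.
Qed.

Lemma Re_Psi mu : complex.Re (Psi a nu mu) = - psi mu.
Proof.
rewrite /Psi /Cintegral /=.
rewrite (@eq_Rintegral _ _ _ _ _ (fun x => -1 * (1 - cos (mu * x)))); last first.
  by move=> x _; rewrite /cexp /= expR0 mul1r; ring.
rewrite RintegralZl//; last exact: integrable_1Bcos.
by rewrite /psi; ring.
Qed.

Lemma measurable_tau : measurable_fun [set: R] (@tau R).
Proof.
rewrite (_ : @tau R = (fun x => Num.max (-1) (Num.min 1 x))).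
  by apply: measurable_maxr => //; exact: measurable_minr.
apply/funext => x; rewrite /tau; case: ifPn => [|].
  by rewrite ler_norml => /andP[? ?]; rewrite min_r// max_r.
rewrite -ltNge ltr_normr => /orP[h|h].
  by rewrite gtr0_norm ?divff ?gt_eqF// ?(lt_trans _ h)// min_l ?(ltW h)// max_r.
rewrite ltr0_norm; last by lra.
rewrite min_r; last by lra.
by rewrite max_l; [field; lra|lra].
Qed.

Lemma Im_Psi mu : complex.Im (Psi a nu mu) = 0.
Proof.
rewrite /Psi /Cintegral /=.
rewrite symmetric_odd_Rintegral ?oppr0 ?addr0//.
- rewrite /cexp /=.
  under eq_fun do rewrite expR0 mul1r.
  apply: measurable_funB; last by apply: measurable_funM => //; exact: measurable_tau.
  under eq_fun do rewrite addr0.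
  exact: measurable_sinM.
- move=> x; rewrite /cexp /= !expR0 !mul1r mulrN sinN /tau normrN.
  by case: ifP => _; ring.
Qed.

End levy_exponent.

(** * Characteristic functions of sums of increments *)

Section levy_increments.
Context d {Omega : measurableType d} {R : realType} (P : probability Omega R).

Lemma expectation_law_eq (X Y : Omega -> R) (f : R -> R) (M : R) :
  measurable_fun setT X -> measurable_fun setT Y -> measurable_fun setT f ->
  (forall x, `|f x| <= M) ->
  (forall B, measurable B -> P (X @^-1` B) = P (Y @^-1` B)) ->
  \int[P]_w f (X w) = \int[P]_w f (Y w).
Proof.
move=> mX mY mf fM XY.
have E (Z : Omega -> R) (mZ : measurable_fun setT Z) : (\int[P]_w (f (Z w))%:E =
    \int[distribution P (mfun_Sub (mem_set mZ) : {mfun Omega >-> R})]_x (f x)%:E)%E.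
  rewrite integral_distribution//; first exact/measurable_EFinP.
  apply: (bounded_measurable_integrable _ (M := M)) => //.
  exact: measurableT_comp.
rewrite /Rintegral; congr fine; rewrite (E X mX) (E Y mY).
by apply: eq_measure_integral => B mB _; exact: XY.
Qed.

Variables (Z : R -> {RV P >-> R}) (a : R) (nu : {measure set R -> \bar R}).
Hypotheses (Z_levy : is_levy_process Z) (a0 : 0 <= a) (nu_levy : levy_measure nu)
  (nu_sym : symmetric_measure nu) (Z_triplet : has_triplet Z a nu).

Lemma levy_cos_sin (t mu : R) : 0 <= t ->
  \int[P]_w cos (mu * Z t w) = expR (- (t * psi a nu mu)) /\
  \int[P]_w sin (mu * Z t w) = 0.
Proof.
move=> t0; have := Z_triplet mu t0; rewrite /Cintegral /cexp.
have rI : complex.Re (Psi a nu mu) = - psi a nu mu by exact: Re_Psi.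
have iI : complex.Im (Psi a nu mu) = 0 by exact: Im_Psi.
case: (Psi a nu mu) rI iI => x y /= -> -> [].
rewrite !mulr0 !mul0r subr0 addr0 cos0 mulr1 sin0 mulr0 mulrN => hc hs; split.
  by rewrite -hc; apply: eq_Rintegral => w _; rewrite expR0 mul1r.
by rewrite -[RHS]hs; apply: eq_Rintegral => w _; rewrite expR0 mul1r.
Qed.

Lemma levy_increment_cos_sin (s t mu : R) : 0 <= s -> s <= t ->
  \int[P]_w cos (mu * (Z t w - Z s w)) = expR (- ((t - s) * psi a nu mu)) /\
  \int[P]_w sin (mu * (Z t w - Z s w)) = 0.
Proof.
move=> s0 st; have ts0 : 0 <= t - s by rewrite subr_ge0.
have [<- <-] := levy_cos_sin mu ts0.
have mZ r : measurable_fun setT (Z r) by exact: measurable_funP.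
have mB : measurable_fun setT (Z t \- Z s) by exact: measurable_funB.
have law B : measurable B -> P ((Z t \- Z s) @^-1` B) = P (Z (t - s) @^-1` B).
  exact: (levy_stationary Z_levy).
split.
  apply: (@expectation_law_eq (Z t \- Z s) _ (fun x => cos (mu * x)) 1) => //.
    exact: measurable_cosM.
  by move=> x; exact: cos_max.
apply: (@expectation_law_eq (Z t \- Z s) _ (fun x => sin (mu * x)) 1) => //.
  exact: measurable_sinM.
by move=> x; exact: sin_max.
Qed.

Lemma levy_increments_indepN (s : nat -> R) (N : nat) :
  0 <= s 0%N -> (forall i, s i <= s i.+1) ->
  indepN P (fun i => Z (s i.+1) \- Z (s i)) N.
Proof.
move=> s0 sS; apply/indepNP; last exact: (levy_independent Z_levy).
by move=> i; apply: measurable_funB; exact: measurable_funP.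
Qed.

Lemma indepN_scale (X : nat -> Omega -> R) (c : nat -> R) (N : nat) :
  (forall i, measurable_fun setT (X i)) -> indepN P X N ->
  indepN P (fun i w => c i * X i w) N.
Proof.
move=> mX iX B mB.
apply: (iX (fun i => (fun x => c i * x) @^-1` B i)) => i.
rewrite -[X in measurable X]setTI.
by apply: (@measurable_funM _ _ _ setT (cst (c i)) id).
Qed.

Lemma levy_increments_cf (s c : nat -> R) (N : nat) (mu : R) :
  0 <= s 0%N -> (forall i, s i <= s i.+1) ->
  \int[P]_w cos (mu * \sum_(i < N) c i * (Z (s i.+1) w - Z (s i) w)) =
    expR (- \sum_(i < N) (s i.+1 - s i) * psi a nu (mu * c i)) /\
  \int[P]_w sin (mu * \sum_(i < N) c i * (Z (s i.+1) w - Z (s i) w)) = 0.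
Proof.
move=> s0 sS.
have sge i : 0 <= s i by elim: i => // i /le_trans; apply.
pose X i w := c i * (Z (s i.+1) w - Z (s i) w).
have mD i : measurable_fun setT (Z (s i.+1) \- Z (s i)).
  by apply: measurable_funB; exact: measurable_funP.
have mX i : measurable_fun setT (X i) by apply: measurable_funM => //; exact: mD.
have iX : indepN P X N.
  by apply: (indepN_scale c mD); exact: levy_increments_indepN.
have inc i := levy_increment_cos_sin (mu * c i) (sge i) (sS i).
have sX i : (i < N)%N -> \int[P]_w sin (mu * X i w) = 0.
  move=> _; rewrite -[RHS](inc i).2; apply: eq_Rintegral => w _.
  by rewrite mulrA.
have [-> ->] := indepN_cos_sin_sum mX iX sX; split => //.
rewrite -sumrN expR_sum; apply: eq_bigr => i _.
by rewrite -(inc i).1; apply: eq_Rintegral => w _; rewrite mulrA.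
Qed.

End levy_increments.

(** * Moments from characteristic functions *)

Section haversine.
Context {R : realType}.
Implicit Types x y : R.

(* The haversine, sin (y / 2) ^+ 2. *)
Definition hav (y : R) : R := (1 - cos y) / 2.

Lemma hav_ge0 y : 0 <= hav y.
Proof. by rewrite divr_ge0// subr_ge0 cos_le1. Qed.

Lemma hav_le1 y : hav y <= 1.
Proof. by have := cos_geN1 y; rewrite /hav; lra. Qed.

Lemma cos_hav y : cos y = 1 - 2 * hav y.
Proof. by rewrite /hav; field. Qed.

Lemma hav_le_sqr y : hav y <= y ^+ 2 / 4.
Proof. by have := cosB1_le y; rewrite /hav; lra. Qed.

Lemma sin_cube_bound x : `|sin x - x| <= `|x| ^+ 3 / 2.
Proof.
wlog x0 : x / 0 <= x.
  move=> H; have [/H//|x0] := leP 0 x.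
  have h : 0 <= - x by rewrite oppr_ge0 ltW.
  have {H h} := H (- x) h; rewrite sinN normrN opprK.
  by rewrite -[X in `|X| <= _]opprK normrN opprD opprK.
have [z] : exists2 z, z \in `[0, x] &
    (sin x - x) - (sin 0 - 0) = (cos z - 1) * (x - 0).
  apply: (@MVT_segment _ (fun u : R => sin u - u) (fun u => cos u - 1)) => //.
  by apply: derivable_within_continuous.
rewrite in_itv/= sin0 !subr0 => /andP[z0 zx] ->.
rewrite normrM (ger0_norm x0) exprS mulrC -mulrA ler_wpM2l// distrC.
rewrite ger0_norm ?subr_ge0 ?cos_le1//; apply: le_trans (cosB1_le z) _.
by rewrite ler_wpM2r// ler_pXn2r.
Qed.

Lemma cos_taylor2 y : `|1 - cos y - y ^+ 2 / 2| <= y ^+ 4 / 8.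
Proof.
have -> : 1 - cos y - y ^+ 2 / 2 = 2 * ((sin (y / 2) - y / 2) * (sin (y / 2) + y / 2)).
  by rewrite cos_half; field.
rewrite !normrM ger0_norm//.
have h1 := sin_cube_bound (y / 2).
have h2 : `|sin (y / 2) + y / 2| <= 2 * `|y / 2|.
  by apply: le_trans (ler_normD _ _) _; have := norm_sin_le (y / 2); lra.
have -> : y ^+ 4 = 16 * `|y / 2| ^+ 4.
  by rewrite -normrX ger0_norm ?exprn_even_ge0//; field.
move: h1 h2; set A := `|sin _ - _|; set B := `|sin _ + _|; set t := `|y / 2| => h1 h2.
have t0 : 0 <= t by exact: normr_ge0.
have : A * B <= (t ^+ 3 / 2) * (2 * t) by apply: ler_pM => //; exact: normr_ge0.
by rewrite (_ : t ^+ 3 / 2 * (2 * t) = t ^+ 4); [lra|field].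
Qed.

(** The addition formulas give hav y cos (c y) = cos (c y) / 2 - cos ((c + 1) y) / 4 - cos ((c - 1)
    y) / 4. The list consists of pairs (coefficient, frequency). *)
Lemma hav_trig_polynomial (K : nat) : exists s : seq (R * R),
  forall y, hav y ^+ K = \sum_(q <- s) q.1 * cos (q.2 * y).
Proof.
elim: K => [|K [s hs]].
  by exists [:: (1, 0)] => y; rewrite big_seq1 expr0 mul0r cos0 mulr1.
exists (flatten [seq [:: (q.1 / 2, q.2); (- q.1 / 4, q.2 + 1); (- q.1 / 4, q.2 - 1)] | q <- s]).
move=> y; rewrite big_flatten big_map exprS hs mulr_sumr; apply: eq_bigr => q _.
transitivity (q.1 / 2 * cos (q.2 * y) + (- q.1 / 4 * cos ((q.2 + 1) * y) +
    (- q.1 / 4 * cos ((q.2 - 1) * y)))).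
  by rewrite mulrDl mulrBl mul1r cosD cosB /hav; field.
by rewrite 3!big_cons big_nil; congr (_ + (_ + _)); rewrite /= addr0.
Qed.

(* With A = hav y and B = hav x, the numbers hav (y + x) and hav (y - x) are m + e and
   m - e for m = A + B - 2 A B and e ^+ 2 = 4 A (1 - A) B (1 - B). *)
Lemma hav_second_difference (k : nat) : exists2 C : R, 0 <= C &
  forall x y, (hav (y + x) ^+ k.+1 + hav (y - x) ^+ k.+1) / 2 - hav y ^+ k.+1 <=
    C * (hav x * hav y ^+ k + hav x ^+ k.+1).
Proof.
(* The induction needs the second bound: the mean of S S^k and T T^k is the product of the means
   plus the product of the half-differences, and the half-differences obey a similar recursion. *)
have [e e0 He] : exists2 e : R, 0 <= e & forall x y,
   (hav (y + x) ^+ k.+1 + hav (y - x) ^+ k.+1) / 2 <=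
     hav y ^+ k.+1 + e * (hav x * (hav y + hav x) ^+ k) /\
   (hav (y + x) - hav (y - x)) / 2 * ((hav (y + x) ^+ k.+1 - hav (y - x) ^+ k.+1) / 2)
     <= e * (hav y * hav x * (hav y + hav x) ^+ k).
  elim: k => [|k [e e0 He]].
    exists 4 => // x y; have A0 := hav_ge0 y; have A1 := hav_le1 y.
    have B0 := hav_ge0 x; have B1 := hav_le1 x.
    rewrite !expr1 !expr0 !mulr1; split.
      rewrite {1 2}/hav cosD cosB (cos_hav y) (cos_hav x); nra.
    have -> : (hav (y + x) - hav (y - x)) / 2 * ((hav (y + x) - hav (y - x)) / 2) =
        (sin y ^+ 2) * (sin x ^+ 2) / 4.
      by rewrite /hav cosD cosB; field.
    rewrite !sin2cos2 (cos_hav y) (cos_hav x).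
    set A := hav y in A0 A1 *; set B := hav x in B0 B1 *.
    have -> : (1 - (1 - 2 * A) ^+ 2) * (1 - (1 - 2 * B) ^+ 2) / 4 =
       4 * (A * B) * ((1 - A) * (1 - B)) by field.
    have AB : 0 <= A * B by exact: mulr_ge0.
    have : (1 - A) * (1 - B) <= 1 by nra.
    nra.
  exists (5 * e + 4) => [|x y]; first by lra.
  have [h1 h2] := He x y; have A0 := hav_ge0 y; have A1 := hav_le1 y.
  have B0 := hav_ge0 x; have B1 := hav_le1 x.
  have S0 := hav_ge0 (y + x); have T0 := hav_ge0 (y - x).
  have mE : (hav (y + x) + hav (y - x)) / 2 = hav y + hav x - 2 * (hav y * hav x).
    by rewrite /hav cosD cosB; field.
  have dE : ((hav (y + x) - hav (y - x)) / 2) ^+ 2 <= 4 * (hav y * hav x).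
    have -> : ((hav (y + x) - hav (y - x)) / 2) ^+ 2 = (sin y ^+ 2) * (sin x ^+ 2) / 4.
      by rewrite /hav cosD cosB; field.
    rewrite !sin2cos2 (cos_hav y) (cos_hav x).
    set A := hav y in A0 A1 *; set B := hav x in B0 B1 *.
    have -> : (1 - (1 - 2 * A) ^+ 2) * (1 - (1 - 2 * B) ^+ 2) / 4 =
       4 * (A * B) * ((1 - A) * (1 - B)) by field.
    have AB : 0 <= A * B by exact: mulr_ge0.
    have : (1 - A) * (1 - B) <= 1 by nra.
    nra.
  rewrite !(exprS _ k.+1).
  move: h1 h2 S0 T0 mE dE; set S := hav (y + x); set T := hav (y - x).
  set A := hav y in A0 A1 *; set B := hav x in B0 B1 *.
  set Sk := S ^+ k.+1; set Tk := T ^+ k.+1; set Ak := A ^+ k.+1.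
  set Q := (A + B) ^+ k => h1 h2 S0 T0 mE dE.
  have Q0 : 0 <= Q by rewrite exprn_ge0// addr_ge0.
  have Sk0 : 0 <= Sk by rewrite exprn_ge0.
  have Tk0 : 0 <= Tk by rewrite exprn_ge0.
  have Ak0 : 0 <= Ak by rewrite exprn_ge0.
  have AkQ : Ak <= (A + B) * Q.
    by rewrite -exprS ler_pXn2r ?nnegrE ?addr_ge0// lerDl.
  have AB0 : 0 <= A * B by exact: mulr_ge0.
  have m0 : 0 <= (S + T) / 2 by rewrite divr_ge0// addr_ge0.
  have m1 : (S + T) / 2 <= A + B by rewrite mE; lra.
  have E0 : 0 <= (Sk + Tk) / 2 by rewrite divr_ge0// addr_ge0.
  have b1 : 0 <= Ak + e * (B * Q) by rewrite addr_ge0// !mulr_ge0.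
  have b2 : 0 <= e * (A * B * Q) by rewrite !mulr_ge0.
  have mEk : (S + T) / 2 * ((Sk + Tk) / 2) <= (A + B) * (Ak + e * (B * Q)).
    exact: ler_pM.
  have mHk : (S + T) / 2 * ((S - T) / 2 * ((Sk - Tk) / 2)) <= (A + B) * (e * (A * B * Q)).
    apply: (@le_trans _ _ ((S + T) / 2 * (e * (A * B * Q)))).
      exact: ler_wpM2l.
    exact: ler_wpM2r.
  have dEk : ((S - T) / 2) ^+ 2 * ((Sk + Tk) / 2) <= 4 * (A * B) * (Ak + e * (B * Q)).
    by apply: ler_pM => //; exact: sqr_ge0.
  have AQ : A * B * Q <= B * ((A + B) * Q).
    by rewrite (_ : A * B * Q = B * (A * Q)); [rewrite ler_wpM2l// ler_wpM2r// lerDl|ring].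
  have BQ : B * Ak <= B * ((A + B) * Q) by rewrite ler_wpM2l.
  split.
    have -> : (S * Sk + T * Tk) / 2 =
       (S + T) / 2 * ((Sk + Tk) / 2) + (S - T) / 2 * ((Sk - Tk) / 2) by field.
    have -> : (A + B) ^+ k.+1 = (A + B) * Q by rewrite exprS.
    have h3 : e * (A * B * Q) <= e * (B * ((A + B) * Q)) by rewrite ler_wpM2l.
    have h4 : (A + B) * (Ak + e * (B * Q)) = A * Ak + B * Ak + e * (B * ((A + B) * Q)).
      by ring.
    have h5 : 0 <= e * (B * ((A + B) * Q)) by rewrite !mulr_ge0// addr_ge0.
    have h6 : 0 <= B * ((A + B) * Q) by rewrite !mulr_ge0// addr_ge0.
    have -> : (5 * e + 4) * (B * ((A + B) * Q)) =
       5 * (e * (B * ((A + B) * Q))) + 4 * (B * ((A + B) * Q)) by ring.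
    lra.
  have -> : (S - T) / 2 * ((S * Sk - T * Tk) / 2) =
     (S + T) / 2 * ((S - T) / 2 * ((Sk - Tk) / 2)) + ((S - T) / 2) ^+ 2 * ((Sk + Tk) / 2).
    by field.
  have -> : (A + B) ^+ k.+1 = (A + B) * Q by rewrite exprS.
  have h3 : A * B * Ak <= A * B * ((A + B) * Q) by rewrite ler_wpM2l.
  have h4 : A * B * (e * (B * Q)) <= e * (A * B * ((A + B) * Q)).
    rewrite (_ : A * B * (e * (B * Q)) = e * (A * B * (B * Q))); last by ring.
    by rewrite ler_wpM2l// ler_wpM2l// ler_wpM2r// lerDr.
  have h5 : 4 * (A * B) * (Ak + e * (B * Q)) = 4 * (A * B * Ak) + 4 * (A * B * (e * (B * Q))).
    by ring.
  have h6 : (A + B) * (e * (A * B * Q)) = e * (A * B * ((A + B) * Q)) by ring.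
  have -> : (5 * e + 4) * (A * B * ((A + B) * Q)) =
     5 * (e * (A * B * ((A + B) * Q))) + 4 * (A * B * ((A + B) * Q)) by ring.
  lra.
exists (e * 2 ^+ k) => [|x y]; first by rewrite mulr_ge0// exprn_ge0.
have [h _] := He x y; have A0 := hav_ge0 y; have B0 := hav_ge0 x.
rewrite lerBlDl; apply: le_trans h _; rewrite lerD2l -mulrA ler_wpM2l//.
(* The sum is at most twice the larger of the two terms. *)
have : (hav y + hav x) ^+ k <= 2 ^+ k * (hav y ^+ k + hav x ^+ k).
  have [h|h] := leP (hav x) (hav y).
    apply: (@le_trans _ _ ((2 * hav y) ^+ k)).
      by rewrite lerXn2r ?nnegrE ?addr_ge0 ?mulr_ge0//; lra.
    by rewrite exprMn ler_wpM2l ?exprn_ge0// lerDl exprn_ge0.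
  apply: (@le_trans _ _ ((2 * hav x) ^+ k)).
    by rewrite lerXn2r ?nnegrE ?addr_ge0 ?mulr_ge0//; lra.
  by rewrite exprMn ler_wpM2l ?exprn_ge0// lerDr exprn_ge0.
move=> /(ler_wpM2l B0) /le_trans; apply.
by rewrite exprS le_eqVlt; apply/orP; left; apply/eqP; ring.
Qed.

End haversine.

Lemma is_derive_expRM {R : realType} (q t r : R) :
  is_derive r (1 : R) (fun x : R => q * expR (- (x * t))) (q * (- t * expR (- (r * t)))).
Proof.
have h1 : is_derive r (1 : R) (fun x : R => - (x * t)) (- t).
  rewrite (_ : (fun x => _) = ((- t) *: (id : R -> R))); last first.
    by apply/funext => x; rewrite mulrC -mulNr.
  by apply: (is_derive_eq (is_deriveZ (- t) (is_derive_id r (1 : R)))); exact: mulr1.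
have h2 := @is_derive1_comp R expR _ r _ _ (is_derive_expR _) h1.
apply: (is_derive_eq (is_deriveZ q h2)).
by rewrite -[LHS]/(q * (expR (- (r * t)) * - t)); ring.
Qed.

Lemma le_of_le_addM {R : realFieldType} (x y L : R) : 0 <= L ->
  (forall h, 0 < h -> h <= 1 -> x <= y + L * h) -> x <= y.
Proof.
move=> L0 H; rewrite leNgt; apply/negP => yx.
have L1 : 0 < L + 1 + (x - y) by lra.
pose h := (x - y) / (L + 1 + (x - y)) / 2.
have h0 : 0 < h by rewrite !divr_gt0//; lra.
have hE : h * (L + 1 + (x - y)) = (x - y) / 2 by rewrite /h; field; lra.
have h1 : h <= 1 by nra.
have := H h h0 h1; nra.
Qed.

Section hav_moment.
Context d {Omega : measurableType d} {R : realType} (P : probability Omega R).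
Variables (a : R) (nu : {measure set R -> \bar R}).
Hypotheses (a0 : 0 <= a) (nu_levy : levy_measure nu).

Lemma measurable_hav_comp d' (S : measurableType d') (X : S -> R) (k : nat) :
  measurable_fun setT X -> measurable_fun setT (fun w => hav (X w) ^+ k).
Proof.
move=> mX; apply: measurable_funX; apply: measurable_funM => //.
apply: measurable_funB => //; apply: (@measurableT_comp _ _ _ _ _ _ (@cos R)) => //.
by apply: continuous_measurable_fun; exact: continuous_cos.
Qed.

Lemma integrable_hav_comp (X : Omega -> R) (k : nat) : measurable_fun setT X ->
  P.-integrable setT (EFin \o (fun w => hav (X w) ^+ k)).
Proof.
move=> mX; apply: (bounded_measurable_integrable _ (M := 1)).
  exact: measurable_hav_comp.
by move=> w; rewrite ger0_norm ?exprn_ge0 ?hav_ge0// exprn_ile1 ?hav_ge0 ?hav_le1.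
Qed.

Lemma integrable_hav_levy (c : R) (k : nat) :
  nu.-integrable setT (EFin \o (fun x => hav (c * x) ^+ k.+1)).
Proof.
apply: (le_integrable measurableT (g := EFin \o (fun x => 1 - cos (c * x)))) => //.
- by apply/measurable_EFinP; apply: measurable_hav_comp; exact: measurable_funM.
- move=> x _ /=; rewrite lee_fin ger0_norm ?exprn_ge0 ?hav_ge0//.
  rewrite ger0_norm ?subr_ge0 ?cos_le1// exprS.
  apply: (@le_trans _ _ (hav (c * x))).
    by rewrite ler_piMr ?hav_ge0// exprn_ile1 ?hav_ge0 ?hav_le1.
  by rewrite /hav; have := cos_le1 (c * x); lra.
- exact: integrable_1Bcos.
Qed.

(** The summand a c^2 / 4 is the Gaussian counterpart of the jump integral, since hav (c x) behaves
    like (c x)^2 / 4 near 0. *)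
Definition hav2_levy (N : nat) (D c : nat -> R) : R :=
  \sum_(i < N) D i * (\int[nu]_x hav (c i * x) + a * c i ^+ 2 / 4).

Definition havK_levy (K N : nat) (D c : nat -> R) : R :=
  \sum_(i < N) D i * \int[nu]_x hav (c i * x) ^+ K.

(* With G r = E (hav (X r) ^+ K), which is an explicit combination of the functions
   exp (- r Psi), the second difference bound gives G' <= C (G + M), and G 0 = 0. *)
Lemma hav_moment (k : nat) : a = 0 \/ (0 < k)%N -> exists2 C : R, 0 <= C &
  forall (N : nat) (D c : nat -> R) (X : R -> Omega -> R),
  (forall i, 0 <= D i) ->
  (forall r, measurable_fun setT (X r)) ->
  (forall r mu, 0 <= r <= 1 -> \int[P]_w cos (mu * X r w) =
     expR (- (r * \sum_(i < N) D i * psi a nu (mu * c i)))) ->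
  \int[P]_w hav (X 1 w) ^+ k.+1 <=
    C * (hav2_levy N D c ^+ k.+1 + havK_levy k.+1 N D c).
Proof.
move=> ak; have [C C0 HC] := @hav_second_difference R k.
have [s hs] := @hav_trig_polynomial R k.+1.
exists (expR C * (1 + C)) => [|N D c X D0 mX cfX]; first by rewrite mulr_ge0 ?expR_ge0 ?addr_ge0.
pose Psi' mu := \sum_(i < N) D i * psi a nu (mu * c i).
pose G r := \sum_(q <- s) q.1 * expR (- (r * Psi' q.2)).
have GE r : 0 <= r <= 1 -> G r = \int[P]_w hav (X r w) ^+ k.+1.
  move=> r01; rewrite (@eq_Rintegral _ _ _ _ _
    (fun w => \sum_(q <- s) q.1 * cos (q.2 * X r w))); last by move=> w _; rewrite hs.
  rewrite Rintegral_sum//; last first.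
    by move=> q; apply: integrable_EFinZl => //; exact: integrable_cos_comp.
  apply: eq_bigr => q _; rewrite RintegralZl//; last exact: integrable_cos_comp.
  by rewrite cfX.
have G0 : G 0 = 0.
  transitivity (hav (0 : R) ^+ k.+1); last by rewrite /hav cos0 subrr mul0r exprS mul0r.
  by rewrite hs /G; apply: eq_bigr => q _; rewrite mul0r oppr0 expR0 mulr0 cos0.
pose dG r := \sum_(q <- s) q.1 * (- Psi' q.2 * expR (- (r * Psi' q.2))).
have GdG (r : R) : is_derive r (1 : R) G (dG r).
  rewrite /G /dG; elim: (s) => [|q s' ih].
    rewrite big_nil; under eq_fun do rewrite big_nil; exact: is_derive_cst.
  rewrite big_cons; under eq_fun do rewrite big_cons.
  apply: is_deriveD.
  exact: is_derive_expRM.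
set M2 := hav2_levy N D c; set MK := havK_levy k.+1 N D c.
have hi0 i : 0 <= \int[nu]_x hav (c i * x).
  by apply: Rintegral_ge0 => x _; exact: hav_ge0.
have M20 : 0 <= M2.
  apply: sumr_ge0 => i _; rewrite mulr_ge0// addr_ge0//.
  by rewrite divr_ge0// mulr_ge0// sqr_ge0.
have MK0 : 0 <= MK.
  apply: sumr_ge0 => i _; rewrite mulr_ge0//.
  by apply: Rintegral_ge0 => x _; rewrite exprn_ge0// hav_ge0.
have main r : 0 <= r <= 1 -> dG r <= C * (G r + (M2 ^+ k.+1 + MK)).
  move=> r01.
  pose EA := \int[P]_w hav (X r w) ^+ k.
  have EA0 : 0 <= EA by apply: Rintegral_ge0 => w _; rewrite exprn_ge0// hav_ge0.
  pose phi t := expR (- (r * Psi' t)).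
  have phiE t : phi t = \int[P]_w cos (t * X r w) by rewrite cfX.
  (* [Phi y] is the expected second difference of the power of [hav] at [X r] with step [y], written
     through the characteristic function. The derivative of [G] is its integral against [nu] plus a
     Gaussian limit of it for small steps. *)
  pose Phi (y : R) := \sum_(q <- s) (q.1 * phi q.2) * (cos (q.2 * y) - 1).
  have PhiB y : Phi y <= C * (hav y * EA + hav y ^+ k.+1).
    have -> : Phi y = \int[P]_w ((hav (X r w + y) ^+ k.+1 + hav (X r w - y) ^+ k.+1) / 2
        - hav (X r w) ^+ k.+1).
      rewrite (@eq_Rintegral _ _ _ _ _ (fun w =>
         \sum_(q <- s) (q.1 * (cos (q.2 * y) - 1)) * cos (q.2 * X r w))); last first.
        move=> w _; rewrite !hs -big_split/= mulr_suml -sumrB; apply: eq_bigr => q _.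
        by rewrite mulrDr mulrBr cosD cosB; field.
      rewrite Rintegral_sum//; last first.
        by move=> q; apply: integrable_EFinZl => //; exact: integrable_cos_comp.
      apply: eq_bigr => q _; rewrite RintegralZl//; last exact: integrable_cos_comp.
      by rewrite phiE mulrAC.
    have mXy (z : R) : measurable_fun setT (fun w => X r w + z) by exact: measurable_funD.
    have -> : C * (hav y * EA + hav y ^+ k.+1) =
        \int[P]_w (C * (hav y * hav (X r w) ^+ k + hav y ^+ k.+1)).
      rewrite RintegralZl//; last first.
        apply: integrable_EFinD => //.
          by apply: integrable_EFinZl => //; exact: integrable_hav_comp.
        exact: (bounded_measurable_integrable _ (M := `|hav y ^+ k.+1|)).
      rewrite RintegralD//; [|by apply: integrable_EFinZl => //; exact: integrable_hav_comp
        |exact: (bounded_measurable_integrable _ (M := `|hav y ^+ k.+1|))].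
      by rewrite Rintegral_probability_cst RintegralZl//; exact: integrable_hav_comp.
    apply: le_Rintegral => //.
    - apply: integrable_EFinB => //; last exact: integrable_hav_comp.
      under eq_fun do rewrite mulrC.
      apply: integrable_EFinZl => //; apply: integrable_EFinD => //.
        exact: (integrable_hav_comp _ (mXy y)).
      exact: (integrable_hav_comp _ (mXy (- y))).
    - apply: integrable_EFinZl => //; apply: integrable_EFinD => //.
        by apply: integrable_EFinZl => //; exact: integrable_hav_comp.
      exact: (bounded_measurable_integrable _ (M := `|hav y ^+ k.+1|)).
  (* A second derivative appears here: the bound for [Phi] at step t h is divided by h^2 and [h]
     tends to 0. For 0 < k the term hav (t h)^(k+1) is of higher order than h^2 and disappears; for
     a = 0 both sides vanish. *)
  have gauss (t : R) : a * \sum_(q <- s) (q.1 * phi q.2) * (- ((q.2 * t) ^+ 2 / 2)) <=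
      C * (a * t ^+ 2 / 4 * EA).
    case: ak => [->|k0]; first by rewrite !mul0r mulr0.
    pose L := \sum_(q <- s) `|q.1 * phi q.2| * ((q.2 * t) ^+ 4 / 8).
    have L0 : 0 <= L.
      apply: sumr_ge0 => q _; rewrite mulr_ge0// divr_ge0//.
      by rewrite (exprM _ 2 2) sqr_ge0.
    have -> : C * (a * t ^+ 2 / 4 * EA) = a * (C * (t ^+ 2 / 4 * EA)) by ring.
    rewrite ler_wpM2l//.
    have T0 : 0 <= t ^+ 2 / 4 by rewrite divr_ge0// sqr_ge0.
    apply: (@le_of_le_addM _ _ _ (C * (t ^+ 2 / 4) ^+ k.+1 + L)).
      by rewrite addr_ge0// mulr_ge0// exprn_ge0.
    move=> h h0 h1.
    have h20 : 0 < h ^+ 2 by rewrite exprn_gt0.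
    rewrite -(ler_pM2r h20) mulr_suml.
    have e1 : \sum_(q <- s) q.1 * phi q.2 * - ((q.2 * t) ^+ 2 / 2) * h ^+ 2 <=
        Phi (t * h) + L * h ^+ 4.
      rewrite /Phi /L mulr_suml -big_split/=; apply: ler_sum => q _.
      have := cos_taylor2 (q.2 * (t * h)).
      have -> : q.1 * phi q.2 * - ((q.2 * t) ^+ 2 / 2) * h ^+ 2 =
         q.1 * phi q.2 * (cos (q.2 * (t * h)) - 1) +
         q.1 * phi q.2 * (1 - cos (q.2 * (t * h)) - (q.2 * (t * h)) ^+ 2 / 2).
        by field.
      move=> hc; rewrite lerD2l; apply: le_trans (ler_norm _) _.
      rewrite normrM -mulrA ler_wpM2l//; apply: le_trans hc _.
      by rewrite le_eqVlt; apply/orP; left; apply/eqP; field.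
    apply: le_trans e1 _.
    have hh : hav (t * h) <= t ^+ 2 / 4 * h ^+ 2.
      by apply: le_trans (hav_le_sqr _) _; rewrite exprMn; lra.
    have hk : hav (t * h) ^+ k.+1 <= (t ^+ 2 / 4) ^+ k.+1 * (h * h ^+ 2).
      apply: (@le_trans _ _ ((t ^+ 2 / 4 * h ^+ 2) ^+ k.+1)).
        by rewrite lerXn2r ?nnegrE ?hav_ge0// mulr_ge0// ltW.
      rewrite exprMn ler_wpM2l ?exprn_ge0//.
      rewrite exprS mulrC ler_wpM2r ?(ltW h20)// -exprM.
      by rewrite -[leRHS]expr1 ler_wiXn2l ?(ltW h0)// muln_gt0.
    apply: (@le_trans _ _ (C * (t ^+ 2 / 4 * h ^+ 2 * EA + (t ^+ 2 / 4) ^+ k.+1 * (h * h ^+ 2))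
        + L * (h * h ^+ 2))).
      apply: lerD.
        apply: le_trans (PhiB _) _; rewrite ler_wpM2l// lerD//.
        by rewrite ler_wpM2r.
      rewrite ler_wpM2l// -exprS; rewrite ler_wiXn2l ?(ltW h0)//.
    by rewrite le_eqVlt; apply/orP; left; apply/eqP; ring.
  have jump (t : R) : \sum_(q <- s) (q.1 * phi q.2) * (- \int[nu]_x (1 - cos (q.2 * t * x)))
      <= C * (\int[nu]_x hav (t * x) * EA + \int[nu]_x hav (t * x) ^+ k.+1).
    have ih1 : nu.-integrable setT (EFin \o (fun x => hav (t * x))).
      by have := integrable_hav_levy t 0; under eq_fun do rewrite expr1.
    have ihk := integrable_hav_levy t k.
    have icos q := integrable_1Bcos nu_levy q.
    have -> : C * (\int[nu]_x hav (t * x) * EA + \int[nu]_x hav (t * x) ^+ k.+1) =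
        \int[nu]_x (C * (hav (t * x) * EA + hav (t * x) ^+ k.+1)).
      rewrite RintegralZl//; last first.
        apply: integrable_EFinD => //.
        by under eq_fun do rewrite mulrC; exact: integrable_EFinZl.
      rewrite RintegralD// ?RintegralZr//.
      by under eq_fun do rewrite mulrC; exact: integrable_EFinZl.
    rewrite (eq_bigr (fun q => \int[nu]_x ((- (q.1 * phi q.2)) * (1 - cos (q.2 * t * x)))));
      last first.
      by move=> q _; rewrite RintegralZl// ?mulNr ?mulrN//; exact: icos.
    rewrite -Rintegral_sum//; last by move=> q; apply: integrable_EFinZl => //; exact: icos.
    apply: le_Rintegral => //.
    - by apply: integrable_EFin_sum => // q; apply: integrable_EFinZl => //; exact: icos.
    - apply: integrable_EFinZl => //; apply: integrable_EFinD => //.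
      by under eq_fun do rewrite mulrC; exact: integrable_EFinZl.
    - move=> x _; apply: le_trans (PhiB (t * x)); rewrite le_eqVlt; apply/orP; left.
      by apply/eqP; apply: eq_bigr => q _; rewrite mulrA; ring.
  (* Exchanging the sums over frequencies and over increments displays the derivative as the
     generator applied to each increment separately. *)
  have dGE : dG r = \sum_(i < N) D i * (
      a * \sum_(q <- s) (q.1 * phi q.2) * (- ((q.2 * c i) ^+ 2 / 2)) +
      \sum_(q <- s) (q.1 * phi q.2) * (- \int[nu]_x (1 - cos (q.2 * c i * x)))).
    transitivity (\sum_(q <- s) \sum_(i < N)
        - (q.1 * phi q.2) * (D i * psi a nu (q.2 * c i))).
      apply: eq_bigr => q _; rewrite -mulr_sumr -/(Psi' q.2) /phi; ring.
    rewrite exchange_big/=; apply: eq_bigr => i _.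
    rewrite mulr_sumr -big_split/= mulr_sumr; apply: eq_bigr => q _.
    by rewrite /psi; field.
  rewrite dGE.
  apply: (@le_trans _ _ (C * (M2 * EA + MK))).
    rewrite /M2 /MK /hav2_levy /havK_levy mulr_suml -big_split/= mulr_sumr.
    apply: ler_sum => i _.
    have := lerD (gauss (c i)) (jump (c i)) => /(ler_wpM2l (D0 i)) /le_trans; apply.
    by rewrite le_eqVlt; apply/orP; left; apply/eqP; ring.
  rewrite ler_wpM2l// addrA lerD2r GE//.
  have -> : M2 * EA = \int[P]_w (M2 * hav (X r w) ^+ k).
    by rewrite RintegralZl//; exact: integrable_hav_comp.
  have icst : P.-integrable setT (EFin \o (fun _ : Omega => M2 ^+ k.+1)).
    exact: (bounded_measurable_integrable _ (M := `|M2 ^+ k.+1|)).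
  rewrite -[X in _ <= _ + X](Rintegral_probability_cst P) -RintegralD//; last exact: integrable_hav_comp.
  apply: le_Rintegral => //.
  - by apply: integrable_EFinZl => //; exact: integrable_hav_comp.
  - by apply: integrable_EFinD => //; exact: integrable_hav_comp.
  (* M2 h^k is at most h^(k+1) or M2^(k+1), according to which of [M2] and h is larger. *)
  move=> w _; have h0 := hav_ge0 (X r w).
  have [h|h] := leP M2 (hav (X r w)).
    by rewrite -[leLHS]addr0 lerD ?exprn_ge0// exprS ler_wpM2r// exprn_ge0.
  rewrite -[leLHS]add0r lerD ?exprn_ge0// exprS ler_wpM2l//.
  by rewrite lerXn2r ?nnegrE// ltW.
pose M := M2 ^+ k.+1 + MK.
have M0 : 0 <= M by rewrite addr_ge0// exprn_ge0.
(* Gronwall's argument: exp (- C r) (G r + M) has nonpositive derivative on [0, 1] and starts at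
   [M]. *)
pose W (r : R) := 1 * expR (- (r * C)) * (G r + M).
pose dW (r : R) := expR (- (r * C)) * (dG r - C * (G r + M)).
have WdW (r : R) : is_derive r (1 : R) W (dW r).
  have h1 := is_derive_expRM 1 C r.
  have h2 : is_derive r (1 : R) (fun r => G r + M) (dG r + 0).
    by apply: is_deriveD.
  apply: (is_derive_eq (is_deriveM h1 h2)).
  rewrite /dW -[LHS]/(1 * expR (- (r * C)) * (dG r + 0) +
    (G r + M) * (1 * (- C * expR (- (r * C))))); ring.
have [z z01 Wz] : exists2 z, z \in `[0, 1] & W 1 - W 0 = dW z * (1 - 0).
  apply: MVT_segment => //; apply: derivable_within_continuous => z _.
  by have [] := WdW z.
have dWz : dW z <= 0.
  rewrite in_itv/= in z01.
  by rewrite /dW pmulr_rle0 ?expR_gt0// subr_le0; exact: main.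
have W01 : W 1 <= W 0 by rewrite -subr_le0 Wz subr0 mulr1.
have h01 : 0 <= (1 : R) <= 1 by rewrite ler01 lexx.
rewrite -GE//; move: W01; rewrite /W !mul1r mul0r oppr0 expR0 mul1r G0 add0r expRN => W01.
have eC := expR_gt0 C.
have : G 1 + M <= expR C * M by rewrite -ler_pdivrMl.
have : 0 <= expR C * (C * M) by rewrite !mulr_ge0// ltW.
rewrite -/M; nra.
Qed.

End hav_moment.

Lemma expr_sqr_swap {R : comPzRingType} (x : R) (j m : nat) :
  ((x ^+ j) ^+ 2) ^+ m = (x ^+ m.*2) ^+ j.
Proof. by rewrite -!exprM; congr (_ ^+ _); lia. Qed.

(** * Powers as dyadic sums of haversines *)

Section dyadic_moments.
Context {R : realType}.
Implicit Types (x q : R) (K j : nat).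

Lemma powR2X (q : R) j : (2 ^+ j : R) `^ q = (2 `^ q) ^+ j.
Proof. by rewrite -powR_mulrn// -powRrM mulrC powRrM powR_mulrn// powR_ge0. Qed.

(** [hav] is even and increasing on [0, pi], an interval that contains [1, 2]. *)
Lemma half_lt_hav x : 1 <= `|x| -> `|x| <= 2 -> hav (1 : R) <= hav x.
Proof.
move=> x1 x2; have pi2 := @pi_ge2 R; rewrite /hav ler_pM2r// lerD2l lerN2.
rewrite -(cos_norm x) le_eqVlt; have [->|x1'] := eqVneq `|x| 1; first by rewrite eqxx.
apply/orP; right; have x1'' : 1 < `|x| by rewrite lt_neqAle eq_sym x1' x1.
rewrite ltr_cos ?in_itv/= ?ler01 ?normr_ge0//; lra.
Qed.

Lemma hav1_gt0 : 0 < hav (1 : R).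
Proof.
have pi2 := @pi_ge2 R.
have : cos (1 : R) < cos 0 by rewrite ltr_cos ?in_itv/= ?ler01 ?lexx//; lra.
by rewrite cos0 /hav; lra.
Qed.

Lemma dyadic_scale x : 1 <= `|x| -> exists j : nat,
  1 <= `|2^-1 ^+ j * x| /\ `|2^-1 ^+ j * x| <= 2.
Proof.
move=> x1.
have ex : exists n, `|x| < 2 ^+ n.
  exists (Num.bound `|x|); apply: lt_le_trans (archi_boundP (normr_ge0 x)) _.
  by rewrite -natrX ler_nat ltnW// ltn_expl.
case: (ex_minnP ex) => -[|n] hn hmin; first by move: hn; rewrite expr0; lra.
have h2 : 2 ^+ n <= `|x| by rewrite leNgt; apply/negP => /hmin; rewrite ltnn.
exists n; rewrite normrM ger0_norm ?exprn_ge0// exprVn.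
have p0 : (0 : R) < 2 ^+ n by rewrite exprn_gt0.
split; first by rewrite mulrC ler_pdivlMr// mul1r.
by rewrite mulrC ler_pdivrMr// -exprS ltW.
Qed.

(** A single scale suffices: if 2^-j |x| lies in [1, 2], the haversine at that scale is at least hav
    1. Points with |x| <= 1 are covered by the summand 1. *)
Lemma dyadic_lower (q : R) (K : nat) : 0 <= q -> exists2 C : R, 0 <= C &
  forall x, exists j : nat,
    `|x| `^ q <= 1 + C * ((2 ^+ j) `^ q * hav (2^-1 ^+ j * x) ^+ K).
Proof.
move=> q0; have h1 := hav1_gt0.
exists (2 `^ q / hav 1 ^+ K) => [|x].
  by rewrite divr_ge0 ?powR_ge0// exprn_ge0// ltW.
have [x1|x1] := leP `|x| 1.
  exists 0%N; apply: (@le_trans _ _ 1); last first.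
    rewrite lerDl !mulr_ge0 ?invr_ge0 ?powR_ge0 ?exprn_ge0 ?hav_ge0//; exact: ltW.
  by have := ge0_ler_powR q0 _ _ x1; rewrite powR1; apply; rewrite nnegrE.
have [j [j1 j2]] := dyadic_scale (ltW x1); exists j.
have hj := half_lt_hav j1 j2.
apply: (@le_trans _ _ ((2 * 2 ^+ j) `^ q)).
  rewrite ge0_ler_powR ?nnegrE ?mulr_ge0 ?exprn_ge0//.
  move: j2; rewrite normrM ger0_norm ?exprn_ge0// exprVn mulrC ler_pdivrMr ?exprn_gt0//.
rewrite powRM ?exprn_ge0//; apply: (@le_trans _ _ (2 `^ q / hav 1 ^+ K *
  ((2 ^+ j) `^ q * hav 1 ^+ K))).
  rewrite [leRHS](_ : _ = 2 `^ q * (2 ^+ j) `^ q)//; field.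
  by rewrite expf_neq0// gt_eqF.
rewrite -[leLHS]add0r lerD// ler_wpM2l ?divr_ge0 ?powR_ge0 ?exprn_ge0 ?(ltW h1)//.
by rewrite ler_wpM2l ?powR_ge0// lerXn2r ?nnegrE ?hav_ge0.
Qed.

Lemma geo_sum_le (r : R) N : 0 <= r -> r < 1 -> \sum_(j < N) r ^+ j <= (1 - r)^-1.
Proof.
move=> r0 r1; have r10 : 0 < 1 - r by rewrite subr_gt0.
elim: N => [|N ih]; first by rewrite big_ord0 invr_ge0 ltW.
rewrite big_ord_recl expr0.
under eq_bigr do rewrite lift0 exprS.
rewrite -mulr_sumr; apply: (@le_trans _ _ (1 + r * (1 - r)^-1)).
  by rewrite lerD2l ler_wpM2l.
by rewrite le_eqVlt; apply/orP; left; apply/eqP; field; rewrite gt_eqF.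
Qed.

Lemma powR2_lt_expr (q : R) K : q < K%:R -> 2 `^ q / 2 ^+ K < 1 :> R.
Proof.
move=> qK; rewrite ltr_pdivrMr ?exprn_gt0// mul1r -powR_mulrn//.
by rewrite /powR pnatr_eq0/= ltr_expR ltr_pM2r// ln_gt0// ltr1n.
Qed.

(** The partial sums satisfy F (N+1) x = hav x^K + 2^q F N (x / 2). For |x| <= 1 the terms decay
    with ratio [rho] < 1 because q < 2 K; larger points are halved until they get there. *)
Lemma dyadic_upper (q : R) (K : nat) : 1 <= q -> q < (K.*2)%:R ->
  exists2 C : R, 0 <= C & forall x N,
    \sum_(j < N) (2 ^+ j) `^ q * hav (2^-1 ^+ j * x) ^+ K <= C * `|x| `^ q.
Proof.
move=> q1 qK; have q0 : 0 <= q by lra.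
pose rho : R := 2 `^ q / 2 ^+ K.*2.
have rho1 : rho < 1 by exact: powR2_lt_expr.
have rho0 : 0 <= rho by rewrite divr_ge0 ?powR_ge0 ?exprn_ge0.
pose C1 := (1 - rho)^-1.
have C1E : 1 + rho * C1 = C1 by rewrite /C1; field; lra.
have C10 : 0 <= C1 by rewrite invr_ge0; lra.
pose F N x := \sum_(j < N) (2 ^+ j) `^ q * hav (2^-1 ^+ j * x) ^+ K.
have FS N x : F N.+1 x = hav x ^+ K + 2 `^ q * F N (x / 2).
  rewrite /F big_ord_recl !expr0 powR1 !mul1r; congr (_ + _).
  rewrite mulr_sumr; apply: eq_bigr => j _; rewrite lift0.
  rewrite !powR2X exprS -mulrA; congr (_ * (_ * hav _ ^+ _)).
  by rewrite exprS; ring.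
have havK x : hav x ^+ K <= `|x| ^+ K.*2.
  rewrite -mul2n exprM lerXn2r ?nnegrE ?hav_ge0 ?sqr_ge0//.
  apply: le_trans (hav_le_sqr x) _; rewrite real_normK ?num_real//.
  by have := sqr_ge0 x; lra.
have small N x : `|x| <= 1 -> F N x <= C1 * `|x| ^+ K.*2.
  elim: N x => [|N ih] x x1.
    by rewrite /F big_ord0 mulr_ge0// exprn_ge0.
  have x2 : `|x / 2| <= 1.
    by rewrite normrM (gtr0_norm (_ : 0 < 2^-1)) ?invr_gt0//; lra.
  rewrite FS -C1E mulrDl mul1r; apply: lerD => //.
  apply: (@le_trans _ _ (2 `^ q * (C1 * `|x / 2| ^+ K.*2))).
    by rewrite ler_wpM2l ?powR_ge0//; exact: ih.
  rewrite normrM (gtr0_norm (_ : 0 < 2^-1)) ?invr_gt0// exprMn exprVn.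
  by rewrite le_eqVlt; apply/orP; left; apply/eqP; rewrite /rho; ring.
pose A := 2 + 2 `^ q * C1.
have q2 : 2 <= 2 `^ q :> R.
  by rewrite -{1}(@powRr1 _ 2)// ler_powR// ler1n.
(* The subtracted 1 carries the induction: one halving turns it into 2^q >= 2, which pays for hav
   x^K <= 1 and restores it. For 1 <= |x| < 2 the halved point is in the small range, for which [A]
   leaves room. *)
have large N x : 1 <= `|x| -> F N x <= A * `|x| `^ q - 1.
  elim: N x => [|N ih] x x1.
    rewrite /F big_ord0 subr_ge0.
    have : 1 <= `|x| `^ q.
      by have := ge0_ler_powR q0 _ _ x1; rewrite powR1; apply; rewrite nnegrE.
    have : 2 <= A by rewrite lerDl mulr_ge0// powR_ge0.
    by nra.
  have h1 : hav x ^+ K <= 1 by rewrite exprn_ile1 ?hav_ge0 ?hav_le1.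
  have xq : 1 <= `|x| `^ q.
    by have := ge0_ler_powR q0 _ _ x1; rewrite powR1; apply; rewrite nnegrE.
  have nx2 : `|x / 2| = `|x| / 2 by rewrite normrM (gtr0_norm (_ : 0 < 2^-1)) ?invr_gt0.
  rewrite FS; have [x2|x2] := leP 2 `|x|.
    have := ih (x / 2); rewrite nx2 => /(_ ltac:(lra)) h2.
    have : 2 `^ q * F N (x / 2) <= 2 `^ q * (A * (`|x| / 2) `^ q - 1).
      by rewrite ler_wpM2l// powR_ge0.
    have -> : 2 `^ q * (A * (`|x| / 2) `^ q - 1) = A * `|x| `^ q - 2 `^ q.
      have -> : `|x| `^ q = (2 * (`|x| / 2)) `^ q by congr (_ `^ _); field.
      by rewrite (@powRM _ 2 (`|x| / 2)) ?divr_ge0//; ring.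
    lra.
  have := small N (x / 2); rewrite nx2 => /(_ ltac:(lra)) h2.
  have : 2 `^ q * F N (x / 2) <= 2 `^ q * C1.
    rewrite ler_wpM2l ?powR_ge0//; apply: le_trans h2 _.
    rewrite ler_piMr// exprn_ile1 ?divr_ge0//; lra.
  have : 0 <= 2 `^ q * C1 by rewrite mulr_ge0// powR_ge0.
  rewrite /A; nra.
exists (C1 + A); first by rewrite !addr_ge0// mulr_ge0// powR_ge0.
move=> x N; rewrite -/(F N x).
have A0 : 0 <= A by rewrite addr_ge0// mulr_ge0// powR_ge0.
have [x1|x1] := leP `|x| 1; last first.
  have h0 : 0 <= C1 * `|x| `^ q by rewrite mulr_ge0// powR_ge0.
  apply: le_trans (large N x (ltW x1)) _.
  have -> : (C1 + A) * `|x| `^ q = C1 * `|x| `^ q + A * `|x| `^ q by ring.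
  by move: (A * _) h0 => t; lra.
apply: le_trans (small N x x1) _.
apply: (@le_trans _ _ (C1 * `|x| `^ q)); last first.
  by rewrite mulrDl lerDl mulr_ge0// powR_ge0.
rewrite ler_wpM2l//; have [x0|x0] := eqVneq `|x| 0.
  have K0 : (0 < K.*2)%N by rewrite -(ltr_nat R); lra.
  by rewrite x0 powR0 ?expr0n ?gtn_eqF//; lra.
rewrite -powR_mulrn//; apply: ger_powR; last exact: ltW.
by rewrite lt_def x0 normr_ge0 x1.
Qed.

End dyadic_moments.

(** * From moments of haversines to absolute moments *)

Section moment_of_cf.
Context d {Omega : measurableType d} {R : realType} (P : probability Omega R).
Variables (a : R) (nu : {measure set R -> \bar R}).
Hypotheses (a0 : 0 <= a) (nu_levy : levy_measure nu).

Lemma measurable_norm_powR d' (S : measurableType d') (X : S -> R) (q : R) :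
  measurable_fun setT X -> measurable_fun setT (fun w => `|X w| `^ q).
Proof.
move=> mX; apply: (@measurableT_comp _ _ _ _ _ _ (fun x : R => x `^ q)).
  exact: measurable_powR.
exact: measurableT_comp.
Qed.

(** The one scale of the lower bound is dominated by the sum over all scales, which is integrated
    term by term. *)
Lemma dyadic_hav_moment (q C B : R) (K : nat) (X : Omega -> R) :
  measurable_fun setT X -> 0 <= C ->
  (forall x : R, exists j : nat,
     `|x| `^ q <= 1 + C * ((2 ^+ j) `^ q * hav (2^-1 ^+ j * x) ^+ K)) ->
  (forall M, \sum_(j < M) (2 ^+ j) `^ q * \int[P]_w hav (2^-1 ^+ j * X w) ^+ K <= B) ->
  (\int[P]_w (`|X w| `^ q)%:E <= (1 + C * B)%:E)%E.
Proof.
move=> mX C0 HC HB.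
pose F j w := (2 ^+ j) `^ q * hav (2^-1 ^+ j * X w) ^+ K.
have F0 j w : 0 <= F j w by rewrite mulr_ge0 ?powR_ge0// exprn_ge0// hav_ge0.
have mFj j : measurable_fun setT (F j).
  by apply: measurable_funM => //; apply: measurable_hav_comp; exact: measurable_funM.
pose G w := (\sum_(0 <= j <oo) (F j w)%:E)%E.
have G0 w : (0 <= G w)%E by apply: nneseries_ge0 => j _ _; rewrite lee_fin.
have mG : measurable_fun setT G.
  apply: ge0_emeasurable_sum => [j w _ _|j _]; first by rewrite lee_fin.
  exact/measurable_EFinP.
have iG : (\int[P]_w G w <= B%:E)%E.
  rewrite integral_nneseries//; last by move=> *; rewrite lee_fin.
    apply: lime_le.
      apply: is_cvg_nneseries => j _ _; apply: integral_ge0 => w _.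
      by rewrite lee_fin.
    apply: nearW => M; apply: le_trans (_ : (\sum_(j < M) (2 ^+ j) `^ q *
        \int[P]_w hav (2^-1 ^+ j * X w) ^+ K)%:E <= _)%E; last by rewrite lee_fin.
    rewrite big_mkord -sumEFin; apply: lee_sum => j _.
    rewrite -RintegralZl//; last by apply: integrable_hav_comp; exact: measurable_funM.
    rewrite /Rintegral fineK//; apply: integrable_fin_num => //.
    apply: integrable_EFinZl => //.
    by apply: integrable_hav_comp; exact: measurable_funM.
  by move=> j; exact/measurable_EFinP.
apply: (@le_trans _ _ (\int[P]_w (1%:E + C%:E * G w))%E).
  apply: ge0_le_integral => //.
  - by apply/measurable_EFinP; exact: measurable_norm_powR.
  - by apply: emeasurable_funD => //; exact: measurable_funeM.
  move=> w _; have [j hj] := HC (X w); rewrite -/(F j w) in hj.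
  apply: (@le_trans _ _ (1 + C * F j w)%:E); first by rewrite lee_fin.
  rewrite EFinD EFinM leeD2l// lee_wpmul2l ?lee_fin//.
  apply: le_trans (_ : \sum_(0 <= i < j.+1) (F i w)%:E <= _)%E; last first.
    by apply: nneseries_lim_ge => i _ _; rewrite lee_fin.
  rewrite big_nat_recr//= leeDr//.
  by apply: sume_ge0 => i _; rewrite lee_fin.
rewrite ge0_integralD//; last 2 first.
- by move=> w _; rewrite mule_ge0.
- exact: measurable_funeM.
have -> : (\int[P]__ 1 = 1)%E.
  by rewrite integral_cst// mul1e; exact: probability_setT.
rewrite ge0_integralZl// EFinD EFinM.
by rewrite leeD2l// lee_wpmul2l// lee_fin.
Qed.

(** The Gronwall inequality runs along the whole semigroup 0 <= r <= 1, so a variable with the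
    required law must exist for each such r. *)
Definition has_cf_family : Prop :=
  forall (N : nat) (D c : nat -> R), (forall i, 0 <= D i) ->
  exists X : R -> Omega -> R, (forall r, measurable_fun setT (X r)) /\
    forall r mu, 0 <= r <= 1 -> \int[P]_w cos (mu * X r w) =
      expR (- (r * \sum_(i < N) D i * psi a nu (mu * c i))).

(** The [D i] stand for lengths of sets and the [c i] for values of a simple function. The constant
    depends only on the bound [b] for the total length, so that the estimate survives limits of
    simple functions. *)
Definition moment_bound_hyp (p q : R) : Prop :=
  forall b : R, exists2 K : R, 0 <= K &
  forall (N : nat) (D c : nat -> R) (X : Omega -> R),
  (forall i, 0 <= D i) -> \sum_(i < N) D i <= b ->
  measurable_fun setT X ->
  (forall mu, \int[P]_w cos (mu * X w) =
     expR (- \sum_(i < N) D i * psi a nu (mu * c i))) ->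
  (\int[P]_w (`|X w| `^ q)%:E <=
     (K * (\sum_(i < N) D i * `|c i| `^ p) `^ (q / p))%:E)%E.

(** Both sides are homogeneous of degree q in (X, c), so it suffices to treat sums that are at most
    1. *)
Lemma moment_of_dyadic_bound (p q : R) (k : nat) :
  has_cf_family -> (a = 0 \/ (0 < k)%N) -> 0 < p -> 0 < q ->
  (forall b : R, exists B : R, forall (N : nat) (D c : nat -> R) (M : nat),
     (forall i, 0 <= D i) -> \sum_(i < N) D i <= b ->
     \sum_(i < N) D i * `|c i| `^ p <= 1 ->
     \sum_(j < M) (2 ^+ j) `^ q * (hav2_levy a nu N D (fun i => 2^-1 ^+ j * c i) ^+ k.+1 +
        havK_levy nu k.+1 N D (fun i => 2^-1 ^+ j * c i)) <= B) ->
  moment_bound_hyp p q.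
Proof.
move=> fam ak p0 q0 HB b.
have [B hB] := HB b; have [C C0 HC] := hav_moment P a0 nu_levy ak.
have [C1 C10 HC1] := @dyadic_lower R q k.+1 (ltW q0).
pose K := 1 + C1 * (C * `|B|).
have K0 : 0 <= K by rewrite addr_ge0// !mulr_ge0.
have unit (N : nat) (D c : nat -> R) (X : Omega -> R) : (forall i, 0 <= D i) -> \sum_(i < N) D i <= b ->
    measurable_fun setT X ->
    (forall mu, \int[P]_w cos (mu * X w) =
       expR (- \sum_(i < N) D i * psi a nu (mu * c i))) ->
    \sum_(i < N) D i * `|c i| `^ p <= 1 ->
    (\int[P]_w (`|X w| `^ q)%:E <= K%:E)%E.
  move=> D0 Db mX cfX S1; apply: (@dyadic_hav_moment q C1 (C * `|B|) k.+1) => // M.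
  apply: (@le_trans _ _ (C * (\sum_(j < M) (2 ^+ j) `^ q *
      (hav2_levy a nu N D (fun i => 2^-1 ^+ j * c i) ^+ k.+1 +
        havK_levy nu k.+1 N D (fun i => 2^-1 ^+ j * c i))))); last first.
    by rewrite ler_wpM2l//; apply: le_trans (ler_norm B); exact: hB.
  rewrite mulr_sumr; apply: ler_sum => j _.
  rewrite mulrCA ler_wpM2l ?powR_ge0//.
  have [Y [mY cfY]] := fam N D (fun i => 2^-1 ^+ j * c i) D0.
  apply: le_trans (HC N D _ Y D0 mY cfY).
  (* The expectation of a trigonometric polynomial depends on the characteristic function only, so
     [X] may be replaced by the member [Y 1] of the semigroup. *)
  have [s hs] := @hav_trig_polynomial R k.+1.
  have E (V : Omega -> R) (mV : measurable_fun setT V) : \int[P]_w hav (V w) ^+ k.+1 =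
      \sum_(r <- s) r.1 * \int[P]_w cos (r.2 * V w).
    rewrite (@eq_Rintegral _ _ _ _ _ (fun w => \sum_(r <- s) r.1 * cos (r.2 * V w)));
      last by move=> w _; rewrite hs.
    rewrite Rintegral_sum//; last first.
      by move=> r; apply: integrable_EFinZl => //; exact: integrable_cos_comp.
    by apply: eq_bigr => r _; rewrite RintegralZl//; exact: integrable_cos_comp.
  rewrite E; last exact: measurable_funM.
  rewrite E// le_eqVlt; apply/orP; left; apply/eqP; apply: eq_bigr => r _; congr (_ * _).
  rewrite cfY ?ler01 ?lexx// mul1r.
  rewrite (@eq_Rintegral _ _ _ _ _ (fun w => cos ((r.2 * 2^-1 ^+ j) * X w))).
    by rewrite cfX; congr expR; congr (- _); apply: eq_bigr => i _; rewrite mulrA.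
  by move=> w _; rewrite mulrA.
exists K => // N D c X D0 Db mX cfX.
set S := \sum_(i < N) D i * `|c i| `^ p.
have S0 : 0 <= S by apply: sumr_ge0 => i _; rewrite mulr_ge0 ?powR_ge0.
have scaled (l : R) : 0 < l -> l `^ p * S <= 1 ->
    ((l `^ q)%:E * \int[P]_w (`|X w| `^ q)%:E <= K%:E)%E.
  move=> l0 lS; rewrite -ge0_integralZl ?lee_fin ?powR_ge0//; last first.
    by apply/measurable_EFinP; exact: measurable_norm_powR.
  rewrite (eq_integral (fun w => (`|l * X w| `^ q)%:E)); last first.
    by move=> w _; rewrite normrM (gtr0_norm l0) powRM ?(ltW l0)// EFinM.
  apply: (@unit N D (fun i => l * c i) (fun w => l * X w)) => //.
  - exact: measurable_funM.
  - move=> mu; rewrite (@eq_Rintegral _ _ _ _ _ (fun w => cos ((mu * l) * X w))).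
      by rewrite cfX; congr expR; congr (- _); apply: eq_bigr => i _; rewrite mulrA.
    by move=> w _; rewrite mulrA.
  - apply: le_trans lS; rewrite mulr_sumr; apply: ler_sum => i _.
    by rewrite normrM (gtr0_norm l0) powRM ?(ltW l0)// mulrCA.
(* For S = 0 every scaling is admissible, and arbitrarily large scalings force the moment to vanish.
   Otherwise scaling by S^(-1/p) normalises the sum to 1. *)
have [S1|S1] := eqVneq S 0.
  rewrite S1 powR0 ?mulr0; last by rewrite mulf_neq0 ?invr_eq0 ?gt_eqF.
  apply/lee_addgt0Pr => e e0; rewrite add0e.
  pose l := (K / e + 1) `^ (q^-1).
  have Ke : 0 < K / e + 1 by rewrite ltr_wpDl// divr_ge0// ltW.
  have lq : l `^ q = K / e + 1.
    by rewrite /l -powRrM mulVf ?gt_eqF// powRr1// ltW.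
  have := scaled l (powR_gt0 _ Ke); rewrite S1 mulr0 => /(_ ler01).
  rewrite lq muleC -lee_pdivlMr// => /le_trans; apply; rewrite lee_fin.
  by rewrite ler_pdivrMr// mulrDr mulrCA divff ?gt_eqF// mulr1 mulr1 lerDl ltW.
have {S1}S1 : 0 < S by rewrite lt_def S1 S0.
have := scaled (S `^ (- p^-1)) (powR_gt0 _ S1).
rewrite -powRrM mulNr mulVf ?gt_eqF// powRN powRr1// mulVf ?gt_eqF// => /(_ (lexx _)).
rewrite -powRrM mulNr powRN muleC.
have Sq : 0 < S `^ (p^-1 * q) by exact: powR_gt0.
rewrite lee_pdivrMr//; first by rewrite EFinM [(q / p)]mulrC.
Qed.

Lemma integrable_norm_powR (q : R) : finite_moment q nu ->
  nu.-integrable setT (EFin \o (fun x : R => `|x| `^ q)).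
Proof.
move=> fm; apply/integrableP; split.
  by apply/measurable_EFinP; exact: measurable_norm_powR.
rewrite (eq_integral (fun x : R => (`|x| `^ q)%:E))//.
by move=> x _; rewrite gee0_abs// lee_fin powR_ge0.
Qed.

(** The scales are summed under the integral against [nu], where [dyadic_upper] turns them into a
    power of |c i x|. *)
Lemma havK_levy_dyadic (q : R) (k : nat) :
  1 <= q -> q < (k.+1.*2)%:R -> finite_moment q nu ->
  exists2 C : R, 0 <= C & forall N (D c : nat -> R) (M : nat), (forall i, 0 <= D i) ->
    \sum_(j < M) (2 ^+ j) `^ q * havK_levy nu k.+1 N D (fun i => 2^-1 ^+ j * c i) <=
    C * \sum_(i < N) D i * `|c i| `^ q * \int[nu]_x `|x| `^ q.
Proof.
move=> q1 qk fm; have [C C0 HC] := dyadic_upper q1 qk; exists C => // N D c M D0.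
rewrite /havK_levy.
under eq_bigr do rewrite mulr_sumr.
rewrite exchange_big/= mulr_sumr; apply: ler_sum => i _.
have -> : \sum_(j < M) (2 ^+ j) `^ q * (D i * \int[nu]_x hav (2^-1 ^+ j * c i * x) ^+ k.+1) =
    D i * \int[nu]_x (\sum_(j < M) (2 ^+ j) `^ q * hav (2^-1 ^+ j * (c i * x)) ^+ k.+1).
  rewrite Rintegral_sum//; last first.
    move=> j; apply: integrable_EFinZl => //.
    under eq_fun do rewrite mulrA; exact: integrable_hav_levy.
  rewrite mulr_sumr; apply: eq_bigr => j _.
  rewrite mulrCA; congr (_ * _); rewrite RintegralZl//; last first.
    by under eq_fun do rewrite mulrA; exact: integrable_hav_levy.
  by congr (_ * _); apply: eq_Rintegral => x _; rewrite mulrA.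
have -> : C * (D i * `|c i| `^ q * \int[nu]_x `|x| `^ q) =
    D i * (C * `|c i| `^ q * \int[nu]_x `|x| `^ q) by ring.
rewrite ler_wpM2l//.
have im := integrable_norm_powR fm.
rewrite -RintegralZl//; apply: le_Rintegral => //.
- apply: integrable_EFin_sum => // j; apply: integrable_EFinZl => //.
  under eq_fun do rewrite mulrA; exact: integrable_hav_levy.
- exact: integrable_EFinZl.
- move=> x _; apply: le_trans (HC _ _) _; rewrite normrM powRM//.
  by rewrite mulrA.
Qed.

(** For p < 2 the first power of [hav] is enough. Without Gaussian part [hav2_levy] and [havK_levy]
    then coincide, whence the factor 2. *)
Lemma moment_bound_small (p : R) : has_cf_family -> a = 0 -> 1 <= p -> p < 2 ->
  finite_moment p nu -> moment_bound_hyp p p.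
Proof.
move=> fam aE p1 p2 fm; have p0 : 0 < p by lra.
apply: (@moment_of_dyadic_bound p p 0) => //; first by left.
move=> b; have [C C0 HC] := @havK_levy_dyadic p 0 p1 p2 fm.
exists (2 * (C * \int[nu]_x `|x| `^ p)) => N D c M D0 Db S1.
have -> : \sum_(j < M) (2 ^+ j) `^ p * (hav2_levy a nu N D (fun i => 2^-1 ^+ j * c i) ^+ 1 +
    havK_levy nu 1 N D (fun i => 2^-1 ^+ j * c i)) =
  2 * \sum_(j < M) (2 ^+ j) `^ p * havK_levy nu 1 N D (fun i => 2^-1 ^+ j * c i).
  rewrite mulr_sumr; apply: eq_bigr => j _.
  have -> : hav2_levy a nu N D (fun i => 2^-1 ^+ j * c i) =
      havK_levy nu 1 N D (fun i => 2^-1 ^+ j * c i).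
    by apply: eq_bigr => i _; rewrite aE !mul0r addr0.
  by rewrite expr1; ring.
rewrite ler_wpM2l//; apply: le_trans (HC N D c M D0) _.
rewrite -mulr_suml mulrA ler_wpM2r//.
  by apply: Rintegral_ge0 => x _; rewrite powR_ge0.
by rewrite -[leRHS]mulr1 ler_wpM2l.
Qed.

(** With q < 2 (k + 1) the second-order terms form a geometric series in the scale. The second
    moment of [nu] is finite because q >= 2, and c^2 <= 1 + |c|^p reduces it to the normalised sum;
    here the bound on the total length enters. The jump term yields the exponent q instead of p, so
    either p = q or the q-th moment of [nu] vanishes. *)
Lemma moment_bound_large (p q : R) : has_cf_family -> 2 <= p -> 2 <= q ->
  finite_moment q nu -> p = q \/ \int[nu]_x `|x| `^ q = 0 ->
  moment_bound_hyp p q.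
Proof.
move=> fam p2 q2 fm pq; have p0 : 0 < p by lra. have q0 : 0 < q by lra.
have q1 : 1 <= q by lra.
have [k k0 qk] : exists2 k, (0 < k)%N & q < (k.+1.*2)%:R.
  exists (Num.bound q).+1 => //.
  by apply: lt_le_trans (archi_boundP (ltW q0)) _; rewrite ler_nat; lia.
apply: (@moment_of_dyadic_bound p q k) => //; first by right.
move=> b; have [C C0 HC] := @havK_levy_dyadic q k q1 qk fm.
have i2 : nu.-integrable setT (EFin \o (fun x : R => x ^+ 2)).
  have imin : nu.-integrable setT (EFin \o (fun x : R => Num.min (x ^+ 2) 1)).
    apply/integrableP; split.
      by apply/measurable_EFinP; apply: measurable_minr => //; exact: measurable_funX.
    rewrite (eq_integral (fun x : R => (Num.min (x ^+ 2) 1)%:E)); first by case: nu_levy.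
    by move=> x _; rewrite gee0_abs// lee_fin le_min sqr_ge0 ler01.
  apply: (le_integrable measurableT (g := EFin \o (fun x : R => Num.min (x ^+ 2) 1 + `|x| `^ q))).
  - by apply/measurable_EFinP; exact: measurable_funX.
  - move=> x _ /=; rewrite lee_fin ger0_norm ?sqr_ge0// ger0_norm; last first.
      by rewrite addr_ge0 ?powR_ge0// le_min sqr_ge0 ler01.
    rewrite /Num.min; case: ifPn => [_|]; first by rewrite lerDl powR_ge0.
    rewrite -leNgt => x1; have nx1 : 1 <= `|x|.
      rewrite leNgt; apply/negP => h; have := normr_ge0 x.
      by rewrite -(real_normK (num_real x)) in x1; nra.
    rewrite -(real_normK (num_real x)) -powR_mulrn//.
    apply: (@le_trans _ _ (`|x| `^ q)); last by rewrite lerDr.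
    exact: ler_powR.
  - by apply: integrable_EFinD => //; exact: integrable_norm_powR.
pose m2 := \int[nu]_x x ^+ 2.
have m20 : 0 <= m2 by apply: Rintegral_ge0 => x _; rewrite sqr_ge0.
pose mq := \int[nu]_x `|x| `^ q.
have mq0 : 0 <= mq by apply: Rintegral_ge0 => x _; rewrite powR_ge0.
pose rho : R := 2 `^ q / 2 ^+ k.+1.*2.
have rho1 : rho < 1 by exact: powR2_lt_expr.
have rho0 : 0 <= rho by rewrite divr_ge0 ?powR_ge0 ?exprn_ge0.
pose L := (m2 + a) / 4 * (`|b| + 1).
have L0 : 0 <= L by rewrite mulr_ge0 ?addr_ge0 ?divr_ge0// addr_ge0.
exists (L ^+ k.+1 * (1 - rho)^-1 + C * mq) => N D c M D0 Db S1.
under eq_bigr do rewrite mulrDr.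
rewrite big_split/= lerD//; last first.
  apply: le_trans (HC N D c M D0) _; rewrite -mulr_suml ler_wpM2l//.
  case: pq => [pq|->]; last by rewrite !mulr0 /mq.
  by rewrite -/mq -pq -[leRHS]mul1r ler_wpM2r// pq.
have c2 : \sum_(i < N) D i * c i ^+ 2 <= `|b| + 1.
  apply: (@le_trans _ _ (\sum_(i < N) (D i + D i * `|c i| `^ p))).
    apply: ler_sum => i _; rewrite -{2}[D i]mulr1 -mulrDr ler_wpM2l//.
    have [h|h] := leP `|c i| 1.
      apply: (@le_trans _ _ 1); last by rewrite lerDl powR_ge0.
      by rewrite -real_normK ?num_real// exprn_ile1.
    rewrite -real_normK ?num_real// -powR_mulrn//.
    apply: (@le_trans _ _ (`|c i| `^ p)); last by rewrite lerDr.
    by apply: ler_powR => //; exact: ltW.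
  by rewrite big_split/= lerD// (le_trans Db)// ler_norm.
have h2 (j : nat) : hav2_levy a nu N D (fun i => 2^-1 ^+ j * c i) <= (2^-1 ^+ j) ^+ 2 * L.
  apply: (@le_trans _ _ (\sum_(i < N) (2^-1 ^+ j) ^+ 2 * ((m2 + a) / 4) * (D i * c i ^+ 2))).
    apply: ler_sum => i _.
    have -> : (2^-1 ^+ j) ^+ 2 * ((m2 + a) / 4) * (D i * c i ^+ 2) =
       D i * (((2^-1 ^+ j * c i) ^+ 2 / 4) * m2 + a * (2^-1 ^+ j * c i) ^+ 2 / 4) by field.
    rewrite ler_wpM2l// lerD2r -RintegralZl//; apply: le_Rintegral => //.
    - by have := integrable_hav_levy nu_levy (2^-1 ^+ j * c i) 0; under eq_fun do rewrite expr1.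
    - exact: integrable_EFinZl.
    - move=> x _; apply: le_trans (hav_le_sqr _) _; rewrite exprMn; lra.
  rewrite -mulr_sumr -mulrA ler_wpM2l ?sqr_ge0//.
  by rewrite ler_wpM2l// divr_ge0// addr_ge0.
apply: (@le_trans _ _ (\sum_(j < M) L ^+ k.+1 * rho ^+ j)).
  apply: ler_sum => j _.
  apply: (@le_trans _ _ ((2 ^+ j) `^ q * ((2^-1 ^+ j) ^+ 2 * L) ^+ k.+1)).
    rewrite ler_wpM2l ?powR_ge0// lerXn2r ?nnegrE//.
      apply: sumr_ge0 => i _; rewrite mulr_ge0// addr_ge0//.
        by apply: Rintegral_ge0 => x _; exact: hav_ge0.
      by rewrite divr_ge0// mulr_ge0// sqr_ge0.
    by rewrite mulr_ge0// sqr_ge0.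
  rewrite powR2X exprMn le_eqVlt; apply/orP; left; apply/eqP.
  have -> : ((2^-1 ^+ j) ^+ 2) ^+ k.+1 = ((2 ^+ k.+1.*2)^-1) ^+ j :> R.
    by rewrite -exprVn; exact: expr_sqr_swap.
  have -> : rho ^+ j = (2 `^ q) ^+ j * (2 ^+ k.+1.*2)^-1 ^+ j by rewrite -exprMn.
  by ring.
rewrite -mulr_sumr ler_wpM2l ?exprn_ge0//; exact: geo_sum_le.
Qed.

End moment_of_cf.

(** * Realisation of the convolution semigroup by increments *)

Section levy_moments.
Context d {Omega : measurableType d} {R : realType} (P : probability Omega R).
Variables (Z : R -> {RV P >-> R}) (a : R) (nu : {measure set R -> \bar R}).
Hypotheses (Z_levy : is_levy_process Z) (a0 : 0 <= a) (nu_levy : levy_measure nu)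
  (nu_sym : symmetric_measure nu) (Z_triplet : has_triplet Z a nu).

(** Consecutive increments of [Z] over intervals of lengths r D i have the required law; the maximum
    with 0 keeps the times nonnegative for all [r]. *)
Lemma levy_has_cf_family : has_cf_family P a nu.
Proof.
move=> N D c D0; pose t (r : R) i := Num.max 0 r * \sum_(j < i) D j.
exists (fun r w => \sum_(i < N) c i * (Z (t r i.+1) w - Z (t r i) w)); split.
  move=> r; apply: measurable_sum => i; apply: measurable_funM => //.
  by apply: measurable_funB; exact: measurable_funP.
move=> r mu /andP[r0 r1].
have [|i|-> _] := @levy_increments_cf _ _ _ P Z a nu Z_levy nu_levy nu_sym Z_triplet (t r) c N mu.
- by rewrite /t big_ord0 mulr0.
- by rewrite /t ler_wpM2l ?le_max ?lexx// big_ord_recr/= lerDl.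
congr expR; congr (- _); rewrite mulr_sumr; apply: eq_bigr => i _.
by rewrite /t max_r// big_ord_recr/= -mulrBr addrAC subrr add0r mulrA.
Qed.

End levy_moments.

(** * Scaling of the normal law and the exponent of a Brownian motion *)

Section normal_scaling.
Context {R : realType}.

Lemma normal_pdf_scale (s c y : R) : s != 0 -> 0 < c ->
  normal_pdf 0 (s * c) (c * y) * c = normal_pdf 0 s y.
Proof.
move=> s0 c0; have sc0 : s * c != 0 by rewrite mulf_neq0// gt_eqF.
rewrite !normal_pdfE// /normal_peak /normal_fun !subr0.
have -> : (s * c) ^+ 2 * trigo.pi *+ 2 = (s ^+ 2 * trigo.pi *+ 2) * c ^+ 2 by ring.
have h0 : 0 <= s ^+ 2 * trigo.pi *+ 2 by rewrite mulrn_wge0// mulr_ge0 ?sqr_ge0// pi_ge0.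
rewrite sqrtrM// sqrtr_sqr gtr0_norm//.
have -> : - (c * y) ^+ 2 / ((s * c) ^+ 2 *+ 2) = - y ^+ 2 / (s ^+ 2 *+ 2).
  by field; rewrite s0 gt_eqF.
by rewrite invfM mulrAC -[_ / c * c]mulrA mulVf ?gt_eqF// mulr1.
Qed.

Lemma normal_prob_scale_ray (s c x : R) : s != 0 -> 0 < c ->
  normal_prob 0 (s * c) `]-oo, c * x]%classic = normal_prob 0 s `]-oo, x]%classic.
Proof.
move=> s0 c0; have sc0 : s * c != 0 by rewrite mulf_neq0// gt_eqF.
have dF : derive1 (fun y : R => c * y) = cst c.
  apply/funext => y; rewrite derive1E.
  have -> : (fun y : R => c * y) = c *: (id : R -> R) by [].
  by rewrite deriveZ// derive_id; exact: mulr1.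
have ddF (y : R) : derivable (fun y : R => c * y) y 1.
  have -> : (fun y : R => c * y) = c *: (id : R -> R) by [].
  exact: derivableZ.
have cF : continuous (fun y : R => c * y).
  by move=> y; apply: cvgM; [exact: cvg_cst|exact: cvg_id].
rewrite /normal_prob (@increasing_ge0_integration_by_substitutionNy _ (fun y => c * y)
  (normal_pdf 0 (s * c)) x).
- apply: eq_integral => y _; congr EFin.
  by rewrite -(@normal_pdf_scale s c y)// fctE/= dF.
- by move=> y z _ _ yz; rewrite ltr_pM2l.
- by rewrite dF => y _; exact: cvg_cst.
- by rewrite dF; exact: is_cvg_cst.
- by rewrite dF; exact: cvg_cst.
- split; first by move=> y _; exact: ddF.
  by apply: cvg_at_left_filter; exact: cF.
- exact: (gt0_cvgMrNy c0 cvg_id).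
- exact/continuous_subspaceT/continuous_normal_pdf.
- by move=> y _; exact: normal_pdf_ge0.
Qed.

End normal_scaling.

Section brownian_exponent.
Context d {Omega : measurableType d} {R : realType} (P : probability Omega R).

Lemma law_eq_of_rays (X Y : Omega -> R) :
  measurable_fun setT X -> measurable_fun setT Y ->
  (forall x : R, P (X @^-1` `]-oo, x]) = P (Y @^-1` `]-oo, x])) ->
  forall B, measurable B -> P (X @^-1` B) = P (Y @^-1` B).
Proof.
move=> mX mY h B mB.
pose QX : probability R R := distribution P (mfun_Sub (mem_set mX) : {mfun Omega >-> R}).
pose QY : probability R R := distribution P (mfun_Sub (mem_set mY) : {mfun Omega >-> R}).
have QXE A : QX A = P (X @^-1` A) by [].
have QYE A : QY A = P (Y @^-1` A) by [].
rewrite -QXE -QYE.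
apply: (measure_unique (@RGenOInfty.G R) (fun n => `](- n%:R)%R, +oo[%classic)) => //.
- exact: RGenOInfty.measurableE.
- move=> _ _ [x ->] [y ->]; exists (Num.max x y).
  by apply/seteqP; split => z /=; rewrite !in_itv/= !andbT gt_max => /andP.
- by move=> i; exists (- i%:R).
- apply/seteqP; split => // z _; exists (Num.bound `|z|) => //=.
  rewrite in_itv/= andbT ltrNl.
  apply: le_lt_trans (archi_boundP (normr_ge0 z)).
  by rewrite -normrN ler_norm.
- move=> A [x ->]; change (P (X @^-1` `]x, +oo[) = P (Y @^-1` `]x, +oo[)).
  have e (W : Omega -> R) : W @^-1` `]x, +oo[ = ~` (W @^-1` `]-oo, x]).
    by rewrite preimage_setC setCitvl.
  by rewrite !e !probability_setC ?h//; exact: measurable_preimageT.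
- by move=> k; rewrite (le_lt_trans (probability_le1 _ _))// ?ltry.
Qed.

(** Only the scaling of the normal law enters, and its characteristic function is never computed. *)
Lemma brownian_cos (Z : R -> {RV P >-> R}) (t mu : R) : is_brownian_motion Z -> 0 < t ->
  \int[P]_w cos (mu * (Z t w - Z 0 w)) =
  \int[P]_w cos (mu * (Num.sqrt t * (Z 1 w - Z 0 w))).
Proof.
move=> [sigma [s0 [_ _ law _]]] t0.
have mZ r : measurable_fun setT (Z r) by exact: measurable_funP.
have mD r : measurable_fun setT (Z r \- Z 0) by exact: measurable_funB.
have mD' : measurable_fun setT (fun w => Num.sqrt t * (Z 1 w - Z 0 w)).
  by apply: measurable_funM => //; exact: mD.
have st0 : 0 < Num.sqrt t by rewrite sqrtr_gt0.
apply: (@expectation_law_eq _ _ _ P (Z t \- Z 0) _ (fun x => cos (mu * x)) 1) => //.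
- exact: measurable_cosM.
- by move=> x; exact: cos_max.
apply: law_eq_of_rays => // x.
rewrite law ?lexx// subr0 -{1}(divfK (lt0r_neq0 st0) x) (mulrC (x / _)).
rewrite normal_prob_scale_ray ?gt_eqF//.
have -> : (fun w => Num.sqrt t * (Z 1 w - Z 0 w)) @^-1` `]-oo, x] =
    (Z 1 \- Z 0) @^-1` `]-oo, x / Num.sqrt t].
  by apply/seteqP; split => w /=; rewrite !in_itv/= ler_pdivlMr// mulrC.
rewrite law; [|exact: lexx|exact: ltr01|exact: measurable_itv].
by rewrite subr0 sqrtr1 mulr1.
Qed.

Variables (Z : R -> {RV P >-> R}) (a : R) (nu : {measure set R -> \bar R}).
Hypotheses (Z_levy : is_levy_process Z) (a0 : 0 <= a) (nu_levy : levy_measure nu)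
  (nu_sym : symmetric_measure nu) (Z_triplet : has_triplet Z a nu).

Lemma psi_mzero (b mu : R) : psi b (@mzero _ R R) mu = b * mu ^+ 2 / 2.
Proof. by rewrite /psi /Rintegral integral_measure_zero addr0. Qed.

(** At time mu^2 the scaling of the increments gives psi mu = mu^2 psi 1, which is a purely Gaussian
    exponent. *)
Lemma brownian_psi : is_brownian_motion Z ->
  psi a nu = psi (2 * psi a nu 1) (@mzero _ R R).
Proof.
move=> Z_bm; apply/funext => mu; rewrite psi_mzero.
have -> : 2 * psi a nu 1 * mu ^+ 2 / 2 = mu ^+ 2 * psi a nu 1 by field.
have [->|mu0] := eqVneq mu 0; first by rewrite psi0 expr0n mul0r.
have mu2 : 0 < mu ^+ 2 by rewrite exprn_even_gt0.
have := @brownian_cos Z (mu ^+ 2) 1 Z_bm mu2.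
have [-> _] := levy_increment_cos_sin Z_levy nu_levy nu_sym Z_triplet 1 (lexx 0) (ltW mu2).
rewrite subr0.
have -> : (fun w => cos (1 * (Num.sqrt (mu ^+ 2) * (Z 1 w - Z 0 w)))) =
    (fun w => cos (mu * (Z 1 w - Z 0 w))).
  apply/funext => w; rewrite mul1r sqrtr_sqr -cos_norm normrM normr_id -normrM.
  by rewrite cos_norm.
have [-> _] := levy_increment_cos_sin Z_levy nu_levy nu_sym Z_triplet mu (lexx 0) (@ler01 R).
by rewrite subr0 mul1r => /expR_inj /oppr_inj.
Qed.

Lemma levy_measure_mzero : levy_measure (@mzero _ R R).
Proof. by split => //; rewrite integral_measure_zero. Qed.

(** The moment bound depends on the triplet through [psi] only, so the triplet may be exchanged for
    a Gaussian one with zero Levy measure, all of whose moments are finite. *)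
Lemma moment_bound_brownian (q : R) : is_brownian_motion Z -> 2 <= q ->
  moment_bound_hyp P a nu 2 q.
Proof.
move=> Z_bm q2; have psiE := brownian_psi Z_bm.
have fam : has_cf_family P (2 * psi a nu 1) (@mzero _ R R).
  rewrite /has_cf_family -psiE.
  exact: (levy_has_cf_family Z_levy nu_levy nu_sym Z_triplet).
rewrite /moment_bound_hyp psiE; apply: (moment_bound_large _ _ fam) => //.
- by rewrite mulr_ge0// psi_ge0.
- exact: levy_measure_mzero.
- by rewrite /finite_moment integral_measure_zero.
- by right; rewrite /Rintegral integral_measure_zero.
Qed.

End brownian_exponent.

(** * Random measures and integrals *)

Section bounded_borel.
Context {R : realType}.

Definition bounded_borel (b : R) (A : set R) : Prop :=
  measurable A /\ A `<=` `]0, b]%classic.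

Definition leb (A : set R) : R := fine (lebesgue_measure A).

Lemma bounded_borel_itv (b s t : R) : 0 <= s -> t <= b -> bounded_borel b `]s, t]%classic.
Proof.
move=> s0 tb; split => // x /=; rewrite !in_itv/= => /andP[sx xt].
by rewrite (le_lt_trans s0 sx) (le_trans xt tb).
Qed.

Lemma bounded_borel_sub (b : R) (A B : set R) :
  bounded_borel b A -> measurable B -> B `<=` A -> bounded_borel b B.
Proof. by move=> [_ Ab] mB BA; split => //; exact: subset_trans Ab. Qed.

Lemma bounded_borel_le (b c : R) (A : set R) : b <= c ->
  bounded_borel b A -> bounded_borel c A.
Proof.
move=> bc [mA Ab]; split => // x /Ab /=; rewrite !in_itv/= => /andP[-> xb].
exact: le_trans bc.
Qed.

Lemma bounded_borelI (b : R) (A B : set R) :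
  bounded_borel b A -> measurable B -> bounded_borel b (A `&` B).
Proof.
move=> [mA Ab] mB; split; first exact: measurableI.
exact: subset_trans (@subIsetl _ _ _) Ab.
Qed.

Lemma lebesgue_bounded_borel_le (b : R) (A : set R) : bounded_borel b A ->
  (lebesgue_measure A <= (Num.max b 0)%:E)%E.
Proof.
move=> [mA Ab]; apply: (@le_trans _ _ (lebesgue_measure `]0%R, b]%classic)).
  by apply: le_measure; rewrite ?inE.
rewrite lebesgue_measure_itv/= lte_fin; case: ifPn => b0.
  by rewrite oppr0 adde0 lee_fin le_max lexx.
by rewrite lee_fin le_max lexx orbT.
Qed.

Lemma EFin_leb (b : R) (A : set R) : bounded_borel b A ->
  (leb A)%:E = lebesgue_measure A.
Proof.
move=> bA; rewrite /leb fineK// ge0_fin_numE ?measure_ge0//.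
exact: le_lt_trans (lebesgue_bounded_borel_le bA) (ltry _).
Qed.

Lemma leb_ge0 (A : set R) : 0 <= leb A.
Proof. by rewrite fine_ge0// measure_ge0. Qed.

Lemma lebU (b : R) (A B : set R) : bounded_borel b A -> bounded_borel b B ->
  A `&` B = set0 -> leb (A `|` B) = leb A + leb B.
Proof.
move=> bA bB AB; have bAB : bounded_borel b (A `|` B).
  by split; [exact: measurableU bA.1 bB.1|rewrite subUset; split; [exact: bA.2|exact: bB.2]].
apply/EFin_inj; rewrite EFinD (EFin_leb bA) (EFin_leb bB) (EFin_leb bAB).
by apply: measureU => //; [exact: bA.1|exact: bB.1].
Qed.

Lemma cvg_leb_sum (b : R) (F : nat -> set R) : (forall i, bounded_borel b (F i)) ->
  trivIset setT F -> \sum_(i < n) leb (F i) @[n --> \oo] --> leb (\bigcup_i F i).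
Proof.
move=> bF tF; have bU : bounded_borel b (\bigcup_i F i).
  split; first by apply: bigcupT_measurable => i; exact: (bF i).1.
  by apply: bigcup_sub => i _; exact: (bF i).2.
have h : (\sum_(0 <= i < n) lebesgue_measure (F i))%E @[n --> \oo] -->
    lebesgue_measure (\bigcup_i F i).
  by apply: measure_sigma_additive => // i; exact: (bF i).1.
rewrite -(EFin_leb bU) in h; move/fine_cvg in h.
rewrite [X in X @ _](_ : _ = fine \o (fun n => (\sum_(0 <= i < n) lebesgue_measure (F i))%E))//.
apply/funext => n /=; rewrite -[LHS]/(fine (\sum_(i < n) leb (F i))%:E) -sumEFin big_mkord.
by congr fine; apply: eq_bigr => i _; rewrite (EFin_leb (bF i)).
Qed.

Lemma leb_itv (s t : R) : s <= t -> leb `]s, t]%classic = t - s.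
Proof.
rewrite le_eqVlt => /predU1P[->|st]; rewrite /leb lebesgue_measure_itv/= lte_fin.
  by rewrite ltxx subrr.
by rewrite st -EFinB.
Qed.

(* The half-open intervals form a pi-system generating the Borel sets. *)
Lemma borel_dynkin_ind (H : set (set R)) : H setT ->
  (forall A, measurable A -> H A -> H (~` A)) ->
  (forall F : nat -> set R, (forall i, measurable (F i)) -> trivIset setT F ->
     (forall i, H (F i)) -> H (\bigcup_i F i)) ->
  (forall s t : R, H `]s, t]%classic) -> forall A, measurable A -> H A.
Proof.
move=> HT HC HU Hitv A mA.
pose H' := [set A | measurable A /\ H A].
suff : <<s (@ocitv R) >> `<=` H' by move=> /(_ A mA)[].
apply: (@lambda_system_subset _ _ (@ocitvI R) setT H') => //; last first.
  by move=> _ [x _ <-]; split.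
apply/dynkin_lambda_system; split.
- by split.
- by move=> B [mB HB]; split; [exact: measurableC|exact: HC].
- move=> F tF HF; split; first by apply: bigcupT_measurable => k; case: (HF k).
  by apply: HU => // i; case: (HF i).
Qed.

End bounded_borel.

Section random_measures.
Context d {Omega : measurableType d} {R : realType} (P : probability Omega R).
Variables (Z : R -> {RV P >-> R}) (L : set R -> {RV P >-> R}).
Hypothesis L_rm : is_random_measure_of Z L.

Lemma measurable_rm A : measurable_fun setT (L A).
Proof. exact: measurable_funP. Qed.

Lemma rm_indepN (b : R) (A : nat -> set R) N :
  (forall i, bounded_borel b (A i)) -> trivIset setT A ->
  indepN P (fun i => L (A i)) N.
Proof.
move=> bA tA; apply/indepNP; first by move=> i; exact: measurable_rm.
by apply: (@rmeas_independent _ _ _ _ _ _ L_rm A b) => // i; case: (bA i).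
Qed.

Lemma rm_series (b : R) (A : nat -> set R) :
  (forall i, bounded_borel b (A i)) -> trivIset setT A ->
  {ae P, forall w, \sum_(i < n) L (A i) w @[n --> \oo] --> L (\bigcup_i A i) w}.
Proof.
move=> bA tA; have := @rmeas_additive _ _ _ _ _ _ L_rm A b.
case/(_ _ _ _)/Wrap => [i|i||]; [exact: (bA i).1|exact: (bA i).2|by []|].
apply: filterS => w; rewrite (_ : series _ = fun n => \sum_(i < n) L (A i) w)//.
by apply/funext => n; rewrite /series/= big_mkord.
Qed.

(** Additivity for a constant sequence of empty sets makes the multiples n L set0 converge, so their
    constant step is 0. *)
Lemma rm0 : {ae P, forall w, L set0 w = 0}.
Proof.
have := @rm_series 0 (fun=> set0); case/(_ _ _)/Wrap => [_||].
- by split => //; exact: sub0set.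
- by apply/trivIsetP => i j _ _ _; rewrite setI0.
apply: filterS => w /cvgP; set u := fun n : nat => _ => cu.
have e n : u n.+1 - u n = L set0 w by rewrite /u big_ord_recr/= addrAC subrr add0r.
have h : u n.+1 - u n @[n --> \oo] --> lim (u n @[n --> \oo]) - lim (u n @[n --> \oo]).
  by apply: cvgB => //; rewrite (cvg_shiftS u).
rewrite subrr in h; apply: (cvg_unique _ _ h) => //.
rewrite [X in X @ _](_ : _ = cst (L set0 w)); first exact: cvg_cst.
by apply/funext => n; rewrite e.
Qed.

Lemma rmU (b : R) (A B : set R) : bounded_borel b A -> bounded_borel b B ->
  A `&` B = set0 -> {ae P, forall w, L (A `|` B) w = L A w + L B w}.
Proof.
move=> bA bB AB; rewrite -bigcup2E.
have := @rm_series b (bigcup2 A B); case/(_ _ _)/Wrap => [i||].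
- by case: i => [//|[//|i]]; split => //=; exact: sub0set.
- by apply/trivIsetP => -[|[|i]] [|[|j]] //= _ _ _; rewrite ?setI0 ?set0I// setIC.
apply: filterS2 rm0 => w L0 h; apply: (cvg_unique _ h) => //.
apply: (@cvg_trans _ (cst (L A w + L B w) @ \oo)); last exact: cvg_cst.
apply: near_eq_cvg; near=> n.
have n2 : (2 <= n)%N by near: n; exists 2%N.
rewrite -(subnK n2) addn2 -(big_mkord xpredT (fun i => L (bigcup2 A B i) w)).
rewrite !big_nat_recl//= big1 ?addr0// => i _; exact: L0.
Unshelve. all: by end_near. Qed.

Lemma rm_sum (J : eqType) (s : seq J) (b : R) (A : set R) (B : J -> set R) :
  bounded_borel b A -> (forall j, measurable (B j)) -> uniq s ->
  (forall i j, i \in s -> j \in s -> i != j -> B i `&` B j = set0) ->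
  (forall x, A x -> exists2 j, j \in s & B j x) ->
  {ae P, forall w, L A w = \sum_(j <- s) L (A `&` B j) w}.
Proof.
move=> + mB; elim: s A => [|j s ih] A bA /=.
  move=> _ _ As; have -> : A = set0 by apply/seteqP; split => // x /As[].
  by apply: filterS rm0 => w ->; rewrite big_nil.
case/andP => js us dis As.
have bD : bounded_borel b (A `\` B j).
  by apply: (bounded_borel_sub bA); [exact: measurableD bA.1 (mB j)|exact: subDsetl].
have := ih (A `\` B j) bD us; case/(_ _ _)/Wrap.
- by move=> i k si ks; apply: dis; rewrite inE ?si ?ks orbT.
- move=> x [Ax Bx]; case: (As x Ax) => i; rewrite inE => /predU1P[->//|si Bi].
  by exists i.
have := rmU (bounded_borelI bA (mB j)) bD _.
case/(_ _)/Wrap; first by rewrite setDE setIACA setICr setI0.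
rewrite setUIDK; apply: filterS2 => w -> ->; rewrite big_cons; congr (_ + _).
apply: eq_big_seq => i si; congr (L _ w).
rewrite setDE -setIA; congr (_ `&` _); apply/setIidPr => x Bi Bj.
have ij : j != i by apply: contraNneq js => ->.
by have : (B j `&` B i) x by []; rewrite (dis j i) ?inE ?eqxx ?si ?orbT.
Qed.

Lemma measurable_preimage_sfun (f : {sfun R >-> R}) (y : R) :
  measurable (f @^-1` [set y]).
Proof. exact: measurable_sfunP. Qed.

Definition srange (f : {sfun R >-> R}) : seq R :=
  finmap.enum_fset (fset_set (range f)).

Lemma srange_uniq f : uniq (srange f).
Proof. exact: finmap.fset_uniq. Qed.

Lemma sfun_range_seq (f : {sfun R >-> R}) (x : R) :
  f x \in srange f.
Proof. by apply: (etrans (in_fset_set (fimfunP f) (f x))); apply: mem_set; exists x. Qed.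

Lemma elementary_integralE (A : set R) (f : {sfun R >-> R}) (w : Omega) :
  elementary_integral L A f w =
  \sum_(y <- srange f) y * L (A `&` f @^-1` [set y]) w.
Proof. by rewrite /elementary_integral fsbig_finite. Qed.

Lemma measurable_elementary (A : set R) (f : {sfun R >-> R}) :
  measurable_fun setT (elementary_integral L A f).
Proof.
rewrite (_ : elementary_integral L A f = fun w =>
  \sum_(y <- srange f) y * L (A `&` f @^-1` [set y]) w); last first.
  by apply/funext => w; rewrite elementary_integralE.
by apply: measurable_sum => y; apply: measurable_funM => //; exact: measurable_rm.
Qed.

Lemma ae_seq (J : eqType) (s : seq J) (Q : J -> Omega -> Prop) :
  (forall j, j \in s -> {ae P, forall w, Q j w}) ->
  {ae P, forall w, forall j, j \in s -> Q j w}.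
Proof.
elim: s => [|i s ih] h; first exact: aeW.
have h1 := ih (fun j js => h j (mem_behead (s := i :: s) js)).
apply: filterS2 (h i (mem_head _ _)) h1 => w Qi Qs j.
by rewrite inE => /predU1P[->|/Qs].
Qed.

(** An elementary integral may be computed on any partition on which [f] is constant: both sums are
    refined by intersecting with the level sets, and the pieces with a wrong value are empty. *)
Lemma elementary_partition (J : eqType) (s : seq J) (b : R) (A : set R)
    (B : J -> set R) (c : J -> R) (f : {sfun R >-> R}) :
  bounded_borel b A -> (forall j, measurable (B j)) -> uniq s ->
  (forall i j, i \in s -> j \in s -> i != j -> B i `&` B j = set0) ->
  (forall x, A x -> exists2 j, j \in s & B j x) ->
  (forall j x, j \in s -> A x -> B j x -> f x = c j) ->
  {ae P, forall w, elementary_integral L A f w = \sum_(j <- s) c j * L (A `&` B j) w}.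
Proof.
move=> bA mB us dis As fc; set r := srange f.
have mf y : measurable (f @^-1` [set y]) by exact: measurable_preimage_sfun.
have h1 : {ae P, forall w, forall y, y \in r ->
    L (A `&` f @^-1` [set y]) w = \sum_(j <- s) L (A `&` f @^-1` [set y] `&` B j) w}.
  apply: ae_seq => y _; apply: (rm_sum (bounded_borelI bA (mf y))) => // x [Ax _].
  exact: As.
have h2 : {ae P, forall w, forall j, j \in s ->
    L (A `&` B j) w = \sum_(y <- r) L (A `&` B j `&` f @^-1` [set y]) w}.
  apply: ae_seq => j _; apply: (rm_sum (bounded_borelI bA (mB j))) => //.
  - exact: srange_uniq.
  - by move=> y z _ _ yz; apply/seteqP; split => // x [/= -> zy]; rewrite zy eqxx in yz.
  - by move=> x _; exists (f x) => //; exact: sfun_range_seq.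
have := rm0; move: h1 h2; apply: filterS3 => w h1 h2 L0.
rewrite elementary_integralE -/r.
under eq_big_seq => y yr do rewrite h1// mulr_sumr.
under [RHS]eq_big_seq => j js do rewrite h2// mulr_sumr.
rewrite exchange_big/=; apply: eq_big_seq => j js; apply: eq_bigr => y _.
rewrite setIAC; have [->//|/eqP yc] := eqVneq y (c j).
rewrite (_ : _ `&` _ = set0) ?L0 ?mulr0//; apply/seteqP; split => // x [[Ax Bx] fx].
by apply: yc; rewrite -(fc j x).
Qed.

Lemma joint_preimage_partition (f g : {sfun R >-> R}) :
  let s := [seq (y, z) | y <- srange f, z <- srange g] in
  let B (yz : R * R) := f @^-1` [set yz.1] `&` g @^-1` [set yz.2] in
  [/\ forall j, measurable (B j), uniq s,
    forall i j, i \in s -> j \in s -> i != j -> B i `&` B j = set0 &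
    forall x, exists2 j, j \in s & B j x].
Proof.
move=> s B; split.
- by move=> j; apply: measurableI; exact: measurable_preimage_sfun.
- by apply: allpairs_uniq => [||[? ?] [? ?] _ _ /= [-> ->]]//; exact: srange_uniq.
- move=> [y z] [y' z'] _ _ ne; apply/seteqP; split => // x /= [[/= fy gz] [/= fy' gz']].
  by move: ne; rewrite -fy -fy' -gz -gz' eqxx.
- move=> x; exists (f x, g x) => //.
  by apply/allpairsP; exists (f x, g x); split => //; exact: sfun_range_seq.
Qed.

Lemma elementary_integralB (b : R) (A : set R) (f g : {sfun R >-> R}) :
  bounded_borel b A -> {ae P, forall w, elementary_integral L A (f - g) w =
    elementary_integral L A f w - elementary_integral L A g w}.
Proof.
move=> bA; have [mB us dis cov] := joint_preimage_partition f g.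
have h := elementary_partition (b := b) (A := A) _ mB us dis.
have hf : {ae P, forall w, _} := h _ f bA (fun x _ => cov x) (fun j x _ _ Bx => Bx.1).
have hg : {ae P, forall w, _} := h _ g bA (fun x _ => cov x) (fun j x _ _ Bx => Bx.2).
have hfg : {ae P, forall w, _} := h (fun j => j.1 - j.2) (f - g) bA (fun x _ => cov x) _.
have := hfg _; case/(_ _)/Wrap => [[y z] x _ _ [/= <- <-]//|].
move: hf hg; apply: filterS3 => w -> -> ->; rewrite -sumrB.
by apply: eq_bigr => j _; rewrite mulrBl.
Qed.

Lemma elementary_integral_restrict (b : R) (A A' : set R) (f g : {sfun R >-> R}) :
  bounded_borel b A -> measurable A' -> A' `<=` A ->
  (forall x, A' x -> g x = f x) -> (forall x, A x -> ~ A' x -> g x = 0) ->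
  {ae P, forall w, elementary_integral L A g w = elementary_integral L A' f w}.
Proof.
move=> bA mA' A'A gf g0.
(* The Boolean records membership in [A']. *)
pose s := [seq (y, z) | y <- srange f, z <- [:: true; false]].
pose B (yz : R * bool) := f @^-1` [set yz.1] `&` (if yz.2 then A' else ~` A').
have mB j : measurable (B j).
  apply: measurableI; first exact: measurable_preimage_sfun.
  by case: j.2 => //; exact: measurableC.
have us : uniq s by apply: allpairs_uniq => [||[? ?] [? ?] _ _ /= [-> ->]]//; exact: srange_uniq.
have := @elementary_partition _ s b A B (fun yz => if yz.2 then yz.1 else 0) g bA mB us.
case/(_ _ _ _)/Wrap.
- move=> [y z] [y' z'] _ _ ne; apply/seteqP; split => // x /= [[/= fy zx] [/= fy' zx']].
  move: ne zx zx'; rewrite -fy -fy' xpair_eqE eqxx/=.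
  by case: z; case: z'.
- move=> x _; exists (f x, `[< A' x >]); last by split => //=; case: asboolP.
  apply/allpairsP; exists (f x, `[< A' x >]); split => //; first exact: sfun_range_seq.
  by case: asboolP.
- move=> [y z] x _ Ax [/= <-]; case: z; [exact: gf|exact: g0].
apply: filterS => w ->; rewrite elementary_integralE big_allpairs.
apply: eq_bigr => y _; rewrite !big_cons big_nil/= mul0r !addr0.
by rewrite /B/= setIA setIAC (setIidr A'A).
Qed.

End random_measures.

Section random_measure_uniqueness.
Context d {Omega : measurableType d} {R : realType} (P : probability Omega R).
Variables (Z : R -> {RV P >-> R}).

(** The increments of [Z] decide on intervals, and agreement passes to complements in ]0, b] and to
    disjoint unions. The exceptional null set depends on [A]. *)
Lemma rm_unique (L L' : set R -> {RV P >-> R}) (b : R) (A : set R) :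
  is_random_measure_of Z L -> is_random_measure_of Z L' -> 0 <= b ->
  bounded_borel b A -> {ae P, forall w, L A w = L' A w}.
Proof.
move=> L_rm L'_rm b0 [mA Ab].
have bb : bounded_borel b `]0, b]%classic by exact: bounded_borel_itv.
pose H := [set A : set R | {ae P, forall w, L (A `&` `]0, b]) w = L' (A `&` `]0, b]) w}].
suff : H A by rewrite /H/= (setIidl Ab).
have Hitv s t : 0 <= s -> t <= b -> {ae P, forall w, L `]s, t]%classic w = L' `]s, t]%classic w}.
  move=> s0 tb; have [st|ts] := leP s t.
    by apply: filterS2 (rmeas_increment L_rm s0 st) (rmeas_increment L'_rm s0 st) => w -> ->.
  rewrite set_itv_ge -?leNgt ?bnd_simp ?ltW//.
  by apply: filterS2 (rm0 L_rm) (rm0 L'_rm) => w -> ->.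
apply: (borel_dynkin_ind (H := H)) => //.
- by rewrite /H/= setTI; exact: Hitv.
- move=> B mB; rewrite /H/= => HB.
  have bB : bounded_borel b (B `&` `]0, b]) by rewrite setIC; exact: bounded_borelI.
  have bC : bounded_borel b (~` B `&` `]0, b]).
    by rewrite setIC; apply: bounded_borelI => //; exact: measurableC.
  have BC : (B `&` `]0, b]) `&` (~` B `&` `]0, b]) = set0.
    by rewrite setIACA setICr set0I.
  have UE : (B `&` `]0, b]) `|` (~` B `&` `]0, b]) = `]0, b]%classic.
    by rewrite -setIUl setUCr setTI.
  have h1 := rmU L_rm bB bC BC; have h2 := rmU L'_rm bB bC BC; rewrite UE in h1 h2.
  have h3 := Hitv 0 b (lexx 0) (lexx b); near=> w.
  have e1 : L `]0, b]%classic w = L (B `&` `]0, b]) w + L (~` B `&` `]0, b]) w by near: w.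
  have e2 : L' `]0, b]%classic w = L' (B `&` `]0, b]) w + L' (~` B `&` `]0, b]) w by near: w.
  have e3 : L `]0, b]%classic w = L' `]0, b]%classic w by near: w.
  have e4 : L (B `&` `]0, b]) w = L' (B `&` `]0, b]) w by near: w.
  lra.
- move=> F mF tF HF; rewrite /H/= setI_bigcupl.
  have bF i : bounded_borel b (F i `&` `]0, b]) by rewrite setIC; exact: bounded_borelI.
  have tF' : trivIset setT (fun i => F i `&` `]0, b]).
    apply/trivIsetP => i j _ _ ij; rewrite setIACA.
    by move/trivIsetP : tF => /(_ i j I I ij) ->; rewrite set0I.
  have := ae_foralln HF; have := rm_series L_rm bF tF'; have := rm_series L'_rm bF tF'.
  apply: filterS3 => w h2 h1 e; apply: (cvg_unique _ h1) => //.
  rewrite [X in X @ _](_ : _ = fun n => \sum_(i < n) L' (F i `&` `]0, b]) w)//.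
  by apply/funext => n; apply: eq_bigr => i _; exact: e.
- move=> s t; rewrite /H/=.
  have -> : `]s, t]%classic `&` `]0, b] = `]Num.max s 0, Num.min t b]%classic.
    apply/seteqP; split => x /=; rewrite !in_itv/= gt_max le_min.
      by move=> [/andP[-> ->] /andP[-> ->]].
    by move=> /andP[/andP[-> ->] /andP[-> ->]].
  by apply: Hitv; [rewrite le_max lexx orbT|rewrite ge_min lexx orbT].
Unshelve. all: by end_near. Qed.

Lemma elementary_integral_unique (L L' : set R -> {RV P >-> R}) (b : R) (A : set R)
    (f : {sfun R >-> R}) :
  is_random_measure_of Z L -> is_random_measure_of Z L' -> 0 <= b ->
  bounded_borel b A ->
  {ae P, forall w, elementary_integral L A f w = elementary_integral L' A f w}.
Proof.
move=> L_rm L'_rm b0 bA.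
have : {ae P, forall w, forall y, y \in srange f ->
    L (A `&` f @^-1` [set y]) w = L' (A `&` f @^-1` [set y]) w}.
  apply: ae_seq => y _; apply: (rm_unique L_rm L'_rm b0).
  by apply: bounded_borelI => //; exact: measurable_preimage_sfun.
apply: filterS => w h; rewrite !elementary_integralE.
by apply: eq_big_seq => y yr; rewrite h.
Qed.

End random_measure_uniqueness.

(** * Lebesgue integrals of simple functions as finite sums *)

Section sfun_integrals.
Context {R : realType}.

Lemma sum_srange_indic (f : {sfun R >-> R}) (phi : R -> R) (x : R) :
  phi (f x) = \sum_(y <- srange f) phi y * \1_(f @^-1` [set y]) x.
Proof.
rewrite (bigD1_seq (f x)) ?srange_uniq ?sfun_range_seq//= indicE mem_set// mulr1.
rewrite big1 ?addr0// => y yf; rewrite indicE memNset ?mulr0//= => fy.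
by rewrite fy eqxx in yf.
Qed.

Variables (b : R) (A : set R).
Hypothesis bA : bounded_borel b A.
Local Notation mu := (@lebesgue_measure R).

Lemma integrable_indic_bounded_borel (B : set R) : measurable B ->
  mu.-integrable A (EFin \o (\1_B : R -> R)).
Proof.
move=> mB; have mA := bA.1; apply/integrableP; split; first exact/measurable_EFinP.
rewrite (eq_integral (fun x : measurableTypeR R => (\1_B x)%:E)); last by move=> x _; rewrite /= ger0_norm.
rewrite integral_indic; [|exact: mA|exact: mB].
apply: (@le_lt_trans _ _ (leb (A `&` B))%:E); last by rewrite ltry.
by rewrite (EFin_leb (bounded_borelI bA mB)) setIC.
Qed.

Lemma integrable_sfun_comp (f : {sfun R >-> R}) (phi : R -> R) :
  mu.-integrable A (EFin \o (fun x => phi (f x))).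
Proof.
rewrite (_ : (fun x => phi (f x)) = fun x => \sum_(y <- srange f) phi y * \1_(f @^-1` [set y]) x).
  apply: integrable_EFin_sum; first exact: bA.1.
  move=> y; apply: integrable_EFinZl; first exact: bA.1.
  by apply: integrable_indic_bounded_borel; exact: measurable_preimage_sfun.
by apply/funext => x; exact: sum_srange_indic.
Qed.

Lemma Rintegral_sfun_comp (f : {sfun R >-> R}) (phi : R -> R) :
  \int[mu]_(x in A) phi (f x) =
  \sum_(y <- srange f) leb (A `&` f @^-1` [set y]) * phi y.
Proof.
have mA := bA.1; have mf y : measurable (f @^-1` [set y]) by exact: measurable_preimage_sfun.
have iI y := integrable_indic_bounded_borel (mf y).
under eq_Rintegral do rewrite (sum_srange_indic f phi).
rewrite Rintegral_sum//; last by move=> y; exact: integrable_EFinZl.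
apply: eq_bigr => y _; rewrite RintegralZl// mulrC; congr (_ * _).
rewrite /Rintegral integral_indic; [|exact: mA|exact: mf].
by rewrite /leb setIC.
Qed.

End sfun_integrals.

(** * The characteristic function of a random measure *)

Section random_measure_cf.
Context d {Omega : measurableType d} {R : realType} (P : probability Omega R).
Variables (Z : R -> {RV P >-> R}) (a : R) (nu : {measure set R -> \bar R}).
Hypotheses (Z_levy : is_levy_process Z) (nu_levy : levy_measure nu)
  (nu_sym : symmetric_measure nu) (Z_triplet : has_triplet Z a nu).
Variable (L : set R -> {RV P >-> R}).
Hypothesis L_rm : is_random_measure_of Z L.

Lemma indepN2 (X : nat -> Omega -> R) : indepN P X 2 -> indep2 P (X 0%N) (X 1%N).
Proof.
move=> iX A B mA mB; have := iX (fun i => if i == 0%N then A else B).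
case/(_ _)/Wrap => [i|]; first by case: ifP.
rewrite !big_ord_recr big_ord0/= mul1r => <-; congr (pr _ _).
apply/seteqP; split => w /=; first by move=> [Xw Yw] -[|[|i]].
by move=> h; split; [exact: (h 0%N)|exact: (h 1%N)].
Qed.

Lemma rm_increment_cos_sin (s t mu : R) : 0 <= s ->
  \int[P]_w cos (mu * L `]s, t]%classic w) =
    expR (- (leb `]s, t]%classic * psi a nu mu)) /\
  \int[P]_w sin (mu * L `]s, t]%classic w) = 0.
Proof.
move=> s0; have mL := measurable_rm L.
have [st|ts] := leP s t.
  have := rmeas_increment L_rm s0 st; rewrite leb_itv// => h.
  have [<- <-] := levy_increment_cos_sin Z_levy nu_levy nu_sym Z_triplet mu s0 st.
  have mZ : measurable_fun setT (fun w => Z t w - Z s w).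
    by apply: measurable_funB; exact: measurable_funP.
  split; apply: ae_eq_Rintegral; rewrite ?(measurable_cos_comp,measurable_sin_comp)//;
    try (by [exact: measurable_cos_comp|exact: measurable_sin_comp]);
    by apply: filterS h => w ->.
rewrite set_itv_ge -?leNgt ?bnd_simp ?ltW// /leb measure0 mul0r oppr0 expR0.
split.
  rewrite -[RHS](Rintegral_probability_cst P); apply: ae_eq_Rintegral => //.
    exact: measurable_cos_comp.
  by apply: filterS (rm0 L_rm) => w ->; rewrite mulr0 cos0.
rewrite -[RHS](Rintegral_probability_cst P); apply: ae_eq_Rintegral => //.
  exact: measurable_sin_comp.
by apply: filterS (rm0 L_rm) => w ->; rewrite mulr0 sin0.
Qed.

(** Dynkin induction from intervals. For a complement in ]0, b] independence gives a product
    formula, from which the exponential, being nonzero, is cancelled; for disjoint unions the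
    partial sums converge almost surely. *)
Lemma rm_cos_sin (b mu : R) (A : set R) : 0 <= b -> bounded_borel b A ->
  \int[P]_w cos (mu * L A w) = expR (- (leb A * psi a nu mu)) /\
  \int[P]_w sin (mu * L A w) = 0.
Proof.
move=> b0 [mA Ab]; have mL := measurable_rm L.
have bb : bounded_borel b `]0, b]%classic by exact: bounded_borel_itv.
have bI (B : set R) : measurable B -> bounded_borel b (B `&` `]0, b]).
  by rewrite setIC => mB; exact: bounded_borelI.
pose H := [set A : set R |
  \int[P]_w cos (mu * L (A `&` `]0, b]) w) = expR (- (leb (A `&` `]0, b]) * psi a nu mu)) /\
  \int[P]_w sin (mu * L (A `&` `]0, b]) w) = 0].
suff : H A by rewrite /H/= (setIidl Ab).
apply: (borel_dynkin_ind (H := H)) => //.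
- by rewrite /H/= setTI; exact: rm_increment_cos_sin.
- move=> B mB [HBc HBs]; have bB := bI B mB; have bC := bI _ (measurableC mB).
  have BC : (B `&` `]0, b]) `&` (~` B `&` `]0, b]) = set0.
    by rewrite setIACA setICr set0I.
  have UE : (B `&` `]0, b]) `|` (~` B `&` `]0, b]) = `]0, b]%classic.
    by rewrite -setIUl setUCr setTI.
  have ind : indep2 P (L (B `&` `]0, b])) (L (~` B `&` `]0, b])).
    pose F := bigcup2 (B `&` `]0, b]) (~` B `&` `]0, b]).
    apply: (@indepN2 (fun i => L (F i))); apply: (rm_indepN L_rm (b := b)).
      by move=> [|[|i]]; [exact: bB|exact: bC|split; [exact: measurable0|exact: sub0set]].
    by apply/trivIsetP => -[|[|i]] [|[|j]] //= _ _ _; rewrite ?setI0 ?set0I// setIC.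
  pose Lb := L `]0, b]%classic.
  have [] := indep2_cos_sin mu (mL _) (mL _) ind; rewrite HBc HBs !mul0r subr0 add0r.
  have add : {ae P, forall w, L (B `&` `]0, b]) w + L (~` B `&` `]0, b]) w = L `]0, b]%classic w}.
    by apply: filterS (rmU L_rm bB bC BC) => w; rewrite UE => ->.
  have mS : measurable_fun setT (fun w => L (B `&` `]0, b]) w + L (~` B `&` `]0, b]) w).
    by apply: measurable_funD; exact: mL.
  have [c0 s0] := rm_increment_cos_sin b mu (lexx 0).
  have -> : \int[P]_w cos (mu * (L (B `&` `]0, b]) w + L (~` B `&` `]0, b]) w)) =
      \int[P]_w cos (mu * Lb w).
    apply: ae_eq_Rintegral; [exact: measurable_cos_comp|exact: measurable_cos_comp|].
    by apply: filterS add => w ->.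
  have -> : \int[P]_w sin (mu * (L (B `&` `]0, b]) w + L (~` B `&` `]0, b]) w)) =
      \int[P]_w sin (mu * Lb w).
    apply: ae_eq_Rintegral; [exact: measurable_sin_comp|exact: measurable_sin_comp|].
    by apply: filterS add => w ->.
  rewrite c0 s0 -{1}UE (lebU bB bC BC) mulrDl opprD expRD => /mulfI hc /esym hs.
  split; first by rewrite -hc ?gt_eqF ?expR_gt0.
  by move/eqP: hs; rewrite mulf_eq0 gt_eqF ?expR_gt0//= => /eqP.
- move=> F mF tF HF.
  have bF i : bounded_borel b (F i `&` `]0, b]) by exact: bI.
  have tF' : trivIset setT (fun i => F i `&` `]0, b]).
    apply/trivIsetP => i j _ _ ij; rewrite setIACA.
    by move/trivIsetP : tF => /(_ i j I I ij) ->; rewrite set0I.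
  rewrite /H/= setI_bigcupl.
  have ser := rm_series L_rm bF tF'.
  have mS n : measurable_fun setT (fun w => \sum_(i < n) L (F i `&` `]0, b]) w).
    by apply: measurable_sum => i; exact: mL.
  have part n := @indepN_cos_sin_sum _ _ _ P (fun i => L (F i `&` `]0, b])) n mu
    (fun i => mL _) (rm_indepN L_rm n bF tF') (fun i _ => (HF i).2).
  have pd0 : pd P (fun w => \sum_(i < n) L (F i `&` `]0, b]) w)
      (L (\bigcup_i (F i `&` `]0, b]))) @[n --> \oo] --> 0 by exact: ae_cvg_pd.
  have Kc x y : `|cos (mu * x) - cos (mu * y)| <= `|mu| * `|x - y|.
    by apply: le_trans (cos_lipschitz _ _) _; rewrite -mulrBr normrM.
  have Ks x y : `|sin (mu * x) - sin (mu * y)| <= `|mu| * `|x - y|.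
    by apply: le_trans (sin_lipschitz _ _) _; rewrite -mulrBr normrM.
  have cc := pd_cvg_lipschitz mS (mL _) (measurable_cosM mu) (fun x => cos_max _) Kc pd0.
  have cs := pd_cvg_lipschitz mS (mL _) (measurable_sinM mu) (fun x => sin_max _) Ks pd0.
  split.
    apply: (cvg_unique _ cc) => //.
    rewrite [X in X @ _](_ : _ = fun n =>
        expR (- ((\sum_(i < n) leb (F i `&` `]0, b])) * psi a nu mu))).
      apply: continuous_cvg; first exact: continuous_expR.
      by apply: cvgN; apply: cvgMr_tmp; exact: cvg_leb_sum bF tF'.
    apply/funext => n; rewrite (part n).1 mulr_suml -sumrN expR_sum.
    by apply: eq_bigr => i _; rewrite (HF i).1.
  apply: (cvg_unique _ cs) => //.
  rewrite [X in X @ _](_ : _ = cst 0); first exact: cvg_cst.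
  by apply/funext => n; rewrite (part n).2.
- move=> s t; rewrite /H/=.
  have -> : `]s, t]%classic `&` `]0, b] = `]Num.max s 0, Num.min t b]%classic.
    apply/seteqP; split => x /=; rewrite !in_itv/= gt_max le_min.
      by move=> [/andP[-> ->] /andP[-> ->]].
    by move=> /andP[/andP[-> ->] /andP[-> ->]].
  by apply: rm_increment_cos_sin; rewrite le_max lexx orbT.
Qed.

End random_measure_cf.

(** * Approximation by simple functions in L^p *)

Section Lp_approximation.
Context {R : realType}.
Local Notation leb_m := (@lebesgue_measure R).

Lemma ae_lebesgueS (Q1 Q2 : R -> Prop) : (forall x, Q1 x -> Q2 x) ->
  {ae leb_m, forall x, Q1 x} -> {ae leb_m, forall x, Q2 x}.
Proof. by move=> h; apply: filterS; first exact: (ae_filter_ringOfSetsType leb_m). Qed.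

Lemma powR_normD_le (p x y : R) : 0 <= p ->
  `|x + y| `^ p <= 2 `^ p * (`|x| `^ p + `|y| `^ p).
Proof.
move=> p0; have h : `|x + y| <= 2 * Num.max `|x| `|y|.
  apply: le_trans (ler_normD _ _) _.
  have : `|x| <= Num.max `|x| `|y| by rewrite le_max lexx.
  have : `|y| <= Num.max `|x| `|y| by rewrite le_max lexx orbT.
  lra.
apply: le_trans (ge0_ler_powR p0 _ _ h) _; rewrite ?nnegrE// ?mulr_ge0// ?le_max ?normr_ge0//.
rewrite powRM// ?le_max ?normr_ge0// ler_wpM2l ?powR_ge0//.
by rewrite maxEle; case: ifP => _; rewrite ?lerDl ?lerDr powR_ge0.
Qed.

Variables (b p : R) (A : set R) (h : R -> R).
Hypotheses (p0 : 0 < p) (bA : bounded_borel b A) (mh : measurable_fun A h).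
Hypothesis ih : leb_m.-integrable A (EFin \o (fun x => `|h x| `^ p)).

(** The positive and the negative part are approximated from below, which gives |phi n| <= |h| and
    thereby domination. *)
Lemma Lp_sfun_approx : exists phi : nat -> {sfun R >-> R},
  [/\ forall x, A x -> phi n x @[n --> \oo] --> h x,
  \int[leb_m]_(x in A) (`|phi n x - h x| `^ p) @[n --> \oo] --> (0 : R) &
  forall n, \int[leb_m]_(x in A) (`|phi n x| `^ p) <= \int[leb_m]_(x in A) (`|h x| `^ p)].
Proof.
have mA := bA.1.
have mE : measurable_fun A (EFin \o h) by exact/measurable_EFinP.
have mp := measurable_funepos mE; have mn := measurable_funeneg mE.
pose fp n : {sfun R >-> R} := nnsfun_approx mA mp n.
pose fn n : {sfun R >-> R} := nnsfun_approx mA mn n.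
have fpE n x : fp n x = approx A (EFin \o h)^\+%E n x := congr1 (@^~ x) (nnsfun_approxE mA mp n).
have fnE n x : fn n x = approx A (EFin \o h)^\-%E n x := congr1 (@^~ x) (nnsfun_approxE mA mn n).
have hpE x : ((EFin \o h)^\+%E x) = (Num.max (h x) 0)%:E by rewrite funeposE EFin_max.
have hnE x : ((EFin \o h)^\-%E x) = (Num.max (- h x) 0)%:E by rewrite funenegE EFin_max.
have fp0 n x : 0 <= fp n x by exact: fun_ge0.
have fn0 n x : 0 <= fn n x by exact: fun_ge0.
have fp_le n x : A x -> fp n x <= Num.max (h x) 0.
  move=> Ax; rewrite -lee_fin -hpE; rewrite fpE; apply: le_approx => // y _; exact: funepos_ge0.
have fn_le n x : A x -> fn n x <= Num.max (- h x) 0.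
  move=> Ax; rewrite -lee_fin -hnE; rewrite fnE; apply: le_approx => // y _; exact: funeneg_ge0.
have dom n x : A x -> `|fp n x - fn n x| <= `|h x|.
  move=> Ax; have := fp_le n x Ax; have := fn_le n x Ax.
  have := fp0 n x; have := fn0 n x; rewrite ler_norml.
  have := ler_norm (h x); have := ler_norm (- h x); rewrite normrN; have := normr_ge0 (h x).
  by rewrite /Num.max; case: ltP => h1; case: ltP => h2 *; apply/andP; split; lra.
pose phi n : {sfun R >-> R} := fp n - fn n.
have phiE n x : phi n x = fp n x - fn n x by [].
have phi_le n x : A x -> `|phi n x| `^ p <= `|h x| `^ p.
  by move=> Ax; rewrite ge0_ler_powR ?nnegrE ?(ltW p0)// phiE dom.
have cvgphi x : A x -> phi n x @[n --> \oo] --> h x.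
  move=> Ax.
  have cp : fp n x @[n --> \oo] --> Num.max (h x) 0.
    have : EFin \o (fun n => fp n x) @ \oo --> (Num.max (h x) 0)%:E.
      by rewrite -hpE; apply: cvg_nnsfun_approx => // y _; exact: funepos_ge0.
    by move/fine_cvg.
  have cn : fn n x @[n --> \oo] --> Num.max (- h x) 0.
    have : EFin \o (fun n => fn n x) @ \oo --> (Num.max (- h x) 0)%:E.
      by rewrite -hnE; apply: cvg_nnsfun_approx => // y _; exact: funeneg_ge0.
    by move/fine_cvg.
  have -> : h x = Num.max (h x) 0 - Num.max (- h x) 0.
    by rewrite /Num.max; case: ltP => ?; case: ltP => ?; lra.
  exact: cvgB.
have mphi n : measurable_fun A (phi n) by exact: measurable_funTS.
have mpow (k : R -> R) : measurable_fun A k -> measurable_fun A (fun x => `|k x| `^ p).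
  move=> mk; apply: (@measurableT_comp _ _ _ _ _ _ (fun x : R => x `^ p)).
    exact: measurable_powR.
  exact: measurableT_comp.
exists phi; split; [exact: cvgphi| |]; last first.
  move=> n; apply: le_Rintegral => //; last by move=> x Ax; exact: phi_le.
  exact: (integrable_sfun_comp bA (phi n) (fun y => `|y| `^ p)).
have := @dominated_convergence _ _ _ leb_m A mA
  (fun n => EFin \o (fun x => `|phi n x - h x| `^ p)) (EFin \o cst 0)
  (fun x => (2 `^ p * (`|h x| `^ p + `|h x| `^ p))%:E) _ _ _ _ _.
case.
- by move=> n; apply/measurable_EFinP; apply: (mpow (fun x => phi n x - h x)); exact: measurable_funB.
- exact/measurable_EFinP.
- apply: aeW => x Ax; apply: cvg_EFin; first exact: nearW.
  have -> : cst 0 x = `|0 : R| `^ p by rewrite normr0 powR0 ?gt_eqF.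
  apply: cvg_norm_powR => //; rewrite -(subrr (h x)).
  by apply: cvgB; [exact: cvgphi|exact: cvg_cst].
- apply: integrable_EFinZl => //.
  by apply: integrable_EFinD.
- apply: aeW => x n Ax; rewrite /= ger0_norm ?powR_ge0// lee_fin.
  apply: le_trans (powR_normD_le _ _ (ltW p0)) _.
  by rewrite ler_wpM2l ?powR_ge0// normrN lerD2r phi_le.
move=> _ _; rewrite [X in _ @ _ --> X -> _](_ : _ = 0%E); first by move/fine_cvg.
by rewrite integral0_eq.
Qed.

Lemma measurable_powR_norm (k : R -> R) :
  measurable_fun A k -> measurable_fun A (fun x => `|k x| `^ p).
Proof.
move=> mk; apply: (@measurableT_comp _ _ _ _ _ _ (fun x : R => x `^ p)).
  exact: measurable_powR.
exact: measurableT_comp.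
Qed.

Lemma integrable_sfunB_powR (phi : {sfun R >-> R}) :
  leb_m.-integrable A (EFin \o (fun x => `|phi x - h x| `^ p)).
Proof.
have mA : measurable (A : set (measurableTypeR R)) := bA.1; have mphi : measurable_fun A phi by exact: measurable_funTS.
apply: (le_integrable mA _ _ (integrable_EFinZl mA (2 `^ p)
  (integrable_EFinD mA (integrable_sfun_comp bA phi (fun y => `|y| `^ p)) ih))).
  apply/measurable_EFinP; apply: (measurable_powR_norm (k := fun x => phi x - h x)).
  exact: measurable_funB.
move=> x _; rewrite /= lee_fin (ger0_norm (powR_ge0 _ _)) [leRHS]ger0_norm.
  by apply: le_trans (powR_normD_le _ _ (ltW p0)) _; rewrite normrN.
by rewrite mulr_ge0 ?addr_ge0 ?powR_ge0.
Qed.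

Lemma sfunB_powR_le (A' : set R) (phi psi : {sfun R >-> R}) :
  measurable A' -> A' `<=` A ->
  \int[leb_m]_(x in A') (`|(phi - psi) x| `^ p) <=
  2 `^ p * (\int[leb_m]_(x in A) (`|phi x - h x| `^ p) +
            \int[leb_m]_(x in A) (`|psi x - h x| `^ p)).
Proof.
move=> mA'_ A'A; have mA : measurable (A : set (measurableTypeR R)) := bA.1.
have mA' : measurable (A' : set (measurableTypeR R)) := mA'_.
have i1 := integrable_sfunB_powR phi; have i2 := integrable_sfunB_powR psi.
have bA' : bounded_borel b A' by exact: bounded_borel_sub bA mA' A'A.
have i12 := integrable_EFinD mA i1 i2.
have iS (B : set R) : measurable B -> B `<=` A ->
  leb_m.-integrable B (EFin \o (fun x => 2 `^ p * (`|phi x - h x| `^ p + `|psi x - h x| `^ p))).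
  move=> mB BA; apply: integrable_EFinZl => //.
  exact: (integrableS mA mB BA i12).
rewrite -RintegralD// -RintegralZl//.
apply: (@le_trans _ _ (\int[leb_m]_(x in A')
    (2 `^ p * (`|phi x - h x| `^ p + `|psi x - h x| `^ p)))).
  apply: le_Rintegral => //.
  - exact: (integrable_sfun_comp bA' (phi - psi) (fun y => `|y| `^ p)).
  - exact: iS.
  - move=> x _; have -> : (phi - psi) x = (phi x - h x) + (h x - psi x).
      by rewrite addrA subrK.
    by apply: le_trans (powR_normD_le _ _ (ltW p0)) _; rewrite (distrC (h x)).
apply: fine_le.
- by apply: integrable_fin_num => //; exact: iS.
- by apply: integrable_fin_num => //; exact: iS.
apply: ge0_subset_integral => //.
- by case/integrableP: (iS A mA (@subset_refl _ _)).
Qed.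

End Lp_approximation.

Section small_moments.
Context d {Omega : measurableType d} {R : realType} (P : probability Omega R).

(** [pd_le_moment] is used at level e / 2, and [eta] is chosen to make the remaining term at most e
    / 2. The choice is uniform in the variables. *)
Lemma pd_small_of_moment (p q K e : R) : 0 < p -> 0 < q -> 0 <= K -> 0 < e ->
  exists2 eta, 0 < eta & forall (X Y : Omega -> R) (x : R),
    measurable_fun setT X -> measurable_fun setT Y -> 0 <= x -> x <= eta ->
    (\int[P]_w (`|X w - Y w| `^ q)%:E <= (K * x `^ (q / p))%:E)%E -> pd P X Y <= e.
Proof.
move=> p0 q0 K0 e0; have e2 : 0 < e / 2 by rewrite divr_gt0.
pose M := (e / 2) `^ (- q) * K + 1.
have M0 : 0 < M by rewrite ltr_pwDr// mulr_ge0 ?powR_ge0.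
pose r := (e / 2) / M; have r0 : 0 < r by rewrite divr_gt0.
exists (r `^ (p / q)); first by rewrite powR_gt0.
move=> X Y x mX mY x0 xr hx; rewrite -lee_fin.
apply: le_trans (pd_le_moment P mX mY q0 e2) _ => //.
apply: (@le_trans _ _ ((e / 2)%:E + ((e / 2) `^ (- q))%:E * (K * r)%:E)%E).
  rewrite leeD2l// lee_wpmul2l ?lee_fin ?powR_ge0//.
  apply: le_trans hx _; rewrite lee_fin ler_wpM2l//.
  apply: (@le_trans _ _ ((r `^ (p / q)) `^ (q / p))).
    by apply: ge0_ler_powR; rewrite ?nnegrE ?powR_ge0// divr_ge0 ?ltW.
  rewrite -powRrM mulrA divfK ?gt_eqF// divff ?gt_eqF// powRr1//; exact: ltW.
rewrite -EFinM -EFinD lee_fin {3}(splitr e) lerD2l mulrA.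
apply: (@le_trans _ _ (M * r)); first by rewrite ler_wpM2r ?(ltW r0)// /M lerDl.
by rewrite /r mulrC divfK ?gt_eqF.
Qed.

End small_moments.

(** * Moments and limits of elementary integrals *)

Section elementary_moments.
Context d {Omega : measurableType d} {R : realType} (P : probability Omega R).
Variables (Z : R -> {RV P >-> R}) (a : R) (nu : {measure set R -> \bar R}).
Hypotheses (Z_levy : is_levy_process Z) (a0 : 0 <= a) (nu_levy : levy_measure nu)
  (nu_sym : symmetric_measure nu) (Z_triplet : has_triplet Z a nu).
Variable (L : set R -> {RV P >-> R}).
Hypothesis L_rm : is_random_measure_of Z L.
Variable b : R.
Hypothesis b0 : 0 <= b.
Local Notation leb_m := (@lebesgue_measure R).
Local Notation el := (elementary_integral L).

(** Listing the level sets as a disjoint sequence, padded with empty sets, turns an elementary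
    integral into a sum of independent variables. *)
Lemma elementary_integral_nat (A : set R) (f : {sfun R >-> R}) : bounded_borel b A ->
  exists N (B : nat -> set R) (c : nat -> R),
  [/\ forall i, bounded_borel b (B i), trivIset setT B,
    forall w, el A f w = \sum_(i < N) c i * L (B i) w,
    forall phi : R -> R, \int[leb_m]_(x in A) phi (f x) = \sum_(i < N) leb (B i) * phi (c i) &
    \sum_(i < N) leb (B i) = leb A].
Proof.
move=> bA; set s := srange f.
pose B i := if (i < size s)%N then A `&` f @^-1` [set nth 0 s i] else set0.
have bB i : bounded_borel b (B i).
  rewrite /B; case: ifP => _; last by split; [exact: measurable0|exact: sub0set].
  by apply: bounded_borelI => //; exact: measurable_preimage_sfun.
have intE (phi : R -> R) :
    \int[leb_m]_(x in A) phi (f x) = \sum_(i < size s) leb (B i) * phi (nth 0 s i).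
  rewrite (Rintegral_sfun_comp bA) (big_nth 0) big_mkord.
  by apply: eq_bigr => i _; rewrite /B ltn_ord.
exists (size s), B, (nth 0 s); split => //.
- apply/trivIsetP => i j _ _ ij; rewrite /B; case: ifP => iN; last by rewrite set0I.
  case: ifP => jN; last by rewrite setI0.
  apply/seteqP; split => // x [[_ /= xi] [_ xj]].
  by move: ij; rewrite -(nth_uniq 0 iN jN (srange_uniq f)) -xi -xj eqxx.
- move=> w; rewrite elementary_integralE (big_nth 0) big_mkord.
  by apply: eq_bigr => i _; rewrite /B ltn_ord.
- have := intE (fun=> 1); rewrite /Rintegral integral_cst; last exact: bA.1.
  rewrite mul1e -/(leb A) => ->; by apply: eq_bigr => i _; rewrite mulr1.
Qed.

Lemma elementary_cos (A : set R) (f : {sfun R >-> R}) (mu : R) : bounded_borel b A ->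
  \int[P]_w cos (mu * el A f w) = expR (- \int[leb_m]_(x in A) psi a nu (mu * f x)).
Proof.
move=> bA; have [N [B [c [bB tB elE intE _]]]] := elementary_integral_nat f bA.
have mL := measurable_rm L.
rewrite (intE (fun y => psi a nu (mu * y))).
have iX := indepN_scale c (fun i => mL (B i)) (rm_indepN L_rm N bB tB).
have cs i := rm_cos_sin Z_levy nu_levy nu_sym Z_triplet L_rm (mu * c i) b0 (bB i).
have [] := @indepN_cos_sin_sum _ _ _ P (fun i w => c i * L (B i) w) N mu _ iX.
- by move=> i; apply: measurable_funM => //; exact: mL.
- move=> i _; rewrite -[RHS](cs i).2.
  by apply: eq_Rintegral => w _; rewrite mulrA.
move=> h _; under eq_Rintegral do rewrite elE.
rewrite h -sumrN expR_sum; apply: eq_bigr => i _; rewrite -(cs i).1.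
by apply: eq_Rintegral => w _; rewrite mulrA.
Qed.

(** [psi] is minus the logarithm of the characteristic function of [Z 1], which is continuous by
    bounded convergence. *)
Lemma psi_continuous : continuous (psi a nu).
Proof.
move=> x; apply/continuous_withinNx/cvgr_dnbhsP => u [_ ux].
have mZ : measurable_fun setT (Z 1) by exact: measurable_funP.
have cfE y : \int[P]_w cos (y * Z 1 w) = expR (- psi a nu y).
  by have [-> _] := levy_cos_sin nu_levy nu_sym Z_triplet y (@ler01 R); rewrite mul1r.
have psiE y : psi a nu y = - ln (\int[P]_w cos (y * Z 1 w)) by rewrite cfE expRK opprK.
rewrite psiE [X in X @ _](_ : _ = fun n => - ln (\int[P]_w cos (u n * Z 1 w))); last first.
  by apply/funext => n; exact: psiE.
apply: cvgN; apply: continuous_cvg; first by apply: continuous_ln; rewrite cfE expR_gt0.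
apply: (@bounded_convergence _ _ _ P _ _ 1).
- by move=> n; exact: measurable_cos_comp.
- exact: measurable_cos_comp.
- by move=> n w; exact: cos_max.
- apply: aeW => w; apply: continuous_cvg; first exact: continuous_cos.
  by apply: cvgM => //; exact: cvg_cst.
Qed.

(** The moment bound for the total length [b] fixed in this section, with a given constant. *)
Definition moment_const (p q K : R) : Prop :=
  forall (N : nat) (D c : nat -> R) (X : Omega -> R),
  (forall i, 0 <= D i) -> \sum_(i < N) D i <= b ->
  measurable_fun setT X ->
  (forall mu, \int[P]_w cos (mu * X w) =
     expR (- \sum_(i < N) D i * psi a nu (mu * c i))) ->
  (\int[P]_w (`|X w| `^ q)%:E <=
     (K * (\sum_(i < N) D i * `|c i| `^ p) `^ (q / p))%:E)%E.

Variables (p q K : R).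
Hypotheses (p0 : 0 < p) (q0 : 0 < q) (K0 : 0 <= K) (hK : moment_const p q K).

(** A constant characteristic function is that of an empty sum, for which the moment bound gives E
    |W|^q <= 0. No uniqueness theorem is involved. *)
Lemma eq0_of_cos (W : Omega -> R) : measurable_fun setT W ->
  (forall mu, \int[P]_w cos (mu * W w) = 1) -> {ae P, forall w, W w = 0}.
Proof.
move=> mW W1; have := @hK 0 (fun=> 0) (fun=> 0) W (fun=> lexx 0).
rewrite !big_ord0 powR0 ?mulr0; last by rewrite mulf_neq0 ?invr_eq0 ?gt_eqF.
case/(_ _ _ _)/Wrap => //; first by move=> mu; rewrite W1 big_ord0 oppr0 expR0.
move=> h; apply: (@pd_eq0 _ _ _ P W (cst 0)) => //.
apply/eqP; rewrite eq_le pd_ge0 andbT; apply/ler_addgt0Pl => e e0; rewrite addr0.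
rewrite -lee_fin; apply: le_trans (pd_le_moment P mW _ q0 e0) _ => //.
have m0 : ((e `^ (- q))%:E * \int[P]_w (`|W w - cst 0 w| `^ q)%:E <= 0)%E.
  apply: mule_ge0_le0; first by rewrite lee_fin powR_ge0.
  by under eq_integral do rewrite subr0.
by have := leeD2l e%:E m0; rewrite adde0.
Qed.

Lemma elementary_moment (A : set R) (f : {sfun R >-> R}) : bounded_borel b A ->
  (\int[P]_w (`|el A f w| `^ q)%:E <=
    (K * (\int[leb_m]_(x in A) (`|f x| `^ p)) `^ (q / p))%:E)%E.
Proof.
move=> bA; have [N [B [c [bB tB elE intE sumE]]]] := elementary_integral_nat f bA.
rewrite (intE (fun y => `|y| `^ p)); apply: (@hK N (fun i => leb (B i)) c).
- by move=> i; exact: leb_ge0.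
- rewrite sumE -lee_fin (EFin_leb bA) (le_trans (lebesgue_bounded_borel_le bA))//.
  by rewrite max_l.
- exact: measurable_elementary.
- move=> mu; rewrite (elementary_cos f mu bA).
  by rewrite (intE (fun y => psi a nu (mu * y))).
Qed.

Lemma pd_elementary_small (e : R) : 0 < e -> exists2 eta, 0 < eta &
  forall A (f : {sfun R >-> R}), bounded_borel b A ->
    \int[leb_m]_(x in A) (`|f x| `^ p) <= eta -> pd P (el A f) (cst 0) <= e.
Proof.
move=> e0; have [eta eta0 h] := pd_small_of_moment P p0 q0 K0 e0.
exists eta => // A f bA fe.
apply: (h _ _ _ (measurable_elementary L A f) _ _ fe) => //.
  by apply: Rintegral_ge0 => x _; exact: powR_ge0.
by under eq_integral do rewrite subr0; exact: elementary_moment.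
Qed.

Lemma pd_sub0 (X Y : Omega -> R) : pd P X Y = pd P (X \- Y) (cst 0).
Proof. by apply: eq_Rintegral => w _; rewrite /= subr0. Qed.

Lemma pd_elementaryB (A : set R) (f g : {sfun R >-> R}) : bounded_borel b A ->
  pd P (el A f) (el A g) = pd P (el A (f - g)) (cst 0).
Proof.
have mel k : measurable_fun setT (el A k) by exact: measurable_elementary.
move=> bA; rewrite pd_sub0; apply: pd_ae => //; first exact: measurable_funB.
- by apply: filterS (elementary_integralB L_rm f g bA) => w ->.
- exact: aeW.
Qed.

Lemma elementary_cauchy (A A' : set R) (h : R -> R) (phi : nat -> {sfun R >-> R}) :
  bounded_borel b A -> measurable A' -> A' `<=` A -> measurable_fun A h ->
  leb_m.-integrable A (EFin \o (fun x => `|h x| `^ p)) ->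
  \int[leb_m]_(x in A) (`|phi n x - h x| `^ p) @[n --> \oo] --> (0 : R) ->
  forall e, 0 < e -> exists N, forall n m, (N <= n)%N -> (N <= m)%N ->
    pd P (el A' (phi n)) (el A' (phi m)) <= e.
Proof.
move=> bA mA' A'A mh ih c e e0; have mA := bA.1.
have bA' : bounded_borel b A' by exact: bounded_borel_sub bA mA' A'A.
have [eta eta0 he] := pd_elementary_small e0.
pose r := eta / (2 * 2 `^ p).
have p2 : 0 < 2 `^ p :> R by rewrite powR_gt0.
have r0 : 0 < r by rewrite divr_gt0// mulr_gt0.
have [N _ hN] : \forall n \near \oo, \int[leb_m]_(x in A) (`|phi n x - h x| `^ p) <= r.
  by near do apply/ltW; apply: (cvgr_lt 0).
exists N => n m Nn Nm; rewrite pd_elementaryB//; apply: he => //.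
apply: le_trans (sfunB_powR_le p0 bA mh ih (phi n) (phi m) mA' A'A) _.
apply: (@le_trans _ _ (2 `^ p * (r + r))); first by rewrite ler_wpM2l ?(ltW p2)//; apply: lerD; exact: hN.
by rewrite /r le_eqVlt; apply/orP; left; apply/eqP; field; rewrite gt_eqF.
Unshelve. all: by end_near. Qed.

(** For c > 0 the sequence [u] converges to - ln c, which is then its lower limit; for c <= 0 the
    claim is trivial. *)
Lemma le_expR_of_einf (u : nat -> R) (x c : R) :
  (x%:E <= limn_einf (fun m => (u m)%:E))%E ->
  expR (- u m) @[m --> \oo] --> c -> c <= expR (- x).
Proof.
move=> hx uc; have [c0|c0] := leP c 0; first by rewrite (le_trans c0)// expR_ge0.
have ul : (u m)%:E @[m --> \oo] --> (- ln c)%:E.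
  apply: cvg_EFin; first exact: nearW.
  rewrite [X in X @ _](_ : _ = fun m => - ln (expR (- u m))); last first.
    by apply/funext => m; rewrite /= expRK opprK.
  by apply: cvgN; apply: continuous_cvg => //; exact: continuous_ln.
move: hx; rewrite is_cvg_limn_einfE; last by apply/cvg_ex; exists (- ln c)%:E.
rewrite (cvg_lim _ ul)// lee_fin => xc.
by rewrite -[leLHS]lnK ?posrE// ler_expR lerNr.
Qed.

(** Write I n for the integral of [k n]. For fixed [n], Fatou's lemma for [psi] along m gives E cos
    (mu (I n - W)) <= E cos (mu I n). As n tends to infinity the left side tends to 1 and the right
    side to E cos (mu W), which is therefore 1. *)
Lemma elementary_limit_eq0 (A : set R) (k : nat -> {sfun R >-> R}) (W : Omega -> R) :
  bounded_borel b A -> measurable_fun setT W ->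
  {ae leb_m, forall x, A x -> k n x @[n --> \oo] --> (0 : R)} ->
  pd P (el A (k n)) W @[n --> \oo] --> 0 -> {ae P, forall w, W w = 0}.
Proof.
move=> bA mW k0 kW; have mA := bA.1; apply: eq0_of_cos => // mu.
have mel (f : {sfun R >-> R}) : measurable_fun setT (el A f) by exact: measurable_elementary.
have mpsi (f : {sfun R >-> R}) :
    measurable_fun A (EFin \o (fun x => psi a nu (mu * f x))).
  by case/integrableP: (integrable_sfun_comp bA f (fun y => psi a nu (mu * y))).
have Kc x y : `|cos (mu * x) - cos (mu * y)| <= `|mu| * `|x - y|.
  by apply: le_trans (cos_lipschitz _ _) _; rewrite -mulrBr normrM.
have lip := pd_cvg_lipschitz (P := P) _ _ (measurable_cosM mu) (fun x => cos_max _) Kc.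
have step n : \int[P]_w cos (mu * (el A (k n) w - W w)) <= \int[P]_w cos (mu * el A (k n) w).
  rewrite (elementary_cos _ _ bA).
  pose I m := \int[leb_m]_(x in A) psi a nu (mu * (k n - k m) x).
  apply: (@le_expR_of_einf I).
    pose F m x := (psi a nu (mu * (k n - k m) x))%:E.
    have -> : (\int[leb_m]_(x in A) psi a nu (mu * k n x))%:E =
        (\int[leb_m]_(x in A) limn_einf (F ^~ x))%E.
      rewrite /Rintegral fineK; last first.
        apply: integrable_fin_num => //.
        exact: (integrable_sfun_comp bA (k n) (fun y => psi a nu (mu * y))).
      apply: ae_eq_integral => //.
      - exact: mpsi.
      - under eq_fun do rewrite -[limn_einf _]oppeK -limn_esupN.
        apply: measurableT_comp => //; apply: measurable_fun_limn_esup => m.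
        by apply: measurableT_comp => //; exact: (mpsi (k n - k m)).
      apply: (ae_lebesgueS _ k0) => x kx Ax.
      have h : F m x @[m --> \oo] --> (psi a nu (mu * k n x))%:E.
        apply: cvg_EFin; first exact: nearW.
        apply: continuous_cvg; first exact: psi_continuous.
        apply: cvgM; first exact: cvg_cst.
        rewrite -[X in _ --> X]subr0; apply: cvgB; first exact: cvg_cst.
        exact: kx.
      by rewrite is_cvg_limn_einfE ?(cvg_lim _ h)//; apply/cvg_ex; eexists; exact: h.
    have -> : (fun m => (I m)%:E) = fun m => (\int[leb_m]_(x in A) F m x)%E.
      apply/funext => m; rewrite /I /Rintegral fineK//; apply: integrable_fin_num => //.
      exact: (integrable_sfun_comp bA (k n - k m) (fun y => psi a nu (mu * y))).
    apply: fatou => //.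
    - by move=> m; exact: (mpsi (k n - k m)).
    - by move=> m x _; rewrite lee_fin psi_ge0.
  rewrite [X in X @ _](_ : _ = fun m => \int[P]_w cos (mu * (el A (k n) w - el A (k m) w))).
    apply: (lip (fun m => el A (k n) \- el A (k m)) (el A (k n) \- W)).
    - by move=> m; exact: measurable_funB.
    - exact: measurable_funB.
    - apply: (@squeeze_cvgr _ _ _ _ (cst 0) (fun m => pd P (el A (k m)) W)) => //; last exact: cvg_cst.
      apply: nearW => m; rewrite pd_ge0/=.
      by have := pdB P (mel (k n)) (mel (k n)) (mel (k m)) mW; rewrite pdxx add0r.
  apply/funext => m; rewrite -(elementary_cos _ _ bA).
  apply: ae_eq_Rintegral; [exact: measurable_cos_comp|..].
    by apply: measurable_cos_comp; exact: measurable_funB.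
  by apply: filterS (elementary_integralB L_rm (k n) (k m) bA) => w ->.
apply/eqP; rewrite eq_le; apply/andP; split.
  rewrite -[leRHS](Rintegral_probability_cst P); apply: le_Rintegral => //.
  - exact: integrable_cos_comp.
  - by apply: (bounded_measurable_integrable _ (M := 1)) => // w; rewrite normr1.
have c1 : \int[P]_w cos (mu * (el A (k n) w - W w)) @[n --> \oo] --> (1 : R).
  have -> : (1 : R) = \int[P]_w cos (mu * cst 0 w).
    rewrite -[LHS](Rintegral_probability_cst P); apply: eq_Rintegral => w _.
    by rewrite mulr0 cos0.
  apply: (lip (fun n => el A (k n) \- W) (cst 0)) => //.
    by move=> n; exact: measurable_funB.
  by rewrite [X in X @ _](_ : _ = fun n => pd P (el A (k n)) W)//; apply/funext => n; rewrite [RHS]pd_sub0.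
have c2 := lip (fun n => el A (k n)) W (fun n => mel (k n)) mW kW.
by apply: (ler_cvg_to c1 c2); exact: nearW.
Qed.

(** The [k n] carry no bound in L^p. They are compared with approximants of [h] in L^p, whose
    integrals are Cauchy in probability; the difference tends to 0 almost everywhere, so both
    sequences have the same limit, and Fatou's lemma applies to the second one. *)
Lemma elementary_limit_moment (A : set R) (h : R -> R) (k : nat -> {sfun R >-> R})
    (J : Omega -> R) :
  bounded_borel b A -> measurable_fun A h ->
  leb_m.-integrable A (EFin \o (fun x => `|h x| `^ p)) ->
  measurable_fun setT J ->
  {ae leb_m, forall x, A x -> k n x @[n --> \oo] --> h x} ->
  pd P (el A (k n)) J @[n --> \oo] --> 0 ->
  (\int[P]_w (`|J w| `^ q)%:E <=
    (K * (\int[leb_m]_(x in A) (`|h x| `^ p)) `^ (q / p))%:E)%E.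
Proof.
move=> bA mh ih mJ kh kJ; have mA := bA.1.
have mel (f : {sfun R >-> R}) : measurable_fun setT (el A f) by exact: measurable_elementary.
have [phi [phih phi0 phi_le]] := Lp_sfun_approx p0 bA mh ih.
have [Y mY [phiY _]] := pd_cauchy_cvg (fun n => mel (phi n))
  (elementary_cauchy bA mA (@subset_refl _ _) mh ih phi0).
have JY : {ae P, forall w, J w = Y w}.
  have mJY : measurable_fun setT (J \- Y) by exact: measurable_funB.
  have := @elementary_limit_eq0 A (fun n => k n - phi n) (J \- Y) bA mJY.
  case/(_ _ _)/Wrap.
  - apply: (ae_lebesgueS _ kh) => x kx Ax; rewrite -(subrr (h x)).
    by apply: cvgB; [exact: kx|exact: phih].
  - apply: (@squeeze_cvgr _ _ _ _ (cst 0)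
      (fun n => pd P (el A (k n)) J + pd P (el A (phi n)) Y)).
    + apply: nearW => n; rewrite pd_ge0/=.
      have <- : pd P (el A (k n) \- el A (phi n)) (J \- Y) = pd P (el A (k n - phi n)) (J \- Y).
        apply: pd_ae => //; [exact: measurable_funB| |exact: aeW].
        by apply: filterS (elementary_integralB L_rm (k n) (phi n) bA) => w ->.
      exact: pdB.
    + exact: cvg_cst.
    + by rewrite -[X in _ --> X]addr0; exact: cvgD.
  by apply: filterS => w /eqP; rewrite subr_eq0 => /eqP.
apply: (fatou_pd_moment (X := fun n => el A (phi n)) _ mJ q0) => //.
  rewrite [X in X @ _](_ : _ = fun n => pd P (el A (phi n)) Y)//.
  by apply/funext => n; apply: pd_ae => //; exact: aeW.
move=> e e0; apply: nearW => n; apply: le_trans (elementary_moment (phi n) bA) _.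
have h1 : (\int[leb_m]_(x in A) (`|phi n x| `^ p)) `^ (q / p) <=
    (\int[leb_m]_(x in A) (`|h x| `^ p)) `^ (q / p).
  apply: ge0_ler_powR; rewrite ?nnegrE; first by rewrite divr_ge0 ?ltW.
  - by apply: Rintegral_ge0 => x _; exact: powR_ge0.
  - by apply: Rintegral_ge0 => x _; exact: powR_ge0.
  - exact: phi_le.
apply: (@le_trans _ _ (K * (\int[leb_m]_(x in A) (`|h x| `^ p)) `^ (q / p))%:E).
  by rewrite lee_fin; exact: (ler_wpM2l K0 h1).
by rewrite leeDl// lee_fin ltW.
Qed.

End elementary_moments.

(** * Dyadic grids and approximation of Borel sets in measure *)

Section dyadic_grid.
Context {R : realType}.
Implicit Types (A B G H : set R) (n j : nat).
Local Notation leb_m := (@lebesgue_measure R).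

Definition pt n j : R := j%:R / 2 ^+ n.

Lemma pt_ge0 n j : 0 <= pt n j.
Proof. by rewrite divr_ge0// exprn_ge0. Qed.

Lemma le_pt n i j : (pt n i <= pt n j) = (i <= j)%N.
Proof. by rewrite ler_pM2r ?invr_gt0 ?exprn_gt0// ler_nat. Qed.

Lemma lt_pt n i j : (pt n i < pt n j) = (i < j)%N.
Proof. by rewrite ltr_pM2r ?invr_gt0 ?exprn_gt0// ltr_nat. Qed.

Lemma ptSS n j : pt n.+1 j.*2 = pt n j.
Proof. by rewrite /pt -muln2 natrM exprS invfM mulrA mulfK. Qed.

Lemma pt_step n j : pt n j.+1 - pt n j = 2 ^- n.
Proof. by rewrite /pt -mulrBl -natrB// subSnn mul1r. Qed.

Lemma pt_nat n N : pt n (N * 2 ^ n) = N%:R.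
Proof. by rewrite /pt natrM natrX mulfK// expf_neq0. Qed.

Definition idx n (x : R) : nat := Num.truncn (x * 2 ^+ n).

Lemma idxP n x : 0 <= x -> pt n (idx n x) <= x < pt n (idx n x).+1.
Proof.
move=> x0; have p0 : 0 < 2 ^+ n :> R by rewrite exprn_gt0.
have := @truncn_itv R (x * 2 ^+ n); rewrite mulr_ge0 ?exprn_ge0// => /(_ isT).
by rewrite /pt /idx ler_pdivrMr// ltr_pdivlMr.
Qed.

Lemma cellP n x : 0 < x -> exists j, pt n j < x <= pt n j.+1.
Proof.
move=> x0; have /andP[h1 h2] := idxP n (ltW x0).
move: h1; rewrite le_eqVlt => /predU1P[h|h]; last by exists (idx n x); rewrite h ltW.
case E : (idx n x) h => [|k] h; first by rewrite -h /pt mul0r ltxx in x0.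
by exists k; rewrite -h lt_pt ltnSn lexx.
Qed.

(** Finite unions of level-n cells inside ]0, n], encoded as constancy on cells. In this form
    Boolean operations and refinement are immediate, and the growing interval eventually contains
    every bounded set. *)
Definition grid n G : Prop := G `<=` `]0, n%:R]%classic /\
  forall j x, pt n j < x <= pt n j.+1 -> (G x <-> G (pt n j.+1)).

Lemma gridS n G : grid n G -> grid n.+1 G.
Proof.
move=> [Gn hG]; split.
  by move=> x /Gn /=; rewrite !in_itv/= => /andP[-> /le_trans]; apply; rewrite ler_nat.
move=> j x /andP[jx xj].
have e1 := leq_half_double.
have hj : (j./2.*2 <= j)%N by rewrite -{2}(odd_double_half j) leq_addl.
have hj' : (j.+1 <= j./2.+1.*2)%N.
  by rewrite doubleS -{1}(odd_double_half j) ltnS; case: (odd j).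
have l1 y : pt n.+1 j < y -> pt n j./2 < y by apply: le_lt_trans; rewrite -ptSS le_pt.
have l2 y : y <= pt n.+1 j.+1 -> y <= pt n j./2.+1.
  by move=> h; apply: le_trans h _; rewrite -(ptSS n) le_pt.
apply: (iff_trans (hG j./2 x _)); first by rewrite l1// l2.
by apply: iff_sym; apply: hG; rewrite l1 ?lt_pt// l2.
Qed.

Lemma grid_le n m G : (n <= m)%N -> grid n G -> grid m G.
Proof. by move=> /subnK <-; elim: (m - n)%N => // k ih /ih; exact: gridS. Qed.

Lemma gridD n G H : grid n G -> grid n H -> grid n (G `\` H).
Proof.
move=> [Gn hG] [_ hH]; split; first exact: subset_trans (@subDsetl _ _ _) Gn.
by move=> j x jx; rewrite /setD/= (hG j x jx) (hH j x jx).
Qed.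

Lemma gridU n G H : grid n G -> grid n H -> grid n (G `|` H).
Proof.
move=> [Gn hG] [Hn hH]; split; first by rewrite subUset.
by move=> j x jx; rewrite /setU/= (hG j x jx) (hH j x jx).
Qed.

Lemma grid0 n : grid n set0.
Proof. by split. Qed.

Lemma grid_itv n i k : (k <= n * 2 ^ n)%N -> grid n `]pt n i, pt n k]%classic.
Proof.
move=> kn; split.
  move=> x /=; rewrite !in_itv/= => /andP[/(le_lt_trans (pt_ge0 _ _)) -> /le_trans]; apply.
  by rewrite -(pt_nat n) le_pt.
move=> j x /andP[jx xj]; rewrite /= !in_itv/= lt_pt le_pt; split.
  move=> /andP[ix xk]; apply/andP; split.
    by have := lt_le_trans ix xj; rewrite lt_pt.
  by have := lt_le_trans jx xk; rewrite lt_pt.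
move=> /andP[ij jk]; apply/andP; split.
  by apply: le_lt_trans jx; rewrite le_pt -ltnS.
by apply: le_trans xj _; rewrite le_pt.
Qed.

Lemma grid_cells n G : grid n G ->
  G = \bigcup_(j in [set j | (j < n * 2 ^ n)%N /\ G (pt n j.+1)]) `]pt n j, pt n j.+1]%classic.
Proof.
move=> [Gn hG]; apply/seteqP; split => x.
  move=> Gx; have /= := Gn x Gx; rewrite in_itv/= => /andP[x0 xn].
  have [j jx] := cellP n x0; exists j => /=; last by rewrite in_itv.
  split; last exact/(hG j x jx).
  case/andP: jx => jx _; have := lt_le_trans jx xn.
  by rewrite -(pt_nat n) lt_pt.
by move=> [j [jn Gj]] /=; rewrite in_itv/= => jx; apply/(hG j x jx).
Qed.

Lemma measurable_grid n G : grid n G -> measurable G.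
Proof.
move=> /grid_cells ->; apply: bigcup_measurable => k _; exact: measurable_itv.
Qed.

Lemma leb_grid n G : grid n G ->
  leb_m G = (\sum_(j < n * 2 ^ n) 2 ^- n * \1_G (pt n j.+1))%:E.
Proof.
move=> gG; rewrite {1}(grid_cells gG).
pose F j := if (j < n * 2 ^ n)%N && (pt n j.+1 \in G) then `]pt n j, pt n j.+1]%classic else set0 : set R.
have -> : \bigcup_(j in [set j | (j < n * 2 ^ n)%N /\ G (pt n j.+1)]) `]pt n j, pt n j.+1]%classic
    = \big[setU/set0]_(j < n * 2 ^ n) F j.
  rewrite -bigcup_mkord; apply/seteqP; split => x.
    by move=> [j /= [jn Gj] jx]; exists j => //=; rewrite /F jn mem_set.
  move=> [j /= jn]; rewrite /F jn/=; case: ifPn => //; rewrite inE => Gj jx.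
  by exists j.
rewrite measure_semi_additive//.
- rewrite -sumEFin; apply: eq_bigr => j _; rewrite /F ltn_ord/= indicE.
  case: (pt n j.+1 \in G); last by rewrite mulr0 measure0.
  by rewrite lebesgue_measure_itv/= lte_fin lt_pt ltnSn -EFinB pt_step mulr1.
- by move=> j; rewrite /F; case: ifP => _; [exact: measurable_itv|exact: measurable0].
- apply/trivIsetP => i j _ _; wlog ij : i j / (i < j)%N.
    by move=> h; rewrite neq_ltn => /orP[]ij; [|rewrite setIC]; apply: h; rewrite // neq_ltn ij ?orbT.
  move=> _; rewrite /F; case: ifP => _; last by rewrite set0I.
  case: ifP => _; last by rewrite setI0.
  apply/seteqP; split => // x [/=]; rewrite !in_itv/= => /andP[_ xi] /andP[jx _].
  by have := lt_le_trans jx xi; rewrite lt_pt ltnNge ij.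
- apply: bigsetU_measurable => j _; rewrite /F; case: ifP => _; [exact: measurable_itv|exact: measurable0].
Qed.

Lemma lebY_triangle A B C : measurable A -> measurable B -> measurable C ->
  (leb_m (A `+` C) <= leb_m (A `+` B) + leb_m (B `+` C))%E.
Proof.
move=> mA mB mC.
have mY (U V : set R) : measurable U -> measurable V -> measurable (U `+` V).
  by move=> mU mV; apply: measurableU; exact: measurableD.
apply: le_trans (measureU2 _ _ _).
- apply: le_measure; rewrite ?inE; [exact: mY|apply: measurableU; exact: mY|].
  move=> x /=; case: (pselect (B x)) => Bx; tauto.
- exact: mY.
- exact: mY.
Qed.

Lemma measurableY A B : measurable A -> measurable B -> measurable (A `+` B).
Proof. by move=> mU mV; apply: measurableU; exact: measurableD. Qed.

Definition grid_approx A : Prop := forall e : R, 0 < e ->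
  exists n G, grid n G /\ (leb_m (A `+` G) <= e%:E)%E.

(** Rounding down moves each endpoint by less than one cell, hence the factor 2. *)
Lemma grid_approx_itv (s t : R) : 0 <= s -> s <= t -> forall n, (t <= n%:R) ->
  (leb_m (`]s, t]%classic `+` `]pt n (idx n s), pt n (idx n t)]%classic) <=
    (2 * 2 ^- n)%:E)%E.
Proof.
move=> s0 st n tn; have t0 := le_trans s0 st.
have /andP[s1 s2] := idxP n s0; have /andP[t1 t2] := idxP n t0.
have mI (x y : R) : measurable `]x, y]%classic by exact: measurable_itv.
apply: (@le_trans _ _ (leb_m (`]pt n (idx n s), s]%classic `|` `]pt n (idx n t), t]%classic))).
  apply: le_measure; rewrite ?inE; [exact: measurableY|exact: measurableU|].
  move=> x /=; rewrite !in_itv/= => -[[/andP[sx xt] nx]|[/andP[ax xc] nx]].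
    right; rewrite xt andbT ltNge; apply/negP => xc; apply: nx.
    by rewrite xc andbT (le_lt_trans s1).
  by left; rewrite ax/= leNgt; apply/negP => sx; apply: nx; rewrite sx (le_trans xc).
apply: le_trans (measureU2 _ _ _) _; [exact: mI|exact: mI|].
have h (x : R) : pt n (idx n x) <= x < pt n (idx n x).+1 ->
    (leb_m `]pt n (idx n x), x]%classic <= (2 ^- n)%:E)%E.
  move=> /andP[x1 x2]; rewrite lebesgue_measure_itv/=; case: ifP => _.
    by rewrite -EFinB lee_fin; have := pt_step n (idx n x); lra.
  by rewrite lee_fin invr_ge0 exprn_ge0.
rewrite mulr_natl mulr2n EFinD; apply: leeD; apply: h; exact/andP.
Qed.

Lemma expr_half_small (e : R) : 0 < e -> exists n, forall m, (n <= m)%N -> 2 ^- m <= e.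
Proof.
move=> e0; exists (Num.bound e^-1) => m nm.
rewrite -[leRHS]invrK lef_pV2 ?posrE ?invr_gt0 ?exprn_gt0//.
apply: le_trans (ltW (archi_boundP _)) _; first by rewrite invr_ge0 ltW.
by rewrite -natrX ler_nat (leq_trans nm)// ltnW// ltn_expl.
Qed.

Lemma grid_nat N n : (N <= n)%N -> grid n `]0, N%:R]%classic.
Proof.
move=> Nn; have := @grid_itv n 0 (N * 2 ^ n); rewrite pt_nat /pt mul0r; apply.
by rewrite leq_mul2r Nn orbT.
Qed.

Lemma cvg_leb_tail (b : R) (F : nat -> set R) : (forall i, bounded_borel b (F i)) ->
  trivIset setT F -> forall e, 0 < e -> exists m, forall n, (m <= n)%N ->
  (leb_m (\bigcup_i F i `+` \big[setU/set0]_(i < n) F i) <= e%:E)%E.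
Proof.
move=> bF tF e e0; have bU : bounded_borel b (\bigcup_i F i).
  split; first by apply: bigcupT_measurable => i; exact: (bF i).1.
  by apply: bigcup_sub => i _; exact: (bF i).2.
have bP n : bounded_borel b (\big[setU/set0]_(i < n) F i).
  apply: (bounded_borel_sub bU); first by apply: bigsetU_measurable => i _; exact: (bF i).1.
  by rewrite -bigcup_mkord; apply: bigcup_sub => i _; exact: bigcup_sup.
have lP n : leb (\big[setU/set0]_(i < n) F i) = \sum_(i < n) leb (F i).
  elim: n => [|n ih]; first by rewrite !big_ord0 /leb measure0.
  rewrite !big_ord_recr/= (lebU (bP n) (bF n)) ?ih//.
  rewrite -bigcup_mkord setI_bigcupl; apply: bigcup0 => i /= ni.
  by move/trivIsetP : tF => /(_ i n I I); apply; rewrite ltn_eqF.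
have c := cvg_leb_sum bF tF.
have [m _ hm] : \forall n \near \oo, leb (\bigcup_i F i) - \sum_(i < n) leb (F i) <= e.
  have c' : leb (\bigcup_i F i) - \sum_(i < n) leb (F i) @[n --> \oo] --> (0 : R).
    rewrite -[X in _ --> X](subrr (leb (\bigcup_i F i))).
    exact: (cvgB (cvg_cst _) c).
  by near do apply/ltW; apply: (cvgr_lt 0).
exists m => n mn; have := hm n mn; rewrite -lP => h.
have sub : \big[setU/set0]_(i < n) F i `<=` \bigcup_i F i.
  by rewrite -bigcup_mkord; apply: bigcup_sub => i _; exact: bigcup_sup.
have bD : bounded_borel b (\bigcup_i F i `\` \big[setU/set0]_(i < n) F i).
  by apply: (bounded_borel_sub bU); [exact: measurableD bU.1 (bP n).1|exact: subDsetl].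
rewrite (_ : _ `+` _ = \bigcup_i F i `\` \big[setU/set0]_(i < n) F i); last first.
  by rewrite /setY; apply/setUidPl => x [Px nUx]; case: nUx; exact: sub.
rewrite -(EFin_leb bD) lee_fin; apply: le_trans h.
rewrite lerBrDl -(lebU (bP n) bD); first by rewrite setDUK.
by rewrite setIDA setIC -setIDA setDv setI0.
Unshelve. all: by end_near. Qed.

(** Dynkin induction inside ]0, N]. For a disjoint union the tail uses e / 2 and the first [m]
    pieces share the other half; the divisor m + 1 also covers m = 0. *)
Lemma grid_approxP b A : bounded_borel b A -> grid_approx A.
Proof.
move=> bA; pose N := Num.bound `|b|.
have bN : b <= N%:R.
  by apply: le_trans (ler_norm b) _; exact: ltW (archi_boundP (normr_ge0 b)).
have [mA AN] := bounded_borel_le bN bA.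
pose I : set R := `]0, N%:R]%classic.
have mI : measurable I by exact: measurable_itv.
suff : grid_approx (A `&` I) by rewrite (setIidl AN).
apply: (borel_dynkin_ind (H := fun A => grid_approx (A `&` I))) => //.
- move=> e e0; exists N, I; rewrite setTI setYK measure0 lee_fin ltW//.
  by split => //; exact: grid_nat.
- move=> B mB HB e e0; have [n [G [gG h]]] := HB e e0.
  exists (maxn n N), (I `\` G); split.
    by apply: gridD; [apply: grid_nat; rewrite leq_maxr|apply: grid_le gG; rewrite leq_maxl].
  have mG := measurable_grid gG.
  apply: le_trans h; apply: le_measure; rewrite ?inE.
  + by apply: measurableY; [apply: measurableI => //; exact: measurableC|exact: measurableD].
  + by apply: measurableY => //; exact: measurableI.
  + by move=> x /=; case: (pselect (G x)); case: (pselect (B x)); case: (pselect (I x)); tauto.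
- move=> F mF tF HF e e0; rewrite setI_bigcupl; set F' := fun i => F i `&` I.
  have bF i : bounded_borel N%:R (F' i) by split; [exact: measurableI|exact: subIsetr].
  have tF' : trivIset setT F'.
    apply/trivIsetP => i j _ _ ij; rewrite /F' setIACA.
    by move/trivIsetP : tF => /(_ i j Logic.I Logic.I ij) ->; rewrite set0I.
  have e2 : 0 < e / 2 by rewrite divr_gt0.
  have [m hm] := cvg_leb_tail bF tF' e2; have {}hm := hm m (leqnn m).
  have HF' i : exists nG : nat * set R, grid nG.1 nG.2 /\
      (leb_m (F' i `+` nG.2) <= (e / 2 / m.+1%:R)%:E)%E.
    have [|n [G hG]] := HF i (e / 2 / m.+1%:R); first by rewrite divr_gt0.
    by exists (n, G).
  have [nG hnG] := choice HF'.
  exists (\sum_(i < m) (nG i).1)%N, (\big[setU/set0]_(i < m) (nG i).2); split.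
    suff : forall k, (k <= m)%N ->
      grid (\sum_(i < k) (nG i).1)%N (\big[setU/set0]_(i < k) (nG i).2) by apply.
    elim=> [|k ih] km; first by rewrite !big_ord0; exact: grid0.
    rewrite !big_ord_recr/=; apply: gridU.
      by apply: grid_le (ih (ltnW km)); rewrite leq_addr.
    by apply: grid_le (hnG k).1; rewrite leq_addl.
  have mG i : measurable (nG i).2 by exact: measurable_grid (hnG i).1.
  have mUF : measurable (\bigcup_i F' i) by apply: bigcupT_measurable => i; exact: (bF i).1.
  have mPF k : measurable (\big[setU/set0]_(i < k) F' i).
    by apply: bigsetU_measurable => i _; exact: (bF i).1.
  have mPG k : measurable (\big[setU/set0]_(i < k) (nG i).2).
    by apply: bigsetU_measurable => i _.
  apply: le_trans (lebY_triangle mUF (mPF m) (mPG m)) _.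
  have -> : e = e / 2 + e / 2 by exact: splitr.
  rewrite EFinD; apply: leeD => //.
  suff : forall k, (leb_m (\big[setU/set0]_(i < k) F' i `+` \big[setU/set0]_(i < k) (nG i).2) <=
      (k%:R * (e / 2 / m.+1%:R))%:E)%E.
    move=> /(_ m) h; apply: le_trans h _; rewrite lee_fin mulrCA ler_piMr ?ltW//.
    by rewrite ltr_pdivrMr// mul1r ltr_nat.
  elim=> [|k ih]; first by rewrite !big_ord0 setYK measure0 mul0r.
  rewrite !big_ord_recr/= -natr1 mulrDl mul1r EFinD.
  apply: le_trans (leeD ih (hnG k).2).
  apply: le_trans (measureU2 _ _ _).
  + apply: le_measure; rewrite ?inE.
    * exact: (measurableY (measurableU _ _ (mPF k) (bF k).1) (measurableU _ _ (mPG k) (mG k))).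
    * exact: (measurableU _ _ (measurableY (mPF k) (mPG k)) (measurableY (bF k).1 (mG k))).
    * by move=> x /=; tauto.
  + exact: (measurableY (mPF k) (mPG k)).
  + exact: (measurableY (bF k).1 (mG k)).
- move=> s t e e0; have e2 : 0 < e / 2 by rewrite divr_gt0.
  have -> : `]s, t]%classic `&` I = `]Num.max s 0, Num.min t N%:R]%classic.
    rewrite /I; apply/seteqP; split => x /=; rewrite !in_itv/= gt_max le_min.
      by move=> [/andP[-> ->] /andP[-> ->]].
    by move=> /andP[/andP[-> ->] /andP[-> ->]].
  set s' := Num.max s 0; set t' := Num.min t N%:R.
  have s0 : 0 <= s' by rewrite le_max lexx orbT.
  have tN : t' <= N%:R by rewrite ge_min lexx orbT.
  have [st|ts] := leP s' t'; last first.
    exists 0%N, set0; split; first exact: grid0.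
    by rewrite set_itv_ge -?leNgt ?bnd_simp ?(ltW ts)// setY0 measure0 lee_fin ltW.
  have [m hm] := expr_half_small e2; pose n := maxn m N.
  have tn : t' <= n%:R by apply: le_trans tN _; rewrite ler_nat leq_maxr.
  exists n, `]pt n (idx n s'), pt n (idx n t')]%classic; split.
    apply: grid_itv; rewrite -(@le_pt n) pt_nat.
    by apply: le_trans tn; case/andP: (idxP n (le_trans s0 st)).
  apply: le_trans (grid_approx_itv s0 st tn) _; rewrite lee_fin.
  have := hm n (leq_maxl _ _); lra.
Qed.

End dyadic_grid.

(** * Construction of the random measure from increments on grids *)

Section grid_measures.
Context d {Omega : measurableType d} {R : realType} (P : probability Omega R).
Variables (Z : R -> {RV P >-> R}) (a : R) (nu : {measure set R -> \bar R}).
Hypotheses (Z_levy : is_levy_process Z) (a0 : 0 <= a) (nu_levy : levy_measure nu)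
  (nu_sym : symmetric_measure nu) (Z_triplet : has_triplet Z a nu).
Variables (p q K : R).
Hypotheses (p0 : 0 < p) (q0 : 0 < q) (K0 : 0 <= K) (hK : moment_const P a nu 1 p q K).
Local Notation leb_m := (@lebesgue_measure R).
Implicit Types (A B G H : set R) (n j : nat).

Definition inc n j (w : Omega) : R := Z (pt n j.+1) w - Z (pt n j) w.

(** The value that additivity forces on a grid set: the increments of [Z] over its cells are added
    up. *)
Definition ZG n G (w : Omega) : R := \sum_(0 <= j < n * 2 ^ n) \1_G (pt n j.+1) * inc n j w.

Lemma measurable_inc n j : measurable_fun setT (inc n j).
Proof. by apply: measurable_funB; exact: measurable_funP. Qed.

Lemma measurable_ZG n G : measurable_fun setT (ZG n G).
Proof.
by apply: measurable_sum => j; apply: measurable_funM => //; exact: measurable_inc.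
Qed.

Lemma sum_pairs (f : nat -> R) M :
  \sum_(0 <= j < M.*2) f j = \sum_(0 <= i < M) (f i.*2 + f i.*2.+1).
Proof.
elim: M => [|M ih]; first by rewrite !big_nil.
by rewrite doubleS !big_nat_recr//= ih addrA.
Qed.

(** Halving a cell splits its increment, and the cells added beyond [n] lie outside [G]. *)
Lemma ZGS n G : grid n G -> ZG n.+1 G = ZG n G.
Proof.
move=> [Gn hG]; apply/funext => w; rewrite /ZG; set M := (n * 2 ^ n)%N.
have MM : (M.*2 <= n.+1 * 2 ^ n.+1)%N.
  by rewrite /M expnS mulnCA -mul2n leq_mul2l/= leq_mul2r leqnSn orbT.
rewrite (big_cat_nat _ MM)//= [X in _ + X]big1_seq ?addr0; last first.
  move=> j /= ; rewrite mem_index_iota => /andP[Mj _].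
  rewrite indicE memNset ?mul0r// => /Gn /=; rewrite in_itv/= => /andP[_].
  rewrite -(pt_nat n.+1 n) le_pt leqNgt ltnS.
  by rewrite expnS mulnCA mul2n Mj.
rewrite sum_pairs; apply: eq_bigr => i _.
have h1 : \1_G (pt n.+1 i.*2.+1) = \1_G (pt n i.+1) :> R.
  have hx : G (pt n.+1 i.*2.+1) <-> G (pt n i.+1).
    by apply: hG; rewrite -!(ptSS n) lt_pt le_pt doubleS leqnSn ltnSn.
  by rewrite !indicE; congr (_%:R); congr nat_of_bool; apply/idP/idP; rewrite !inE => /hx.
rewrite h1 -doubleS ptSS -mulrDr; congr (_ * _); rewrite /inc -doubleS !ptSS.
by rewrite addrC addrA subrK.
Qed.

Lemma ZG_le n m G : (n <= m)%N -> grid n G -> ZG m G = ZG n G.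
Proof.
move=> /subnK <- gG; elim: (m - n)%N => // k ih; rewrite addSn ZGS//.
by apply: grid_le gG; rewrite leq_addl.
Qed.

(** The difference has coefficients 0, 1 and -1, nonzero exactly on the cells of the symmetric
    difference. Setting the weights [D] to 0 on the other cells makes the total length equal to its
    measure, hence at most 1. *)
Lemma ZG_moment n G H : grid n G -> grid n H -> (leb_m (G `+` H) <= 1)%E ->
  (\int[P]_w (`|ZG n G w - ZG n H w| `^ q)%:E <=
    (K * (leb (G `+` H)) `^ (q / p))%:E)%E.
Proof.
move=> gG gH GH1; have gGH : grid n (G `+` H) by apply: gridU; exact: gridD.
have lE := leb_grid gGH.
pose M := (n * 2 ^ n)%N.
pose D j : R := 2 ^- n * \1_(G `+` H) (pt n j.+1).
pose c j : R := \1_G (pt n j.+1) - \1_H (pt n j.+1).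
have D0 j : 0 <= D j by rewrite mulr_ge0 ?invr_ge0 ?exprn_ge0.
have SD : \sum_(j < M) D j = leb (G `+` H) by rewrite /leb lE.
have Dc j : D j * `|c j| `^ p = D j.
  rewrite /D /c !indicE in_setU !in_setD.
  case: (_ \in G); case: (_ \in H); rewrite /= ?mulr0 ?mul0r//.
    by rewrite subr0 normr1 powR1 mulr1.
  by rewrite sub0r normrN normr1 powR1 mulr1.
have Dpsi j mu : (pt n j.+1 - pt n j) * psi a nu (mu * c j) = D j * psi a nu (mu * c j).
  rewrite pt_step /D /c !indicE in_setU !in_setD.
  case: (_ \in G); case: (_ \in H); rewrite /= ?mulr1// ?subrr ?mulr0 ?psi0 ?mulr0//.
have -> : leb (G `+` H) = \sum_(j < M) D j * `|c j| `^ p.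
  by rewrite -SD; apply: eq_bigr => j _; rewrite Dc.
have E w : ZG n G w - ZG n H w = \sum_(i < M) c i * (Z (pt n i.+1) w - Z (pt n i) w).
  by rewrite /ZG -sumrB big_mkord; apply: eq_bigr => i _; rewrite -mulrBl.
have mE : measurable_fun setT (fun w => ZG n G w - ZG n H w).
  by apply: measurable_funB; exact: measurable_ZG.
apply: (@hK M D c (fun w => ZG n G w - ZG n H w)) => //.
  by rewrite SD -lee_fin /leb lE fineK// -lE.
move=> mu; under eq_Rintegral do rewrite E.
have [|i|-> _] := levy_increments_cf Z_levy nu_levy nu_sym Z_triplet c M mu (s := pt n).
- exact: pt_ge0.
- by rewrite le_pt.
by congr (expR (- _)); apply: eq_bigr => i _; rewrite Dpsi.
Qed.

Lemma ZG_small (e : R) : 0 < e -> exists2 eta, 0 < eta &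
  forall n m G H, grid n G -> grid m H -> (leb_m (G `+` H) <= eta%:E)%E ->
    pd P (ZG n G) (ZG m H) <= e.
Proof.
move=> e0; have [eta eta0 h] := pd_small_of_moment P p0 q0 K0 e0.
exists (Num.min eta 1); first by rewrite lt_min eta0 ltr01.
move=> n m G H gG gH; pose k := maxn n m.
have gG' : grid k G by apply: grid_le gG; rewrite leq_maxl.
have gH' : grid k H by apply: grid_le gH; rewrite leq_maxr.
rewrite -(ZG_le (leq_maxl n m) gG) -(ZG_le (leq_maxr n m) gH) -/k => le.
have gGH : grid k (G `+` H) by apply: gridU; exact: gridD.
have lE : leb_m (G `+` H) = (leb (G `+` H))%:E by rewrite /leb (leb_grid gGH).
have := le; rewrite lE lee_fin le_min => /andP[l1 l2].
apply: (h _ _ (leb (G `+` H))) => //; [exact: measurable_ZG|exact: measurable_ZG|exact: leb_ge0|].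
by apply: ZG_moment => //; rewrite lE lee_fin.
Qed.

(** The limit of [ZG] as grid sets approach [A] in measure, stated with e and eta so as not to
    depend on an approximating sequence. *)
Definition rm_value A (X : Omega -> R) : Prop := forall e : R, 0 < e ->
  exists2 eta, 0 < eta & forall n G, grid n G ->
    (leb_m (A `+` G) <= eta%:E)%E -> pd P (ZG n G) X <= e.

Lemma rm_value_exists b A : bounded_borel b A ->
  exists2 X, measurable_fun setT X & rm_value A X.
Proof.
move=> bA; have hG k : exists nG : nat * set R, grid nG.1 nG.2 /\
    (leb_m (A `+` nG.2) <= (2 ^- k)%:E)%E.
  have [|n [G h]] := grid_approxP bA (e := 2 ^- k); first by rewrite invr_gt0 exprn_gt0.
  by exists (n, G).
have [nG hnG] := choice hG; have mA := bA.1.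
have mG k : measurable (nG k).2 by exact: measurable_grid (hnG k).1.
have [|e e0|X mX [cX _]] := @pd_cauchy_cvg _ _ _ P (fun k => ZG (nG k).1 (nG k).2).
- by move=> k; exact: measurable_ZG.
- have [eta eta0 h] := ZG_small e0.
  have [|N hN] := @expr_half_small R (eta / 2); first by rewrite divr_gt0.
  exists N => n m Nn Nm; apply: h; [exact: (hnG n).1|exact: (hnG m).1|].
  apply: le_trans (lebY_triangle (mG n) mA (mG m)) _.
  rewrite (splitr eta) EFinD setYC; apply: leeD.
    by apply: le_trans (hnG n).2 _; rewrite lee_fin hN.
  by apply: le_trans (hnG m).2 _; rewrite lee_fin hN.
exists X => // e e0; have e2 : 0 < e / 2 by rewrite divr_gt0.
have [eta eta0 h] := ZG_small e2; exists (eta / 2); first by rewrite divr_gt0.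
move=> n G gG le.
have [|N hN] := @expr_half_small R (eta / 2); first by rewrite divr_gt0.
have [N' _ hN'] : \forall k \near \oo, pd P (ZG (nG k).1 (nG k).2) X <= e / 2.
  by near do apply/ltW; apply: (cvgr_lt 0).
pose k := maxn N N'.
rewrite (splitr e); apply: le_trans (pd_triangle P (measurable_ZG n G) (measurable_ZG (nG k).1 (nG k).2) mX) _.
apply: lerD; last by apply: hN'; rewrite /= leq_maxr.
apply: h => //; first exact: (hnG k).1.
apply: le_trans (lebY_triangle (measurable_grid gG) mA (mG k)) _.
rewrite (splitr eta) EFinD setYC; apply: leeD => //.
by apply: le_trans (hnG k).2 _; rewrite lee_fin hN// leq_maxl.
Unshelve. all: by end_near. Qed.

Lemma rm_value_limit A (X : Omega -> R) (n : nat -> nat) (G : nat -> set R) :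
  measurable_fun setT X -> rm_value A X -> (forall k, grid (n k) (G k)) ->
  (forall e : R, 0 < e -> \forall k \near \oo, (leb_m (A `+` G k) <= e%:E)%E) ->
  pd P (ZG (n k) (G k)) X @[k --> \oo] --> 0.
Proof.
move=> mX hX gG hG; apply/cvgrPdist_le => e e0; have [eta eta0 h] := hX e e0.
have := hG eta eta0; apply: filterS => k hk.
by rewrite sub0r normrN ger0_norm ?pd_ge0// h.
Qed.

End grid_measures.

(** * Existence of the independently scattered random measure *)

Section random_measure_existence.
Context d {Omega : measurableType d} {R : realType} (P : probability Omega R).
Variables (Z : R -> {RV P >-> R}) (a : R) (nu : {measure set R -> \bar R}).
Hypotheses (Z_levy : is_levy_process Z) (a0 : 0 <= a) (nu_levy : levy_measure nu)
  (nu_sym : symmetric_measure nu) (Z_triplet : has_triplet Z a nu).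
Variables (p q K : R).
Hypotheses (p0 : 0 < p) (q0 : 0 < q) (K0 : 0 <= K) (hK : moment_const P a nu 1 p q K).
Local Notation leb_m := (@lebesgue_measure R).
Local Notation ZG := (ZG Z).
Implicit Types (A B G H : set R).

Lemma indepN_ext (X Y : nat -> Omega -> R) N : (forall i, (i < N)%N -> X i = Y i) ->
  indepN P X N -> indepN P Y N.
Proof.
move=> XY iX B mB.
have -> : \bigcap_(i in `I_N) (Y i @^-1` B i) = \bigcap_(i in `I_N) (X i @^-1` B i).
  by apply/seteqP; split => w h i iN; move: (h i iN); rewrite XY.
by rewrite iX//; apply: eq_bigr => i _; rewrite XY.
Qed.

(** Earlier approximants are removed from later ones. A point of [A i] lost in this way lies in an
    earlier approximant but not in the set it approximates, so the error is at most the sum of the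
    errors up to index [i]. *)
Lemma disjoint_grid_approx (b : R) (A : nat -> set R) (N : nat) :
  (forall i, bounded_borel b (A i)) -> trivIset setT A ->
  exists (n : nat -> nat) (G : nat -> nat -> set R),
  [/\ forall k i, (i < N)%N -> grid (n k) (G k i),
    forall k i j, (i < j)%N -> G k i `&` G k j = set0 &
    forall i e, (i < N)%N -> 0 < e -> \forall k \near \oo, (leb_m (A i `+` G k i) <= e%:E)%E].
Proof.
move=> bA tA.
have hG (ki : nat * nat) : exists nG : nat * set R, grid nG.1 nG.2 /\
    (leb_m (A ki.2 `+` nG.2) <= (2 ^- ki.1)%:E)%E.
  have [|n [G h]] := grid_approxP (bA ki.2) (e := 2 ^- ki.1); first by rewrite invr_gt0 exprn_gt0.
  by exists (n, G).
have [nG hnG] := choice hG.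
pose H k i := (nG (k, i)).2.
have mA i : measurable (A i) by exact: (bA i).1.
have mH k i : measurable (H k i) by exact: measurable_grid (hnG (k, i)).1.
pose n k := (\sum_(i < N) (nG (k, val i)).1)%N.
have gH k i : (i < N)%N -> grid (n k) (H k i).
  move=> iN; apply: grid_le (hnG (k, i)).1; rewrite /n (bigD1 (Ordinal iN))//=.
  exact: leq_addr.
exists n, (fun k i => H k i `\` \big[setU/set0]_(l < i) H k l); split.
- move=> k i iN; apply: gridD; first exact: gH.
  have : (i <= N)%N by exact: ltnW.
  elim: i {iN} => [|i ih] iN; first by rewrite big_ord0; exact: grid0.
  by rewrite big_ord_recr/=; apply: gridU; [exact: ih (ltnW iN)|exact: gH].
- move=> k i j ij; apply/seteqP; split => // x [[Hi _] [_ nHj]]; apply: nHj.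
  by rewrite -bigcup_mkord; exists i.
move=> i e iN e0.
have [|m hm] := @expr_half_small R (e / i.+1%:R); first by rewrite divr_gt0.
exists m => // k /= mk.
have mY l : measurable (A l `+` H k l) by exact: (measurableY (mA l) (mH k l)).
apply: (@le_trans _ _ (leb_m (\big[setU/set0]_(l < i.+1) (A l `+` H k l)))).
  apply: le_measure; rewrite ?inE.
  - by apply: measurableY => //; apply: measurableD => //; apply: bigsetU_measurable.
  - by apply: bigsetU_measurable => l _; exact: mY.
  rewrite -(bigcup_mkord i.+1 (fun l => A l `+` H k l)) => x /= [[Ax nG']|[[Hx _] nAx]]; last first.
    by exists i => //=; right.
  have [Hx|nHx] := pselect (H k i x); last by exists i => //=; left.
  have [l li Hl] : exists2 l, (l < i)%N & H k l x.
    have : (\big[setU/set0]_(l < i) H k l) x by apply: contrapT => h; apply: nG'.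
    by rewrite -(bigcup_mkord i (H k)) => -[l /= li Hl]; exists l.
  exists l => /=; first exact: ltnW.
  right; split => // Al; move/trivIsetP : tA => /(_ l i I I).
  rewrite ltn_eqF// => /(_ isT) /seteqP[h _]; exact: (h x).
have h : forall r, (leb_m (\big[setU/set0]_(l < r) (A l `+` H k l)) <= (r%:R * 2 ^- k)%:E)%E.
  elim=> [|r ih]; first by rewrite big_ord0 measure0 mul0r.
  rewrite big_ord_recr/= -natr1 mulrDl mul1r EFinD.
  apply: le_trans (measureU2 _ _ _) _ => //.
    by apply: bigsetU_measurable => l _; exact: mY.
    exact: mY.
  by apply: leeD => //; exact: (hnG (k, r)).2.
apply: le_trans (h i.+1) _; rewrite lee_fin mulrC.
by have := hm k mk; rewrite ler_pdivlMr.
Qed.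

(** Each cell belongs to at most one of the disjoint sets. [kap] sends it to the index of that set,
    or to the spare block [N], which is dropped at the end. *)
Lemma ZG_indepN n (G : nat -> set R) N :
  (forall i j, (i < j)%N -> G i `&` G j = set0) ->
  indepN P (fun i => ZG n (G i)) N.
Proof.
move=> dG; set M := (n * 2 ^ n)%N.
have iX : indepN P (inc Z n) M.
  apply: (levy_increments_indepN Z_levy (s := pt n)); first exact: pt_ge0.
  by move=> i; rewrite le_pt.
pose kap j := find (fun i => pt n j.+1 \in G i) (iota 0 N).
have kN j : (kap j < N.+1)%N by rewrite ltnS -[leqRHS](size_iota 0 N) find_size.
have := indepN_block_sum (@measurable_inc _ _ _ _ Z n) iX (kap := kap) (m := N.+1) (fun j _ => kN j).
move=> /(indepN_le _ (leqnSn N)) h.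
apply: (indepN_ext _ (h _)); last first.
  move=> i; apply: measurable_sum => j.
  by case: (kap j == i); [exact: measurable_inc|exact: measurable_cst].
move=> i iN; apply/funext => w; rewrite /ZG big_mkord; apply: eq_bigr => j _.
have mem_kap : (kap j < N)%N -> pt n j.+1 \in G (kap j).
  move=> kj; have hs : has (fun i => pt n j.+1 \in G i) (iota 0 N).
    by rewrite has_find size_iota.
  by have := nth_find 0%N hs; rewrite nth_iota// add0n.
rewrite indicE; case: eqVneq => [ki|ki].
  by rewrite -ki mem_kap ?ki// mul1r.
case: (boolP (_ \in G i)) => [Gi|_]; last by rewrite mul0r.
have kj : (kap j < N)%N.
  by rewrite -[ltnRHS](size_iota 0 N) -has_find; apply/hasP; exists i => //; rewrite mem_iota.
have Gk := mem_kap kj; rewrite !inE in Gi Gk.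
move: ki; rewrite neq_ltn => /orP[]/dG/seteqP[h0 _]; exfalso.
  exact: (h0 _ (conj Gk Gi)).
exact: (h0 _ (conj Gi Gk)).
Qed.

Lemma rv_of_measurable (X : Omega -> R) : measurable_fun setT X ->
  exists Y : {RV P >-> R}, forall w, Y w = X w.
Proof. by move=> mX; exists (mfun_Sub (mem_set mX)). Qed.

Lemma rm_value_choice : exists L : set R -> {RV P >-> R},
  forall b A, bounded_borel b A -> rm_value Z A (L A).
Proof.
have h A : exists X : {RV P >-> R}, forall b, bounded_borel b A -> rm_value Z A X.
  have [[b bA]|nb] := pselect (exists b, bounded_borel b A); last first.
    by exists (Z 0) => b bA; case: nb; exists b.
  have [X mX hX] := rm_value_exists Z_levy nu_levy nu_sym Z_triplet p0 q0 K0 hK bA.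
  have [Y YX] := rv_of_measurable mX; exists Y => _ _.
  by have -> : (Y : Omega -> R) = X by apply/funext.
have [L hL] := choice h; exists L => b A; exact: hL.
Qed.

Lemma levy_stoch_cvg (s : R) (r : nat -> R) : 0 <= s -> (forall n, 0 <= r n) ->
  r n @[n --> \oo] --> s -> pd P (Z (r n)) (Z s) @[n --> \oo] --> 0.
Proof.
move=> s0 r0 rs; apply/cvg_in_probability_pd => [n||e e0]; [exact: measurable_funP|exact: measurable_funP|].
have h := levy_stoch_continuous Z_levy s0 e0.
apply: (cvg_comp _ _ _ h) => V /= hV.
have : \forall n \near \oo, r n \in [set` `[0, +oo[%R] -> V (r n).
  by have [M _ hM] := rs _ hV; exists M => // n /= Mn /set_mem; exact: (hM n Mn).
by apply: filterS => n; apply; rewrite inE /= in_itv/= r0.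
Qed.

Section choice_is_random_measure.
Variable L : set R -> {RV P >-> R}.
Hypothesis hL : forall b A, bounded_borel b A -> rm_value Z A (L A).

Let mL A : measurable_fun setT (L A). Proof. exact: measurable_funP. Qed.

Lemma pd_rm_limit b A (n : nat -> nat) (G : nat -> set R) : bounded_borel b A ->
  (forall k, grid (n k) (G k)) ->
  (forall e : R, 0 < e -> \forall k \near \oo, (leb_m (A `+` G k) <= e%:E)%E) ->
  pd P (ZG (n k) (G k)) (L A) @[k --> \oo] --> 0.
Proof. by move=> bA; apply: rm_value_limit => //; exact: hL bA. Qed.

Lemma choice_close (e : R) : 0 < e -> exists2 eta, 0 < eta &
  forall b A B, bounded_borel b A -> bounded_borel b B ->
    (leb_m (A `+` B) <= eta%:E)%E -> pd P (L A) (L B) <= e.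
Proof.
move=> e0; have e3 : 0 < e / 3 by rewrite divr_gt0.
have [eta eta0 h] := ZG_small Z_levy nu_levy nu_sym Z_triplet p0 q0 K0 hK e3.
have eta3 : 0 < eta / 3 by rewrite divr_gt0.
exists (eta / 3) => // b A B bA bB AB.
have appr C : bounded_borel b C -> exists n G, [/\ grid n G,
    (leb_m (C `+` G) <= (eta / 3)%:E)%E & pd P (ZG n G) (L C) <= e / 3].
  move=> bC; have [etaC etaC0 hC] := hL bC e3.
  have [|n [G [gG le]]] := grid_approxP bC (e := Num.min (eta / 3) etaC).
    by rewrite lt_min eta3.
  exists n, G; split => //; first by apply: le_trans le _; rewrite lee_fin ge_min lexx.
  by apply: hC => //; apply: le_trans le _; rewrite lee_fin ge_min lexx orbT.
have [n [G [gG lG pG]]] := appr A bA; have [m [H [gH lH pH]]] := appr B bB.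
have mG := measurable_grid gG; have mH := measurable_grid gH.
have mZG k F : measurable_fun setT (ZG k F) by exact: measurable_ZG.
have : pd P (ZG n G) (ZG m H) <= e / 3.
  apply: h => //; apply: le_trans (lebY_triangle mG bA.1 mH) _.
  rewrite setYC; apply: le_trans (leeD lG (lebY_triangle bA.1 bB.1 mH)) _.
  apply: le_trans (leeD2l _ (leeD AB lH)) _.
  by rewrite -!EFinD lee_fin; lra.
have t1 := pd_triangle P (mL A) (mZG n G) (mL B).
have t2 := pd_triangle P (mZG n G) (mZG m H) (mL B).
rewrite pdC in pG; lra.
Qed.

Lemma choice_indepN b (A : nat -> set R) N : (forall i, bounded_borel b (A i)) ->
  trivIset setT A -> indepN P (fun i => L (A i)) N.
Proof.
move=> bA tA; have [n [G [gG dG lG]]] := disjoint_grid_approx N bA tA.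
apply: (indepN_pd_limit (Xn := fun k i => ZG (n k) (G k i))) => //.
- by move=> k i; exact: measurable_ZG.
- by move=> k; apply: ZG_indepN => i j ij; exact: dG.
- move=> i iN; apply: (pd_rm_limit (bA i)); first by move=> k; exact: gG.
  by move=> e e0; exact: lG.
Qed.

Lemma choice0 : {ae P, forall w, L set0 w = 0}.
Proof.
have b0 : bounded_borel (0 : R) set0 by split => //; exact: sub0set.
apply: (@pd_eq0 _ _ _ P (L set0) (cst 0)) => //.
apply/eqP; rewrite eq_le pd_ge0 andbT; apply/ler_addgt0Pl => e e0; rewrite addr0.
have [eta eta0 h] := hL b0 e0.
have := h 0%N set0 (grid0 0); rewrite setYK measure0 lee_fin ltW// => /(_ isT).
rewrite pdC; congr (_ <= _); apply: eq_Rintegral => w _.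
by rewrite /ZG mul0n big_nil.
Qed.

(** Additivity is exact for disjoint grid sets and passes to the limit in probability. *)
Lemma choiceU b A B : bounded_borel b A -> bounded_borel b B -> A `&` B = set0 ->
  {ae P, forall w, L (A `|` B) w = L A w + L B w}.
Proof.
move=> bA bB AB; pose F := bigcup2 A B.
have bF i : bounded_borel b (F i).
  by move: i => [|[|i]]; [exact: bA|exact: bB|split; [exact: measurable0|exact: sub0set]].
have tF : trivIset setT F.
  by apply/trivIsetP => -[|[|i]] [|[|j]] //= _ _ _; rewrite ?setI0 ?set0I// setIC.
have bAB : bounded_borel b (A `|` B).
  by split; [exact: measurableU bA.1 bB.1|rewrite subUset; split; [exact: bA.2|exact: bB.2]].
have [n [G [gG dG lG]]] := disjoint_grid_approx 2 bF tF.
have cA := pd_rm_limit bA (fun k => gG k 0%N isT) (fun e => lG 0%N e isT).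
have cB := pd_rm_limit bB (fun k => gG k 1%N isT) (fun e => lG 1%N e isT).
have mZG k E : measurable_fun setT (ZG k E) by exact: measurable_ZG.
have mG k i : (i < 2)%N -> measurable (G k i) by move=> i2; exact: measurable_grid (gG k i i2).
have cAB : pd P (ZG (n k) (G k 0%N `|` G k 1%N)) (L (A `|` B)) @[k --> \oo] --> 0.
  apply: (pd_rm_limit bAB) => [k|e e0]; first by apply: gridU; exact: gG.
  have e2 : 0 < e / 2 by rewrite divr_gt0.
  have := lG 1%N (e / 2) isT e2; have := lG 0%N (e / 2) isT e2.
  apply: filterS2 => k h0 h1; rewrite (splitr e) EFinD.
  apply: le_trans (leeD h0 h1); apply: le_trans (measureU2 _ _ _).
  - apply: le_measure; rewrite ?inE.
    + exact: (measurableY bAB.1 (measurableU _ _ (mG k 0%N isT) (mG k 1%N isT))).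
    + exact: (measurableU _ _ (measurableY bA.1 (mG k 0%N isT)) (measurableY bB.1 (mG k 1%N isT))).
    + by move=> x /=; tauto.
  - exact: (measurableY bA.1 (mG k 0%N isT)).
  - exact: (measurableY bB.1 (mG k 1%N isT)).
have ZGU k : ZG (n k) (G k 0%N `|` G k 1%N) = ZG (n k) (G k 0%N) \+ ZG (n k) (G k 1%N).
  apply/funext => w; rewrite /ZG/= -big_split/=; apply: eq_bigr => j _.
  rewrite -mulrDl; congr (_ * _); rewrite !indicE in_setU.
  case: (boolP (_ \in G k 0%N)) => [|_] /=; last by rewrite add0r.
  case: (boolP (_ \in G k 1%N)) => [|_] /=; last by rewrite addr0.
  rewrite !inE => h1 h0; have /seteqP[h _] := dG k 0%N 1%N isT.
  by case: (h _ (conj h0 h1)).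
apply: (pd_cvg_unique (X := fun k => ZG (n k) (G k 0%N `|` G k 1%N)) (P := P)) => //.
  exact: measurable_funD.
apply: (@squeeze_cvgr _ _ _ _ (cst 0)
  (fun k => pd P (ZG (n k) (G k 0%N)) (L A) + pd P (ZG (n k) (G k 1%N)) (L B))).
- by apply: nearW => k; rewrite pd_ge0 ZGU; exact: pdD.
- exact: cvg_cst.
- by rewrite -[X in _ --> X]addr0; exact: cvgD.
Qed.

Lemma choice_sum b (A : nat -> set R) n : (forall i, bounded_borel b (A i)) ->
  trivIset setT A ->
  {ae P, forall w, L (\big[setU/set0]_(i < n) A i) w = \sum_(0 <= i < n) L (A i) w}.
Proof.
move=> bA tA; elim: n => [|n ih].
  by rewrite big_ord0; apply: filterS choice0 => w ->; rewrite big_nil.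
rewrite big_ord_recr/=.
have bU : bounded_borel b (\big[setU/set0]_(i < n) A i).
  split; first by apply: bigsetU_measurable => i _; exact: (bA i).1.
  by rewrite -bigcup_mkord; apply: bigcup_sub => i _; exact: (bA i).2.
have dis : \big[setU/set0]_(i < n) A i `&` A n = set0.
  rewrite -bigcup_mkord setI_bigcupl; apply: bigcup0 => i /= ni.
  by move/trivIsetP : tA => /(_ i n I I); apply; rewrite ltn_eqF.
have := choiceU bU (bA n) dis; move: ih; apply: filterS2 => w e1 ->.
by rewrite big_nat_recr//= e1.
Qed.

(** The missing tail has small Lebesgue measure, so the partial sums converge in probability; by
    independence they then converge almost surely. *)
Lemma choice_series b (A : nat -> set R) : (forall i, bounded_borel b (A i)) ->
  trivIset setT A ->
  {ae P, forall w, \sum_(0 <= i < n) L (A i) w @[n --> \oo] --> L (\bigcup_i A i) w}.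
Proof.
move=> bA tA; apply: indep_series_ae_cvg => //.
  by move=> N; exact: choice_indepN bA tA.
have bU : bounded_borel b (\bigcup_i A i).
  split; first by apply: bigcupT_measurable => i; exact: (bA i).1.
  by apply: bigcup_sub => i _; exact: (bA i).2.
have bP n : bounded_borel b (\big[setU/set0]_(i < n) A i).
  apply: (bounded_borel_sub bU); first by apply: bigsetU_measurable => i _; exact: (bA i).1.
  by rewrite -bigcup_mkord; apply: bigcup_sub => i _; exact: bigcup_sup.
apply/cvgrPdist_le => e e0; have [eta eta0 h] := choice_close e0.
have [m hm] := cvg_leb_tail bA tA eta0.
exists m => // n /= mn; rewrite sub0r normrN ger0_norm ?pd_ge0//.
have -> : pd P (fun w => \sum_(0 <= i < n) L (A i) w) (L (\bigcup_i A i)) =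
    pd P (L (\bigcup_i A i)) (L (\big[setU/set0]_(i < n) A i)).
  rewrite [RHS]pdC; apply: pd_ae => //.
  - by apply: measurable_sum => i.
  - by apply: filterS (choice_sum n bA tA) => w ->.
  - exact: aeW.
by apply: (h b) => //; exact: hm.
Qed.

Lemma ZG_itv n i k w : (i <= k)%N -> (k <= n * 2 ^ n)%N ->
  ZG n `]pt n i, pt n k]%classic w = Z (pt n k) w - Z (pt n i) w.
Proof.
move=> ik kn; rewrite /ZG (big_cat_nat _ (leq_trans ik kn))//= (big_cat_nat ik kn)//=.
rewrite big1_seq ?add0r => [|j]; last first.
  rewrite mem_index_iota leq0n /= => ji.
  by rewrite indicE memNset ?mul0r//= in_itv/= lt_pt ltnS leqNgt ji.
rewrite [X in _ + X]big1_seq ?addr0 => [|j]; last first.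
  rewrite mem_index_iota /= => /andP[kj _].
  by rewrite indicE memNset ?mul0r//= in_itv/= le_pt ltnNge kj andbF.
rewrite -(telescope_sumr (fun j => Z (pt n j) w) ik).
apply: eq_big_nat => j /andP[ij jk]; rewrite indicE mem_set ?mul1r//= in_itv/=.
by rewrite lt_pt le_pt ltnS ij jk.
Qed.

Lemma pt_idx_cvg (s : R) : 0 <= s -> pt n (idx n s) @[n --> \oo] --> s.
Proof.
move=> s0; apply/cvgrPdist_le => e e0; have [m hm] := expr_half_small e0.
exists m => // n /= mn; have /andP[h1 h2] := idxP n s0.
rewrite ger0_norm ?subr_ge0//; apply: le_trans (hm n mn).
by rewrite -(pt_step n (idx n s)) lerD2r ltW.
Qed.

(** For grid endpoints the sum telescopes. Stochastic continuity of [Z] carries the identity to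
    arbitrary endpoints. *)
Lemma choice_increment s t : 0 <= s -> s <= t ->
  {ae P, forall w, L `]s, t]%classic w = Z t w - Z s w}.
Proof.
move=> s0 st; have t0 := le_trans s0 st.
have bst : bounded_borel t `]s, t]%classic by exact: bounded_borel_itv.
have mZ r : measurable_fun setT (Z r) by exact: measurable_funP.
pose N := Num.bound t; have tN : t <= N%:R by exact: ltW (archi_boundP t0).
(* Starting at level [N] keeps the rounded interval inside the range of the grid. *)
pose G n : set R := `]pt (n + N) (idx (n + N) s), pt (n + N) (idx (n + N) t)]%classic.
have idxN n : (idx (n + N) t <= (n + N) * 2 ^ (n + N))%N.
  rewrite -(@le_pt R (n + N)) pt_nat.
  have /andP[h _] := idxP (n + N) t0; apply: le_trans h (le_trans tN _).
  by rewrite ler_nat leq_addl.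
have idx_le n : (idx n s <= idx n t)%N.
  by rewrite /idx le_truncn// ler_wpM2r// exprn_ge0.
have c1 : pd P (ZG (n + N) (G n)) (L `]s, t]%classic) @[n --> \oo] --> 0.
  apply: (pd_rm_limit bst (n := fun n => (n + N)%N)) => [n|e e0].
    exact: grid_itv.
  have [m hm] := @expr_half_small R (e / 2) (divr_gt0 e0 (ltr0Sn _ 1)).
  exists m => // n /= mn; apply: le_trans (grid_approx_itv s0 st _) _.
    by rewrite (le_trans tN)// ler_nat leq_addl.
  rewrite lee_fin; have := hm (n + N)%N (leq_trans mn (leq_addr _ _)); lra.
have c2 : pd P (ZG (n + N) (G n)) (Z t \- Z s) @[n --> \oo] --> 0.
  have E n : ZG (n + N) (G n) =
      Z (pt (n + N) (idx (n + N) t)) \- Z (pt (n + N) (idx (n + N) s)).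
    by apply/funext => w; rewrite ZG_itv.
  have sh (r : R) : 0 <= r -> pt (n + N) (idx (n + N) r) @[n --> \oo] --> r.
    by move=> r0; rewrite (cvg_shiftn N (fun n => pt n (idx n r))); exact: pt_idx_cvg.
  have ct := levy_stoch_cvg t0 (fun n => pt_ge0 _ _) (sh t t0).
  have cs := levy_stoch_cvg s0 (fun n => pt_ge0 _ _) (sh s s0).
  apply: (@squeeze_cvgr _ _ _ _ (cst 0) (fun n =>
    pd P (Z (pt (n + N) (idx (n + N) t))) (Z t) + pd P (Z (pt (n + N) (idx (n + N) s))) (Z s))).
  - by apply: nearW => n; rewrite pd_ge0 E; exact: pdB.
  - exact: cvg_cst.
  - by rewrite -[X in _ --> X]addr0; exact: cvgD.
apply: (pd_cvg_unique (P := P) _ _ _ c1 c2) => //.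
by move=> n; exact: measurable_ZG.
Qed.

Lemma choice_is_random_measure : is_random_measure_of Z L.
Proof.
split.
- exact: choice_increment.
- move=> A b mA Ab tA n.
  apply: (proj1 (@indepNP _ _ _ P (fun i => L (A i)) n _)) => //.
  by apply: (choice_indepN (b := b)) => // i; split.
- move=> A b mA Ab tA.
  have := @choice_series b A (fun i => conj (mA i) (Ab i)) tA.
  by apply: filterS => w.
Qed.

End choice_is_random_measure.

Lemma random_measure_exists : exists L : set R -> {RV P >-> R}, is_random_measure_of Z L.
Proof.
by have [L hL] := rm_value_choice; exists L; exact: choice_is_random_measure.
Qed.

End random_measure_existence.

(** * Existence of the integral and moments of its increments *)

Section levy_integrals.
Context d {Omega : measurableType d} {R : realType} (P : probability Omega R).
Variables (Z : R -> {RV P >-> R}) (a : R) (nu : {measure set R -> \bar R}).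
Hypotheses (Z_levy : is_levy_process Z) (a0 : 0 <= a) (nu_levy : levy_measure nu)
  (nu_sym : symmetric_measure nu) (Z_triplet : has_triplet Z a nu).
Variables (p q : R).
Hypotheses (p0 : 0 < p) (q0 : 0 < q) (hK : moment_bound_hyp P a nu p q).
Local Notation leb_m := (@lebesgue_measure R).

(** One sequence of approximants of [f] in L^p serves every Borel subset of ]0, t], since a bound in
    L^p is inherited by subsets. The total length 1 is enough to construct the measure, while the
    integral needs length [t]. *)
Lemma levy_integral_exists (t : R) (f : R -> R) : 0 <= t ->
  measurable_fun `]0, t]%classic f ->
  leb_m.-integrable `]0, t]%classic (EFin \o (fun x => `|f x| `^ p)) ->
  exists I : {RV P >-> R}, is_levy_integral Z t f I.
Proof.
move=> t0 mf intf; have [K1 K10 hK1] := hK 1.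
have [L L_rm] := random_measure_exists Z_levy nu_levy nu_sym Z_triplet p0 q0 K10 hK1.
have [K K0 hKt] := hK t.
have bt : bounded_borel t `]0, t]%classic by exact: bounded_borel_itv.
have [phi [phif phi0 _]] := Lp_sfun_approx p0 bt mf intf.
have J A : measurable A -> A `<=` `]0, t]%classic ->
    exists J : {RV P >-> R}, cvg_in_probability P (fun n => elementary_integral L A (phi n)) J.
  move=> mA At.
  have [|Y mY [phiY _]] := pd_cauchy_cvg (P := P) (X := fun n => elementary_integral L A (phi n)) _
    (elementary_cauchy Z_levy nu_levy nu_sym Z_triplet L_rm t0 p0 q0 K0 hKt bt mA At mf intf phi0).
    by move=> n; exact: measurable_elementary.
  have [J JY] := rv_of_measurable P mY; exists J.
  have -> : (J : Omega -> R) = Y by apply/funext.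
  by apply/cvg_in_probability_pd => // n; exact: measurable_elementary.
have [I hI] := J _ (measurable_itv _) (@subset_refl _ _).
exists I, L, phi; split => //.
by apply: aeW => x; exact: phif.
Qed.

(** The integrand of an increment over ]0, t]: an integral over ]0, s] is that of the function
    extended by 0 beyond [s]. *)
Definition kernel_diff (f h : R -> R) (s x : R) : R := f x - (if x <= s then h x else 0).

(** The two integrals may come with different random measures and simple functions. Uniqueness of
    the measure and extension by 0 write the increment as one limit of elementary integrals over ]0,
    t], to which [elementary_limit_moment] applies. *)
Lemma levy_integral_increment_moment (T : R) : 0 <= T -> exists2 K, 0 <= K &
  forall (s t : R) (f h : R -> R) (Yt Ys : {RV P >-> R}), 0 <= s -> s <= t -> t <= T ->
  is_levy_integral Z t f Yt -> is_levy_integral Z s h Ys ->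
  measurable_fun `]0, t]%classic (kernel_diff f h s) ->
  leb_m.-integrable `]0, t]%classic (EFin \o (fun x => `|kernel_diff f h s x| `^ p)) ->
  (\int[P]_w (`|Yt w - Ys w| `^ q)%:E <=
    (K * (\int[leb_m]_(x in `]0%R, t]%classic) (`|kernel_diff f h s x| `^ p)) `^ (q / p))%:E)%E.
Proof.
move=> T0; have [K K0 hKT] := hK T; exists K => // s t f h Yt Ys s0 st tT.
move=> [L [fn [L_rm fnf _ fnI]]] [L' [fn' [L'_rm fn'h _ fn'I]]] mk ik.
have bt : bounded_borel T `]0, t]%classic by exact: bounded_borel_itv.
have bs : bounded_borel T `]0, s]%classic by apply: bounded_borel_itv => //; exact: le_trans tT.
have ms : measurable (`]0, s]%classic : set R) by exact: measurable_itv.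
pose A : set R := `]0, t]%classic; pose A' : set R := `]0, s]%classic.
pose g n : {sfun R >-> R} := fn' n * indic_sfun A' ms.
have gE n x : g n x = fn' n x * \1_A' x by [].
have mel (M : set R -> {RV P >-> R}) B (k : {sfun R >-> R}) : measurable_fun setT (elementary_integral M B k : Omega -> R).
  exact: measurable_elementary.
have A'A : A' `<=` A by rewrite /A /A' => x /=; rewrite !in_itv/= => /andP[-> /le_trans]; exact.
have gel n : {ae P, forall w, elementary_integral L A (g n) w = elementary_integral L' A' (fn' n) w}.
  have h1 : {ae P, forall w, elementary_integral L A (g n) w = elementary_integral L A' (fn' n) w}.
    apply: (elementary_integral_restrict L_rm bt ms A'A) => x Ax.
      by rewrite gE indicE mem_set// mulr1.
    by move=> nAx; rewrite gE indicE memNset// mulr0.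
  have h2 := elementary_integral_unique (fn' n) L_rm L'_rm T0 bs.
  by move: h1 h2; apply: filterS2 => w -> ->.
have dE n : {ae P, forall w, elementary_integral L A (fn n - g n) w =
    elementary_integral L A (fn n) w - elementary_integral L' A' (fn' n) w}.
  by move: (elementary_integralB L_rm (fn n) (g n) bt) (gel n); apply: filterS2 => w -> ->.
have cI : pd P (elementary_integral L A (fn n)) Yt @[n --> \oo] --> 0.
  by apply/cvg_in_probability_pd => //; exact: measurable_funP.
have cI' : pd P (elementary_integral L' A' (fn' n)) Ys @[n --> \oo] --> 0.
  by apply/cvg_in_probability_pd => //; exact: measurable_funP.
apply: (elementary_limit_moment Z_levy a0 nu_levy nu_sym Z_triplet L_rm T0 p0 q0 K0 hKT bt mk ik
  (k := fun n => fn n - g n) (J := Yt \- Ys)).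
- by apply: measurable_funB; exact: measurable_funP.
- have F := ae_filter_ringOfSetsType leb_m.
  apply: (@filterS2 _ _ F _ _ _ _ fnf fn'h) => x fx hx Ax.
  apply: cvgB; first exact: fx.
  case: ifPn => xs.
    have A'x : A' x by move: Ax; rewrite /A' /= !in_itv/= xs => /andP[->].
    rewrite [X in X @ _](_ : _ = fun n => fn' n x); first exact: hx.
    by apply/funext => n; rewrite -[LHS]/(g n x) gE indicE mem_set// mulr1.
  rewrite [X in X @ _](_ : _ = cst 0); first exact: cvg_cst.
  apply/funext => n; rewrite -[LHS]/(g n x) gE indicE memNset ?mulr0//.
  by rewrite /A' /= in_itv/= (negbTE xs) andbF.
- apply: (@squeeze_cvgr _ _ _ _ (cst 0) (fun n => pd P (elementary_integral L A (fn n)) Yt +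
    pd P (elementary_integral L' A' (fn' n)) Ys)).
  + apply: nearW => n; rewrite pd_ge0/=.
    rewrite (_ : pd P _ _ = pd P (elementary_integral L A (fn n) \-
        elementary_integral L' A' (fn' n)) (Yt \- Ys)); first exact: pdB.
    have mY : measurable_fun setT (Yt \- Ys).
      by apply: measurable_funB; exact: measurable_funP.
    have mD : measurable_fun setT (elementary_integral L A (fn n) \- elementary_integral L' A' (fn' n)).
      by apply: measurable_funB; exact: measurable_elementary.
    exact: (pd_ae (measurable_elementary L A (fn n - g n)) mY mD mY (dE n) (aeW _ (fun=> erefl))).
  + exact: cvg_cst.
  + by rewrite -[X in _ --> X]addr0; exact: cvgD.
Qed.

End levy_integrals.

(** * Kernel estimates *)

Section power_integrals.
Context {R : realType}.
Local Notation leb_m := (@lebesgue_measure R).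
Implicit Types (r c M : R).

Lemma exprn_powR (x c : R) n : 0 <= x -> (x ^+ n) `^ c = (x `^ c) ^+ n.
Proof.
move=> x0; elim: n => [|n ih]; first by rewrite !expr0 powR1.
by rewrite !exprS powRM ?exprn_ge0// ih.
Qed.

Lemma gt0_powRD (x r s : R) : 0 < x -> x `^ (r + s) = x `^ r * x `^ s.
Proof. by move=> x0; rewrite powRD// (gt_eqF x0) implybT. Qed.

(** The power is monotone in a direction given by the sign of [c]; the summand 1 in each constant
    covers the trivial direction, the other summand the factor 2. *)
Lemma powR_comparable c (x y : R) : 0 < x -> x <= y -> y <= 2 * x ->
  y `^ c <= (1 + 2 `^ c) * x `^ c /\ x `^ c <= (1 + 2 `^ (- c)) * y `^ c.
Proof.
move=> x0 xy yx; have y0 : 0 < y by exact: lt_le_trans xy.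
have [c0|c0] := leP 0 c; split.
- apply: (@le_trans _ _ ((2 * x) `^ c)).
    by rewrite ge0_ler_powR ?nnegrE ?mulr_ge0 ?(ltW x0) ?(ltW y0).
  by rewrite powRM ?(ltW x0)// ler_wpM2r ?powR_ge0// lerDr.
- apply: (@le_trans _ _ (y `^ c)).
    by rewrite ge0_ler_powR ?nnegrE ?(ltW x0) ?(ltW y0).
  by rewrite -[leLHS]mul1r ler_wpM2r ?powR_ge0// lerDl powR_ge0.
- have h : y `^ c <= x `^ c.
    rewrite -[c]opprK !(powRN _ (- c)) lef_pV2 ?posrE ?powR_gt0//.
    by rewrite ge0_ler_powR ?nnegrE ?(ltW x0) ?(ltW y0)// oppr_ge0 ltW.
  by apply: le_trans h _; rewrite -[leLHS]mul1r ler_wpM2r ?powR_ge0// lerDl powR_ge0.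
- have h : (2 * x) `^ c <= y `^ c.
    rewrite -[c]opprK !(powRN _ (- c)) lef_pV2 ?posrE ?powR_gt0// ?mulr_gt0//.
    by rewrite ge0_ler_powR ?nnegrE ?mulr_ge0 ?(ltW x0) ?(ltW y0)// oppr_ge0 ltW.
  rewrite powRM ?(ltW x0)// in h.
  have -> : x `^ c = 2 `^ (- c) * (2 `^ c * x `^ c).
    by rewrite mulrA -gt0_powRD// addNr powRr0 mul1r.
  apply: (@le_trans _ _ (2 `^ (- c) * y `^ c)); first by rewrite ler_wpM2l ?powR_ge0.
  by rewrite ler_wpM2r ?powR_ge0// lerDr.
Qed.

Lemma dyadic_cell r y : 0 < y -> y <= r -> exists k, r * 2^-1 ^+ k.+1 < y <= r * 2^-1 ^+ k.
Proof.
move=> y0 yr; have r0 : 0 < r by exact: lt_le_trans yr.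
have ex : exists k, r * 2^-1 ^+ k.+1 < y.
  have [n hn] := @expr_half_small R (y / (2 * r)) (divr_gt0 y0 (mulr_gt0 (ltr0Sn _ 1) r0)).
  exists n; have := hn n.+1 (leqnSn n); rewrite exprVn => h.
  apply: (@le_lt_trans _ _ (r * (y / (2 * r)))); first by rewrite ler_wpM2l ?(ltW r0).
  have -> : r * (y / (2 * r)) = y / 2 by field; rewrite gt_eqF.
  by rewrite ltr_pdivrMr// ltr_pMr// ltr1n.
have := ex_minnP ex => -[k hk kmin]; exists k; rewrite hk/=.
case: k hk kmin => [|k] hk kmin; first by rewrite expr0 mulr1.
by rewrite leNgt; apply/negP => h; have := kmin k h; rewrite ltnn.
Qed.

(* [dist] is the distance to the singular endpoint, [E k] its k-th dyadic shell. *)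
Lemma integral_powR_shells (c : R) : -1 < c -> exists2 M, 0 <= M &
  forall r (D : set R) (E : nat -> set R) (dist : R -> R), 0 < r ->
  measurable D -> measurable_fun setT dist -> (forall k, measurable (E k)) -> trivIset setT E ->
  D `<=` \bigcup_k E k ->
  (forall k, leb_m (E k) <= (r * 2^-1 ^+ k.+1)%:E)%E ->
  (forall k x, E k x -> r * 2^-1 ^+ k.+1 <= dist x <= r * 2^-1 ^+ k) ->
  (\int[leb_m]_(x in D) (dist x `^ c)%:E <= (M * r `^ (c + 1))%:E)%E.
Proof.
(* A shell contributes its length times the value there, of order r^(c+1) rho^k, and rho < 1 because
   c > -1. *)
move=> c1; pose rho : R := 2^-1 `^ (c + 1).
have c10 : 0 < c + 1 by rewrite -ltrBlDr sub0r.
have rho0 : 0 <= rho by exact: powR_ge0.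
have rho1 : rho < 1.
  have -> : 1 = 1 `^ (c + 1) :> R by rewrite powR1.
  by apply: gt0_ltr_powR; rewrite ?nnegrE ?invr_ge0// invf_lt1// ltr1n.
have rho10 : 0 < 1 - rho by rewrite subr_gt0.
exists ((1 + 2 `^ c) * (1 - rho)^-1).
  by rewrite mulr_ge0 ?invr_ge0 ?ltW// ltr_wpDr ?powR_ge0.
move=> r D E dist r0 mD mdist mE tE DE lE hE.
have mU : measurable (\bigcup_k E k) by exact: bigcupT_measurable.
have mf : measurable_fun setT (fun x => (dist x `^ c)%:E).
  apply/measurable_EFinP; apply: (measurableT_comp (measurable_powR _)) => //.
have x0 k : 0 < r * 2^-1 ^+ k.+1 by rewrite mulr_gt0 ?exprn_gt0.
apply: (@le_trans _ _ (\int[leb_m]_(x in \bigcup_k E k) (dist x `^ c)%:E)%E).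
  apply: ge0_subset_integral => //; first exact: measurable_funTS.
  by move=> x _; rewrite lee_fin powR_ge0.
rewrite ge0_integral_bigcup//; last 2 first.
- exact: measurable_funTS.
- by move=> x _; rewrite lee_fin powR_ge0.
have step k : (\int[leb_m]_(x in E k) (dist x `^ c)%:E <=
    ((1 + 2 `^ c) * (r `^ (c + 1) * rho ^+ k))%:E)%E.
  apply: (@le_trans _ _ (\int[leb_m]_(x in E k) ((1 + 2 `^ c) * (r * 2^-1 ^+ k.+1) `^ c)%:E)%E).
    apply: ge0_le_integral => //.
    - exact: mE.
    - by move=> x _; rewrite lee_fin powR_ge0.
    - exact: measurable_funTS.
    - move=> x Ex; rewrite lee_fin; have /andP[h1 h2] := hE k x Ex.
      have [|//] := powR_comparable c (x0 k) h1.
      by apply: le_trans h2 _; rewrite exprS le_eqVlt; apply/orP; left; apply/eqP; field.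
  rewrite integral_cst; last exact: mE.
  apply: (le_trans (lee_wpmul2l _ (lE k))).
    by rewrite lee_fin mulr_ge0 ?powR_ge0// addr_ge0 ?powR_ge0.
  rewrite -EFinM lee_fin -mulrA ler_wpM2l ?addr_ge0 ?powR_ge0//.
  rewrite -{2}[r * 2^-1 ^+ k.+1]powRr1 ?(ltW (x0 k))// -gt0_powRD//.
  rewrite powRM ?exprn_ge0 ?(ltW r0)// ler_wpM2l ?powR_ge0//.
  have -> : (2^-1 ^+ k.+1 : R) `^ (c + 1) = rho ^+ k.+1.
    by apply: exprn_powR; rewrite invr_ge0.
  by rewrite exprS ler_piMl ?exprn_ge0// ltW.
apply: lime_le; first by apply: is_cvg_nneseries => k _ _; apply: integral_ge0 => x _; rewrite lee_fin powR_ge0.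
apply: nearW => n.
apply: (@le_trans _ _ (\sum_(0 <= k < n) ((1 + 2 `^ c) * (r `^ (c + 1) * rho ^+ k))%:E)%E).
  by apply: lee_sum => k _; exact: step.
rewrite sumEFin lee_fin -mulr_sumr -mulr_sumr -mulrA ler_wpM2l ?addr_ge0 ?powR_ge0//.
by rewrite mulrC ler_wpM2r ?powR_ge0// big_mkord; exact: geo_sum_le.
Qed.

Lemma shell_itv_trivIset r (F : nat -> set R) (h : R -> R) : 0 <= r ->
  (forall k x, F k x -> r * 2^-1 ^+ k.+1 < h x <= r * 2^-1 ^+ k) -> trivIset setT F.
Proof.
move=> r0 hF; apply/trivIsetP => i j _ _; wlog ij : i j / (i < j)%N.
  move=> H; rewrite neq_ltn => /orP[]ij; [|rewrite setIC]; apply: H => //; rewrite neq_ltn ij ?orbT//.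
move=> _; apply/seteqP; split => // x [/hF/andP[h1 _] /hF/andP[_ h2]].
have := lt_le_trans h1 h2; rewrite ltNge => /negP; apply.
rewrite ler_wpM2l// ler_wiXn2l ?invr_ge0// invf_le1// ler1n//.
Qed.

Lemma integral_powR_left (c : R) : -1 < c -> exists2 M, 0 <= M & forall t, 0 < t ->
  (\int[leb_m]_(x in `]0%R, t[%classic) (x `^ c)%:E <= (M * t `^ (c + 1))%:E)%E.
Proof.
move=> c1; have [M M0 hM] := integral_powR_shells c1; exists M => // t t0.
pose E k : set R := `]t * 2^-1 ^+ k.+1, t * 2^-1 ^+ k]%classic.
have EP k x : E k x -> t * 2^-1 ^+ k.+1 < x <= t * 2^-1 ^+ k by rewrite /E /= in_itv.
apply: (hM t _ E id) => //.
- by move=> k; exact: measurable_itv.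
- exact: shell_itv_trivIset (ltW t0) EP.
- move=> x /=; rewrite in_itv/= => /andP[x0 xt].
  by have [k hk] := dyadic_cell x0 (ltW xt); exists k => //; rewrite /E /= in_itv.
- move=> k; rewrite /E lebesgue_measure_itv/= lte_fin; case: ifPn => _.
    by rewrite -EFinB lee_fin exprS le_eqVlt; apply/orP; left; apply/eqP; field.
  by rewrite lee_fin mulr_ge0 ?(ltW t0)// exprn_ge0// invr_ge0.
- by move=> k x /EP /andP[/ltW -> ->].
Qed.

Lemma integral_powR_right (c : R) : -1 < c -> exists2 M, 0 <= M & forall s t, s < t ->
  (\int[leb_m]_(x in `]s, t[%classic) ((t - x) `^ c)%:E <= (M * (t - s) `^ (c + 1))%:E)%E.
Proof.
move=> c1; have [M M0 hM] := integral_powR_shells c1; exists M => // s t st.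
pose r := t - s; have r0 : 0 < r by rewrite subr_gt0.
pose E k : set R := `[t - r * 2^-1 ^+ k, t - r * 2^-1 ^+ k.+1[%classic.
have EP k x : E k x -> r * 2^-1 ^+ k.+1 < t - x <= r * 2^-1 ^+ k.
  by rewrite /E /= in_itv/= => /andP[? ?]; apply/andP; split; lra.
apply: (hM r _ E (fun x => t - x)) => //.
- by apply: measurable_funB.
- by move=> k; exact: measurable_itv.
- exact: shell_itv_trivIset (ltW r0) EP.
- move=> x /=; rewrite in_itv/= => /andP[x0 xt].
  have [||k /andP[h1 h2]] := @dyadic_cell r (t - x); first by rewrite subr_gt0.
    by rewrite /r lerD2l lerN2 ltW.
  by exists k => //; rewrite /E /= in_itv/=; apply/andP; split; lra.
- move=> k; rewrite /E lebesgue_measure_itv/= lte_fin; case: ifPn => _.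
    by rewrite -EFinB lee_fin exprS le_eqVlt; apply/orP; left; apply/eqP; field.
  by rewrite lee_fin mulr_ge0 ?(ltW r0)// exprn_ge0// invr_ge0.
- by move=> k x /EP /andP[/ltW -> ->].
Qed.

End power_integrals.

(** * Integral estimates for the kernel and its increments *)

Section kernel_estimates.
Context {R : realType}.
Local Notation leb_m := (@lebesgue_measure R).
Variables (T : R) (g : R -> R -> R) (p alpha beta gamma delta : R).
Hypotheses (T0 : 0 < T) (p0 : 0 < p) (mg : jointly_measurable_kernel T g).
Hypotheses (B1 : condB1 T g alpha beta gamma) (B2 : condB2 T g p delta).
Hypotheses (bp : - p^-1 < beta) (gp : - p^-1 < gamma)
  (kp : - p^-1 < kappa alpha beta gamma).

Lemma measurable_kernel_section (t : R) : t <= T -> measurable_fun `]0, t]%classic (g t).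
Proof.
move=> tT; set D := [set z : R * R | 0 <= z.2 /\ z.2 <= z.1 <= T].
have mD : measurable D.
  have -> : D = (snd @^-1` `[0, +oo[) `&` ((fun z : R * R => z.1 - z.2) @^-1` `[0, +oo[) `&`
      (fst @^-1` `]-oo, T]).
    apply/seteqP; split => z /=; rewrite !in_itv/= !andbT subr_ge0.
      by move=> [-> /andP[-> ->]].
    by move=> [[h0 h1] h2]; rewrite /D /= h0 h1 h2.
  apply: measurableI; first apply: measurableI.
  - by rewrite -[X in measurable X]setTI; apply: measurable_snd.
  - have h : measurable_fun setT (fun z : R * R => z.1 - z.2).
      by apply: measurable_funB; [exact: measurable_fst|exact: measurable_snd].
    by rewrite -[X in measurable X]setTI; apply: h.
  - by rewrite -[X in measurable X]setTI; apply: measurable_fst.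
apply: (measurable_comp mD _ mg (g := fun u => (t, u))); last first.
  by apply/measurable_funTS; exact: measurable_fun_pair.
by move=> _ [u /= + <-]; rewrite in_itv/= => /andP[u0 ut]; split => /=; [exact: ltW|rewrite ut tT].
Qed.

Lemma mul_gtN1 (x : R) : - p^-1 < x -> -1 < x * p.
Proof.
by move=> h; rewrite -(divfK (lt0r_neq0 p0) (-1)) ltr_pM2r// mulN1r.
Qed.

(** If t <= 2 s, then u is comparable to [t] on ]s, t[ and only the singularity at u = t matters.
    Otherwise t - s is comparable to [t], and the integral is extended to ]0, t[ and split at t / 2,
    so that each half contains one singularity. *)
Lemma kernel_tail : exists2 C, 0 <= C & forall s t, 0 <= s -> s < t -> t <= T ->
  (\int[leb_m]_(u in `]s, t[%classic) (`|g t u| `^ p)%:E <=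
     (C * (t - s) `^ (1 + kappa alpha beta gamma * p))%:E)%E.
Proof.
have [C0 [C00 hC0]] := B1.
have Bp := mul_gtN1 bp; have Gp := mul_gtN1 gp.
set A := alpha * p; set B := beta * p in Bp; set G := gamma * p in Gp.
have [ML ML0 hML] := integral_powR_left Bp; have [MR MR0 hMR] := integral_powR_right Gp.
pose cB : R := 1 + 2 `^ (- B); pose cG : R := 1 + 2 `^ (- G).
have cB0 : 0 <= cB by rewrite addr_ge0 ?powR_ge0.
have cG0 : 0 <= cG by rewrite addr_ge0 ?powR_ge0.
pose Cp := C0 `^ p; have Cp0 : 0 <= Cp by exact: powR_ge0.
have gle t u : 0 < u -> u < t -> t <= T -> `|g t u| `^ p <= Cp * t `^ A * u `^ B * (t - u) `^ G.
  move=> u0 ut tT; have := hC0 t u u0 ut tT; set X := _ * _ => h.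
  have X0 : 0 <= X by rewrite !mulr_ge0 ?powR_ge0 ?ltW.
  apply: le_trans (ge0_ler_powR (ltW p0) _ _ h) _; rewrite ?nnegrE//.
  by rewrite /X !powRM ?mulr_ge0 ?powR_ge0 ?(ltW C00)// -!powRrM.
have half1 t u : 0 < u -> u < t -> t <= 2 * u -> t <= T ->
    `|g t u| `^ p <= Cp * cB * (t `^ A * t `^ B) * (t - u) `^ G.
  move=> u0 ut tu tT; apply: le_trans (gle t u u0 ut tT) _.
  have [_ h] := powR_comparable B u0 (ltW ut) tu.
  have -> : Cp * cB * (t `^ A * t `^ B) * (t - u) `^ G =
    Cp * t `^ A * (cB * t `^ B) * (t - u) `^ G by ring.
  by rewrite ler_wpM2r ?powR_ge0// ler_wpM2l ?mulr_ge0 ?powR_ge0.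
have half2 t u : 0 < u -> u < t -> 2 * u <= t -> t <= T ->
    `|g t u| `^ p <= Cp * cG * (t `^ A * t `^ G) * u `^ B.
  move=> u0 ut tu tT; apply: le_trans (gle t u u0 ut tT) _.
  have tu0 : 0 < t - u by rewrite subr_gt0.
  have [|//|_ h] := @powR_comparable _ G (t - u) t tu0; [lra|lra|].
  have -> : Cp * cG * (t `^ A * t `^ G) * u `^ B =
    Cp * t `^ A * u `^ B * (cG * t `^ G) by ring.
  by rewrite ler_wpM2l ?mulr_ge0 ?powR_ge0.
have mgt s t : 0 <= s -> t <= T -> measurable_fun `]s, t[%classic (fun u => (`|g t u| `^ p)%:E).
  move=> s0 tT; apply/measurable_EFinP; apply: (measurableT_comp (measurable_powR _)).
  apply: measurableT_comp => //.
  apply: measurable_funS (measurable_kernel_section tT); first exact: measurable_itv.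
  by move=> x /=; rewrite !in_itv/= => /andP[/(le_lt_trans s0) -> /ltW ->].
have mR t (D : set R) : measurable_fun D (fun u => ((t - u) `^ G)%:E).
  apply/measurable_EFinP; apply: (measurableT_comp (measurable_powR _)).
  exact: measurable_funB.
have mL (D : set R) : measurable_fun D (fun u => (u `^ B)%:E).
  by apply/measurable_EFinP; exact: measurable_funTS (measurable_powR _).
pose c1 : R := 1 + T `^ (A + B).
have c10 : 0 <= c1 by rewrite addr_ge0 ?powR_ge0.
(* The origin of [kappa]: if alpha + beta < 0, the power of t is bounded by that of x <= t,
   otherwise by a power of [T]. *)
have pow1 t x : 0 < x -> x <= t -> t <= T ->
    t `^ A * t `^ B * x `^ (G + 1) <= c1 * x `^ (1 + kappa alpha beta gamma * p).
  move=> x0 xt tT; have t0 : 0 < t by exact: lt_le_trans xt.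
  rewrite -gt0_powRD//.
  rewrite /kappa; case: ltP => ab.
    have AB0 : A + B < 0 by rewrite -mulrDl pmulr_llt0.
    have h : t `^ (A + B) <= x `^ (A + B).
      rewrite -[A + B]opprK !(powRN _ (- (A + B))) lef_pV2 ?posrE ?powR_gt0//.
      by rewrite ge0_ler_powR ?nnegrE ?(ltW x0) ?(ltW t0)// oppr_ge0 ltW.
    apply: (@le_trans _ _ (x `^ (A + B) * x `^ (G + 1))); first by rewrite ler_wpM2r ?powR_ge0.
    rewrite -gt0_powRD//.
    have -> : A + B + (G + 1) = 1 + (alpha + beta + gamma) * p by rewrite /A /B /G; ring.
    by rewrite -[leLHS]mul1r ler_wpM2r ?powR_ge0// lerDl powR_ge0.
  have AB0 : 0 <= A + B by rewrite -mulrDl mulr_ge0 ?(ltW p0).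
  rewrite [G + 1]addrC ler_wpM2r ?powR_ge0//.
  apply: (@le_trans _ _ (T `^ (A + B))); last by rewrite lerDr.
  by rewrite ge0_ler_powR ?nnegrE ?(ltW t0) ?(ltW T0).
exists (Cp * (cB * MR + (cB * MR + cG * ML) * 2 `^ (G + 1)) * c1).
  by rewrite !mulr_ge0 ?addr_ge0 ?mulr_ge0 ?addr_ge0 ?mulr_ge0 ?powR_ge0.
move=> s t s0 st tT; have t0 : 0 < t by exact: le_lt_trans st.
have x0 : 0 < t - s by rewrite subr_gt0.
have xt : t - s <= t by rewrite gerBl.
have G10 : 0 <= G + 1 by lra.
have E0 : 0 <= t `^ A * t `^ B by rewrite mulr_ge0 ?powR_ge0.
set e := 1 + _; set x := t - s in x0 xt *.
have [ts|ts] := leP t (2 * s).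
  apply: (@le_trans _ _ (\int[leb_m]_(u in `]s, t[%classic)
      ((Cp * cB * (t `^ A * t `^ B))%:E * ((t - u) `^ G)%:E))%E).
    apply: ge0_le_integral => //.
    - exact: mgt.
    - by apply/measurable_EFinP; apply: measurable_funM => //; apply/measurable_EFinP; exact: mR.
    - move=> u /=; rewrite in_itv/= => /andP[su ut]; rewrite -EFinM lee_fin.
      by apply: half1 => //; [exact: le_lt_trans su|lra].
  rewrite ge0_integralZl_EFin; try exact: measurable_itv; try exact: mR; try exact: mL;
  try (by rewrite !mulr_ge0 ?powR_ge0); try (by move=> u _; rewrite lee_fin powR_ge0).
  apply: le_trans (lee_wpmul2l _ (hMR s t st)) _; first by rewrite lee_fin !mulr_ge0 ?powR_ge0.
  rewrite -EFinM lee_fin -/x.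
  have -> : Cp * cB * (t `^ A * t `^ B) * (MR * x `^ (G + 1)) =
    (Cp * (cB * MR)) * (t `^ A * t `^ B * x `^ (G + 1)) by ring.
  rewrite -[leRHS]mulrA; apply: ler_pM; rewrite ?mulr_ge0 ?powR_ge0//; last exact: pow1.
  by rewrite ler_wpM2l// lerDl !mulr_ge0 ?addr_ge0 ?mulr_ge0 ?powR_ge0.
apply: (@le_trans _ _ (\int[leb_m]_(u in `]0%R, t[%classic)
    ((Cp * cB * (t `^ A * t `^ B))%:E * ((t - u) `^ G)%:E +
     (Cp * cG * (t `^ A * t `^ G))%:E * (u `^ B)%:E)%E)%E).
  apply: (@le_trans _ _ (\int[leb_m]_(u in `]0%R, t[%classic) (`|g t u| `^ p)%:E)%E).
    apply: ge0_subset_integral => //.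
    - exact: mgt.
    - by move=> u /=; rewrite !in_itv/= => /andP[/(le_lt_trans s0) -> ->].
  apply: ge0_le_integral => //.
  - exact: mgt.
  - apply/measurable_EFinP; apply: measurable_funD; apply: measurable_funM => //.
      by apply/measurable_EFinP; exact: mR.
    by apply/measurable_EFinP; exact: mL.
  - move=> u /=; rewrite in_itv/= => /andP[u0 ut]; rewrite -!EFinM -EFinD lee_fin.
    have [tu|tu] := leP t (2 * u).
      by apply: le_trans (half1 t u u0 ut tu tT) _; rewrite lerDl !mulr_ge0 ?powR_ge0.
    by apply: le_trans (half2 t u u0 ut (ltW tu) tT) _; rewrite lerDr !mulr_ge0 ?powR_ge0.
rewrite ge0_integralD//; try exact: measurable_itv;
  try (by move=> u _; rewrite -EFinM lee_fin !mulr_ge0 ?powR_ge0);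
  try (by apply/measurable_EFinP; apply: measurable_funM => //; apply/measurable_EFinP;
    first [exact: mR|exact: mL]).
rewrite !ge0_integralZl_EFin; try exact: measurable_itv; try exact: mR; try exact: mL;
  try (by rewrite !mulr_ge0 ?powR_ge0); try (by move=> u _; rewrite lee_fin powR_ge0).
have h1 := hMR 0 t t0; rewrite subr0 in h1.
apply: le_trans (leeD (lee_wpmul2l _ h1) (lee_wpmul2l _ (hML t t0))) _.
- by rewrite lee_fin !mulr_ge0 ?powR_ge0.
- by rewrite lee_fin !mulr_ge0 ?powR_ge0.
rewrite -!EFinM -EFinD lee_fin.
have tB : t `^ G * t `^ (B + 1) = t `^ B * t `^ (G + 1).
  by rewrite -!gt0_powRD//; congr (_ `^ _); ring.
have -> : Cp * cB * (t `^ A * t `^ B) * (MR * t `^ (G + 1)) +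
   Cp * cG * (t `^ A * t `^ G) * (ML * t `^ (B + 1)) =
   Cp * (cB * MR + cG * ML) * (t `^ A * t `^ B * t `^ (G + 1)).
  have -> : Cp * cG * (t `^ A * t `^ G) * (ML * t `^ (B + 1)) =
    Cp * cG * ML * t `^ A * (t `^ G * t `^ (B + 1)) by ring.
  by rewrite tB; ring.
have tx : t `^ (G + 1) <= 2 `^ (G + 1) * x `^ (G + 1).
  rewrite -powRM ?(ltW x0)// ge0_ler_powR ?nnegrE ?mulr_ge0 ?(ltW t0) ?(ltW x0)//.
  by rewrite /x; lra.
apply: (@le_trans _ _ (Cp * (cB * MR + cG * ML) * (t `^ A * t `^ B * (2 `^ (G + 1) * x `^ (G + 1))))).
  by apply: ler_wpM2l; [rewrite mulr_ge0 ?addr_ge0 ?mulr_ge0|exact: ler_wpM2l].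
have -> : Cp * (cB * MR + cG * ML) * (t `^ A * t `^ B * (2 `^ (G + 1) * x `^ (G + 1))) =
  Cp * ((cB * MR + cG * ML) * 2 `^ (G + 1)) * (t `^ A * t `^ B * x `^ (G + 1)) by ring.
rewrite -[leRHS]mulrA; apply: ler_pM; rewrite ?mulr_ge0 ?addr_ge0 ?mulr_ge0 ?powR_ge0//; last exact: pow1.
by rewrite ler_wpM2l// lerDr mulr_ge0.
Qed.

End kernel_estimates.

Section kernel_increments.
Context {R : realType}.
Local Notation leb_m := (@lebesgue_measure R).
Variables (T : R) (g : R -> R -> R) (p alpha beta gamma delta : R).
Hypotheses (T0 : 0 < T) (p0 : 0 < p) (mg : jointly_measurable_kernel T g).
Hypotheses (B1 : condB1 T g alpha beta gamma) (B2 : condB2 T g p delta).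
Hypotheses (bp : - p^-1 < beta) (gp : - p^-1 < gamma)
  (kp : - p^-1 < kappa alpha beta gamma).

Lemma measurable_kernel_diff (s t : R) : s <= t -> t <= T ->
  measurable_fun `]0, t]%classic (kernel_diff (g t) (g s) s).
Proof.
move=> st tT; apply: measurable_funB; first exact: (measurable_kernel_section mg).
have ms : measurable_fun setT ((g s) \_ `]0, s]%classic).
  apply: (proj1 (measurable_restrictT (g s) (measurable_itv _))).
  by apply: (measurable_kernel_section mg); exact: le_trans tT.
apply: (eq_measurable_fun ((g s) \_ `]0, s]%classic)); last exact: measurable_funTS.
move=> x; rewrite inE/= in_itv/= => /andP[x0 _]; rewrite patchE.
have [xs|xs] := leP x s; first by rewrite mem_set//= in_itv/= x0.
by rewrite memNset//= in_itv/= leNgt xs andbF.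
Qed.

(** On ]0, s] condition (B2) yields the exponent delta p; on ]s, t] only g t remains and
    [kernel_tail] yields 1 + kappa p. The excess over the smaller exponent goes into powers of
    [T]. *)
Lemma kernel_diff_bound : exists2 C, 0 <= C & forall s t, 0 <= s -> s <= t -> t <= T ->
  (\int[leb_m]_(u in `]0%R, t]%classic) (`|kernel_diff (g t) (g s) s u| `^ p)%:E <=
    (C * (t - s) `^ (Num.min (delta * p) (1 + kappa alpha beta gamma * p)))%:E)%E.
Proof.
have [C1 C10 hC1] := kernel_tail T0 p0 mg B1 bp gp.
have [d0 [h [mh hgh hsup]]] := B2.
set S := ereal_sup _ in hsup; pose M : R := `|fine S|; have M0 : 0 <= M by exact: normr_ge0.
have hM s t : 0 < s -> s < t -> t <= T ->
    (\int[leb_m]_(u in `]0%R, s[%classic) (`|h t s u| `^ p)%:E <= M%:E)%E.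
  move=> s0 st tT; set r := (X in (X <= _)%E).
  have rS : (r <= S)%E by apply: ereal_sup_ubound; exists s, t; split.
  have r0 : (0 <= r)%E by apply: integral_ge0 => u _; rewrite lee_fin powR_ge0.
  have Sfin : S \is a fin_num by rewrite (ge0_fin_numE (le_trans r0 rS)).
  by apply: (le_trans rS); rewrite /M -[X in (X <= _)%E](fineK Sfin) lee_fin ler_norm.
set e := 1 + _; set rho := Num.min _ _.
have e0 : 0 < e by have := mul_gtN1 p0 kp; rewrite /e; lra.
have dp0 : 0 < delta * p by rewrite mulr_gt0.
have rho0 : 0 < rho by rewrite /rho lt_min dp0.
have pow x c : 0 < x -> x <= T -> rho <= c -> x `^ c <= (T `^ (c - rho)) * x `^ rho.
  move=> x0 xT rc; have -> : x `^ c = x `^ (c - rho) * x `^ rho by rewrite -gt0_powRD// subrK.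
  rewrite ler_wpM2r ?powR_ge0//.
  by rewrite ge0_ler_powR ?nnegrE ?subr_ge0 ?(ltW x0) ?(ltW T0).
exists (M * T `^ (delta * p - rho) + C1 * T `^ (e - rho)).
  by rewrite addr_ge0 ?mulr_ge0 ?powR_ge0.
move=> s t s0; rewrite le_eqVlt => /predU1P[<-|st] tT.
  rewrite subrr powR0 ?gt_eqF// mulr0 integral0_eq// => u /=; rewrite in_itv/= => /andP[_ us].
  by rewrite /kernel_diff us subrr normr0 powR0 ?gt_eqF.
have t0 : 0 < t by exact: le_lt_trans st.
set x := t - s; have x0 : 0 < x by rewrite subr_gt0.
have xT : x <= T by rewrite /x lerBlDr (le_trans tT)// lerDl.
pose f u := (`|kernel_diff (g t) (g s) s u| `^ p)%:E.
have mf (D : set R) : measurable D -> D `<=` `]0, t]%classic -> measurable_fun D f.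
  move=> mD Dt; apply/measurable_EFinP; apply: (measurableT_comp (measurable_powR _)).
  apply: measurableT_comp => //.
  exact: measurable_funS (measurable_itv _) Dt (measurable_kernel_diff (ltW st) tT).
have f0 u : (0 <= f u)%E by rewrite lee_fin powR_ge0.
have sub1 : `]0, s]%classic `<=` `]0, t]%classic.
  by move=> u /=; rewrite !in_itv/= => /andP[-> /le_trans]; apply; exact: ltW.
have sub2 : `]s, t]%classic `<=` `]0, t]%classic.
  by move=> u /=; rewrite !in_itv/= => /andP[/(le_lt_trans s0) ->].
have -> : `]0, t]%classic = `]0, s]%classic `|` `]s, t]%classic.
  apply/seteqP; split => u /=; last by case; [exact: sub1|exact: sub2].
  by rewrite !in_itv/= => /andP[u0 ut]; have [us|us] := leP u s; [left; rewrite u0|right].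
rewrite ge0_integral_setU//; last 2 first.
- by apply: mf; [apply: measurableU; exact: measurable_itv|rewrite subUset].
- apply/disj_setPS => u /= []; rewrite !in_itv/= => /andP[_ us] /andP[su _].
  by have := lt_le_trans su us; rewrite ltxx.
rewrite mulrDl EFinD; apply: leeD.
  have [->|sn0] := eqVneq s 0.
    by rewrite set_itv_ge ?bnd_simp// integral_set0 lee_fin !mulr_ge0 ?powR_ge0.
  have s0' : 0 < s by rewrite lt_neqAle eq_sym sn0.
  rewrite -integral_itv_bndo_bndc; last first.
    apply: mf; first exact: measurable_itv.
    by apply: subset_trans sub1 => u /=; rewrite !in_itv/= => /andP[-> /ltW].
  apply: (@le_trans _ _ (\int[leb_m]_(u in `]0%R, s[%classic)
      ((x `^ (delta * p))%:E * (`|h t s u| `^ p)%:E)%E)%E).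
    apply: ge0_le_integral => //.
    + apply: mf; first exact: measurable_itv.
      by apply: subset_trans sub1 => u /=; rewrite !in_itv/= => /andP[-> /ltW].
    + apply/measurable_EFinP; apply: measurable_funM => //.
      apply: (measurableT_comp (measurable_powR _)); apply: measurableT_comp => //.
      exact: mh.
    + move=> u /=; rewrite in_itv/= => /andP[u0 us]; rewrite -EFinM lee_fin.
      rewrite /kernel_diff (ltW us) powRrM -powRM ?powR_ge0//.
      apply: ge0_ler_powR; rewrite ?nnegrE ?mulr_ge0 ?powR_ge0 ?(ltW p0)//.
      apply: le_trans (hgh t s u u0 us st tT) _.
      by rewrite gtr0_norm// ler_wpM2l ?powR_ge0// ler_norm.
  rewrite ge0_integralZl_EFin; try exact: measurable_itv;
    try (by rewrite powR_ge0); try (by move=> u _; rewrite lee_fin powR_ge0);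
    try (by apply/measurable_EFinP; apply: (measurableT_comp (measurable_powR _));
      apply: measurableT_comp => //; exact: mh).
  apply: le_trans (lee_wpmul2l _ (hM s t s0' st tT)) _; first by rewrite lee_fin powR_ge0.
  rewrite -EFinM lee_fin mulrC -mulrA ler_wpM2l//.
  by apply: pow => //; rewrite ge_min lexx.
rewrite -integral_itv_bndo_bndc; last first.
  apply: mf; first exact: measurable_itv.
  by apply: subset_trans sub2 => u /=; rewrite !in_itv/= => /andP[-> /ltW].
rewrite (eq_integral (fun u : measurableTypeR R => (`|g t u| `^ p)%:E)); last first.
  move=> u; rewrite inE/= in_itv/= => /andP[su _].
  by rewrite /kernel_diff leNgt su subr0.
apply: le_trans (hC1 s t s0 st tT) _; rewrite lee_fin -mulrA ler_wpM2l//.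
by apply: pow => //; rewrite ge_min lexx orbT.
Qed.

Lemma kernel_diff_integrable (s t : R) : 0 <= s -> s <= t -> t <= T ->
  leb_m.-integrable `]0, t]%classic (EFin \o (fun u => `|kernel_diff (g t) (g s) s u| `^ p)).
Proof.
move=> s0 st tT; have [C C0 hC] := kernel_diff_bound; apply/integrableP; split.
  apply/measurable_EFinP; apply: (measurableT_comp (measurable_powR _)).
  by apply: measurableT_comp => //; exact: measurable_kernel_diff.
rewrite (eq_integral (fun u : measurableTypeR R => (`|kernel_diff (g t) (g s) s u| `^ p)%:E)).
  exact: le_lt_trans (hC s t s0 st tT) (ltry _).
by move=> u _; rewrite /= ger0_norm ?powR_ge0.
Qed.

End kernel_increments.

(** * Continuity of paths *)

Section chaining.
Context {R : realType}.
Variable T : R.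
Hypothesis T0 : 0 < T.

(** For [t] in [0, T] the largest point T j 2^-n not exceeding [t]. *)
Definition dyp (n : nat) (t : R) : R := T * pt n (idx n (t / T)).

Lemma idx_le_expn n (t : R) : 0 <= t <= T -> (idx n (t / T) <= 2 ^ n)%N.
Proof.
move=> /andP[t0 tT]; have x0 : 0 <= t / T by rewrite divr_ge0// ltW.
have e1 : pt n (2 ^ n) = 1 :> R by rewrite -[(2 ^ n)%N]mul1n pt_nat.
have /andP[h _] := idxP n x0; rewrite -(@le_pt R n) e1.
by apply: le_trans h _; rewrite ler_pdivrMr// mul1r.
Qed.

Lemma dypP n (t : R) : 0 <= t <= T -> [/\ 0 <= dyp n t, dyp n t <= t & t - dyp n t <= T * 2^-1 ^+ n].
Proof.
move=> /andP[t0 tT]; have x0 : 0 <= t / T by rewrite divr_ge0// ltW.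
have /andP[h1 h2] := idxP n x0; split.
- by rewrite mulr_ge0 ?(ltW T0)// pt_ge0.
- by rewrite /dyp mulrC -ler_pdivlMr.
- have tE : t = T * (t / T) by rewrite mulrCA mulfV ?gt_eqF// mulr1.
  rewrite {1}tE /dyp -mulrBr ler_pM2l// exprVn -(pt_step n (idx n (t / T))).
  by rewrite lerD2r ltW.
Qed.

Lemma idxS n (x : R) : 0 <= x ->
  idx n.+1 x = (idx n x).*2 \/ idx n.+1 x = (idx n x).*2.+1.
Proof.
move=> x0; have /andP[h1 h2] := idxP n x0; have /andP[h3 h4] := idxP n.+1 x0.
rewrite -ptSS in h1; rewrite -ptSS doubleS in h2.
have := le_lt_trans h1 h4; have := le_lt_trans h3 h2; rewrite !lt_pt; lia.
Qed.

Lemma idx_close n (x y : R) : 0 <= x -> x <= y -> y - x <= 2^-1 ^+ n ->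
  idx n y = idx n x \/ idx n y = (idx n x).+1.
Proof.
move=> x0 xy yx; have y0 := le_trans x0 xy.
have /andP[h1 h2] := idxP n x0; have /andP[h3 h4] := idxP n y0.
rewrite exprVn in yx; have st := @pt_step R n (idx n x).+1.
have h : pt n (idx n y) < pt n (idx n x).+2 :> R.
  by apply: (le_lt_trans h3); lra.
have := le_lt_trans (le_trans h1 xy) h4; move: h; rewrite !lt_pt; lia.
Qed.

Variables (y : R -> R) (M r : R).
Hypotheses (M0 : 0 <= M) (r0 : 0 <= r) (r1 : r < 1).
Hypothesis hy : forall n j, (j < 2 ^ n)%N ->
  `|y (T * pt n j.+1) - y (T * pt n j)| <= M * r ^+ n.

(** Approximations of consecutive levels coincide or are neighbours in the finer grid. *)
Lemma chain_step n (t : R) : 0 <= t <= T -> `|y (dyp n.+1 t) - y (dyp n t)| <= M * r ^+ n.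
Proof.
move=> tT; have /andP[t0 _] := tT.
have x0 : 0 <= t / T by rewrite divr_ge0// ltW.
have := idx_le_expn n.+1 tT; rewrite /dyp -(ptSS n).
have [->|->] := idxS n x0 => h; first by rewrite subrr normr0 mulr_ge0 ?exprn_ge0.
apply: le_trans (hy h) _; rewrite exprS mulrCA ler_piMl ?mulr_ge0 ?exprn_ge0//.
exact: ltW.
Qed.

Lemma chain_dist n m (t : R) : 0 <= t <= T -> (n <= m)%N ->
  `|y (dyp m t) - y (dyp n t)| <= M * r ^+ n / (1 - r).
Proof.
move=> tT /subnK <-; set k := (m - n)%N.
have r10 : 0 < 1 - r by rewrite subr_gt0.
have h : `|y (dyp (k + n) t) - y (dyp n t)| <= M * r ^+ n * \sum_(i < k) r ^+ i.
  elim: k => [|k ih]; first by rewrite add0n subrr normr0 big_ord0 mulr0.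
  rewrite big_ord_recr/= mulrDr addSn.
  have -> : y (dyp (k + n).+1 t) - y (dyp n t) =
    (y (dyp (k + n) t) - y (dyp n t)) + (y (dyp (k + n).+1 t) - y (dyp (k + n) t)) by ring.
  apply: le_trans (ler_normD _ _) _; apply: lerD => //.
  by rewrite -mulrA -exprD addnC; exact: chain_step.
apply: le_trans h _; rewrite ler_wpM2l ?mulr_ge0 ?exprn_ge0//.
exact: geo_sum_le.
Qed.

Lemma chain_cvg (t : R) : 0 <= t <= T -> cvg (y (dyp n t) @[n --> \oo]).
Proof.
move=> tT; apply: (@summable_steps_cvg _ _ (M / (1 - r))) => N.
apply: (@le_trans _ _ (\sum_(0 <= n < N) M * r ^+ n)).
  apply: ler_sum => n _; rewrite ge_min distrC.
  by rewrite chain_step.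
rewrite -mulr_sumr ler_wpM2l// big_mkord; exact: geo_sum_le.
Qed.

Lemma chain_limit_dist n (t l : R) : 0 <= t <= T -> y (dyp m t) @[m --> \oo] --> l ->
  `|l - y (dyp n t)| <= M * r ^+ n / (1 - r).
Proof.
move=> tT c.
have c' : `|y (dyp m t) - y (dyp n t)| @[m --> \oo] --> `|l - y (dyp n t)|.
  by apply: cvg_norm; apply: cvgB => //; exact: cvg_cst.
apply: (ler_cvg_to c' (cvg_cst _)).
by exists n => // m /= nm; exact: chain_dist.
Qed.

(** At distance at most T 2^-n the level-n approximations of the two points coincide or are
    neighbours; two geometric tails lead from them to the limits. *)
Lemma chain_modulus n (s t ls lt : R) : 0 <= s -> s <= t -> t <= T -> t - s <= T * 2^-1 ^+ n ->
  y (dyp m s) @[m --> \oo] --> ls -> y (dyp m t) @[m --> \oo] --> lt ->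
  `|lt - ls| <= M * r ^+ n * (1 + 2 / (1 - r)).
Proof.
move=> s0 st tT ts cs ct; have t0 := le_trans s0 st.
have sT : 0 <= s <= T by rewrite s0 (le_trans st).
have tT' : 0 <= t <= T by rewrite t0.
have h1 := chain_limit_dist n sT cs; have h2 := chain_limit_dist n tT' ct.
have x0 : 0 <= s / T by rewrite divr_ge0// ltW.
have h3 : `|y (dyp n t) - y (dyp n s)| <= M * r ^+ n.
  have [||e|e] := @idx_close n (s / T) (t / T) x0.
  - by rewrite ler_pM2r ?invr_gt0.
  - by rewrite -mulrBl ler_pdivrMr// mulrC.
  - by rewrite /dyp e subrr normr0 mulr_ge0 ?exprn_ge0.
  - rewrite /dyp e; apply: hy.
    by have := idx_le_expn n tT'; rewrite e.
have -> : lt - ls = (lt - y (dyp n t)) + (y (dyp n t) - y (dyp n s)) - (ls - y (dyp n s)) by ring.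
apply: le_trans (ler_normB _ _) _; apply: le_trans (lerD (ler_normD _ _) (lexx _)) _.
rewrite mulrDr mulr1 mulrA; lra.
Qed.

End chaining.

(** * Kolmogorov's continuity criterion *)

Section kolmogorov.
Context d {Omega : measurableType d} {R : realType} (P : probability Omega R).
Variables (T : R) (Y : R -> {RV P >-> R}) (q C eta : R).
Hypotheses (T0 : 0 < T) (q0 : 0 < q) (C0 : 0 <= C) (eta0 : 0 < eta).
Hypothesis hY : forall s t, 0 <= s -> s <= t -> t <= T ->
  (\int[P]_w (`|Y t w - Y s w| `^ q)%:E <= (C * (t - s) `^ (1 + eta))%:E)%E.

(** The expected sum of the q-th powers of the level-n increments is of order 2^(- n eta) = rho^(2
    n). One factor rho^n is the almost sure rate, the other makes the weighted series summable; the
    q-th root gives the rate [r] of single increments. *)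
Let rho : R := 2^-1 `^ (eta / 2).
Let r : R := rho `^ q^-1.

Let S n (w : Omega) : R :=
  \sum_(j < 2 ^ n) `|Y (T * pt n j.+1) w - Y (T * pt n j) w| `^ q.

Let rho0 : 0 < rho. Proof. by rewrite powR_gt0. Qed.

Let rho1 : rho < 1.
Proof.
have -> : 1 = 1 `^ (eta / 2) :> R by rewrite powR1.
by apply: gt0_ltr_powR; rewrite ?divr_gt0// ?nnegrE ?invr_ge0// invf_lt1// ltr1n.
Qed.

Let r0 : 0 <= r. Proof. exact: powR_ge0. Qed.

Let r1 : r < 1.
Proof.
have -> : 1 = 1 `^ q^-1 :> R by rewrite powR1.
by apply: gt0_ltr_powR; rewrite ?invr_gt0// nnegrE// ltW.
Qed.

Let mY t : measurable_fun setT (Y t). Proof. exact: measurable_funP. Qed.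

Let mS n : measurable_fun setT (S n).
Proof.
by apply: measurable_sum => j; apply: measurable_norm_powR; exact: measurable_funB.
Qed.

(** The number 2^n of increments cancels the first power of 2^-n in (T 2^-n)^(1 + eta). *)
Let S_moment n : (\int[P]_w (S n w)%:E <= (C * T `^ (1 + eta) * rho ^+ n * rho ^+ n)%:E)%E.
Proof.
have -> : (\int[P]_w (S n w)%:E =
    \sum_(j < 2 ^ n) \int[P]_w (`|Y (T * pt n j.+1) w - Y (T * pt n j) w| `^ q)%:E)%E.
  under eq_integral do rewrite /S -sumEFin.
  rewrite ge0_integral_sum//.
  by move=> j; apply/measurable_EFinP; apply: measurable_norm_powR; exact: measurable_funB.
have step (j : 'I_(2 ^ n)) : (\int[P]_w (`|Y (T * pt n j.+1) w - Y (T * pt n j) w| `^ q)%:E <=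
    (C * T `^ (1 + eta) * (2^-1 * rho ^+ 2) ^+ n)%:E)%E.
  apply: le_trans (hY _ _ _) _.
  - by rewrite mulr_ge0 ?(ltW T0)// pt_ge0.
  - by rewrite ler_pM2l// le_pt.
  - rewrite -[leRHS]mulr1 ler_pM2l//.
    have e1 : pt n (2 ^ n) = 1 :> R by rewrite -[(2 ^ n)%N]mul1n pt_nat.
    by rewrite -e1 le_pt.
  have e2 : (2^-1 ^+ n : R) `^ (1 + eta) = (2^-1 * rho ^+ 2) ^+ n.
    rewrite exprn_powR ?invr_ge0//; congr (_ ^+ n).
    rewrite gt0_powRD ?invr_gt0// powRr1 ?invr_ge0//; congr (_ * _).
    by rewrite /rho expr2 -gt0_powRD ?invr_gt0// -splitr.
  by rewrite -mulrBr pt_step -exprVn powRM ?(ltW T0) ?exprn_ge0 ?invr_ge0// e2 mulrA.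
apply: (@le_trans _ _ (\sum_(j < 2 ^ n) (C * T `^ (1 + eta) * (2^-1 * rho ^+ 2) ^+ n)%:E)%E).
  by apply: lee_sum => j _; exact: step.
rewrite sumEFin lee_fin sumr_const card_ord -[leLHS]mulr_natl natrX exprMn.
have -> : 2 ^+ n * (C * T `^ (1 + eta) * (2^-1 ^+ n * (rho ^+ 2) ^+ n)) =
  (2 ^+ n * 2^-1 ^+ n) * (C * T `^ (1 + eta)) * (rho ^+ 2) ^+ n by ring.
rewrite -exprMn mulfV// expr1n mul1r -[leRHS]mulrA -exprMn -expr2.
exact: lexx.
Qed.

Let good (w : Omega) : Prop := exists2 M, 0 <= M & forall n j, (j < 2 ^ n)%N ->
  `|Y (T * pt n j.+1) w - Y (T * pt n j) w| <= M * r ^+ n.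

Let ae_good : {ae P, forall w, good w}.
Proof.
pose f n w := rho^-1 ^+ n * S n w.
have S0 n w : 0 <= S n w by apply: sumr_ge0 => j _; exact: powR_ge0.
have f0 n w : 0 <= f n w by rewrite mulr_ge0// exprn_ge0// invr_ge0 ltW.
pose D : R := C * T `^ (1 + eta).
have D0 : 0 <= D by rewrite mulr_ge0 ?powR_ge0.
have := @ae_bounded_sums _ _ _ P f (D / (1 - rho)).
case/(_ _ _ _)/Wrap => [n|//|N|].
- by apply: measurable_funM => //; exact: mS.
- apply: (@le_trans _ _ (\sum_(0 <= n < N) (D * rho ^+ n)%:E)%E).
    apply: lee_sum => n _; rewrite /f.
    under eq_integral do rewrite EFinM.
    rewrite ge0_integralZl_EFin//; last 3 first.
    + by move=> w _; rewrite lee_fin.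
    + by apply/measurable_EFinP; exact: mS.
    + by rewrite exprn_ge0// invr_ge0 ltW.
    apply: le_trans (lee_wpmul2l _ (S_moment n)) _.
      by rewrite lee_fin exprn_ge0// invr_ge0 ltW.
    rewrite -EFinM lee_fin -/D.
    have -> : rho^-1 ^+ n * (D * rho ^+ n * rho ^+ n) =
      (rho^-1 ^+ n * rho ^+ n) * (D * rho ^+ n) by ring.
    by rewrite -exprMn mulVf ?gt_eqF// expr1n mul1r.
  rewrite sumEFin lee_fin -mulr_sumr ler_wpM2l// big_mkord.
  exact: geo_sum_le (ltW rho0) rho1.
apply: filterS => w [M hM].
have hf n : f n w <= M.
  apply: le_trans (hM n.+1); rewrite big_nat_recr//= lerDr.
  by apply: sumr_ge0 => i _; exact: f0.
have M0 : 0 <= M := le_trans (f0 0%N w) (hf 0%N).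
exists (M `^ q^-1) => [|n j jn]; first exact: powR_ge0.
have Sle : `|Y (T * pt n j.+1) w - Y (T * pt n j) w| `^ q <= M * rho ^+ n.
  apply: (@le_trans _ _ (S n w)).
    rewrite /S (bigD1 (Ordinal jn))//= lerDl.
    by apply: sumr_ge0 => i _; exact: powR_ge0.
  have := hf n; rewrite /f exprVn mulrC ler_pdivrMr ?exprn_gt0//.
have -> : `|Y (T * pt n j.+1) w - Y (T * pt n j) w| =
    (`|Y (T * pt n j.+1) w - Y (T * pt n j) w| `^ q) `^ q^-1.
  by rewrite -powRrM mulfV ?gt_eqF// powRr1.
apply: le_trans (ge0_ler_powR _ _ _ Sle) _; rewrite ?nnegrE ?powR_ge0 ?invr_ge0 ?(ltW q0)//.
  by rewrite mulr_ge0 ?exprn_ge0 ?(ltW rho0).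
by rewrite powRM ?exprn_ge0 ?(ltW rho0)// exprn_powR ?(ltW rho0).
Qed.

Let Y'f t : Omega -> R := limit_rv (fun n => Y (dyp T n t)).

Let Y'f_cvg t w : 0 <= t <= T -> good w -> Y (dyp T n t) w @[n --> \oo] --> Y'f t w.
Proof.
move=> tT [M M0 hM]; apply: (@limit_rv_cvg _ _ _ (fun n => Y (dyp T n t) : Omega -> R)).
exact: (@chain_cvg _ _ T0 (fun t => Y t w) M r M0 r0 r1 hM t tT).
Qed.

Let dyp_cvg t : 0 <= t <= T -> pd P (Y (dyp T n t)) (Y t) @[n --> \oo] --> 0.
Proof.
move=> tT; have /andP[t0 tT'] := tT.
apply/cvgrPdist_le => e e0.
have [epsi epsi0 h] := pd_small_of_moment P q0 q0 C0 e0.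
have e1 : 0 < epsi `^ (1 + eta)^-1 / T by rewrite divr_gt0// powR_gt0.
have [m hm] := expr_half_small e1; exists m => // n /= mn.
rewrite sub0r normrN ger0_norm ?pd_ge0// pdC.
have [h1 h2 h3] := dypP T0 n tT.
apply: (h _ _ ((t - dyp T n t) `^ (1 + eta))) => //; first exact: powR_ge0.
  have te : t - dyp T n t <= epsi `^ (1 + eta)^-1.
    apply: le_trans h3 _; rewrite mulrC -ler_pdivlMr// exprVn; exact: hm.
  have eta1 : 0 < 1 + eta by rewrite addr_gt0.
  apply: le_trans (ge0_ler_powR (ltW eta1) _ _ te) _; rewrite ?nnegrE ?subr_ge0 ?powR_ge0//.
  by rewrite -powRrM mulVf ?gt_eqF// powRr1// ltW.
by rewrite divff ?gt_eqF// powRr1 ?powR_ge0//; exact: hY.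
Qed.

(** The modification is the upper limit along dyadic approximations from below. It agrees with [Y]
    at each time because increments are small in probability, and it is bounded because the chain
    starts at level 0, at one of the points 0 and [T]. *)
Theorem continuous_modification : exists Y' : R -> {RV P >-> R},
  [/\ is_modification T Y' Y, as_continuous T Y' & as_bounded T Y'].
Proof.
have mY' t : measurable_fun setT (Y'f t) by exact: measurable_limit_rv.
exists (fun t => mfun_Sub (mem_set (mY' t))); split.
- move=> t tT; apply: (pd_cvg_unique (X := fun n => Y (dyp T n t)) (P := P)) => //.
    apply: ae_cvg_pd => //.
    by apply: filterS ae_good => w gw; exact: Y'f_cvg.
  exact: dyp_cvg.
- apply: filterS ae_good => w gw; have [M M0 hM] := gw.
  apply/subspace_continuousP => t /=; rewrite in_itv/= => tT.
  apply/cvgrPdist_le => e e0.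
  pose K := M * (1 + 2 / (1 - r)).
  have K0 : 0 <= K.
    by rewrite mulr_ge0// addr_ge0// divr_ge0// subr_ge0 ltW.
  have [n hn] : exists n, K * r ^+ n <= e.
    have c : K * r ^+ n @[n --> \oo] --> (0 : R).
      rewrite -[X in _ --> X](mulr0 K); apply: cvgM; first exact: cvg_cst.
      by apply: cvg_expr; rewrite ger0_norm.
    have [m _ hm] : \forall n \near \oo, K * r ^+ n <= e.
      by near do apply/ltW; apply: (cvgr_lt 0).
    by exists m; apply: hm => /=.
  have mod s u : 0 <= s -> s <= u -> u <= T -> u - s <= T * 2^-1 ^+ n ->
      `|Y'f u w - Y'f s w| <= e.
    move=> s0 su uT us; apply: le_trans hn.
    have -> : K * r ^+ n = M * r ^+ n * (1 + 2 / (1 - r)) by rewrite /K; ring.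
    apply: (@chain_modulus _ _ T0 (fun t => Y t w) M r M0 r0 r1 hM n s u _ _ s0 su uT us);
      apply: Y'f_cvg => //.
      by rewrite s0 (le_trans su).
    by rewrite uT (le_trans s0).
  have de : 0 < T * 2^-1 ^+ n by rewrite mulr_gt0 ?exprn_gt0 ?invr_gt0.
  rewrite near_withinE; near=> s => sT.
  have ds : `|t - s| <= T * 2^-1 ^+ n.
    by apply: ltW; near: s; exact: cvgr_dist_lt.
  move: sT; rewrite /= in_itv/= => /andP[s0 sT]; have /andP[t0 tT'] := tT.
  have [st|ts] := leP s t.
    by apply: mod => //; rewrite -(ger0_norm (x := t - s)) ?subr_ge0.
  rewrite distrC; apply: mod => //; first exact: ltW.
  by rewrite -(ger0_norm (x := s - t)) ?subr_ge0 ?(ltW ts)// distrC.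
- apply: filterS ae_good => w gw; have [M M0 hM] := gw.
  exists (M * r ^+ 0 / (1 - r) + (`|Y 0 w| + `|Y T w|)) => t tT.
  have h := @chain_limit_dist _ _ T0 (fun t => Y t w) M r M0 r0 r1 hM 0 t _ tT (Y'f_cvg tT gw).
  have h2 : `|Y (dyp T 0 t) w| <= `|Y 0 w| + `|Y T w|.
    have : (idx 0 (t / T) <= 1)%N by have := idx_le_expn T0 0 tT; rewrite expn0.
    rewrite /dyp /pt expr0 divr1; case: (idx _ _) => [|[|//]] _.
      by rewrite mulr0 lerDl.
    by rewrite mulr1 lerDr.
  apply: le_trans (lerD h h2).
  by rewrite -[leLHS]/(`|Y'f t w|) -{1}(subrK (Y (dyp T 0 t) w) (Y'f t w)); exact: ler_normD.
Unshelve. all: by end_near. Qed.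

End kolmogorov.

(** * The pathwise equation *)

Section real_estimates.
Context {R : realType}.

Lemma discrete_gronwall (e : nat -> R) (c d : R) (N : nat) : 0 <= c -> 0 <= d -> e 0%N <= 0 ->
  (forall j, (j < N)%N -> e j.+1 <= (1 + c) * e j + c * d) ->
  forall j, (j <= N)%N -> e j <= d * expR (c * j%:R).
Proof.
move=> c0 d0 e0 he j jN; have c1 : 0 <= 1 + c by rewrite addr_ge0.
have h : e j <= d * ((1 + c) ^+ j - 1).
  elim: j jN => [|j ih] jN; first by rewrite expr0 subrr mulr0.
  apply: (le_trans (he _ jN)).
  apply: (@le_trans _ _ ((1 + c) * (d * ((1 + c) ^+ j - 1)) + c * d)).
    by rewrite lerD2r ler_wpM2l// ih// ltnW.
  by rewrite exprS le_eqVlt; apply/orP; left; apply/eqP; ring.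
apply: (le_trans h); rewrite ler_wpM2l// mulrC expRM_natl.
apply: (@le_trans _ _ ((1 + c) ^+ j)); first by rewrite gerBl.
by rewrite lerXn2r ?nnegrE ?expR_ge0// expR_ge1Dx.
Qed.

Lemma within_continuous_bounded (T : R) (w : R -> R) : {within `[0, T], continuous w} ->
  exists2 B : R, 0 <= B & forall t : R, 0 <= t <= T -> `|w t| <= B.
Proof.
move=> cw; have [M [_ hM]] := compact_bounded (continuous_compact cw (@segment_compact R 0 T)).
exists (`|M| + 1); first by rewrite addr_ge0.
move=> t tT; apply: hM; first by rewrite ltr_pwDr// ler_norm.
by exists t.
Qed.

(** Uniform continuity measured on the step sizes of the dyadic grids. *)
Definition uniform_modulus (T : R) (w : R -> R) := forall e : R, 0 < e ->
  exists N, forall n, (N <= n)%N -> forall s t : R, 0 <= s <= T -> 0 <= t <= T ->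
    `|s - t| <= T * 2 ^- n -> `|w s - w t| <= e.

Lemma within_continuous_uniform (T : R) (w : R -> R) : 0 < T ->
  {within `[0, T], continuous w} -> uniform_modulus T w.
Proof.
move=> T0 cw e e0.
have := near_covering_withinP (`[0, T] : set R).
have /compact_near_coveringP cv := @segment_compact R 0 T.
case=> _ /(_ cv) {}cv.
pose Q (n : nat) (s : R) := forall t : R, 0 <= t <= T -> `|s - t| <= T * 2 ^- n -> `|w s - w t| <= e.
have [|N _ hN] := cv _ \oo Q _; last first.
  by exists N => n Nn s t sT tT; apply: (hN n).
move=> x xT; have e2 : 0 < e / 2 by rewrite divr_gt0.
have /cvgrPdist_le /(_ _ e2) := (subspace_continuousP _ _).1 cw x xT.
rewrite near_withinE => /nbhs_ballP[r /= r0 hr].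
have r2 : 0 < r / 2 by rewrite divr_gt0.
have [n0 hn0] := expr_half_small (divr_gt0 r2 (ltr_wpDr ler01 T0)).
exists (ball x (r / 2), [set n | (n0 <= n)%N]) => /=.
  by split; [exact: nbhsx_ballx|exists n0].
move=> [s n] /= [sx n0n] sT t tT st.
have bs : ball x r s by apply: le_ball sx; lra.
have tb : ball x r t.
  rewrite /ball/= in sx *; have := hn0 _ n0n; rewrite ler_pdivlMr ?addr_gt0// => hh.
  have : T * 2 ^- n < r / 2.
    apply: lt_le_trans hh; rewrite mulrC ltr_pM2l ?invr_gt0 ?exprn_gt0//; lra.
  have : `|x - t| <= `|x - s| + `|s - t| by rewrite (le_trans _ (ler_normD _ _))// subrKA.
  lra.
have h1 := hr _ bs; have h2 := hr _ tb.
have {}h1 : `|w x - w s| <= e / 2 by apply: h1.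
have {}h2 : `|w x - w t| <= e / 2 by apply: h2; rewrite /= in_itv.
have : `|w s - w t| <= `|w s - w x| + `|w x - w t|.
  by rewrite (le_trans _ (ler_normD _ _))// subrKA.
rewrite distrC in h1; lra.
Qed.

Lemma idx_divn n m (x : R) : 0 <= x -> (n <= m)%N -> idx n x = (idx m x %/ 2 ^ (m - n))%N.
Proof.
move=> x0 nm; have /andP[h1 h2] := idxP n x0; have /andP[h3 h4] := idxP m x0.
have e j : pt n j = pt m (j * 2 ^ (m - n)) :> R.
  by rewrite /pt natrM natrX -[in RHS](subnK nm) addnK exprD invfM mulrA mulfK.
rewrite e in h1; rewrite e in h2.
have := le_lt_trans h1 h4; have := le_lt_trans h3 h2; rewrite !lt_pt ltnS => a b.
apply/esym/eqP; rewrite eqn_leq leq_divRL ?expn_gt0// b andbT -ltnS ltn_divLR ?expn_gt0//.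
Qed.

End real_estimates.

(** * The Euler scheme: bounds and comparison of levels *)

Section euler_scheme.
Context {R : realType}.

(** The scheme follows only the drift integral, that is X - w. The driver [w], initial value
    included, enters with its exact values at the grid points. *)
Fixpoint euler (T : R) (u w : R -> R) (n j : nat) : R :=
  if j is j'.+1 then
    euler T u w n j' + T * 2 ^- n * u (w (T * pt n j') + euler T u w n j')
  else 0.

Variables (T : R) (u w : R -> R).
Hypotheses (T0 : 0 < T) (cw : {within `[0, T], continuous w}).
Hypotheses (ug : linear_growth u) (ul : locally_lipschitz u).

Local Notation E := (euler T u w).

Lemma pt_le1 n j : (j <= 2 ^ n)%N -> pt n j <= 1 :> R.
Proof. by move=> jn; rewrite -[leRHS](pt_nat n 1) le_pt mul1n. Qed.

Lemma grid_in n j : (j <= 2 ^ n)%N -> 0 <= T * pt n j <= T.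
Proof.
by move=> jn; rewrite mulr_ge0 ?pt_ge0 ?(ltW T0)// ler_piMr ?(ltW T0)// pt_le1.
Qed.

Lemma step_ge0 n : 0 <= T * 2 ^- n.
Proof. by rewrite mulr_ge0 ?(ltW T0)// invr_ge0 exprn_ge0. Qed.

Lemma step_expR (c : R) n j : 0 <= c -> (j <= 2 ^ n)%N ->
  expR (T * 2 ^- n * c * j%:R) <= expR (T * c).
Proof.
move=> c0 jn; rewrite ler_expR.
have -> : T * 2 ^- n * c * j%:R = T * c * pt n j by rewrite /pt; ring.
by rewrite ler_piMr ?pt_le1// mulr_ge0// ltW.
Qed.

(** Linear growth and the discrete Gronwall inequality give a bound uniform in the level, hence a
    fixed ball with one Lipschitz constant for [u]. *)
Lemma euler_bounded : exists2 r : R, 0 < r & forall (t : R) n j, 0 <= t <= T -> (j <= 2 ^ n)%N ->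
  `|w t + E n j| <= r.
Proof.
have [B B0 hB] := within_continuous_bounded cw; have [C [C0 hC]] := ug.
have B1 : 0 < 1 + B by rewrite ltr_pwDl.
exists (B + (1 + B) * expR (T * C)).
  by rewrite ltr_wpDl// mulr_gt0 ?expR_gt0.
move=> t n j tT jn; apply: le_trans (ler_normD _ _) _; apply: lerD; first exact: hB.
have c0 : 0 <= T * 2 ^- n * C by rewrite mulr_ge0 ?step_ge0// ltW.
apply: (@le_trans _ _ ((1 + B) * expR (T * 2 ^- n * C * j%:R))); last first.
  by rewrite ler_pM2l// step_expR// ltW.
apply: (@discrete_gronwall _ (fun j => `|E n j|) _ _ (2 ^ n)) => //=.
- exact: ltW.
- by rewrite normr0.
move=> k kn; apply: le_trans (ler_normD _ _) _.
rewrite mulrDl mul1r -addrA lerD2l normrM (ger0_norm (step_ge0 n)) -!mulrA -!mulrDr.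
rewrite !ler_wpM2l ?(ltW T0) ?invr_ge0 ?exprn_ge0//.
apply: le_trans (hC _) _; rewrite ler_pM2l//.
have := ler_normD (w (T * pt n k)) (E n k); have := hB _ (grid_in (ltnW kn)); lra.
Qed.

Lemma euler_compare (e : R) : 0 < e -> exists N, forall n m, (N <= n)%N -> (n <= m)%N ->
  forall k, (k <= 2 ^ m)%N -> `|E m k - E n (k %/ 2 ^ (m - n))| <= e.
Proof.
move=> e0; have [r r0 hr] := euler_bounded.
have [L [L0 hL]] := ul (addr_gt0 r0 ltr01).
have [C [C0 hC]] := ug.
pose M := C * (1 + r); have M0 : 0 < M by rewrite mulr_gt0 ?addr_gt0.
have hM v : `|v| <= r -> `|u v| <= M.
  by move=> vr; apply: le_trans (hC _) _; rewrite ler_pM2l// lerD2l.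
pose X := expR (T * L); have X1 : 1 <= X by rewrite /X -expR0 ler_expR mulr_ge0// ltW.
have X0 : 0 < X by exact: expR_gt0.
(* Three errors of size [d]: the oscillation of [w] and the interpolation error, both amplified by
   the Gronwall factor [X], and once more the interpolation error. *)
pose d : R := e / (3 * X); have d0 : 0 < d by rewrite divr_gt0 ?mulr_gt0.
have dE : e = (d + d) * X + d * X by rewrite /d; field; rewrite gt_eqF.
clearbody d.
have [N1 hN1] := within_continuous_uniform T0 cw d0.
have [N2 hN2] := expr_half_small (divr_gt0 d0 (mulr_gt0 T0 M0)).
exists (maxn N1 N2) => n m; rewrite geq_max => /andP[N1n N2n] nm.
have hM_d : T * 2 ^- n * M <= d.
  have h := hN2 _ N2n; rewrite (ler_pdivlMr _ _ (mulr_gt0 T0 M0)) in h.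
  by apply: le_trans h; rewrite le_eqVlt; apply/orP; left; apply/eqP; ring.
set q := (2 ^ (m - n))%N; have q0 : (0 < q)%N by rewrite expn_gt0.
have qm : (2 ^ n * q = 2 ^ m)%N by rewrite -expnD subnKC.
have qR : T * 2 ^- m * q%:R = T * 2 ^- n.
  have -> : 2 ^+ m = (2 ^+ n) * q%:R :> R by rewrite /q natrX -exprD subnKC.
  by rewrite invfM mulrA mulfVK// pnatr_eq0 -lt0n.
have ptq j : pt m (j * q) = pt n j :> R.
  have := qR; rewrite /pt natrM => qR'.
  have : T * (j%:R * q%:R / 2 ^+ m) = T * (j%:R / 2 ^+ n).
    have -> : T * (j%:R * q%:R / 2 ^+ m) = (T * 2 ^- m * q%:R) * j%:R by ring.
    by rewrite qR'; ring.
  by apply: mulfI; rewrite gt_eqF.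
pose v k := w (T * pt n (k %/ q)) + E n (k %/ q).
pose b k := E n (k %/ q) + (k %% q)%:R * (T * 2 ^- m * u (v k)).
(* [b] interpolates the coarse scheme linearly at the fine grid points. *)
have bS k : b k.+1 = b k + T * 2 ^- m * u (v k).
  have kE : (k.+1 = k %/ q * q + (k %% q).+1)%N by rewrite addnS -divn_eq.
  rewrite /b /v; have [kq|kq] := ltnP (k %% q).+1 q.
    have [-> ->] : (k.+1 %/ q = k %/ q)%N /\ (k.+1 %% q = (k %% q).+1)%N.
      by rewrite kE divnMDl// (divn_small kq) addn0 modnMDl (modn_small kq).
    by rewrite -natr1; ring.
  have kq' : ((k %% q).+1 = q)%N by apply/eqP; rewrite eqn_leq kq ltn_pmod.
  have [-> ->] : (k.+1 %/ q = (k %/ q).+1)%N /\ (k.+1 %% q = 0)%N.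
    by rewrite kE kq' -mulSnr mulnK// modnMl.
  have hE : T * 2 ^- n = T * 2 ^- m * ((k %% q)%:R + 1) by rewrite -qR natr1 kq'.
  by rewrite /= hE; ring.
have kqn k : (k <= 2 ^ m)%N -> (k %/ q <= 2 ^ n)%N by rewrite -qm => h; rewrite -(mulnK (2 ^ n)%N q0) leq_div2r.
have vr k : (k <= 2 ^ m)%N -> `|v k| <= r.
  by move=> km; apply: hr; rewrite ?kqn//; exact: grid_in (kqn _ km).
have bE k : (k <= 2 ^ m)%N -> `|b k - E n (k %/ q)| <= d.
  move=> km; rewrite /b addrAC subrr add0r normrM normrM (ger0_norm (step_ge0 m)) ger0_norm//.
  apply: le_trans hM_d; rewrite -qR mulrA.
  apply: ler_pM; [exact: mulr_ge0 (ler0n _ _) (step_ge0 m)|exact: normr_ge0| |exact/hM/vr].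
  by rewrite mulrC ler_wpM2l ?step_ge0// ler_nat ltnW// ltn_pmod.
have wd k : (k <= 2 ^ m)%N -> `|w (T * pt m k) - w (T * pt n (k %/ q))| <= d.
  move=> km; apply: (hN1 _ N1n); try exact: grid_in; first exact: (grid_in (kqn _ km)).
  rewrite -mulrBr -ptq normrM (gtr0_norm T0) ler_pM2l// -(pt_step n (k %/ q)) -!ptq.
  have kk : (k %/ q * q <= k)%N by rewrite leq_divM.
  rewrite ger0_norm ?subr_ge0 ?le_pt// lerD2r le_pt.
  by rewrite ltnW// ltn_ceil.
have dL0 : 0 <= d + d by lra.
have main k : (k <= 2 ^ m)%N -> `|E m k - b k| <= (d + d) * X.
  move=> km; have c0 : 0 <= T * 2 ^- m * L by rewrite mulr_ge0 ?step_ge0// ltW.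
  apply: (@le_trans _ _ ((d + d) * expR (T * 2 ^- m * L * k%:R))); last first.
    by rewrite ler_wpM2l// step_expR// ltW.
  apply: (@discrete_gronwall _ (fun k => `|E m k - b k|) _ _ (2 ^ m)) => //=.
    by rewrite /b div0n mod0n /= mul0r addr0 subrr normr0.
  move=> j jm; rewrite bS.
  have -> : E m j + T * 2 ^- m * u (w (T * pt m j) + E m j) - (b j + T * 2 ^- m * u (v j)) =
    (E m j - b j) + T * 2 ^- m * (u (w (T * pt m j) + E m j) - u (v j)) by ring.
  apply: le_trans (ler_normD _ _) _.
  rewrite mulrDl mul1r -addrA lerD2l normrM (ger0_norm (step_ge0 m)) -[T * 2 ^- m * L]/(_) -!mulrA.
  rewrite -!mulrDr !ler_wpM2l ?(ltW T0) ?invr_ge0 ?exprn_ge0//.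
  have lt_r (x : R) : `|x| <= r -> `|x| < r + 1 by move=> h; rewrite (le_lt_trans h)// ltrDl.
  apply: le_trans (hL _ _ _ _) _.
  - by apply/lt_r/hr; [exact/grid_in/ltnW|exact: ltnW].
  - by apply/lt_r/vr; exact: ltnW.
  rewrite ler_pM2l// /v.
  have -> : w (T * pt m j) + E m j - (w (T * pt n (j %/ q)) + E n (j %/ q)) =
    (E m j - b j) + (w (T * pt m j) - w (T * pt n (j %/ q))) + (b j - E n (j %/ q)) by ring.
  apply: le_trans (ler_normD _ _) _; apply: le_trans (lerD (ler_normD _ _) (lexx _)) _.
  rewrite -[leLHS]addrA lerD2l; apply: lerD; [exact/wd/ltnW|exact/bE/ltnW].
move=> k km; rewrite dE -(subrKA (b k)); apply: le_trans (ler_normD _ _) _; apply: lerD; first exact: main.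
by apply: le_trans (bE _ km) _; rewrite ler_peMr// ltW.
Qed.

End euler_scheme.

Lemma solution_continuous {R : realType} (T : R) (u : R -> R) x0 y (x : R -> R) : 0 < T ->
  {within `[0, T], continuous y} ->
  is_solution T u x0 y x -> {within `[0, T], continuous x}.
Proof.
move=> T0 cy [iu hx]; have cS := parameterized_integral_continuous (ltW T0) iu.
apply/subspace_continuousP => t /= tT.
have tT' : 0 <= t <= T by move: tT; rewrite in_itv.
apply: (@cvg_trans _ ((x0 + (\int[lebesgue_measure]_(v in `[0, s]) u (x v)) + y s) @[s --> within `[0, T] (nbhs t)])).
  apply: near_eq_cvg; rewrite near_withinE; near=> s => /=; rewrite in_itv/= => sT.
  by rewrite [RHS](hx _ sT).
change (from_subspace `[0, T] x t) with (x t); rewrite hx//; apply: cvgD; first (apply: cvgD; first exact: cvg_cst).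
  exact: (subspace_continuousP _ _).1 cS t tT.
exact: (subspace_continuousP _ _).1 cy t tT.
Unshelve. all: by end_near. Qed.

(** * Limits of the Euler scheme *)

Section euler_limit.
Context {R : realType}.
Local Notation leb := (@lebesgue_measure R).
Variables (T : R) (u w : R -> R).
Hypotheses (T0 : 0 < T) (cw : {within `[0, T], continuous w}).
Hypotheses (ug : linear_growth u) (ul : locally_lipschitz u).

Local Notation E := (euler T u w).
Local Notation S x := (fun t => \int[leb]_(s in `[0, t]) u (x s)).

Lemma div_in (t : R) : 0 <= t <= T -> 0 <= t / T.
Proof. by case/andP=> t0 _; rewrite divr_ge0// ltW. Qed.

Lemma dyp_dist n (t : R) : 0 <= t <= T -> `|t - dyp T n t| <= T * 2 ^- n.
Proof.
by move=> tT; have [h1 h2] := dypP T0 n tT; rewrite exprVn ger0_norm// subr_ge0.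
Qed.

Lemma dyp_in n (t : R) : 0 <= t <= T -> 0 <= dyp T n t <= T.
Proof. by move=> tT; apply: grid_in => //; exact: idx_le_expn. Qed.

Lemma uniform_modulus_continuous (v : R -> R) : uniform_modulus T v ->
  {within `[0, T], continuous v}.
Proof.
move=> uv; apply/subspace_continuousP => t /=; rewrite in_itv/= => tT.
apply/cvgrPdist_le => e e0; have [N hN] := uv _ e0.
have d0 : 0 < T * 2 ^- N by rewrite mulr_gt0 ?invr_gt0 ?exprn_gt0.
rewrite near_withinE; near=> s => sT.
have ds : `|t - s| <= T * 2 ^- N by apply: ltW; near: s; exact: cvgr_dist_lt.
exact: (hN N).
Unshelve. all: by end_near. Qed.

Lemma euler_path_cvg (t : R) : 0 <= t <= T -> cvg (E n (idx n (t / T)) @[n --> \oo]).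
Proof.
move=> tT; apply/cauchy_cvgP/cauchy_exP => e e0.
have [N hN] := euler_compare T0 cw ug ul (divr_gt0 e0 (ltr0Sn R 1)).
exists (E N (idx N (t / T))); exists N => // m /= Nm.
rewrite /ball/= distrC (idx_divn (div_in tT) Nm).
apply: le_lt_trans (hN N m _ _ _ _) _ => //; first exact: idx_le_expn.
by rewrite ltr_pdivrMr// ltr_pMr// ltr1n.
Qed.

Definition euler_lim (t : R) : R := lim (E n (idx n (t / T)) @[n --> \oo]).

Lemma euler_lim_dist (e : R) : 0 < e -> exists N, forall n, (N <= n)%N ->
  forall t, 0 <= t <= T -> `|euler_lim t - E n (idx n (t / T))| <= e.
Proof.
move=> e0; have [N hN] := euler_compare T0 cw ug ul e0; exists N => n Nn t tT.
have h : `|E m (idx m (t / T)) - E n (idx n (t / T))| @[m --> \oo] -->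
    `|euler_lim t - E n (idx n (t / T))|.
  by apply: cvg_norm; apply: cvgB; [exact: euler_path_cvg|exact: cvg_cst].
rewrite -(cvg_lim _ h)//; apply: limr_le; first by apply/cvg_ex; eexists; exact: h.
exists n => // m /= nm; rewrite (idx_divn (div_in tT) nm); apply: hN => //.
exact: idx_le_expn.
Qed.

(** Between two points at distance at most T 2^-n the level-n scheme takes at most one step, which
    is small; the limit is uniformly close to it. *)
Lemma euler_lim_continuous : {within `[0, T], continuous euler_lim}.
Proof.
apply: uniform_modulus_continuous => e e0.
have [r r0 hr] := euler_bounded T0 cw ug; have [C [C0 hC]] := ug.
pose M := C * (1 + r); have M0 : 0 < M by rewrite mulr_gt0 ?addr_gt0.
have e4 : 0 < e / 4 by rewrite divr_gt0.
have [N1 hN1] := euler_lim_dist e4.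
have [N2 hN2] := expr_half_small (divr_gt0 e4 (mulr_gt0 T0 M0)).
exists (maxn N1 N2) => n; rewrite geq_max => /andP[N1n N2n].
have hM_d : T * 2 ^- n * M <= e / 4.
  have h := hN2 _ N2n; rewrite (ler_pdivlMr _ _ (mulr_gt0 T0 M0)) in h.
  by apply: le_trans h; rewrite le_eqVlt; apply/orP; left; apply/eqP; ring.
suff main (s t : R) : s <= t -> 0 <= s <= T -> 0 <= t <= T -> `|s - t| <= T * 2 ^- n ->
    `|euler_lim s - euler_lim t| <= e.
  move=> s t sT tT st; have [h|h] := leP s t; first exact: main.
  by rewrite distrC; apply: main => //; [exact: ltW|rewrite distrC].
move=> st sT tT; rewrite distrC ger0_norm ?subr_ge0// => dst.
have step : `|E n (idx n (s / T)) - E n (idx n (t / T))| <= e / 4.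
  have [||->|->] := idx_close T0 (n := n) (y := t / T) (div_in sT).
  - by rewrite ler_pM2r ?invr_gt0.
  - by rewrite -mulrBl ler_pdivrMr// mulrC exprVn.
  - by rewrite subrr normr0 ltW.
  rewrite /= opprD addrA subrr add0r normrN normrM (ger0_norm (step_ge0 T0 n)).
  apply: le_trans hM_d; rewrite ler_wpM2l ?step_ge0//.
  apply: le_trans (hC _) _; rewrite ler_pM2l// lerD2l hr//; first exact: dyp_in.
  exact: idx_le_expn.
have h1 := hN1 _ N1n _ sT; have h2 := hN1 _ N1n _ tT.
have -> : euler_lim s - euler_lim t = (euler_lim s - E n (idx n (s / T))) +
  (E n (idx n (s / T)) - E n (idx n (t / T))) - (euler_lim t - E n (idx n (t / T))) by ring.
have := ler_normB ((euler_lim s - E n (idx n (s / T))) +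
  (E n (idx n (s / T)) - E n (idx n (t / T)))) (euler_lim t - E n (idx n (t / T))).
have := ler_normD (euler_lim s - E n (idx n (s / T)))
  (E n (idx n (s / T)) - E n (idx n (t / T))).
lra.
Qed.

Hypothesis mu : measurable_fun setT u.

Lemma continuous_drift_integrable (x : R -> R) : {within `[0, T], continuous x} ->
  leb.-integrable `[0, T] (EFin \o (u \o x)).
Proof.
move=> cx; have [B B0 hB] := within_continuous_bounded cx; have [C [C0 hC]] := ug.
apply: measurable_bounded_integrable => //=.
- by rewrite lebesgue_measure_itv/=; case: ifP => _; rewrite ?ltry// -EFinB ltry.
- apply: (measurableT_comp mu).
  by apply: subspace_continuous_measurable_fun => //; exact: measurable_itv.
exists (C * (1 + B)); split; first exact: num_real.
move=> M hM t tT; apply/ltW/(le_lt_trans _ hM)/(le_trans (hC _)).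
by rewrite ler_pM2l// lerD2l hB//; move: tT; rewrite /= in_itv.
Qed.

Lemma Rintegral_step (G : R -> R) (s t c eta : R) : 0 <= s -> s <= t ->
  leb.-integrable `[0, t] (EFin \o G) ->
  (forall v, s < v -> v <= t -> `|G v - c| <= eta) ->
  `|\int[leb]_(v in `[0, t]) G v - \int[leb]_(v in `[0, s]) G v - (t - s) * c| <= (t - s) * eta.
Proof.
move=> s0 st iG hG; rewrite Rintegral_itvB ?bnd_simp//.
have mst : measurable (`]s, t]%classic : set (measurableTypeR R)) by exact: measurable_itv.
have lst : leb `]s, t]%classic = (t - s)%:E.
  rewrite lebesgue_measure_itv/= lte_fin; case: ltP => [//|ts].
  have -> : t = s by apply/eqP; rewrite eq_le ts.
  by rewrite subrr.
have icst (k : R) : leb.-integrable `]s, t]%classic (EFin \o cst k).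
  apply: measurable_bounded_integrable => //; first exact: (eq_ind_r (fun z => z < +oo)%E (ltry _) lst).
  exists `|k|; split; first exact: num_real.
  by move=> M kM v _ /=; exact: ltW.
have iG' : leb.-integrable `]s, t]%classic (EFin \o G).
  apply: integrableS iG => //; try exact: measurable_itv.
  by move=> v /=; rewrite !in_itv/= => /andP[sv ->]; rewrite andbT ltW// (le_lt_trans s0).
have Ec k : \int[leb]_(v in `]s, t]) (cst k v) = (t - s) * k.
  by rewrite Rintegral_cst// mulrC; congr (_ * _); exact: (congr1 fine lst).
rewrite -(Ec c) -RintegralB//.
have iB : leb.-integrable `]s, t]%classic (EFin \o (fun v => G v - c)).
  rewrite (_ : EFin \o _ = (EFin \o G) \- (EFin \o cst c))%E; last by apply/funext => v.
  exact: integrableB.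
apply: le_trans (le_normr_Rintegral mst iB) _; rewrite -(Ec eta).
apply: le_Rintegral => //.
- have := integrable_abse iB; congr (integrable _ _ _).
- by move=> v /=; rewrite in_itv/= => /andP[sv vt]; exact: hG.
Qed.

(* A Gronwall argument on the grid: a discretisation error that is small
   relative to the deviation [S x - E] itself is enough for convergence. *)
Lemma euler_integral_cvg (x : R -> R) : {within `[0, T], continuous x} ->
  (forall e, 0 < e -> exists N, forall n, (N <= n)%N -> forall k, (k <= 2 ^ n)%N ->
    `|x (T * pt n k) - (w (T * pt n k) + E n k)| <= e + `|S x (T * pt n k) - E n k|) ->
  forall t, 0 <= t <= T -> E n (idx n (t / T)) @[n --> \oo] --> S x t.
Proof.
move=> cx hx t tT.
have iu := continuous_drift_integrable cx.
have iS s : s <= T -> leb.-integrable `[0, s] (EFin \o (u \o x)).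
  move=> sT; apply: integrableS iu => //; try exact: measurable_itv.
  by move=> v /=; rewrite !in_itv/= => /andP[-> vs]; rewrite (le_trans vs).
have cS : {within `[0, T], continuous (S x)}.
  exact: (parameterized_integral_continuous (ltW T0) iu).
have [Bx Bx0 hBx] := within_continuous_bounded cx.
have [r r0 hr] := euler_bounded T0 cw ug.
have [L [L0 hL]] := ul (ltr_wpDl Bx0 (addr_gt0 r0 ltr01)).
pose X := expR (T * L); have X0 : 0 < X by exact: expR_gt0.
have X1 : 1 <= X by rewrite /X -expR0 ler_expR mulr_ge0// ltW.
apply/cvgrPdist_le => e e0; pose d : R := e / (3 * X).
have d0 : 0 < d by rewrite divr_gt0 ?mulr_gt0.
have dE : e = (d + d) * X + d * X by rewrite /d; field; rewrite gt_eqF.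
clearbody d.
have [N1 hN1] := within_continuous_uniform T0 cx d0.
have [N2 hN2] := hx _ d0.
have [N3 hN3] := within_continuous_uniform T0 cS d0.
exists (maxn (maxn N1 N2) N3) => // n /=; rewrite !geq_max => /andP[/andP[N1n N2n] N3n].
have dL0 : 0 <= d + d by lra.
have c0 : 0 <= T * 2 ^- n * L by rewrite mulr_ge0 ?(step_ge0 T0)// ltW.
have main k : (k <= 2 ^ n)%N -> `|S x (T * pt n k) - E n k| <= (d + d) * X.
  move=> kn; apply: (@le_trans _ _ ((d + d) * expR (T * 2 ^- n * L * k%:R))); last first.
    by rewrite ler_wpM2l// step_expR// ltW.
  apply: (@discrete_gronwall _ (fun k => `|S x (T * pt n k) - E n k|) _ _ (2 ^ n)) => //=.
    by rewrite /pt mul0r mulr0 subr0 set_itv1 Rintegral_set1 normr0.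
  move=> j jn; have jn' := ltnW jn.
  have /andP[p0 pT] := grid_in T0 jn'; have /andP[q0 qT] := grid_in T0 jn.
  have pq : T * pt n j.+1 - T * pt n j = T * 2 ^- n by rewrite -mulrBr pt_step.
  have h1 : `|S x (T * pt n j.+1) - S x (T * pt n j) - T * 2 ^- n * u (x (T * pt n j))| <=
      T * 2 ^- n * (L * d).
    rewrite -pq; apply: Rintegral_step => //; [by rewrite ler_pM2l// le_pt|exact: iS|].
    move=> v v1 v2; have v0 := le_trans p0 (ltW v1); have vT := le_trans v2 qT.
    apply: le_trans (hL _ _ _ _) _.
    - by rewrite (le_lt_trans (hBx _ _)) ?v0// ltrDl addr_gt0.
    - by rewrite (le_lt_trans (hBx _ _)) ?p0// ltrDl addr_gt0.
    rewrite ler_pM2l//; apply: (hN1 _ N1n); rewrite ?v0 ?p0//.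
    by rewrite ger0_norm ?subr_ge0 ?(ltW v1)// -pq lerD2r.
  have h2 : `|u (x (T * pt n j)) - u (w (T * pt n j) + E n j)| <=
      L * (d + `|S x (T * pt n j) - E n j|).
    apply: le_trans (hL _ _ _ _) _.
    - by rewrite (le_lt_trans (hBx _ _)) ?p0// ltrDl addr_gt0.
    - by rewrite (le_lt_trans (hr _ _ _ _ _)) ?p0//; lra.
    by rewrite ler_pM2l//; exact: hN2.
  have -> : S x (T * pt n j.+1) - (E n j + T * 2 ^- n * u (w (T * pt n j) + E n j)) =
    (S x (T * pt n j) - E n j) +
    (S x (T * pt n j.+1) - S x (T * pt n j) - T * 2 ^- n * u (x (T * pt n j))) +
    T * 2 ^- n * (u (x (T * pt n j)) - u (w (T * pt n j) + E n j)) by ring.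
  apply: le_trans (ler_normD _ _) _.
  rewrite normrM (ger0_norm (step_ge0 T0 n)).
  apply: le_trans (lerD (le_trans (ler_normD _ _) (lerD (lexx _) h1))
    (ler_wpM2l (step_ge0 T0 n) h2)) _.
  by rewrite le_eqVlt; apply/orP; left; apply/eqP; ring.
rewrite -(subrKA (S x (dyp T n t))) dE; apply: le_trans (ler_normD _ _) _.
rewrite addrC; apply: lerD; first exact: (main _ (idx_le_expn T0 n tT)).
apply: (@le_trans _ _ d); last by rewrite ler_peMr// ltW.
by apply: (hN3 _ N3n) => //; [exact: dyp_in|exact: dyp_dist].
Qed.

End euler_limit.

Section euler_solution.
Context {R : realType}.
Variables (T : R) (u y : R -> R) (x0 : R).
Hypotheses (T0 : 0 < T) (cy : {within `[0, T], continuous y}).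
Hypotheses (mu : measurable_fun setT u) (ug : linear_growth u) (ul : locally_lipschitz u).
Let w t := x0 + y t.

Let cw : {within `[0, T], continuous w}.
Proof.
apply/subspace_continuousP => t /= tT; apply: cvgD; first exact: cvg_cst.
exact: (subspace_continuousP _ _).1 cy t tT.
Qed.

(** Uniform convergence of the scheme on the grid makes the criterion [euler_integral_cvg]
    applicable to its own limit, which is thereby the drift integral. *)
Lemma euler_lim_solution : is_solution T u x0 y (fun t => x0 + y t + euler_lim T u w t).
Proof.
have cA := euler_lim_continuous T0 cw ug ul.
have cx : {within `[0, T], continuous (fun t => x0 + y t + euler_lim T u w t)}.
  apply/subspace_continuousP => t /= tT; apply: cvgD.
    exact: (subspace_continuousP _ _).1 cw t tT.
  exact: (subspace_continuousP _ _).1 cA t tT.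
split; first exact: continuous_drift_integrable.
move=> t tT; rewrite addrAC; congr (_ + _ + _).
rewrite /euler_lim; apply: cvg_lim => //.
apply: (euler_integral_cvg T0 cw ug ul mu cx) => // e e0.
have [N hN] := euler_lim_dist T0 cw ug ul e0; exists N => n Nn k kn.
apply: (@le_trans _ _ e); last by rewrite lerDl.
have -> : forall a b c : R, a + b - (a + c) = b - c by move=> *; ring.
have := hN _ Nn _ (grid_in T0 kn).
(* At the k-th grid point the index function returns [k], so limit and scheme are compared at the
   same index. *)
by rewrite (mulrC T) mulfK ?gt_eqF// /idx /pt divfK ?expf_neq0// natrK.
Qed.

(** For a solution the deviation of [x] from the scheme equals that of its drift integral, so the
    criterion holds from level 0 on for every tolerance. Uniqueness follows, the scheme being
    independent of [x]. *)
Lemma solution_euler_cvg (x : R -> R) : is_solution T u x0 y x -> forall t, 0 <= t <= T ->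
  x0 + y t + euler T u w n (idx n (t / T)) @[n --> \oo] --> x t.
Proof.
move=> sx t tT; have cx := solution_continuous T0 cy sx; have [_ hx] := sx.
rewrite hx// addrAC; apply: cvgD; first exact: cvg_cst.
apply: (euler_integral_cvg T0 cw ug ul mu cx) => // e e0.
exists 0%N => n _ k kn; rewrite (hx _ (grid_in T0 kn)) /w.
have -> : forall a b c d : R, a + b + c - (a + c + d) = b - d by move=> *; ring.
by rewrite lerDr ltW.
Qed.

End euler_solution.

Section random_equation.
Context d {Omega : measurableType d} {R : realType} (P : probability Omega R).
Variables (T : R) (Y : R -> {RV P >-> R}) (u : R -> R) (x0 : R).
Hypotheses (T0 : 0 < T) (cY : as_continuous T Y).
Hypotheses (mu : measurable_fun setT u) (ug : linear_growth u) (ul : locally_lipschitz u).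

Lemma measurable_euler n j :
  measurable_fun setT (fun w => euler T u (fun t => x0 + Y t w) n j).
Proof.
elim: j => [|j ih] /=; first exact: measurable_cst.
apply: measurable_funD => //; apply: measurable_funM; first exact: measurable_cst.
apply: (measurableT_comp mu); apply: measurable_funD => //.
exact: measurable_funD.
Qed.

(** Measurability comes from taking the upper limit of the scheme, whose terms are random variables;
    on each continuous path this limit is the solution. *)
Theorem random_equation_solution : exists X : R -> {RV P >-> R},
  {ae P, forall w, is_solution T u x0 (fun t => Y t w) (fun t => X t w) /\
    forall x : R -> R, is_solution T u x0 (fun t => Y t w) x ->
      forall t, 0 <= t <= T -> x t = X t w}.
Proof.
pose Xn t n w := x0 + Y t w + euler T u (fun t => x0 + Y t w) n (idx n (t / T)).
have mX t : measurable_fun setT (limit_rv (Xn t)).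
  apply: measurable_limit_rv => n; apply: measurable_funD; last exact: measurable_euler.
  exact: measurable_funD.
exists (fun t => mfun_Sub (mem_set (mX t))); apply: filterS cY => w cw.
have XE x : is_solution T u x0 (fun t => Y t w) x ->
    forall t, 0 <= t <= T -> limit_rv (Xn t) w = x t.
  by move=> sx t tT; apply: limit_rvE; exact: (solution_euler_cvg T0 cw mu ug ul sx).
split; last by move=> x sx t tT; rewrite -(XE _ sx).
have sA := euler_lim_solution x0 T0 cw mu ug ul.
set A := (X in is_solution T u x0 _ X) in sA.
have [iA hA] := sA; split.
  apply: eq_integrable iA; first exact: measurable_itv.
  move=> t; rewrite inE/= in_itv/= => tT; congr (u _)%:E.
  by rewrite [RHS](XE _ sA).
move=> t tT; rewrite -[LHS]/(limit_rv (Xn t) w) (XE _ sA)// hA//.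
congr (_ + _ + _); apply: eq_Rintegral => s; rewrite inE/= in_itv/= => /andP[s0 st].
have /andP[_ tT'] := tT.
congr (u _); rewrite [RHS](XE _ sA)// s0 (le_trans st)//.
Qed.

End random_equation.

(** * Volterra processes and the three cases of the theorem *)

Section volterra_process.
Context d {Omega : measurableType d} {R : realType} (P : probability Omega R).
Variables (T : R) (Z : R -> {RV P >-> R}) (a : R) (nu : {measure set R -> \bar R}).
Variables (g : R -> R -> R) (p q alpha beta gamma delta : R).
Hypotheses (T0 : 0 < T) (Z_levy : is_levy_process Z) (a0 : 0 <= a).
Hypotheses (nu_levy : levy_measure nu) (nu_sym : symmetric_measure nu).
Hypotheses (Z_triplet : has_triplet Z a nu) (mg : jointly_measurable_kernel T g).
Hypotheses (p0 : 0 < p) (q0 : 0 < q) (hK : moment_bound_hyp P a nu p q).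
Hypotheses (B1 : condB1 T g alpha beta gamma) (B2 : condB2 T g p delta).
Hypotheses (bp : - p^-1 < beta) (gp : - p^-1 < gamma).
Hypothesis kp : - p^-1 < kappa alpha beta gamma.

Lemma volterra_integral_exists (t : R) : 0 <= t <= T ->
  exists I : {RV P >-> R}, is_levy_integral Z t (g t) I.
Proof.
move=> /andP[t0 tT].
apply: (levy_integral_exists Z_levy nu_levy nu_sym Z_triplet p0 q0 hK t0).
  exact: (measurable_kernel_section mg tT).
(* For s = 0 the kernel increment is [g t] itself on ]0, t]. *)
have := kernel_diff_integrable T0 p0 mg B1 B2 bp gp kp (lexx 0) t0 tT.
apply: eq_integrable; first exact: measurable_itv.
move=> u; rewrite inE/= in_itv/= => /andP[u0 _].
by rewrite /kernel_diff leNgt u0 subr0.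
Qed.

(** The integral of the kernel increment is raised to the power q / p, so the exponent in
    Kolmogorov's criterion is the stated product, and its excess over 1 is the required margin. *)
Lemma volterra_continuous_modification (Y : R -> {RV P >-> R}) :
  1 < Num.min (delta * p) (1 + kappa alpha beta gamma * p) * (q / p) ->
  (forall t, 0 <= t <= T -> is_levy_integral Z t (g t) (Y t)) ->
  exists Y' : R -> {RV P >-> R},
    [/\ is_modification T Y' Y, as_continuous T Y' & as_bounded T Y'].
Proof.
set rho := Num.min _ _ => rho1 hY.
have [K K0 hKY] := levy_integral_increment_moment Z_levy a0 nu_levy nu_sym Z_triplet
  p0 q0 hK (ltW T0).
have [C C0 hC] := kernel_diff_bound T0 p0 mg B1 B2 bp gp kp.
have eta0 : 0 < rho * (q / p) - 1 by rewrite subr_gt0.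
apply: (@continuous_modification _ _ _ P T Y q (K * C `^ (q / p)) _ T0 q0 _ eta0).
  by rewrite mulr_ge0 ?powR_ge0.
move=> s t s0 st tT.
have sT : 0 <= s <= T by rewrite s0 (le_trans st).
have tT' : 0 <= t <= T by rewrite (le_trans s0 st).
apply: le_trans (hKY s t _ _ _ _ s0 st tT (hY _ tT') (hY _ sT) _ _) _.
- exact: (measurable_kernel_diff mg st tT).
- exact: (kernel_diff_integrable T0 p0 mg B1 B2 bp gp kp s0 st tT).
rewrite lee_fin -mulrA ler_wpM2l//.
have e : C `^ (q / p) * (t - s) `^ (1 + (rho * (q / p) - 1)) = (C * (t - s) `^ rho) `^ (q / p).
  by rewrite powRM ?powR_ge0// -powRrM (addrC 1) subrK.
rewrite e ge0_ler_powR ?nnegrE ?divr_ge0 ?(ltW q0) ?(ltW p0)//.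
- by apply: Rintegral_ge0 => u _; exact: powR_ge0.
- by rewrite mulr_ge0// powR_ge0.
rewrite /Rintegral -lee_fin; have h := hC s t s0 st tT.
rewrite fineK//; apply/fin_numPlt; rewrite (lt_le_trans (ltNyr 0))/=.
  by apply: le_lt_trans h _; exact: ltry.
by apply: integral_ge0 => u _; rewrite lee_fin powR_ge0.
Qed.

End volterra_process.

Theorem theorem3 (d : measure_display) (Omega : measurableType d) (R : realType)
    (P : probability Omega R)
    (T : R) (Z : R -> {RV P >-> R}) (a : R) (pi : {measure set R -> \bar R})
    (g : R -> R -> R) :
  0 < T ->
  is_levy_process Z ->
  0 <= a -> levy_measure pi -> symmetric_measure pi ->
  has_triplet Z a pi ->
  jointly_measurable_kernel T g ->
  [\/ exists p alpha beta gamma delta : R,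
        [/\ 1 <= p, a = 0 & finite_moment p pi] /\
        [/\ condB1 T g alpha beta gamma & condB2 T g p delta] /\
        [/\ - p^-1 < beta, - p^-1 < gamma & p^-1 < delta] /\
        - p^-1 < alpha + beta + gamma /\ 0 < kappa alpha beta gamma,
      exists p alpha beta gamma delta : R,
        [/\ 2 <= p & finite_moment p pi] /\
        [/\ condB1 T g alpha beta gamma & condB2 T g p delta] /\
        [/\ - p^-1 < beta, - p^-1 < gamma & p^-1 < delta] /\
        - p^-1 < alpha + beta + gamma /\ 0 < kappa alpha beta gamma
    | is_brownian_motion Z /\
      exists alpha beta gamma delta : R,
        [/\ condB1 T g alpha beta gamma & condB2 T g 2 delta] /\
        [/\ - 2^-1 < beta, - 2^-1 < gamma & 0 < delta] /\
        - 2^-1 < alpha + beta + gamma /\ - 2^-1 < kappa alpha beta gamma] ->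
  (forall t, 0 <= t <= T -> exists I : {RV P >-> R}, is_levy_integral Z t (g t) I)
  /\
  forall Y : R -> {RV P >-> R},
    (forall t, 0 <= t <= T -> is_levy_integral Z t (g t) (Y t)) ->
    (exists Y' : R -> {RV P >-> R},
       [/\ is_modification T Y' Y, as_continuous T Y' & as_bounded T Y'])
    /\
    forall (Y' : R -> {RV P >-> R}),
      is_modification T Y' Y -> as_continuous T Y' ->
      forall (u : R -> R) (x0 : R),
        measurable_fun [set: R] u -> linear_growth u -> locally_lipschitz u ->
        exists X : R -> {RV P >-> R},
          {ae P, forall w,
             is_solution T u x0 (fun t => Y' t w) (fun t => X t w) /\
             forall x : R -> R, is_solution T u x0 (fun t => Y' t w) x ->
               forall t, 0 <= t <= T -> x t = X t w}.
Proof.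
move=> T0 Z_levy a0 pi_levy pi_sym Z_triplet mg cases.
(* All cases reduce to one pair of exponents: q = p in the first two, and p = 2 with a large q for a
   Brownian motion. *)
suff [p [q [alpha [beta [gamma [delta [[p0 q0 hK] [[B1 B2] [[bp gp kp] rho1]]]]]]]]] :
  exists p q alpha beta gamma delta : R,
    [/\ 0 < p, 0 < q & moment_bound_hyp P a pi p q] /\
    [/\ condB1 T g alpha beta gamma & condB2 T g p delta] /\
    [/\ - p^-1 < beta, - p^-1 < gamma & - p^-1 < kappa alpha beta gamma] /\
    1 < Num.min (delta * p) (1 + kappa alpha beta gamma * p) * (q / p).
  split.
    exact: (volterra_integral_exists T0 Z_levy pi_levy pi_sym Z_triplet mg p0 q0 hK B1 B2 bp gp kp).
  move=> Y hY; split.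
    exact: (volterra_continuous_modification T0 Z_levy a0 pi_levy pi_sym Z_triplet mg
      p0 q0 hK B1 B2 bp gp kp rho1 hY).
  move=> Y' _ cY' u x0 mu ug ul; exact: random_equation_solution.
have cf := levy_has_cf_family Z_levy pi_levy pi_sym Z_triplet.
(* With q = p the requirement is that both delta p and 1 + kappa p exceed 1, which is what delta >
   1/p and kappa > 0 say. *)
have moment_case (p alpha beta gamma delta : R) : 1 <= p -> p^-1 < delta ->
    0 < kappa alpha beta gamma -> [/\ - p^-1 < kappa alpha beta gamma &
    1 < Num.min (delta * p) (1 + kappa alpha beta gamma * p) * (p / p)].
  move=> p1 dp k0; have p0 : 0 < p by exact: lt_le_trans p1.
  split; first by rewrite (lt_trans _ k0)// oppr_lt0 invr_gt0.
  rewrite mulfV ?gt_eqF// mulr1 lt_min ltrDl mulr_gt0// andbT.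
  by rewrite -ltr_pdivrMr// div1r.
case: cases => [[p [al [be [ga [de [[p1 aE fm] [B [[bp gp dp] [_ k0]]]]]]]]]|
    [p [al [be [ga [de [[p2 fm] [B [[bp gp dp] [_ k0]]]]]]]]]|
    [bm [al [be [ga [de [B [[bp gp d0] [_ k0]]]]]]]]].
- have p0 : 0 < p by exact: lt_le_trans p1.
  have [kp rho1] := moment_case _ _ _ _ _ p1 dp k0.
  exists p, p, al, be, ga, de; split; last by [].
  (* Below 2 the absence of a Gaussian part is essential; from 2 on the argument is that of the
     second case. *)
  split => //; have [p2|p2] := ltP p 2; first exact: moment_bound_small.
  by apply: moment_bound_large => //; left.
- have p1 : 1 <= p by apply: le_trans p2; rewrite ler1n.
  have p0 : 0 < p by exact: lt_le_trans p1.
  have [kp rho1] := moment_case _ _ _ _ _ p1 dp k0.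
  exists p, p, al, be, ga, de; split; last by [].
  by split => //; apply: moment_bound_large => //; left.
(* For Gaussian integrals every moment is controlled by the second one, so q is
   taken large enough for Kolmogorov's criterion. *)
pose rho := Num.min (de * 2) (1 + kappa al be ga * 2).
have rho0 : 0 < rho.
  rewrite lt_min mulr_gt0//=; lra.
have q2 : 2 <= 2 + 4 / rho by rewrite lerDl divr_ge0// ltW.
exists 2, (2 + 4 / rho), al, be, ga, de; split; last split=> //; last split=> //.
  split=> //; first exact: lt_le_trans q2.
  exact: (moment_bound_brownian Z_levy a0 pi_levy pi_sym Z_triplet bm q2).
rewrite -/rho; have -> : rho * ((2 + 4 / rho) / 2) = rho + 2 by field; rewrite gt_eqF.
lra.
Qed.
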